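(* Let $E/k$ be a finite extension of (arbitrary) fields and let $\underline\alpha=(\alpha_1,\dots,\alpha_n)$ be a finite family of generators of $E/k$. Then $$ \mathrm{Tr}^{MW}_{E/k}=\mathrm{Tr}^{MW,\underline \alpha}_{E/k} $$ as maps $\mathrm K^{MW}_q(E,\omega_{E/k})\to\mathrm K^{MW}_q(k)$ for every $q\in\mathbb Z$. Here $\mathrm{Tr}^{MW}_{E/k}$ is the transfer obtained by gluing the differential trace on powers of the fundamental ideal with Kato's transfer on Milnor K-theory, and $\mathrm{Tr}^{MW,\underline\alpha}_{E/k}$ is the composite of the Bass-Tate transfers along the tower of monogenic extensions $k\subset k[\alpha_1]\subset\dots\subset k[\alpha_1,\dots,\alpha_n]=E$.
   Context: Milnor-Witt K-theory. For a field $K$, $\mathrm K^{MW}_*(K)$ is the $\mathbb Z$-graded associative ring generated by $[a]$ ($a\in K^\times$) in degree $1$ and $\eta$ in degree $-1$, with relations $[a][1-a]=0$ ($a\neq0,1$), $[ab]=[a]+[b]+\eta[a][b]$, $\eta[a]=[a]\eta$, $\eta h=0$, $h=2+\eta[-1]$. Put $\langle a\rangle=1+\eta[a]$, $\epsilon=-\langle-1\rangle$, $n_\epsilon=\sum_{i=0}^{n-1}(-\epsilon)^i$ ($n\ge0$), $n_\epsilon=\epsilon(-n)_\epsilon$ ($n<0$). For a one-dimensional $K$-vector space $L$, $\mathrm K^{MW}_n(K,L)=\mathrm K^{MW}_n(K)\otimes_{\mathbb Z[K^\times]}\mathbb Z[L\setminus\{0\}]$, $u$ acting by $\langle u\rangle$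 on the left factor. $\omega_{E/k}$ is the determinant of the cotangent complex of a finite extension $E/k$; for a tower $k\subset K'\subset E$ there is a canonical isomorphism $\omega_{E/k}\simeq\omega_{E/K'}\otimes_{K'}\omega_{K'/k}$. If $E=k[t_1,\dots,t_n]/I$, $I=(f_1,\dots,f_n)$ with $f_i\in k[t_1,\dots,t_i]$ monic in $t_i$ lifting the minimal polynomial of $\alpha_i$ over $k[\alpha_1,\dots,\alpha_{i-1}]$, then $\omega_{E/k}\simeq\Lambda^n(I/I^2)^\vee\otimes\Omega^n_{k[\underline t]/k}$ has basis $w=(\bar f_1\wedge\dots\wedge\bar f_n)^*\otimes(dt_1\wedge\dots\wedge dt_n)$. Gluing definition of $\mathrm{Tr}^{MW}_{E/k}$. Let $\mathrm I(K)\subset\mathrm W(K)=\mathrm{GW}(K)/(h)$ be the fundamental ideal (kernel of the rank mod 2), $\mathrm I^n(K)$ its powers ($\mathrm I^n=\mathrm W$ for $n\le0$), $\bar{\mathrm I}^n=\mathrm I^n/\mathrm I^{n+1}$ for $n\ge0$ and $0$ for $n<0$, and $\mathrm I^n(K,L)=\mathrm I^n(K)\otimes_{\mathbb Z[K^\times]}\mathbb Z[L\setminus\{0\}]\subset\mathrm W(K,L)$ (Witt group of $L$-valued inner product spaces). Let $F:\mathrm K^{MW}_n(K,L)\to\mathrm K_n^M(K)$ be reduction mod $\eta$ (forgetting $L$) and $\mu':\mathrm K^{MW}_*(K,L)\to\mathrm I^*(K,L)$ the map induced by $[u]\mapsto 1-\langle u\rangle\in\mathrm I^1(K)$, $\eta\mapsto-1\in\mathrm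 I^{-1}(K)$. These induce an isomorphism $\mathrm K_n^{MW}(K,L)\simeq\mathrm I^n(K,L)\times_{\bar{\mathrm I}^n(K)}\mathrm K_n^M(K)$, where $\mathrm K^M_n\to\bar{\mathrm I}^n$ sends $\{u_1,\dots,u_n\}$ to the class of $\prod_i(1-\langle u_i\rangle)$. Let $\mathrm{Tr}^\omega_{E/k}:\omega_{E/k}\to k$ be the trace map of Grothendieck duality; explicitly $\mathrm{Tr}^\omega_{E/k}(b\,w)=\tau(b)$ for $b\in E$ and $w=(\bar f_1\wedge\dots\wedge\bar f_n)^*\otimes(dt_1\wedge\dots\wedge dt_n)$ the basis of $\omega_{E/k}$ associated with the presentation $E=k[t_1,\dots,t_n]/(f_1,\dots,f_n)$, $t_i\mapsto\alpha_i$, where, with $d_i=[k[\alpha_1,\dots,\alpha_i]:k[\alpha_1,\dots,\alpha_{i-1}]]$, $\tau$ is the $k$-linear form with $\tau(\alpha_1^{d_1-1}\cdots\alpha_n^{d_n-1})=1$ and zero on the other monomials $\alpha_1^{j_1}\cdots\alpha_n^{j_n}$, $0\le j_i<d_i$. Put $\mathrm{Tr}^\omega_{E/k*}[\Phi]=[\mathrm{Tr}^\omega_{E/k}\circ\Phi]$ for an $\omega_{E/k}$-valued inner product space $\Phi$; this maps $\mathrm I^n(E,\omega_{E/k})$ to $\mathrm I^n(k)$. Let $\mathrm{Tr}^M_{E/k}$ be Kato's transfer (norm) on Milnor K-theory. Then $\mathrm{Tr}^{MW}_{E/k}$ corresponds under the fiber product isomorphisms to $(\sigma,\tau)\mapsto(\mathrm{Tr}^\omega_{E/k*}(\sigma),\mathrm{Tr}^M_{E/k}(\tau))$.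 Bass-Tate definition. For a discretely valued field $(K,v)$, $\omega_v=(\mathcal M_v/\mathcal M_v^2)^\vee$, the residue $\partial_v:\mathrm K^{MW}_n(K)\to\mathrm K^{MW}_{n-1}(\kappa_v,\omega_v)$ is the unique $\eta$-linear map with $\partial_v([v_1\pi^m][u_2]\cdots[u_n])=m_\epsilon\langle\overline{v_1}\rangle[\overline{u_2}]\cdots[\overline{u_n}]\otimes\bar\pi^*$ for any uniformizer $\pi$ and units $v_1,u_i$; for an invertible $\mathcal O_v$-module with generator $l_0$, $\partial_v(\sigma\otimes l_0)=\partial_v(\sigma)\otimes\overline{l_0}$. For $\mathbb P^1_k$ with canonical sheaf $\omega$, using the canonical isomorphisms $\omega_{x/\mathbb P^1_k}\otimes\omega|_x\simeq\omega_{\kappa_x/k}$ (where $\omega_{x/\mathbb P^1_k}=(\mathcal M_x/\mathcal M_x^2)^\vee$) one gets $\partial_x:\mathrm K^{MW}_{q+1}(k(t),\omega_{k(t)/k})\to\mathrm K^{MW}_q(\kappa_x,\omega_{\kappa_x/k})$ for each closed point $x$. There is a unique family of maps $\mathrm{Tr}_x:\mathrm K^{MW}_q(\kappa_x,\omega_{\kappa_x/k})\to\mathrm K^{MW}_q(k)$ with $\mathrm{Tr}_\infty=\mathrm{Id}$ and $\sum_x\mathrm{Tr}_x\circ\partial_x=0$. For a monogenic extension $E=k[\alpha]$, with corresponding closed point $x\in\mathbb A^1_k$, put $\mathrm{Tr}^{MW,\alpha}_{E/k}=\mathrm{Tr}_x$; for a one-dimensional $k$-vector space $\mathcal L$ its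 twisted version $\mathrm K^{MW}_q(E,\omega_{E/k}\otimes\mathcal L_E)\to\mathrm K^{MW}_q(k,\mathcal L)$ is $\sigma\otimes w\otimes(l'\otimes u)\mapsto\mathrm{Tr}^{MW,\alpha}_{E/k}(\langle u\rangle\sigma\otimes w)\otimes l'$ ($l'\in\mathcal L^\times$, $u\in E^\times$). For a family $\underline\alpha$, put $\kappa_i=k[\alpha_1,\dots,\alpha_i]$, $\kappa_0=k$; $\mathrm{Tr}^{MW,\underline\alpha}_{E/k}$ is the composite of the $\omega_{\kappa_{i-1}/k}$-twisted maps $\mathrm{Tr}^{MW,\alpha_i}_{\kappa_i/\kappa_{i-1}}:\mathrm K^{MW}_q(\kappa_i,\omega_{\kappa_i/k})\to\mathrm K^{MW}_q(\kappa_{i-1},\omega_{\kappa_{i-1}/k})$, $i=n,\dots,1$. *)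

(* Defs.v *)
From HB Require Import structures.
From mathcomp Require Import all_boot all_order all_algebra all_field.
From mathcomp Require Import generic_quotient.
From mathcomp Require Import boolp classical_sets functions cardinality fsbigop.
From mathcomp Require Import ring.

Set Implicit Arguments.
Unset Strict Implicit.
Unset Printing Implicit Defensive.

Import GRing.Theory.
Local Open Scope ring_scope.

(** Abelian groups and associative rings given by generators and relations are
    constructed as quotients of the types of formal expressions. *)

Local Open Scope quotient_scope.

Inductive gterm (G : Type) :=
  GVar of G | GZero | GOpp of gterm G | GAdd of gterm G & gterm G.
Arguments GZero {G}.

Inductive gcong (G : Type) (R : gterm G -> gterm G -> Prop) :
    gterm G -> gterm G -> Prop :=
| gcong_rel s t : R s t -> gcong R s t
| gcong_refl s : gcong R s s
| gcong_sym s t : gcong R s t -> gcong R t s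
| gcong_trans t s u : gcong R s t -> gcong R t u -> gcong R s u
| gcong_opp s s' : gcong R s s' -> gcong R (GOpp s) (GOpp s')
| gcong_add s s' t t' :
    gcong R s s' -> gcong R t t' -> gcong R (GAdd s t) (GAdd s' t')
| gcong_addA s t u : gcong R (GAdd s (GAdd t u)) (GAdd (GAdd s t) u)
| gcong_addC s t : gcong R (GAdd s t) (GAdd t s)
| gcong_add0 s : gcong R (GAdd GZero s) s
| gcong_addN s : gcong R (GAdd (GOpp s) s) GZero.

Section PresentedGroup.
Variables (G : Type) (R : gterm G -> gterm G -> Prop).

HB.instance Definition _ := gen_eqMixin (gterm G).
HB.instance Definition _ := gen_choiceMixin (gterm G).

Definition gcongb (s t : gterm G) : bool := `[< gcong R s t >].

Lemma gcongb_refl : reflexive gcongb.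
Proof. by move=> s; apply/asboolP/gcong_refl. Qed.
Lemma gcongb_sym : symmetric gcongb.
Proof. by move=> s t; apply/asboolP/asboolP; apply: gcong_sym. Qed.
Lemma gcongb_trans : transitive gcongb.
Proof.
by move=> t s u /asboolP st /asboolP tu; apply/asboolP; apply: gcong_trans tu.
Qed.
Canonical gcong_equiv := EquivRel gcongb gcongb_refl gcongb_sym gcongb_trans.

Definition pgroup : Type := {eq_quot gcongb}.
HB.instance Definition _ : EqQuotient _ gcongb pgroup := EqQuotient.on pgroup.
HB.instance Definition _ := Choice.on pgroup.

Definition pgclass (s : gterm G) : pgroup := \pi_pgroup s.

Lemma pgclass_eq s t : gcong R s t <-> pgclass s = pgclass t.
Proof.
split; first by move=> st; apply/eqmodP/asboolP.
by move/eqmodP/asboolP.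
Qed.

Lemma pgclass_repr (x : pgroup) : pgclass (repr x) = x.
Proof. exact: reprK. Qed.

Definition pgopp (x : pgroup) := pgclass (GOpp (repr x)).
Definition pgadd (x y : pgroup) := pgclass (GAdd (repr x) (repr y)).

Lemma pgoppE s : pgopp (pgclass s) = pgclass (GOpp s).
Proof. by apply/pgclass_eq/gcong_opp/pgclass_eq; rewrite pgclass_repr. Qed.
Lemma pgaddE s t : pgadd (pgclass s) (pgclass t) = pgclass (GAdd s t).
Proof. by apply/pgclass_eq/gcong_add; apply/pgclass_eq; rewrite pgclass_repr. Qed.

Lemma pgaddA : associative pgadd.
Proof.
move=> x y z; rewrite -(pgclass_repr x) -(pgclass_repr y) -(pgclass_repr z).
by rewrite !pgaddE; apply/pgclass_eq/gcong_addA.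
Qed.
Lemma pgaddC : commutative pgadd.
Proof.
move=> x y; rewrite -(pgclass_repr x) -(pgclass_repr y).
by rewrite !pgaddE; apply/pgclass_eq/gcong_addC.
Qed.
Lemma pgadd0 : left_id (pgclass GZero) pgadd.
Proof.
by move=> x; rewrite -(pgclass_repr x) pgaddE; apply/pgclass_eq/gcong_add0.
Qed.
Lemma pgaddN : left_inverse (pgclass GZero) pgopp pgadd.
Proof.
move=> x; rewrite -(pgclass_repr x) pgoppE pgaddE.
exact/pgclass_eq/gcong_addN.
Qed.
HB.instance Definition _ :=
  GRing.isZmodule.Build pgroup pgaddA pgaddC pgadd0 pgaddN.

Definition pggen (g : G) : pgroup := pgclass (GVar g).

Lemma pgclass0 : pgclass GZero = 0. Proof. by []. Qed.
Lemma pgclassN s : pgclass (GOpp s) = - pgclass s.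
Proof. by rewrite -pgoppE. Qed.
Lemma pgclassD s t : pgclass (GAdd s t) = pgclass s + pgclass t.
Proof. by rewrite -pgaddE. Qed.

Section Lift.
Variables (A : zmodType) (h : G -> A).
Fixpoint geval (s : gterm G) : A :=
  match s with
  | GVar g => h g | GZero => 0 | GOpp s => - geval s
  | GAdd s t => geval s + geval t
  end.
Hypothesis hR : forall s t, R s t -> geval s = geval t.

Lemma geval_cong s t : gcong R s t -> geval s = geval t.
Proof.
elim=> //=.
- by move=> t' s' u _ -> _ ->.
- by move=> s' s'' _ ->.
- by move=> s1 s2 t1 t2 _ -> _ ->.
- by move=> *; rewrite addrA.
- by move=> *; rewrite addrC.
- by move=> *; rewrite add0r.
- by move=> *; rewrite addNr.
Qed.

Definition pglift (_ : forall s t, R s t -> geval s = geval t) (x : pgroup) : A :=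
  geval (repr x).

Lemma pgliftE s : pglift hR (pgclass s) = geval s.
Proof. by apply: geval_cong; apply/pgclass_eq; rewrite pgclass_repr. Qed.

Lemma pglift_gen g : pglift hR (pggen g) = h g.
Proof. exact: pgliftE. Qed.

Lemma pglift_is_zmod_morphism : zmod_morphism (pglift hR).
Proof.
move=> x y; rewrite -(pgclass_repr x) -(pgclass_repr y).
by rewrite -pgclassN -pgclassD !pgliftE.
Qed.
HB.instance Definition _ :=
  GRing.isZmodMorphism.Build pgroup A (pglift hR) pglift_is_zmod_morphism.
End Lift.

Lemma pgroup_ind (P : pgroup -> Prop) :
  P 0 -> (forall x, P x -> P (- x)) -> (forall x y, P x -> P y -> P (x + y)) ->
  (forall g, P (pggen g)) -> forall x, P x.
Proof.
move=> P0 PN PD Pg x; rewrite -(pgclass_repr x); elim: (repr x) => //.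
- by move=> s Ps; rewrite pgclassN; apply: PN.
- by move=> s Ps t Pt; rewrite pgclassD; apply: PD.
Qed.

End PresentedGroup.

Inductive rterm (G : Type) :=
  RVar of G | RZero | ROne | ROpp of rterm G
| RAdd of rterm G & rterm G | RMul of rterm G & rterm G.
Arguments RZero {G}.
Arguments ROne {G}.

Inductive rcong (G : Type) (R : rterm G -> rterm G -> Prop) :
    rterm G -> rterm G -> Prop :=
| rcong_rel s t : R s t -> rcong R s t
| rcong_refl s : rcong R s s
| rcong_sym s t : rcong R s t -> rcong R t s
| rcong_trans t s u : rcong R s t -> rcong R t u -> rcong R s u
| rcong_opp s s' : rcong R s s' -> rcong R (ROpp s) (ROpp s')
| rcong_add s s' t t' :
    rcong R s s' -> rcong R t t' -> rcong R (RAdd s t) (RAdd s' t')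
| rcong_mul s s' t t' :
    rcong R s s' -> rcong R t t' -> rcong R (RMul s t) (RMul s' t')
| rcong_addA s t u : rcong R (RAdd s (RAdd t u)) (RAdd (RAdd s t) u)
| rcong_addC s t : rcong R (RAdd s t) (RAdd t s)
| rcong_add0 s : rcong R (RAdd RZero s) s
| rcong_addN s : rcong R (RAdd (ROpp s) s) RZero
| rcong_mulA s t u : rcong R (RMul s (RMul t u)) (RMul (RMul s t) u)
| rcong_mul1l s : rcong R (RMul ROne s) s
| rcong_mul1r s : rcong R (RMul s ROne) s
| rcong_mulDl s t u : rcong R (RMul (RAdd s t) u) (RAdd (RMul s u) (RMul t u))
| rcong_mulDr s t u : rcong R (RMul s (RAdd t u)) (RAdd (RMul s t) (RMul s u)).

Section PresentedRing.
Variables (G : Type) (R : rterm G -> rterm G -> Prop).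

HB.instance Definition _ := gen_eqMixin (rterm G).
HB.instance Definition _ := gen_choiceMixin (rterm G).

Definition rcongb (s t : rterm G) : bool := `[< rcong R s t >].

Lemma rcongb_refl : reflexive rcongb.
Proof. by move=> s; apply/asboolP/rcong_refl. Qed.
Lemma rcongb_sym : symmetric rcongb.
Proof. by move=> s t; apply/asboolP/asboolP; apply: rcong_sym. Qed.
Lemma rcongb_trans : transitive rcongb.
Proof.
by move=> t s u /asboolP st /asboolP tu; apply/asboolP; apply: rcong_trans tu.
Qed.
Canonical rcong_equiv := EquivRel rcongb rcongb_refl rcongb_sym rcongb_trans.

Definition pring : Type := {eq_quot rcongb}.
HB.instance Definition _ : EqQuotient _ rcongb pring := EqQuotient.on pring.
HB.instance Definition _ := Choice.on pring.

Definition prclass (s : rterm G) : pring := \pi_pring s.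

Lemma prclass_eq s t : rcong R s t <-> prclass s = prclass t.
Proof.
split; first by move=> st; apply/eqmodP/asboolP.
by move/eqmodP/asboolP.
Qed.

Lemma prclass_repr (x : pring) : prclass (repr x) = x.
Proof. exact: reprK. Qed.

Definition propp (x : pring) := prclass (ROpp (repr x)).
Definition pradd (x y : pring) := prclass (RAdd (repr x) (repr y)).
Definition prmul (x y : pring) := prclass (RMul (repr x) (repr y)).

Lemma proppE s : propp (prclass s) = prclass (ROpp s).
Proof. by apply/prclass_eq/rcong_opp/prclass_eq; rewrite prclass_repr. Qed.
Lemma praddE s t : pradd (prclass s) (prclass t) = prclass (RAdd s t).
Proof. by apply/prclass_eq/rcong_add; apply/prclass_eq; rewrite prclass_repr. Qed.
Lemma prmulE s t : prmul (prclass s) (prclass t) = prclass (RMul s t).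
Proof. by apply/prclass_eq/rcong_mul; apply/prclass_eq; rewrite prclass_repr. Qed.

Lemma praddA : associative pradd.
Proof.
move=> x y z; rewrite -(prclass_repr x) -(prclass_repr y) -(prclass_repr z).
by rewrite !praddE; apply/prclass_eq/rcong_addA.
Qed.
Lemma praddC : commutative pradd.
Proof.
move=> x y; rewrite -(prclass_repr x) -(prclass_repr y).
by rewrite !praddE; apply/prclass_eq/rcong_addC.
Qed.
Lemma pradd0 : left_id (prclass RZero) pradd.
Proof.
by move=> x; rewrite -(prclass_repr x) praddE; apply/prclass_eq/rcong_add0.
Qed.
Lemma praddN : left_inverse (prclass RZero) propp pradd.
Proof.
move=> x; rewrite -(prclass_repr x) proppE praddE.
exact/prclass_eq/rcong_addN.
Qed.
HB.instance Definition _ :=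
  GRing.isZmodule.Build pring praddA praddC pradd0 praddN.

Lemma prmulA : associative prmul.
Proof.
move=> x y z; rewrite -(prclass_repr x) -(prclass_repr y) -(prclass_repr z).
by rewrite !prmulE; apply/prclass_eq/rcong_mulA.
Qed.
Lemma prmul1l : left_id (prclass ROne) prmul.
Proof.
by move=> x; rewrite -(prclass_repr x) prmulE; apply/prclass_eq/rcong_mul1l.
Qed.
Lemma prmul1r : right_id (prclass ROne) prmul.
Proof.
by move=> x; rewrite -(prclass_repr x) prmulE; apply/prclass_eq/rcong_mul1r.
Qed.
Lemma prmulDl : left_distributive prmul pradd.
Proof.
move=> x y z; rewrite -(prclass_repr x) -(prclass_repr y) -(prclass_repr z).
rewrite !(praddE, prmulE).
exact/prclass_eq/rcong_mulDl.
Qed.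
Lemma prmulDr : right_distributive prmul pradd.
Proof.
move=> x y z; rewrite -(prclass_repr x) -(prclass_repr y) -(prclass_repr z).
rewrite !(praddE, prmulE).
exact/prclass_eq/rcong_mulDr.
Qed.
HB.instance Definition _ := GRing.Zmodule_isPzRing.Build pring
  prmulA prmul1l prmul1r prmulDl prmulDr.

Definition prgen (g : G) : pring := prclass (RVar g).

Lemma prclass0 : prclass RZero = 0. Proof. by []. Qed.
Lemma prclass1 : prclass ROne = 1. Proof. by []. Qed.
Lemma prclassN s : prclass (ROpp s) = - prclass s.
Proof. by rewrite -proppE. Qed.
Lemma prclassD s t : prclass (RAdd s t) = prclass s + prclass t.
Proof. by rewrite -praddE. Qed.
Lemma prclassM s t : prclass (RMul s t) = prclass s * prclass t.
Proof. by rewrite -prmulE. Qed.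

Section Lift.
Variables (A : pzRingType) (h : G -> A).
Fixpoint reval (s : rterm G) : A :=
  match s with
  | RVar g => h g | RZero => 0 | ROne => 1 | ROpp s => - reval s
  | RAdd s t => reval s + reval t | RMul s t => reval s * reval t
  end.
Hypothesis hR : forall s t, R s t -> reval s = reval t.

Lemma reval_cong s t : rcong R s t -> reval s = reval t.
Proof.
elim=> //=.
- by move=> t' s' u _ -> _ ->.
- by move=> s' s'' _ ->.
- by move=> s1 s2 t1 t2 _ -> _ ->.
- by move=> s1 s2 t1 t2 _ -> _ ->.
- by move=> *; rewrite addrA.
- by move=> *; rewrite addrC.
- by move=> *; rewrite add0r.
- by move=> *; rewrite addNr.
- by move=> *; rewrite mulrA.
- by move=> *; rewrite mul1r.
- by move=> *; rewrite mulr1.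
- by move=> *; rewrite mulrDl.
- by move=> *; rewrite mulrDr.
Qed.

Definition prlift (_ : forall s t, R s t -> reval s = reval t) (x : pring) : A :=
  reval (repr x).

Lemma prliftE s : prlift hR (prclass s) = reval s.
Proof. by apply: reval_cong; apply/prclass_eq; rewrite prclass_repr. Qed.

Lemma prlift_gen g : prlift hR (prgen g) = h g.
Proof. exact: prliftE. Qed.

Lemma prlift_is_zmod_morphism : zmod_morphism (prlift hR).
Proof.
move=> x y; rewrite -(prclass_repr x) -(prclass_repr y).
by rewrite -prclassN -prclassD !prliftE.
Qed.
Lemma prlift_is_monoid_morphism : monoid_morphism (prlift hR).
Proof.
split=> [|x y]; first by rewrite -prclass1 prliftE.
rewrite -(prclass_repr x) -(prclass_repr y).
by rewrite -prclassM !prliftE.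
Qed.
HB.instance Definition _ :=
  GRing.isZmodMorphism.Build pring A (prlift hR) prlift_is_zmod_morphism.
HB.instance Definition _ :=
  GRing.isMonoidMorphism.Build pring A (prlift hR) prlift_is_monoid_morphism.
End Lift.

Lemma pring_ind (P : pring -> Prop) :
  P 0 -> P 1 -> (forall x, P x -> P (- x)) ->
  (forall x y, P x -> P y -> P (x + y)) -> (forall x y, P x -> P y -> P (x * y)) ->
  (forall g, P (prgen g)) -> forall x, P x.
Proof.
move=> P0 P1 PN PD PM Pg x; rewrite -(prclass_repr x); elim: (repr x) => //.
- by move=> s Ps; rewrite prclassN; apply: PN.
- by move=> s Ps t Pt; rewrite prclassD; apply: PD.
- by move=> s Ps t Pt; rewrite prclassM; apply: PM.
Qed.

Section Grading.
Variable deg : G -> int.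

Inductive hdeg : int -> pring -> Prop :=
| hdeg0 n : hdeg n 0
| hdeg1 : hdeg 0 1
| hdeg_gen g : hdeg (deg g) (prgen g)
| hdegN n x : hdeg n x -> hdeg n (- x)
| hdegD n x y : hdeg n x -> hdeg n y -> hdeg n (x + y)
| hdegM m n x y : hdeg m x -> hdeg n y -> hdeg (m + n) (x * y).

Definition hdegb (n : int) : {pred pring} := [pred x | `[< hdeg n x >]].

Lemma hdegbP n x : reflect (hdeg n x) (x \in hdegb n).
Proof. exact: asboolP. Qed.

Lemma hdegb_zmod_closed n : zmod_closed (hdegb n).
Proof.
split; first exact/hdegbP/hdeg0.
move=> x y /hdegbP hx /hdegbP hy.
exact/hdegbP/hdegD/hdegN.
Qed.
HB.instance Definition _ n := GRing.isZmodClosed.Build pring (hdegb n)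
  (hdegb_zmod_closed n).

Record gpart (n : int) := Gpart { gpart_val : pring; _ : gpart_val \in hdegb n }.
HB.instance Definition _ n := [isSub for @gpart_val n].
HB.instance Definition _ n := [Choice of gpart n by <:].
HB.instance Definition _ n := [SubChoice_isSubZmodule of gpart n by <:].

End Grading.
End PresentedRing.

Local Close Scope quotient_scope.

Lemma prlift_hdeg G R G' R' (deg : G -> int) (deg' : G' -> int)
    (h : G -> @pring G' R') hR :
  (forall g, hdeg deg' (deg g) (h g)) ->
  forall n x, hdeg deg n x -> hdeg deg' n (@prlift G R _ h hR x).
Proof.
move=> hdegh n x; elim=> {n x}.
- by move=> n; rewrite raddf0; apply: hdeg0.
- by rewrite rmorph1; apply: hdeg1.
- by move=> g; rewrite prlift_gen.
- by move=> n x _ hx; rewrite raddfN; apply: hdegN.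
- by move=> n x y _ hx _ hy; rewrite raddfD; apply: hdegD.
- by move=> m n x y _ hx _ hy; rewrite rmorphM; apply: hdegM.
Qed.


(** There is a generator [MWsym a] for every [a] in the field; the one attached
    to [0] is killed, so only the symbols of units remain. *)
Variant mw_gen (K : Type) := MWsym of K | MWeta.
Arguments MWeta {K}.

Section MilnorWitt.
Variable K : fieldType.
Local Notation "'[[' a ']]'" := (RVar (MWsym a)) (at level 0).
Local Notation "'eta_'" := (RVar (@MWeta K)).

Variant mw_rel : rterm (mw_gen K) -> rterm (mw_gen K) -> Prop :=
| mw_rel0 : mw_rel [[0]] RZero
| mw_rel_steinberg (a : K) : a != 0 -> a != 1 ->
    mw_rel (RMul [[a]] [[1 - a]]) RZero
| mw_rel_mul (a b : K) : a != 0 -> b != 0 ->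
    mw_rel [[a * b]] (RAdd (RAdd [[a]] [[b]]) (RMul eta_ (RMul [[a]] [[b]])))
| mw_rel_comm (a : K) : mw_rel (RMul eta_ [[a]]) (RMul [[a]] eta_)
| mw_rel_hyp :
    mw_rel (RMul eta_ (RAdd (RAdd ROne ROne) (RMul eta_ [[-1]]))) RZero.

Definition KMWring := pring mw_rel.
HB.instance Definition _ := GRing.PzRing.on KMWring.

Definition mw_deg (g : mw_gen K) : int :=
  match g with MWsym _ => 1 | MWeta => -1 end.

Definition KMW (n : int) := gpart mw_rel mw_deg n.
HB.instance Definition _ n := GRing.Zmodule.on (KMW n).
HB.instance Definition _ n := SubType.on (KMW n).

Definition mw_sym (a : K) : KMWring := prgen mw_rel (MWsym a).
Definition mw_eta : KMWring := prgen mw_rel MWeta.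
Definition mw_angle (a : K) : KMWring := 1 + mw_eta * mw_sym a.
Definition mw_eps : KMWring := - mw_angle (-1).
Definition mw_neps (m : int) : KMWring :=
  match m with
  | Posz n => \sum_(i < n) (- mw_eps) ^+ i
  | Negz n => mw_eps * \sum_(i < n.+1) (- mw_eps) ^+ i
  end.

Lemma mw_sym0 : mw_sym 0 = 0.
Proof. exact/prclass_eq/rcong_rel/mw_rel0. Qed.
Lemma mw_sym_steinberg (a : K) : a != 0 -> a != 1 -> mw_sym a * mw_sym (1 - a) = 0.
Proof.
move=> a0 a1; have /prclass_eq := rcong_rel (mw_rel_steinberg a0 a1).
by rewrite prclassM.
Qed.
Lemma mw_symM (a b : K) : a != 0 -> b != 0 ->
  mw_sym (a * b) = mw_sym a + mw_sym b + mw_eta * (mw_sym a * mw_sym b).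
Proof.
move=> a0 b0; have /prclass_eq := rcong_rel (mw_rel_mul a0 b0).
by rewrite !prclassD !prclassM.
Qed.
Lemma eta_sym (a : K) : mw_eta * mw_sym a = mw_sym a * mw_eta.
Proof.
by have /prclass_eq := rcong_rel (mw_rel_comm a); rewrite !prclassM.
Qed.
Lemma eta_hyp : mw_eta * (1 + 1 + mw_eta * mw_sym (-1)) = 0.
Proof.
have /prclass_eq := rcong_rel mw_rel_hyp.
by rewrite !(prclassM, prclassD).
Qed.

Lemma eta_angle (a : K) : mw_eta * mw_angle a = mw_angle a * mw_eta.
Proof. by rewrite mulrDr mulrDl mulr1 mul1r -mulrA -eta_sym. Qed.

Lemma hdeg_eta n x : hdeg mw_deg n x -> hdeg mw_deg (n - 1) (mw_eta * x).
Proof. by move=> hx; rewrite addrC; apply: hdegM hx; apply: (@hdeg_gen _ mw_rel mw_deg MWeta). Qed.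

Definition eta_mul n (s : KMW n) : KMW (n - 1).
Proof.
exists (mw_eta * val s).
by apply/hdegbP/hdeg_eta/hdegbP; case: s.
Defined.

End MilnorWitt.

Section Milnor.
Variable K : fieldType.

Variant m_rel : rterm K -> rterm K -> Prop :=
| m_rel0 : m_rel (RVar 0) RZero
| m_rel_steinberg (a : K) : a != 0 -> a != 1 ->
    m_rel (RMul (RVar a) (RVar (1 - a))) RZero
| m_rel_mul (a b : K) : a != 0 -> b != 0 ->
    m_rel (RVar (a * b)) (RAdd (RVar a) (RVar b)).

Definition KMring := pring m_rel.
HB.instance Definition _ := GRing.PzRing.on KMring.

Definition m_deg (a : K) : int := 1.
Definition KM (n : int) := gpart m_rel m_deg n.
HB.instance Definition _ n := GRing.Zmodule.on (KM n).
HB.instance Definition _ n := SubType.on (KM n).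

Definition milnor_sym (a : K) : KMring := prgen m_rel a.

Lemma milnor_sym0 : milnor_sym 0 = 0.
Proof. exact/prclass_eq/rcong_rel/m_rel0. Qed.
Lemma milnor_sym_steinberg (a : K) : a != 0 -> a != 1 -> milnor_sym a * milnor_sym (1 - a) = 0.
Proof.
move=> a0 a1; have /prclass_eq := rcong_rel (m_rel_steinberg a0 a1).
by rewrite prclassM.
Qed.
Lemma milnor_symM (a b : K) : a != 0 -> b != 0 -> milnor_sym (a * b) = milnor_sym a + milnor_sym b.
Proof.
move=> a0 b0; have /prclass_eq := rcong_rel (m_rel_mul a0 b0).
by rewrite prclassD.
Qed.
End Milnor.

Section Functoriality.
Variables (K K' : fieldType) (phi : {rmorphism K -> K'}).

Definition mw_map_gen (g : mw_gen K) : KMWring K' :=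
  match g with MWsym a => mw_sym (phi a) | MWeta => mw_eta K' end.

Lemma mw_map_rel s t : mw_rel s t -> reval mw_map_gen s = reval mw_map_gen t.
Proof.
case=> //= [|a a0 a1|a b a0 b0|a|].
- by rewrite rmorph0 mw_sym0.
- by rewrite rmorphB rmorph1 mw_sym_steinberg // ?fmorph_eq0 ?fmorph_eq1.
- by rewrite rmorphM mw_symM ?fmorph_eq0.
- by rewrite eta_sym.
- by rewrite rmorphN rmorph1 eta_hyp.
Qed.

Definition KMWring_map : KMWring K -> KMWring K' := prlift mw_map_rel.
HB.instance Definition _ := GRing.RMorphism.copy KMWring_map (prlift mw_map_rel).

Lemma KMWring_map_hdeg n x :
  hdeg (@mw_deg K) n x -> hdeg (@mw_deg K') n (KMWring_map x).
Proof.
apply: prlift_hdeg => -[a|]; first exact: (@hdeg_gen _ (@mw_rel K') (@mw_deg K') (MWsym _)).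
exact: (@hdeg_gen _ (@mw_rel K') (@mw_deg K') MWeta).
Qed.

Definition KMW_map n (s : KMW K n) : KMW K' n.
Proof.
exists (KMWring_map (val s)).
by apply/hdegbP/KMWring_map_hdeg/hdegbP; case: s.
Defined.

Definition m_map_gen (a : K) : KMring K' := milnor_sym (phi a).

Lemma m_map_rel s t : m_rel s t -> reval m_map_gen s = reval m_map_gen t.
Proof.
case=> [|a a0 a1|a b a0 b0] /=; rewrite /m_map_gen.
- by rewrite rmorph0 milnor_sym0.
- by rewrite rmorphB rmorph1 milnor_sym_steinberg // ?fmorph_eq0 ?fmorph_eq1.
- by rewrite rmorphM milnor_symM ?fmorph_eq0.
Qed.

Definition KMring_map : KMring K -> KMring K' := prlift m_map_rel.
HB.instance Definition _ := GRing.RMorphism.copy KMring_map (prlift m_map_rel).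

Lemma KMring_map_hdeg n x :
  hdeg (@m_deg K) n x -> hdeg (@m_deg K') n (KMring_map x).
Proof. by apply: prlift_hdeg => a; apply: (@hdeg_gen _ (@m_rel K') (@m_deg K') (phi a)). Qed.

Definition KM_map n (s : KM K n) : KM K' n.
Proof.
exists (KMring_map (val s)).
by apply/hdegbP/KMring_map_hdeg/hdegbP; case: s.
Defined.

End Functoriality.

Section ModEta.
Variable K : fieldType.

Definition modeta_gen (g : mw_gen K) : KMring K :=
  match g with MWsym a => milnor_sym a | MWeta => 0 end.

Lemma modeta_rel s t : mw_rel s t -> reval modeta_gen s = reval modeta_gen t.
Proof.
case=> //= [|a a0 a1|a b a0 b0|a|].
- exact: milnor_sym0.
- exact: milnor_sym_steinberg.
- by rewrite mul0r addr0 milnor_symM.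
- by rewrite mul0r mulr0.
- by rewrite mul0r.
Qed.

Definition modeta_ring : KMWring K -> KMring K := prlift modeta_rel.
HB.instance Definition _ := GRing.RMorphism.copy modeta_ring (prlift modeta_rel).


Lemma modeta_hdeg n x :
  hdeg (@mw_deg K) n x -> hdeg (@m_deg K) n (modeta_ring x).
Proof. by apply: prlift_hdeg => -[a|]; [apply: (@hdeg_gen _ (@m_rel K) (@m_deg K) a)|apply: hdeg0]. Qed.

Definition modeta n (s : KMW K n) : KM K n.
Proof.
exists (modeta_ring (val s)).
by apply/hdegbP/modeta_hdeg/hdegbP; case: s.
Defined.

Lemma modetaD n (s t : KMW K n) : modeta (s + t) = modeta s + modeta t.
Proof. by apply: val_inj; rewrite /= raddfD. Qed.

Lemma modeta_angle (u : K) : modeta_ring (mw_angle u) = 1.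
Proof.
rewrite /mw_angle rmorphD rmorph1 rmorphM /=.
by rewrite [X in X * _](prlift_gen modeta_rel MWeta) mul0r addr0.
Qed.
End ModEta.

(** Twists: [KMWt L n] is the tensor product of [KMW K n] and the free abelian
    group on [L \ {0}] over the group ring of the units of [K]; the extra
    generators attached to the zero vector are killed. *)

Section Twist.
Variables (K : fieldType) (L : lmodType K) (n : int).

Variant tw_rel : gterm (KMW K n * L) -> gterm (KMW K n * L) -> Prop :=
| tw_rel0 s : tw_rel (GVar (s, 0)) GZero
| tw_relD s t l :
    tw_rel (GVar (s + t, l)) (GAdd (GVar (s, l)) (GVar (t, l)))
| tw_relA (u : K) (s s' : KMW K n) (l : L) : u != 0 ->
    val s' = mw_angle u * val s -> tw_rel (GVar (s', l)) (GVar (s, u *: l)).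

Definition KMWt := pgroup tw_rel.
HB.instance Definition _ := GRing.Zmodule.on KMWt.

Definition tens (s : KMW K n) (l : L) : KMWt := pggen tw_rel (s, l).

Lemma tens0 s : tens s 0 = 0.
Proof. exact/pgclass_eq/gcong_rel/tw_rel0. Qed.
Lemma tensD s t l : tens (s + t) l = tens s l + tens t l.
Proof.
by have /pgclass_eq := gcong_rel (tw_relD s t l); rewrite pgclassD.
Qed.
Lemma tensA u s s' l : u != 0 -> val s' = mw_angle u * val s ->
  tens s' l = tens s (u *: l).
Proof. by move=> u0 ss'; apply/pgclass_eq/gcong_rel/tw_relA. Qed.

Definition modeta_tw_gen (sl : KMW K n * L) : KM K n :=
  if sl.2 == 0 then 0 else modeta sl.1.

Lemma modeta_tw_rel s t :
  tw_rel s t -> geval modeta_tw_gen s = geval modeta_tw_gen t.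
Proof.
case=> [s'|s1 s2 l|u s1 s2 l u0 e] /=; rewrite /modeta_tw_gen /=.
- by rewrite eqxx.
- by case: eqP; rewrite ?addr0 // modetaD.
- rewrite scaler_eq0 (negPf u0) /=; case: eqP => // _.
  by apply: val_inj; rewrite /= e rmorphM /= modeta_angle mul1r.
Qed.

Definition modeta_tw : KMWt -> KM K n := pglift modeta_tw_rel.
HB.instance Definition _ := GRing.Additive.copy modeta_tw (pglift modeta_tw_rel).
End Twist.

Section EtaTwist.
Variables (K : fieldType) (L : lmodType K) (n : int).

Definition eta_tw_gen (sl : KMW K n * L) : KMWt L (n - 1) :=
  tens (eta_mul sl.1) sl.2.

Lemma eta_tw_rel s t : tw_rel s t -> geval eta_tw_gen s = geval eta_tw_gen t.
Proof.
case=> [s'|s1 s2 l|u s1 s2 l u0 e] /=; rewrite /eta_tw_gen /=.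
- exact: tens0.
- by rewrite -tensD; congr tens; apply: val_inj; rewrite /= mulrDr.
- by apply: tensA => //=; rewrite e mulrA eta_angle mulrA.
Qed.

Definition eta_tw : KMWt L n -> KMWt L (n - 1) := pglift eta_tw_rel.
HB.instance Definition _ := GRing.Additive.copy eta_tw (pglift eta_tw_rel).
End EtaTwist.


Section EndoRing.
Variable W : zmodType.

Record endo := Endo { endo_fun :> W -> W; endoB : zmod_morphism endo_fun }.
HB.instance Definition _ (f : endo) :=
  GRing.isZmodMorphism.Build W W f (endoB f).
HB.instance Definition _ := gen_eqMixin endo.
HB.instance Definition _ := gen_choiceMixin endo.

Lemma endo_eq (f g : endo) : f =1 g -> f = g.
Proof.
case: f g => [f fB] [g gB] /= /funext fg; case: _ / fg in gB *.
by congr Endo; apply: Prop_irrelevance.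
Qed.

Definition endo_zero : endo := @Endo (fun=> 0) (fun _ _ => esym (subrr 0)).
Definition endo_one : endo := @Endo id (fun _ _ => erefl).
Definition endo_opp (f : endo) : endo.
Proof. by exists (fun x => - f x) => x y; rewrite raddfB opprB addrC opprK. Defined.
Definition endo_add (f g : endo) : endo.
Proof. by exists (fun x => f x + g x) => x y; rewrite !raddfB opprD addrACA. Defined.
Definition endo_mul (f g : endo) : endo.
Proof. by exists (f \o g) => x y /=; rewrite !raddfB. Defined.

Lemma endo_addA : associative endo_add.
Proof. by move=> f g h; apply: endo_eq => x /=; rewrite addrA. Qed.
Lemma endo_addC : commutative endo_add.
Proof. by move=> f g; apply: endo_eq => x /=; rewrite addrC. Qed.
Lemma endo_add0 : left_id endo_zero endo_add.
Proof. by move=> f; apply: endo_eq => x /=; rewrite add0r. Qed.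
Lemma endo_addN : left_inverse endo_zero endo_opp endo_add.
Proof. by move=> f; apply: endo_eq => x /=; rewrite addNr. Qed.
HB.instance Definition _ :=
  GRing.isZmodule.Build endo endo_addA endo_addC endo_add0 endo_addN.

Lemma endo_mulA : associative endo_mul.
Proof. by move=> f g h; apply: endo_eq. Qed.
Lemma endo_mul1l : left_id endo_one endo_mul.
Proof. by move=> f; apply: endo_eq. Qed.
Lemma endo_mul1r : right_id endo_one endo_mul.
Proof. by move=> f; apply: endo_eq. Qed.
Lemma endo_mulDl : left_distributive endo_mul endo_add.
Proof. by move=> f g h; apply: endo_eq. Qed.
Lemma endo_mulDr : right_distributive endo_mul endo_add.
Proof. by move=> f g h; apply: endo_eq => x /=; rewrite raddfD. Qed.
HB.instance Definition _ := GRing.Zmodule_isPzRing.Build endo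
  endo_mulA endo_mul1l endo_mul1r endo_mulDl endo_mulDr.

Lemma endoD (f g : endo) x : (f + g) x = f x + g x. Proof. by []. Qed.
Lemma endoN (f : endo) x : (- f) x = - f x. Proof. by []. Qed.
Lemma endoM (f g : endo) x : (f * g) x = f (g x). Proof. by []. Qed.
Lemma endo1 x : (1 : endo) x = x. Proof. by []. Qed.
Lemma endo0 x : (0 : endo) x = 0. Proof. by []. Qed.
End EndoRing.


Section Witt.
Variables (K : fieldType) (L : lmodType K).

(** [L] is meant to be of dimension one. Up to isometry, the underlying vector
    space may be taken to be a space of row vectors. *)
Record ips := Ips {
  ips_dim : nat;
  ips_form :> 'rV[K]_ips_dim -> 'rV[K]_ips_dim -> L;
  ips_linear : forall a v v' w,
    ips_form (a *: v + v') w = a *: ips_form v w + ips_form v' w;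
  ips_sym : forall v w, ips_form v w = ips_form w v;
  ips_nondeg : forall v, (forall w, ips_form v w = 0) -> v = 0
}.

Definition isometric (P Q : ips) : Prop :=
  exists g : 'rV[K]_(ips_dim P) -> 'rV[K]_(ips_dim Q),
    [/\ linear g, bijective g & forall v w, Q (g v) (g w) = P v w].

Lemma ips_form0l (P : ips) w : P 0 w = 0.
Proof.
have := ips_linear (-1) 0 0 w; rewrite scaler0 add0r scaleN1r => e.
by rewrite e addNr.
Qed.
Lemma ips_formDl (P : ips) v v' w : P (v + v') w = P v w + P v' w.
Proof. by rewrite -{1}[v]scale1r ips_linear scale1r. Qed.
Lemma ips_formZl (P : ips) a v w : P (a *: v) w = a *: P v w.
Proof. by rewrite -[a *: v]addr0 ips_linear ips_form0l addr0. Qed.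
Lemma ips_form0r (P : ips) w : P w 0 = 0.
Proof. by rewrite ips_sym ips_form0l. Qed.
Lemma ips_formDr (P : ips) v v' w : P w (v + v') = P w v + P w v'.
Proof. by rewrite !(ips_sym w) ips_formDl. Qed.
Lemma ips_formZr (P : ips) a v w : P w (a *: v) = a *: P w v.
Proof. by rewrite !(ips_sym w) ips_formZl. Qed.

Definition ips_sum (P Q : ips) : ips.
Proof.
exists (ips_dim P + ips_dim Q)%N
  (fun v w => P (lsubmx v) (lsubmx w) + Q (rsubmx v) (rsubmx w)).
- by move=> a v v' w; rewrite !linearP !ips_linear scalerDr addrACA.
- by move=> v w; rewrite ips_sym [Q _ _]ips_sym.
- move=> v hv; rewrite -[v]hsubmxK; rewrite -[RHS]row_mx0; congr row_mx.
  + apply: (@ips_nondeg P) => w; have := hv (row_mx w 0).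
    by rewrite row_mxKl row_mxKr ips_form0r addr0.
  + apply: (@ips_nondeg Q) => w; have := hv (row_mx 0 w).
    by rewrite row_mxKl row_mxKr ips_form0r add0r.
Defined.

(** Forms are only scaled by units: [ips_scale 0] is the identity. *)
Definition unit_or_1 (u : K) : K := if u == 0 then 1 else u.
Lemma unit_or_1_neq0 u : unit_or_1 u != 0.
Proof. by rewrite /unit_or_1; have [_|] := eqVneq u 0; rewrite ?oner_eq0. Qed.
Lemma unit_or_1E u : u != 0 -> unit_or_1 u = u.
Proof. by rewrite /unit_or_1 => /negPf->. Qed.

Definition ips_scale (u : K) (P : ips) : ips.
Proof.
exists (ips_dim P) (fun v w => unit_or_1 u *: P v w).
- by move=> a v v' w; rewrite ips_linear scalerDr !scalerA mulrC.
- by move=> v w; rewrite ips_sym.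
- move=> v hv; apply: (@ips_nondeg P) => w; apply/eqP.
  by have /eqP := hv w; rewrite scaler_eq0 (negPf (unit_or_1_neq0 u)).
Defined.

Definition ips_line (l : L) (l0 : l != 0) : ips.
Proof.
exists 1%N (fun v w => (v 0 0 * w 0 0) *: l).
- by move=> a v v' w; rewrite !mxE mulrDl scalerDl -mulrA scalerA.
- by move=> v w; rewrite mulrC.
- move=> v /(_ (const_mx 1)) /eqP; rewrite mxE mulr1 scaler_eq0 (negPf l0) orbF.
  by move/eqP => v0; apply/rowP => i; rewrite ord1 mxE.
Defined.

(** The Witt group: the Grothendieck group of inner product spaces modulo the
    multiples [h.P] of the hyperbolic plane, [h.P] being the sum of [P] and of
    its opposite. *)
Variant witt_rel : gterm ips -> gterm ips -> Prop :=
| witt_rel_iso P Q : isometric P Q -> witt_rel (GVar P) (GVar Q)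
| witt_rel_sum P Q :
    witt_rel (GVar (ips_sum P Q)) (GAdd (GVar P) (GVar Q))
| witt_rel_hyp P : witt_rel (GVar (ips_sum P (ips_scale (-1) P))) GZero.

Definition Witt := pgroup witt_rel.
HB.instance Definition _ := GRing.Zmodule.on Witt.

Definition wclass (P : ips) : Witt := pggen witt_rel P.

Lemma wclass_iso P Q : isometric P Q -> wclass P = wclass Q.
Proof. by move=> PQ; apply/pgclass_eq/gcong_rel/witt_rel_iso. Qed.
Lemma wclass_sum P Q : wclass (ips_sum P Q) = wclass P + wclass Q.
Proof. by have /pgclass_eq := gcong_rel (witt_rel_sum P Q); rewrite pgclassD. Qed.
Lemma wclass_hyp P : wclass P + wclass (ips_scale (-1) P) = 0.
Proof.
by rewrite -wclass_sum; apply/pgclass_eq/gcong_rel/witt_rel_hyp.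
Qed.

Definition wline (l : L) : Witt :=
  if @idP (l != 0) is ReflectT l0 then wclass (ips_line l0) else 0.

Lemma wline0 : wline 0 = 0.
Proof. by rewrite /wline; destruct idP as [p|] => //; exfalso; move: p; rewrite eqxx. Qed.

Lemma wlineE l (l0 : l != 0) : wline l = wclass (ips_line l0).
Proof.
rewrite /wline; destruct idP as [p|np]; last by case: np.
by congr (wclass (ips_line _)); apply: bool_irrelevance.
Qed.

Definition wscale_gen (u : K) (P : ips) : Witt := wclass (ips_scale u P).

Lemma wscale_rel u s t :
  witt_rel s t -> geval (wscale_gen u) s = geval (wscale_gen u) t.
Proof.
case=> [P Q [g [lg bg hg]]|P Q|P] /=; rewrite /wscale_gen.
- by apply: wclass_iso; exists g; split=> // v w /=; rewrite hg.
- rewrite -wclass_sum; apply: wclass_iso; exists id; split=> // [|v w]; first by exists id.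
  by rewrite /= scalerDr.
- rewrite -(wclass_hyp (ips_scale u P)) -wclass_sum.
  apply: wclass_iso; exists id; split=> // [|v w]; first by exists id.
  by rewrite /= scalerDr !scalerA mulrC.
Qed.

(** The class of [u] in [GW(K)] acts on [L]-valued forms by scaling. *)
Definition wscale (u : K) : endo Witt :=
  Endo (pglift_is_zmod_morphism (wscale_rel u)).

Lemma wscaleE u P : wscale u (wclass P) = wclass (ips_scale u P).
Proof. exact: (pglift_gen (wscale_rel u)). Qed.

Lemma endo_ext (f g : endo Witt) :
  (forall P, f (wclass P) = g (wclass P)) -> f = g.
Proof.
move=> fg; apply: endo_eq; apply: pgroup_ind => [|x e|x y ex ey|P].
- by rewrite !raddf0.
- by rewrite !raddfN; congr (- _).
- by rewrite !raddfD; congr (_ + _).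
- exact: fg.
Qed.

Lemma wscale0 : wscale 0 = 1.
Proof.
apply: endo_ext => P; rewrite wscaleE; apply: wclass_iso; exists id; split=> // [|v w]; first by exists id.
by rewrite /= /unit_or_1 eqxx scale1r.
Qed.

Lemma wscaleM u v : u != 0 -> v != 0 -> wscale (u * v) = wscale u * wscale v.
Proof.
move=> u0 v0; apply: endo_ext => P; rewrite endoM !wscaleE.
apply: wclass_iso; exists id; split=> // [|x y]; first by exists id.
by rewrite /= !unit_or_1E ?mulf_neq0 // scalerA.
Qed.

Lemma wscaleN1 : 1 + wscale (-1) = 0.
Proof. by apply: endo_ext => P; rewrite endoD wscaleE; apply: wclass_hyp. Qed.

Lemma wscaleC u v : wscale u * wscale v = wscale v * wscale u.
Proof.
apply: endo_ext => P; rewrite !endoM !wscaleE.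
apply: wclass_iso; exists id; split=> // [|x y]; first by exists id.
by rewrite /= !scalerA mulrC.
Qed.

Lemma wscale_steinberg a : a != 0 -> a != 1 ->
  (1 - wscale a) * (1 - wscale (1 - a)) = 0.
Proof.
move=> a0 a1; have b0 : 1 - a != 0 by rewrite subr_eq0 eq_sym.
have e : 1 + wscale (a * (1 - a)) = wscale a + wscale (1 - a).
  apply: endo_ext => P; rewrite !endoD !wscaleE -!wclass_sum.
  apply: wclass_iso.
  pose g (v : 'rV[K]_(ips_dim P + ips_dim P)) : 'rV[K]_(ips_dim P + ips_dim P) :=
    row_mx (lsubmx v - (1 - a) *: rsubmx v) (lsubmx v + a *: rsubmx v).
  pose g' (v : 'rV[K]_(ips_dim P + ips_dim P)) : 'rV[K]_(ips_dim P + ips_dim P) :=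
    row_mx (a *: lsubmx v + (1 - a) *: rsubmx v) (rsubmx v - lsubmx v).
  exists g; split.
  - move=> c v w; rewrite /g scale_row_mx add_row_mx.
    congr row_mx; apply/rowP => i; rewrite !mxE; ring.
  - exists g' => v; rewrite /g /g' !row_mxKl !row_mxKr -[RHS]hsubmxK;
      congr row_mx; apply/rowP => i; rewrite !mxE; ring.
  - move=> v w /=; rewrite /g !row_mxKl !row_mxKr !unit_or_1E ?mulf_neq0 //.
    rewrite -!scaleNr !(ips_formDl, ips_formDr, ips_formZl, ips_formZr).
    rewrite ?scale1r.
    set x := P _ _; set y := P _ _; set z := P _ _; set t := P _ _.
    rewrite !(scalerDr, scalerA) /=.
    transitivity ((a + (1 - a)) *: x + (a * - (1 - a) + (1 - a) * a) *: y
      + (a * - (1 - a) + (1 - a) * a) *: z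
      + (a * (- (1 - a) * - (1 - a)) + (1 - a) * (a * a)) *: t).
      by rewrite !scalerDl !addrA (ACl (1*5*6*2*7*3*8*4*9)).
    have -> : a + (1 - a) = 1 by ring.
    have -> : a * - (1 - a) + (1 - a) * a = 0 by ring.
    have -> : a * (- (1 - a) * - (1 - a)) + (1 - a) * (a * a) = a * (1 - a) by ring.
    by rewrite scale1r !scale0r !addr0.
rewrite mulrBl mul1r mulrBr mulr1 -wscaleM //.
by rewrite opprB addrACA e -opprD [wscale (1 - a) + _]addrC subrr.
Qed.

(** [[u] |-> 1 - <u>] and [eta |-> -1] define a ring morphism to the Witt ring of
    [K], here composed with the action of the latter on the Witt group of
    [L]-valued spaces. *)
Definition mu_gen (g : mw_gen K) : endo Witt :=
  match g with MWsym a => 1 - wscale a | MWeta => -1 end.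

Lemma mu_rel s t : mw_rel s t -> reval mu_gen s = reval mu_gen t.
Proof.
case=> //= [|a a0 a1|a b a0 b0|a|].
- by rewrite wscale0 subrr.
- exact: wscale_steinberg.
- rewrite wscaleM // mulN1r mulrBl mul1r mulrBr mulr1.

  by rewrite opprB -[RHS]addrA [X in _ = _ + X]addrC subrK addrA subrK.
- by rewrite mulN1r mulrN1.
- rewrite !mulN1r opprB opprD addrA [1 - wscale _]addrC addrK -opprD.
  by rewrite [wscale _ + 1]addrC wscaleN1 oppr0.
Qed.

Definition mu_ring : KMWring K -> endo Witt := prlift mu_rel.
HB.instance Definition _ := GRing.RMorphism.copy mu_ring (prlift mu_rel).

Lemma mu_sym a : mu_ring (mw_sym a) = 1 - wscale a.
Proof. exact: (prlift_gen mu_rel (MWsym a)). Qed.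
Lemma mu_eta : mu_ring (mw_eta K) = -1.
Proof. exact: (prlift_gen mu_rel MWeta). Qed.
Lemma mu_angle a : mu_ring (mw_angle a) = wscale a.
Proof.
rewrite /mw_angle rmorphD rmorph1 rmorphM /= [X in _ + X * _]mu_eta [X in _ * X]mu_sym.
by rewrite mulN1r opprB addrC subrK.
Qed.

Lemma mu_wscale x a : mu_ring x * wscale a = wscale a * mu_ring x.
Proof.
elim/pring_ind: x => [||x e|x y ex ey|x y ex ey|[b|]].
- by rewrite rmorph0 mul0r mulr0.
- by rewrite rmorph1 mul1r mulr1.
- by rewrite rmorphN mulNr mulrN e.
- by rewrite rmorphD mulrDl mulrDr ex ey.
- by rewrite rmorphM -mulrA ey mulrA ex mulrA.
- by rewrite [mu_ring _]mu_sym mulrBl mulrBr mul1r mulr1 wscaleC.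
- by rewrite [mu_ring _]mu_eta mulN1r mulrN1.
Qed.

Lemma wscale_line u l : u != 0 -> wscale u (wline l) = wline (u *: l).
Proof.
move=> u0; have [->|l0] := eqVneq l 0.
  by rewrite scaler0 wline0 raddf0.
have ul0 : u *: l != 0 by rewrite scaler_eq0 negb_or u0.
rewrite (wlineE l0) (wlineE ul0) wscaleE.
apply: wclass_iso; exists id; split=> // [|x y]; first by exists id.
by rewrite /= unit_or_1E // !scalerA mulrC.
Qed.

Variable n : int.

Definition mu_tw_gen (sl : KMW K n * L) : Witt :=
  mu_ring (val sl.1) (wline sl.2).

Lemma mu_tw_rel s t : tw_rel s t -> geval mu_tw_gen s = geval mu_tw_gen t.
Proof.
case=> [s'|s1 s2 l|u s1 s2 l u0 e] /=; rewrite /mu_tw_gen /=.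
- by rewrite wline0 raddf0.
- by rewrite rmorphD.
- have -> : mu_ring (val s2) = wscale u * mu_ring (val s1).
    by rewrite e rmorphM; congr (_ * _); apply: mu_angle.
  by rewrite -mu_wscale endoM wscale_line.
Qed.

(** Its image is the subgroup [I^n(K, L)] of the Witt group, where [I^n] is the
    [n]-th power of the fundamental ideal. *)
Definition mu_tw : KMWt L n -> Witt := pglift mu_tw_rel.
HB.instance Definition _ := GRing.Additive.copy mu_tw (pglift mu_tw_rel).

End Witt.

Section UntwistedWitt.
Variables (K : fieldType) (n : int).

Definition mu (s : KMW K n) : Witt K^o := mu_ring K^o (val s) (wline (1 : K^o)).
End UntwistedWitt.

From mathcomp Require Import mpoly.

Module Cotangent.

Definition fcat (T : Type) n m (x : 'I_n -> T) (y : 'I_m -> T) (i : 'I_(n + m)) : T :=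
  match fintype.split i with inl a => x a | inr b => y b end.

Definition mrename (k : fieldType) n N (s : 'I_n -> 'I_N) (p : {mpoly k[n]}) :
  {mpoly k[N]} := mmap (@mpolyC N k) (fun i => 'X_(s i)) p.

Section Omega.
Variables (k E : fieldType) (iota : {rmorphism k -> E}).

Definition ev n (x : 'I_n -> E) : {mpoly k[n]} -> E := mmap iota x.

(** [E = k[t_1..t_n] / (f_1..f_n)], the variable [t_i] being sent to [x i] *)
Definition presentation n (x : 'I_n -> E) (f : 'I_n -> {mpoly k[n]}) : Prop :=
  (forall e : E, exists p, ev x p = e) /\
  (forall p, ev x p = 0 <->
     exists a : 'I_n -> {mpoly k[n]}, p = \sum_i a i * f i).

(** Membership in the square of the kernel of the evaluation at [x] *)
Definition in_ker_sq n (x : 'I_n -> E) (p : {mpoly k[n]}) : Prop :=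
  exists (m : nat) (a b : 'I_m -> {mpoly k[n]}),
    (forall i, ev x (a i) = 0 /\ ev x (b i) = 0) /\ p = \sum_i a i * b i.

(** Two presentations [(x, f)] and [(y, g)] are compared inside the polynomial
    ring in both families of variables [t], [s]: with [y j = p_j(x)] and
    [x i = q_i(y)], the kernel [I] of the evaluation at [(x, y)] is generated both
    by [(f(t), s - p(t))] and by [(t - q(s), g(s))]; [d] is the determinant of the
    matrix expressing the first basis of [I / I^2] in terms of the second one. *)
Definition transition n (x : 'I_n -> E) (f : 'I_n -> {mpoly k[n]})
    m (y : 'I_m -> E) (g : 'I_m -> {mpoly k[m]}) (d : E) : Prop :=
  exists (p : 'I_m -> {mpoly k[n]}) (q : 'I_n -> {mpoly k[m]})
         (M : 'M[{mpoly k[n + m]}]_(n + m)),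
  let F := fcat (fun i => mrename (@lshift n m) (f i))
                (fun j => 'X_(rshift n j) - mrename (@lshift n m) (p j)) in
  let G := fcat (fun i => 'X_(lshift m i) - mrename (@rshift n m) (q i))
                (fun j => mrename (@rshift n m) (g j)) in
  [/\ forall j, ev x (p j) = y j,
      forall i, ev y (q i) = x i,
      forall i, in_ker_sq (fcat x y) (F i - \sum_j M i j * G j) &
      d = \det (map_mx (ev (fcat x y)) M)].

Definition pdata : Type :=
  {n : nat & (('I_n -> E) * ('I_n -> {mpoly k[n]}))%type}.

(** An element of [omega] is given by its coordinates with respect to the bases
    [(f_1 ^ .. ^ f_n)^* (x) (dt_1 ^ .. ^ dt_n)] of
    [det (I / I^2)^vee (x) Omega^n] attached to all presentations. If the first
    basis of [I / I^2] is [M] times the second one, the basis vector attached to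
    the first presentation is [det M ^-1] times the second one. *)
Definition coherent (c : pdata -> E^o) : Prop :=
  (forall n (x : 'I_n -> E) f,
     ~ presentation x f -> c (existT _ n (x, f)) = 0) /\
  (forall n (x : 'I_n -> E) f m (y : 'I_m -> E) g d,
     presentation x f -> presentation y g -> transition x f y g d ->
     c (existT _ n (x, f)) = d * c (existT _ m (y, g))).

Definition coherentb : {pred (pdata -> E^o)} := [pred c | `[< coherent c >]].

Lemma coherentb_submod_closed : submod_closed coherentb.
Proof.
split; first by apply/asboolP; split=> // *; rewrite mulr0.
move=> a c c' /asboolP[c0 cT] /asboolP[c0' cT']; apply/asboolP; split.
  by move=> n x f nP; rewrite !fctE c0 // c0' // addr0 scaler0.
move=> n x f m y g d P Q t; rewrite !fctE (cT _ _ _ _ _ _ _ P Q t).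
by rewrite (cT' _ _ _ _ _ _ _ P Q t) mulrDr scalerAr.
Qed.
HB.instance Definition _ :=
  GRing.isSubmodClosed.Build E (pdata -> E^o) coherentb coherentb_submod_closed.

Record omega := Omega { omega_val : pdata -> E^o; _ : omega_val \in coherentb }.
HB.instance Definition _ := [isSub for omega_val].
HB.instance Definition _ := [Choice of omega by <:].
HB.instance Definition _ := [SubChoice_isSubLmodule of omega by <:].

Definition ocoord (l : omega) n (x : 'I_n -> E) (f : 'I_n -> {mpoly k[n]}) : E :=
  omega_val l (existT _ n (x, f)).

(** [f_i] is a polynomial in [t_1..t_i], monic of degree [d i] in [t_i]. *)
Definition triangular n (f : 'I_n -> {mpoly k[n]}) (d : 'I_n -> nat) : Prop :=
  forall i m, m \in msupp (f i - 'X_i ^+ d i) ->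
    (m i < d i)%N /\ forall j : 'I_n, (i < j)%N -> m j = 0%N.

Definition duality_trace (tr : omega -> k) : Prop :=
  (forall c l l', tr (iota c *: l + l') = c * tr l + tr l') /\
  (forall n (x : 'I_n -> E) f d, presentation x f -> triangular f d ->
   forall (j : 'I_n -> nat) l, (forall i, j i < d i)%N ->
     ocoord l x f = \prod_i x i ^+ j i ->
     tr l = [forall i, j i == (d i).-1]%:R).

Definition trace_form (tr : omega -> k) (P : ips omega) (Q : ips k^o) : Prop :=
  exists g : 'rV[k]_(ips_dim Q) -> 'rV[E]_(ips_dim P),
    [/\ bijective g,
        forall c v w, g (c *: v + w) = iota c *: g v + g w &
        forall v w, Q v w = tr (P (g v) (g w))].

End Omega.

End Cotangent.
Export Cotangent.

Module ResidueMaps.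
(** For a tower [k -> K -> E], [l] corresponds to [w (x) l'] under the canonical
    isomorphism between [omega] of [E/k] and the tensor product of [omega] of [E/K]
    and [omega] of [K/k]. A presentation [(x, f)] of [K/k] and a presentation
    [(y, g)] of [E/K] are concatenated, lifting the [g j] to polynomials [g' j] over
    [k] in both families of variables. *)
Definition tower_iso (k K E : fieldType) (i1 : {rmorphism k -> K})
    (i2 : {rmorphism K -> E}) (i : {rmorphism k -> E})
    (w : omega i2) (l' : omega i1) (l : omega i) : Prop :=
  forall n (x : 'I_n -> K) f m (y : 'I_m -> E) g (g' : 'I_m -> {mpoly k[n + m]}),
    presentation i1 x f -> presentation i2 y g ->
    (forall j, mmap (fun c => (i1 c)%:MP)
                 (fcat (fun a => (x a)%:MP) (fun b => 'X_b)) (g' j) = g j) ->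
    ocoord l (fcat (i2 \o x) y) (fcat (fun a => mrename (@lshift n m) (f a)) g')
      = ocoord w y g * i2 (ocoord l' x f).

(** [l'] is the image of [l] under the isomorphism of [omega] induced by the
    isomorphism [phi] of extensions of [k]. *)
Definition omega_iso (k E E' : fieldType) (i : {rmorphism k -> E})
    (i' : {rmorphism k -> E'}) (phi : {rmorphism E -> E'})
    (l : omega i) (l' : omega i') : Prop :=
  forall n (x : 'I_n -> E) f, presentation i x f ->
    ocoord l' (phi \o x) f = phi (ocoord l x f).

(** The coordinate with respect to the empty presentation, for a bijective
    [iota]: it identifies [omega] with the base field. *)
Definition ocoord0 (k E : fieldType) (iota : {rmorphism k -> E}) (l : omega iota) : E :=
  @ocoord _ _ iota l 0 (fun=> 0) (fun=> 0).


Section ProjectiveLine.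
Variable k : fieldType.

Record finite_point := FinitePoint {
  fp_poly :> {poly k};
  fp_irr : monic_irreducible_poly fp_poly
}.
HB.instance Definition _ := gen_eqMixin finite_point.
HB.instance Definition _ := gen_choiceMixin finite_point.

(** [None] is the point at infinity. *)
Definition closed_point := option finite_point.
HB.instance Definition _ := Choice.on closed_point.

Definition residue_field (x : closed_point) : fieldType :=
  match x with
  | Some p => {poly %/ fp_poly p with fp_irr p}
  | None => k
  end.

Definition residue_inj (x : closed_point) : {rmorphism k -> residue_field x} :=
  match x with
  | Some p => in_alg {poly %/ fp_poly p with fp_irr p}
  | None => idfun
  end.

Definition ratfun : fieldType := {fraction {poly k}}.
Definition ratvar : ratfun := FracField.tofrac 'X.

(** The module of differentials of [k(t)], [f : Omega_ratfun] standing for [f dt] *)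
Definition Omega_ratfun : lmodType ratfun := ratfun^o.

(** A local coordinate on the line near [x] ([t], and [s = 1/t] at infinity) is
    used; [x] is the zero locus of the polynomial [pt_poly x] in it, and
    [pt_coord x] is its value at [x]. *)
Definition pt_poly (x : closed_point) : {poly k} :=
  if x is Some p then fp_poly p else 'X.
Definition pt_coord (x : closed_point) : residue_field x :=
  match x with Some p => in_qpoly (fp_poly p) 'X | None => 0 end.

Definition pt_param (x : closed_point) : ratfun :=
  if x is Some p then FracField.tofrac (fp_poly p) else ratvar^-1.

(** The generator [dt], or [ds = - t^-2 dt], of the differentials near [x] *)
Definition pt_diff (x : closed_point) : Omega_ratfun :=
  if x is Some _ then 1 else - ratvar ^- 2.

Definition multiplicity (p a : {poly k}) : nat :=
  \max_(m < size a | dvdp (p ^+ m) a) m.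

Definition pt_val (x : closed_point) (f : ratfun) : int :=
  let a := \n_(repr f) in let b := \d_(repr f) in
  if x is Some p then (multiplicity p a)%:Z - (multiplicity p b)%:Z
  else (size b)%:Z - (size a)%:Z.

Definition pt_unit (x : closed_point) (f : ratfun) : Prop :=
  f != 0 /\ pt_val x f = 0.
Definition pt_uniformizer (x : closed_point) (f : ratfun) : Prop :=
  f != 0 /\ pt_val x f = 1.

Definition pt_red (x : closed_point) (f : ratfun) : residue_field x :=
  let a := \n_(repr f) in let b := \d_(repr f) in
  match x return residue_field x with
  | Some p =>
      let r c : {poly %/ fp_poly p with fp_irr p} :=
        in_qpoly (fp_poly p) (c %/ (fp_poly p : {poly k}) ^+ multiplicity p c)%R in
      r a / r b
  | None => lead_coef a / lead_coef b
  end.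

Definition poly_mpoly1 (p : {poly k}) : {mpoly k[1]} :=
  (map_poly (@mpolyC 1 k) p).['X_ord0].

(** [l] is the image of [pi^* (x) (f dt)] under the canonical isomorphism between
    the tensor product of [(M_x/M_x^2)^vee] with the fiber at [x] of the
    differentials of the line, and [omega] of the residue field at [x]. *)
Definition adjunction (x : closed_point) (pi : ratfun) (f : Omega_ratfun)
    (l : omega (residue_inj x)) : Prop :=
  @ocoord _ _ _ l 1 (fun=> pt_coord x) (fun=> poly_mpoly1 (pt_poly x)) =
  pt_red x (f / pt_diff x) / pt_red x (pi / pt_param x).

Definition mw_residue (x : closed_point)
    (D : forall q : int, {additive KMWt Omega_ratfun (q + 1) ->
                                   KMWt (omega (residue_inj x)) q}) : Prop :=
  [/\ forall (q : int) (s : KMW ratfun (q + 1)) (s' : KMW ratfun (q - 1 + 1)) f,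
        val s' = mw_eta ratfun * val s ->
        D (q - 1) (tens s' f) = eta_tw (D q (tens s f)),
      forall (q m : int) (v pi : ratfun) (us : seq ratfun) (f : Omega_ratfun)
          (s : KMW ratfun (q + 1)) (s' : KMW (residue_field x) q) l,
        pt_unit x v -> pt_uniformizer x pi -> (forall u, u \in us -> pt_unit x u) ->
        pt_unit x (f / pt_diff x) -> adjunction pi f l ->
        val s = mw_sym (v * pi ^ m) * \prod_(u <- us) mw_sym u ->
        val s' = mw_neps _ m * mw_angle (pt_red x v)
                   * \prod_(u <- us) mw_sym (pt_red x u) ->
        D q (tens s f) = tens s' l &
      (* [1] is an empty product of symbols of units; its residue is not determined
         by the other conditions in degrees [<= 0] *)
      forall (q : int) (s : KMW ratfun (q + 1)) (f : Omega_ratfun),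
        pt_unit x (f / pt_diff x) -> val s = 1 -> D q (tens s f) = 0].

Definition m_residue (x : closed_point)
    (D : forall q : int, {additive KM ratfun (q + 1) -> KM (residue_field x) q}) :
    Prop :=
  forall (q m : int) (v pi : ratfun) (us : seq ratfun)
         (s : KM ratfun (q + 1)) (s' : KM (residue_field x) q),
    pt_unit x v -> pt_uniformizer x pi -> (forall u, u \in us -> pt_unit x u) ->
    val s = milnor_sym (v * pi ^ m) * \prod_(u <- us) milnor_sym u ->
    val s' = (\prod_(u <- us) milnor_sym (pt_red x u)) *~ m ->
    D q s = s'.

Definition mw_point_transfers (q : int)
    (T : forall x : closed_point,
       {additive KMWt (omega (residue_inj x)) q -> KMW k q}) : Prop :=
  (forall s l s', val s' = mw_angle (ocoord0 l) * val s -> l != 0 ->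
     T None (tens s l) = s') /\
  exists D : (forall x q, {additive KMWt Omega_ratfun (q + 1) ->
                                    KMWt (omega (residue_inj x)) q}),
    (forall x, mw_residue (D x)) /\
    forall s : KMWt Omega_ratfun (q + 1),
      finite_set [set x | D x q s != 0]%classic /\
      \sum_(x \in [set: closed_point]%classic) T x (D x q s) = 0.

Definition m_point_transfers (q : int)
    (T : forall x : closed_point, {additive KM (residue_field x) q -> KM k q}) :
    Prop :=
  T None =1 id /\
  exists D : (forall x q, {additive KM ratfun (q + 1) -> KM (residue_field x) q}),
    (forall x, m_residue (D x)) /\
    forall s : KM ratfun (q + 1),
      finite_set [set x | D x q s != 0]%classic /\
      \sum_(x \in [set: closed_point]%classic) T x (D x q s) = 0.

End ProjectiveLine.

End ResidueMaps.
Export ResidueMaps.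


Section Monogenic.
Variables (K E : fieldType) (j : {rmorphism K -> E}) (a : E) (q : int).

(** [a] generates [E] over [K]; the residue field of the closed point of the affine
    line given by its minimal polynomial is identified with [E] by [phi]. *)
Definition mw_monogenic_transfer
    (T : {additive KMWt (omega j) q -> KMW K q}) : Prop :=
  exists (Tx : forall x : closed_point K,
            {additive KMWt (omega (residue_inj x)) q -> KMW K q})
         (p : finite_point K)
         (phi : {rmorphism residue_field (Some p) -> E}),
    [/\ mw_point_transfers Tx,
        phi \o residue_inj (Some p) =1 j,
        phi (pt_coord (Some p)) = a &
        forall s l l', omega_iso phi l l' ->
          T (tens (KMW_map phi s) l') = Tx (Some p) (tens s l)].

Definition m_monogenic_transfer (T : {additive KM E q -> KM K q}) : Prop :=
  exists (Tx : forall x : closed_point K, {additive KM (residue_field x) q -> KM K q})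
         (p : finite_point K)
         (phi : {rmorphism residue_field (Some p) -> E}),
    [/\ m_point_transfers Tx,
        phi \o residue_inj (Some p) =1 j,
        phi (pt_coord (Some p)) = a &
        forall s, T (KM_map phi s) = Tx (Some p) s].

(** The twist of [T] by the line [omega] of [K/k]: the image of
    [s (x) w (x) (l' (x) u)] is [T (<u> s (x) w) (x) l'], the line [omega] of [E/k]
    being identified with [omega_{E/K} (x) omega_{K/k}]. *)
Definition twisted_transfer (k : fieldType) (i1 : {rmorphism k -> K})
    (i : {rmorphism k -> E}) (T : {additive KMWt (omega j) q -> KMW K q})
    (Ttw : {additive KMWt (omega i) q -> KMWt (omega i1) q}) : Prop :=
  forall (u : E) (s s' : KMW E q) w l' l, u != 0 -> tower_iso w l' l ->
    val s' = mw_angle u * val s ->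
    Ttw (tens s (u *: l)) = tens (T (tens s' w)) l'.

End Monogenic.

Definition subfield_gen (k : fieldType) (E : fieldExtType k) m
    (alpha : 'I_m -> E) : {subfield E} := <<1 & codom alpha>>%AS.

Definition family_init (T : Type) m (alpha : 'I_m.+1 -> T) (i : 'I_m) : T :=
  alpha (widen_ord (leqnSn m) i).

Fixpoint bass_tate_transfer (k : fieldType) (q : int) (n : nat) :
    forall (E : fieldExtType k) (alpha : 'I_n -> E),
      {additive KMWt (omega (in_alg E)) q -> KMW k q} -> Prop :=
  match n with
  | 0 => fun E _ T =>
      forall (u : k) (s s' : KMW k q) l, l != 0 -> ocoord0 l = u%:A ->
        val s' = mw_angle u * val s ->
        T (tens (KMW_map (in_alg E) s) l) = s'
  | m.+1 => fun E alpha T =>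
      let K := subfield_gen (family_init alpha) in
      exists (T' : {additive KMWt (omega (in_alg (subvs_of K))) q -> KMW k q})
             (M : {additive KMWt (omega (vsval : {rmorphism subvs_of K -> E})) q ->
                            KMW (subvs_of K) q})
             (Mtw : {additive KMWt (omega (in_alg E)) q ->
                              KMWt (omega (in_alg (subvs_of K))) q}),
        [/\ bass_tate_transfer (vsproj K \o family_init alpha) T',
            mw_monogenic_transfer (alpha ord_max) M,
            twisted_transfer M Mtw &
            T =1 T' \o Mtw]
  end.

Fixpoint m_bass_tate_transfer (k : fieldType) (q : int) (n : nat) :
    forall (E : fieldExtType k) (alpha : 'I_n -> E),
      {additive KM E q -> KM k q} -> Prop :=
  match n with
  | 0 => fun E _ T => forall s, T (KM_map (in_alg E) s) = s
  | m.+1 => fun E alpha T =>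
      let K := subfield_gen (family_init alpha) in
      exists (T' : {additive KM (subvs_of K) q -> KM k q})
             (M : {additive KM E q -> KM (subvs_of K) q}),
        [/\ m_bass_tate_transfer (vsproj K \o family_init alpha) T',
            m_monogenic_transfer (vsval : {rmorphism subvs_of K -> E})
              (alpha ord_max) M &
            T =1 T' \o M]
  end.

(** Kato's transfer: the common value of the composites of Bass-Tate transfers
    associated with all families of generators *)
Definition kato_transfer (k : fieldType) (E : fieldExtType k) (q : int)
    (N : {additive KM E q -> KM k q}) : Prop :=
  forall n (alpha : 'I_n -> E), subfield_gen alpha = fullv :> {vspace E} ->
    m_bass_tate_transfer alpha N.

Definition witt_transfer (k E : fieldType) (iota : {rmorphism k -> E})
    (tr : omega iota -> k)
    (W : {additive Witt (omega iota) -> Witt k^o}) : Prop :=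
  forall P Q, trace_form tr P Q -> W (wclass P) = wclass Q.

(** The transfer obtained by gluing: [T z] is the element of [KMW k q]
    corresponding to the pair of the transfers of the two components of [z] under
    the isomorphism of [KMW] with the fiber product of [I^q] and [KM]; that is, it
    is the only element with these two components. *)
Definition glued_transfer (k : fieldType) (E : fieldExtType k) (q : int)
    (T : {additive KMWt (omega (in_alg E)) q -> KMW k q}) : Prop :=
  exists (tr : omega (in_alg E) -> k)
         (W : {additive Witt (omega (in_alg E)) -> Witt k^o})
         (N : {additive KM E q -> KM k q}),
    [/\ duality_trace tr, witt_transfer tr W, kato_transfer N &
        forall z y, T z = y <-> mu y = W (mu_tw z) /\ modeta y = N (modeta_tw z)].

(* Main.v *)
(** An element of [KMW k q] is determined by its classes in the Witt group and
    modulo [eta], so both transfers are compared after applying [mu] and [modeta].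

    On the Witt side, let [s_x] be the linear form "coefficient of degree
    [deg x - 1]" at a closed point [x] of the projective line. The transfers of Witt
    groups along the [s_x] satisfy the reciprocity law: the sum over [x] of the
    transfers of the residues of a rational form vanishes. Indeed, for coprime monic
    [p] and [H], the form [coef_{n-1} (a b h mod p H)] is Witt equivalent to the sum
    of the forms attached to [(p, h H)] and [(H, h p)], and for a constant [h] it is a
    Hankel form, whose class is [<h>] or [0] according to the parity of the degree.
    Modulo [eta], the residues of Milnor-Witt K-theory reduce to those of Milnor
    K-theory. In both cases, two families of maps indexed by the points which agree
    at infinity and satisfy reciprocity coincide, by induction on the degree of the
    point.

    This identifies the two components of the Bass-Tate transfer of a monogenic
    extension. Both are compatible with towers: the canonical isomorphism between the
    lines [omega] turns the composite of the trace forms of the steps into the trace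
    form given by the basis of monomials in all generators. That the isomorphism does
    not depend on the presentations comes from a dual system of functionals on the
    conormal module, which exhibits the transition coefficients as determinants and
    thus gives the cocycle relation. *)
Require Import Defs.
From mathcomp Require Import all_boot all_order all_algebra all_fingroup all_field.
From mathcomp Require Import generic_quotient mpoly.
From mathcomp Require Import boolp classical_sets functions cardinality fsbigop.
From mathcomp Require Import ring zify.
From HB Require Import structures.

Set Implicit Arguments.
Unset Strict Implicit.
Unset Printing Implicit Defensive.

Import GRing.Theory.
Local Open Scope ring_scope.

(** * Functionals on the conormal module *)

(** The fields are arbitrary, so extensions may be inseparable and 2 may be zero: the trace forms
    are coefficient forms and not field traces, and metabolic planes, which need not be sums of
    lines in characteristic 2, are handled after adding a line. On the Witt side the degree is
    immaterial because [eta] acts as -1: multiplying by enough powers of [eta] brings a monomial to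
    a degree where each [eta [u]] can be traded for [<u> - 1], and [<u>] is absorbed by the
    differential; what remains is the form [<f>] attached to [f dt], a matter of polynomial
    arithmetic. Statements on residues are proved for every family satisfying [mw_residue] or
    [m_residue], hence for the one that accompanies a given transfer. A vector of [omega] is a
    family of coordinates over all presentations at once, so that even the existence of a nonzero
    one, or of a vector corresponding to a tensor product along a tower, rests on the cocycle
    relation. *)

Definition functional (R : comNzRingType) (E : fieldType) (ev : R -> E) (phi : R -> E) :=
  forall a P Q, ev P = 0 -> ev Q = 0 -> phi (a * P + Q) = ev a * phi P + phi Q.

Section FunctionalTheory.
Variables (R : comNzRingType) (E : fieldType) (ev : {rmorphism R -> E}) (phi : R -> E).
Hypothesis phiP : functional ev phi.

Lemma functional0 : phi 0 = 0.
Proof.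
have := phiP 1 (rmorph0 ev) (rmorph0 ev).
by rewrite mulr0 addr0 rmorph1 mul1r -{1}[phi 0]addr0 => /addrI <-.
Qed.

Lemma functionalD P Q : ev P = 0 -> ev Q = 0 -> phi (P + Q) = phi P + phi Q.
Proof. by move=> p0 q0; rewrite -[P]mul1r phiP // rmorph1 !mul1r. Qed.

Lemma functionalM a P : ev P = 0 -> phi (a * P) = ev a * phi P.
Proof.
by move=> p0; rewrite -[a * P]addr0 phiP // ?rmorph0 // functional0 addr0.
Qed.

Lemma functionalB P Q : ev P = 0 -> ev Q = 0 -> phi (P - Q) = phi P - phi Q.
Proof.
move=> p0 q0; rewrite -mulN1r functionalD //; last by rewrite rmorphM q0 mulr0.
by rewrite functionalM // rmorphN1 mulN1r.
Qed.

Lemma functional_sum (I : Type) (r : seq I) (a P : I -> R) :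
  (forall i, ev (P i) = 0) ->
  phi (\sum_(i <- r) a i * P i) = \sum_(i <- r) ev (a i) * phi (P i).
Proof.
move=> P0; elim: r => [|i r IH]; first by rewrite !big_nil functional0.
rewrite !big_cons phiP ?IH // rmorph_sum big1 // => j _.
by rewrite rmorphM P0 mulr0.
Qed.

End FunctionalTheory.

Section Extension.
Import Pdiv.Ring Pdiv.RingMonic.
Variables (S : comNzRingType) (E : fieldType) (e0 : {rmorphism S -> E}) (a : E).
Hypothesis inv_im : forall c, e0 c != 0 -> exists b, e0 b * e0 c = 1.

Definition evp (P : {poly S}) : E := (map_poly e0 P).[a].
HB.instance Definition _ := GRing.RMorphism.copy evp
  (horner_eval a \o map_poly e0).

Lemma evpD P Q : evp (P + Q) = evp P + evp Q.
Proof. exact: (rmorphD evp). Qed.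
Lemma evpM P Q : evp (P * Q) = evp P * evp Q.
Proof. exact: (rmorphM evp). Qed.
Lemma evpC c : evp c%:P = e0 c.
Proof. by rewrite /evp map_polyC hornerC. Qed.
Lemma evpX : evp 'X = a.
Proof. by rewrite /evp map_polyX hornerX. Qed.

Hypothesis integral : exists2 F : {poly S}, F \is monic & evp F = 0.

(** [F] is a monic lift of the minimal polynomial of [a] over the image of [e0], which is a field by
    [inv_im]. A shorter polynomial with root [a] and some coefficient outside the kernel of [e0]
    would, once its leading image is made 1, lift to a shorter monic polynomial with root [a]. *)
Lemma min_monic : exists F : {poly S}, [/\ F \is monic, evp F = 0 &
  forall P : {poly S}, (size P < size F)%N -> evp P = 0 -> map_poly e0 P = 0].
Proof.
pose Q n := `[< exists F : {poly S}, [/\ F \is monic, evp F = 0 & size F = n] >].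
have exQ : exists n, Q n.
  by have [F Fm F0] := integral; exists (size F); apply/asboolP; exists F.
case: (ex_minnP exQ) => n /asboolP[F [Fm F0 sF]] minF; exists F; split=> // P.
rewrite sF => sP P0; apply/eqP/negPn/negP => nz.
pose d := (size (map_poly e0 P)).-1.
have sE : size (map_poly e0 P) = d.+1 by rewrite prednK // size_poly_gt0.
have : e0 P`_d != 0 by rewrite -coef_map -/(lead_coef _) lead_coef_eq0.
move=> /inv_im[b eb].
have dP : (d.+1 <= size P)%N by rewrite -sE size_poly.
(* Degrees above [d] are dropped, since the coefficients of [P] there lie in the kernel of [e0]. The
   leading coefficient 1 is imposed: [b] times the coefficient of degree [d] is 1 only after
   applying [e0]. *)
pose G : {poly S} := 'X^d + \poly_(i < d) (b * P`_i).
have sG : size G = d.+1.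
  by rewrite size_polyDl size_polyXn // ltnS size_poly.
have Gm : G \is monic.
  rewrite monicE lead_coefDl ?lead_coefXn // size_polyXn ltnS; exact: size_poly.
have mG : map_poly e0 G = e0 b *: map_poly e0 P.
  apply/polyP => i; rewrite coefZ !coef_map coefD coefXn coef_poly.
  case: (ltngtP i d) => [id|di|->] /=.
  - by rewrite add0r rmorphM.
  - rewrite addr0 rmorph0 -[e0 P`_i]coef_map nth_default ?mulr0 //.
    by rewrite sE.
  - by rewrite addr0 rmorph1 eb.
have G0 : evp G = 0.
  by rewrite /evp mG hornerZ -/(evp P) P0 mulr0.
have := minF d.+1; have -> : Q d.+1 by apply/asboolP; exists G.
by move/(_ isT); rewrite leqNgt (leq_ltn_trans dP sP).
Qed.

Section Ext.
Variable F : {poly S}.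
Hypotheses (Fm : F \is monic) (F0 : evp F = 0).
Hypothesis minF :
  forall P : {poly S}, (size P < size F)%N -> evp P = 0 -> map_poly e0 P = 0.

Lemma evp_rmodp P : evp (rmodp P F) = evp P.
Proof. by rewrite {2}[P](rdivp_eq Fm) evpD evpM F0 mulr0 add0r. Qed.

Lemma map_rmodp0 P : evp P = 0 -> map_poly e0 (rmodp P F) = 0.
Proof.
move=> P0; apply: minF; last by rewrite evp_rmodp.
by rewrite ltn_rmodpN0 // monic_neq0.
Qed.

Lemma map_rdivp0 P : map_poly e0 P = 0 ->
  map_poly e0 (rdivp P F) = 0 /\ map_poly e0 (rmodp P F) = 0.
Proof.
move=> P0; have P1 : evp P = 0 by rewrite /evp P0 horner0.
split; last exact: map_rmodp0.
have := congr1 (map_poly e0) (rdivp_eq Fm P).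
rewrite P0 rmorphD rmorphM /= map_rmodp0 // addr0 => /esym/eqP.
rewrite mulf_eq0 => /orP[/eqP //|/eqP mF].
have := monic_map e0 Fm; rewrite mF monicE lead_coef0 eq_sym.
by rewrite oner_eq0.
Qed.

Lemma size_min_gt1 : (1 < size F)%N.
Proof.
rewrite ltnNge; apply/negP => /size1_polyC Fc; move: Fm F0.
rewrite monicE Fc lead_coefC evpC => /eqP->; rewrite rmorph1 => /eqP.
by rewrite oner_eq0.
Qed.

Section Old.
Variable phi : S -> E.
Hypothesis phiP : functional e0 phi.

(** On polynomials with coefficients in the kernel of [e0], this is the extension of scalars of
    [phi] along the evaluation at [a]. *)
Definition psi (P : {poly S}) := (map_poly phi P).[a].
Let phi0 : phi 0 = 0 := functional0 phiP.

Lemma psi_linear c P Q : map_poly e0 P = 0 -> map_poly e0 Q = 0 ->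
  psi (c *: P + Q) = e0 c * psi P + psi Q.
Proof.
move=> P0 Q0; rewrite /psi -hornerZ -hornerD; congr (_.[_]).
apply/polyP => i; rewrite coefD coefZ !coef_map_id0 // coefD coefZ phiP //.
  by rewrite -coef_map P0 coef0.
by rewrite -coef_map Q0 coef0.
Qed.

Lemma psiXl P : map_poly e0 P = 0 -> psi ('X * P) = a * psi P.
Proof.
move=> P0; rewrite /psi.
have -> : map_poly phi ('X * P) = 'X * map_poly phi P.
  apply/polyP => i; rewrite coef_map_id0 // !coefXM.
  by case: i => [|i] //=; rewrite coef_map_id0.
by rewrite hornerM hornerX.
Qed.

Lemma psi_functional A P Q : map_poly e0 P = 0 -> map_poly e0 Q = 0 ->
  psi (A * P + Q) = evp A * psi P + psi Q.
Proof.
move=> + Q0; elim/poly_ind: A P Q Q0 => [|A c IH] P Q Q0 P0.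
  by rewrite mul0r rmorph0 mul0r !add0r.
rewrite mulrDl -mulrA -addrA IH //; first last.
- by rewrite rmorphM /= P0 mulr0.
- by rewrite rmorphD rmorphM /= P0 mulr0 Q0 addr0.
rewrite psiXl // mul_polyC psi_linear // evpD evpM evpX evpC.
by rewrite mulrDl !mulrA addrA.
Qed.

Definition ext_functional (P : {poly S}) := psi (rmodp P F).

(** Remainders modulo [F] of elements of the kernel have all their coefficients in the kernel of
    [e0], where [psi] is linear. Reducing [A] times such a remainder subtracts [D * F] with [D] of
    the same kind, and [psi] sends this to [evp F * psi D], which is 0. *)
Lemma ext_functionalP : functional evp ext_functional.
Proof.
move=> A P Q P0 Q0; rewrite /ext_functional rmodpD //.
rewrite -(rmodp_mulmr Fm).
have -> : rmodp (A * rmodp P F) F =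
    A * rmodp P F - rdivp (A * rmodp P F) F * F.
  by rewrite {2}[A * rmodp P F](rdivp_eq Fm) addrAC subrr add0r.
have m0 := map_rmodp0 P0; have n0 := map_rmodp0 Q0.
have d0 : map_poly e0 (rdivp (A * rmodp P F) F) = 0.
  by apply: (map_rdivp0 _).1; rewrite rmorphM /= m0 mulr0.
move: (rdivp (A * rmodp P F) F) d0 => D d0.
have -> : A * rmodp P F - D * F + rmodp Q F = A * rmodp P F + (F * (- D) + rmodp Q F).
  by ring.
have D0 : map_poly e0 (- D) = 0 by rewrite rmorphN /= d0 oppr0.
rewrite !psi_functional ?F0 ?mul0r ?add0r //.
by rewrite rmorphD rmorphM /= D0 mulr0 add0r.
Qed.

Lemma ext_functionalC c : ext_functional c%:P = phi c.
Proof.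
rewrite /ext_functional rmodp_small ?(leq_ltn_trans (size_polyC_leq1 _)) //;
  last exact: size_min_gt1.
rewrite /psi -[RHS](hornerC _ a); congr (_.[_]).
by apply/polyP => i; rewrite coef_map_id0 // !coefC; case: ifP.
Qed.

Lemma ext_functionalF : ext_functional F = 0.
Proof.
rewrite /ext_functional rmodpp // /psi -[RHS](horner0 a); congr (_.[_]).
by apply/polyP => i; rewrite coef_map_id0 // !coef0.
Qed.
End Old.

(** The coordinate along [F] in the conormal module: an element of the kernel is a multiple of [F]
    plus a polynomial with coefficients in the kernel of [e0], and the value at [a] of the cofactor
    of [F] is what survives modulo squares. *)
Definition new_functional (P : {poly S}) := evp (rdivp P F).

Lemma new_functionalP : functional evp new_functional.
Proof.
move=> A P Q P0 Q0; rewrite /new_functional.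
pose r := A * rmodp P F + rmodp Q F.
have -> : A * P + Q = (A * rdivp P F + rdivp Q F) * F + r.
  by rewrite {1}[P](rdivp_eq Fm) {1}[Q](rdivp_eq Fm) /r; ring.
rewrite rdivp_addl_mul // !evpD evpM -[RHS]addr0; congr (_ + _).
rewrite /evp (map_rdivp0 _).1 ?horner0 // rmorphD rmorphM /= !map_rmodp0 //.
by rewrite mulr0 addr0.
Qed.

Lemma new_functionalC c : new_functional c%:P = 0.
Proof.
rewrite /new_functional rdivp_small ?rmorph0 //.
exact: leq_ltn_trans (size_polyC_leq1 _) size_min_gt1.
Qed.

Lemma new_functionalF : new_functional F = 1.
Proof. by rewrite /new_functional rdivpp // rmorph1. Qed.
End Ext.
End Extension.

Lemma mpoly_rmorph_eq (k : comNzRingType) (R : comNzRingType) n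
    (f g : {rmorphism {mpoly k[n]} -> R}) :
  (forall c, f c%:MP = g c%:MP) -> (forall i, f 'X_i = g 'X_i) -> f =1 g.
Proof.
move=> fgC fgX p; rewrite [p]mpolyE !rmorph_sum; apply: eq_bigr => m _.
rewrite -mul_mpolyC !rmorphM /= fgC; congr (_ * _).
by rewrite mpolyXE_id !rmorph_prod; apply: eq_bigr => i _; rewrite !rmorphXn /= fgX.
Qed.

Section Ev.
Variables (k E : fieldType) (iota : {rmorphism k -> E}).
HB.instance Definition _ n (x : 'I_n -> E) :=
  GRing.RMorphism.copy (ev iota x) (mmap iota x).

Lemma evC n (x : 'I_n -> E) c : ev iota x c%:MP = iota c.
Proof. exact: mmapC. Qed.
Lemma evX n (x : 'I_n -> E) i : ev iota x 'X_i = x i.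
Proof. by rewrite /ev mmapX mmap1U. Qed.
Lemma evN n (x : 'I_n -> E) p : ev iota x (- p) = - ev iota x p.
Proof. exact: (rmorphN (ev iota x)). Qed.
Lemma evB n (x : 'I_n -> E) p q : ev iota x (p - q) = ev iota x p - ev iota x q.
Proof. exact: (rmorphB (ev iota x)). Qed.
Lemma evM n (x : 'I_n -> E) p q : ev iota x (p * q) = ev iota x p * ev iota x q.
Proof. exact: (rmorphM (ev iota x)). Qed.
Lemma ev0 n (x : 'I_n -> E) : ev iota x 0 = 0.
Proof. exact: (rmorph0 (ev iota x)). Qed.
Lemma ev_sum n (x : 'I_n -> E) (I : Type) (r : seq I) (P : pred I) F :
  ev iota x (\sum_(i <- r | P i) F i) = \sum_(i <- r | P i) ev iota x (F i).
Proof. exact: (rmorph_sum (ev iota x)). Qed.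
Lemma ev_eq n (x y : 'I_n -> E) : x =1 y -> ev iota x =1 ev iota y.
Proof. by move/funext->. Qed.

Definition algebraic_ext := forall e : E,
  exists2 q : {poly k}, q != 0 & root (map_poly iota q) e.
End Ev.

Section Rename.
Variable k : fieldType.
HB.instance Definition _ n N (s : 'I_n -> 'I_N) :=
  GRing.RMorphism.copy (@mrename k n N s) (mmap (@mpolyC N k) (fun i => 'X_(s i))).

Lemma mrenameC n N (s : 'I_n -> 'I_N) (c : k) : mrename s c%:MP = c%:MP.
Proof. exact: mmapC. Qed.
Lemma mrenameX n N (s : 'I_n -> 'I_N) i : mrename s ('X_i : {mpoly k[n]}) = 'X_(s i).
Proof. by rewrite /mrename mmapX mmap1U. Qed.

Lemma mrename_comp n N M (s : 'I_n -> 'I_N) (t : 'I_N -> 'I_M) (p : {mpoly k[n]}) :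
  mrename t (mrename s p) = mrename (t \o s) p.
Proof.
apply: (mpoly_rmorph_eq (f := mrename t \o mrename s) (g := mrename (t \o s))).
  by move=> c; rewrite /= !mrenameC.
by move=> i; rewrite /= !mrenameX.
Qed.

Lemma ev_mrename (E : fieldType) (iota : {rmorphism k -> E}) n N
    (s : 'I_n -> 'I_N) (x : 'I_N -> E) p :
  ev iota x (mrename s p) = ev iota (x \o s) p.
Proof.
apply: (mpoly_rmorph_eq (f := ev iota x \o mrename s) (g := ev iota (x \o s))).
  by move=> c; rewrite /= !mrenameC !evC.
by move=> i; rewrite /= !mrenameX !evX.
Qed.
End Rename.

Section FunctionalSystem.
Variables (k E : fieldType) (iota : {rmorphism k -> E}).
Hypothesis alg : algebraic_ext iota.

Lemma algebraic_coef0 (e : E) : e != 0 ->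
  exists2 q : {poly k}, q`_0 != 0 & root (map_poly iota q) e.
Proof.
move=> e0; have [q q0 rq] := alg e.
have [m] := ubnP (size q); elim: m q q0 rq => // m IH q q0 rq sq.
have [qz|] := eqVneq q`_0 0; last by exists q.
elim/poly_ind: q q0 rq sq qz => [|q c _]; first by rewrite eqxx.
move=> q0 rq sq; rewrite coefD coefMX coefC add0r => cz.
move: q0 rq sq; rewrite cz addr0 rmorphM /= map_polyX rootM.
rewrite mulf_eq0 negb_or => /andP[q0 _] rq.
rewrite size_mulX // ltnS => sq; apply: (IH q) => //.
by case/orP: rq => //; rewrite rootX (negPf e0).
Qed.

(** The inverse of a nonzero algebraic element is a polynomial in it, read off from a relation with
    nonzero constant term. So the image of the evaluation is a field even if the family [x] does not
    generate [E]. *)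
Lemma ev_inv n (x : 'I_n -> E) c : ev iota x c != 0 ->
  exists b, ev iota x b * ev iota x c = 1.
Proof.
move=> e0; have [q q0 rq] := algebraic_coef0 e0.
pose q' := \poly_(i < (size q).-1) q`_i.+1.
have qE : q = q' * 'X + (q`_0)%:P.
  apply/polyP => -[|i]; rewrite coefD coefMX coefC /= ?add0r // addr0.
  rewrite coef_poly; case: ltnP => // s; rewrite nth_default //.
  by case: (size q) s.
exists (- (q`_0)^-1%:MP * (map_poly (@mpolyC n k) q').[c]).
have ev_h : ev iota x (map_poly (@mpolyC n k) q').[c] = (map_poly iota q').[ev iota x c].
  rewrite -[LHS](horner_map (ev iota x)) /= -map_poly_comp /=.
  by congr (_.[_]); apply: eq_map_poly => a /=; rewrite evC.
rewrite evM evN evC ev_h.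
move: rq; rewrite {1}qE rootE rmorphD rmorphM /= map_polyX map_polyC /=.
rewrite hornerD hornerM hornerX hornerC addr_eq0 => /eqP h.
by rewrite -mulrA h mulNr mulrN opprK fmorphV mulVf // fmorph_eq0.
Qed.

Lemma ev_integral n (x : 'I_n -> E) a :
  exists2 F : {poly {mpoly k[n]}}, F \is monic & evp (ev iota x) a F = 0.
Proof.
have [q q0 rq] := alg a.
exists (map_poly (@mpolyC n k) ((lead_coef q)^-1 *: q)).
  by rewrite map_monic // monicE lead_coefZ mulVf // lead_coef_eq0.
rewrite /evp -map_poly_comp /=.
rewrite (eq_map_poly (g := iota)); last by move=> c /=; rewrite evC.
by rewrite map_polyZ hornerZ (rootP rq) mulr0.
Qed.

Lemma muniXwiden n (i : 'I_n) :
  muni ('X_(widen_ord (leqnSn n) i) : {mpoly k[n.+1]}) = ('X_i)%:P.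
Proof.
rewrite /muni mmapX mmap1U; case: splitP => [j /= e|j /= e].
  by congr ('X__)%:P; apply/val_inj.
by have := ltn_ord i; rewrite e ltnNge leq_addr.
Qed.

Lemma muniXmax n : muni ('X_ord_max : {mpoly k[n.+1]}) = 'X.
Proof.
rewrite /muni mmapX mmap1U; case: splitP => [j /= e|j //].
by have := ltn_ord j; rewrite -e ltnn.
Qed.

Lemma muni_mwiden n (p : {mpoly k[n]}) : muni (mwiden p) = p%:P.
Proof.
apply: (mpoly_rmorph_eq (f := @muni n k \o @mwiden n k)
  (g := @polyC {mpoly k[n]})).
  by move=> c; rewrite /= mwidenC muniC.
by move=> i; rewrite /= mwidenX mnmwiden1 muniXwiden.
Qed.

Lemma mmultiK n (F : {poly {mpoly k[n]}}) : muni (mmulti F) = F.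
Proof.
rewrite /mmulti rmorph_sum -[RHS]coefK poly_def; apply: eq_bigr => i _.
by rewrite rmorphM rmorphXn /= muni_mwiden muniXmax mul_polyC.
Qed.

Lemma evp_muni n (x : 'I_n.+1 -> E) p :
  evp (ev iota (x \o widen_ord (leqnSn n))) (x ord_max) (muni p) = ev iota x p.
Proof.
apply: (mpoly_rmorph_eq (g := ev iota x)
  (f := evp (ev iota (x \o widen_ord (leqnSn n))) (x ord_max) \o @muni n k)).
  by move=> c; rewrite /= muniC evpC; exact: etrans (evC _ _ _) (esym (evC _ _ _)).
move=> i; rewrite /= evX; case: (unliftP ord_max i) => [j|] ->.
  have -> : lift ord_max j = widen_ord (leqnSn n) j.
    by apply/val_inj => /=; rewrite /bump leqNgt ltn_ord.
  by rewrite muniXwiden evpC; exact: evX.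
by rewrite muniXmax evpX.
Qed.

(** The conormal module of the kernel has rank [n]: each new variable contributes one basis vector,
    a monic lift of the minimal polynomial of its value over the preceding ones. Determinants of
    values of the functionals then compare any two families of [n] elements of the kernel. *)
Lemma functional_system n (x : 'I_n -> E) :
  exists (phi : 'I_n -> {mpoly k[n]} -> E) (T : 'I_n -> {mpoly k[n]}),
    [/\ forall i, functional (ev iota x) (phi i),
        forall j, ev iota x (T j) = 0 &
        forall i j, phi i (T j) = (i == j)%:R].
Proof.
elim: n x => [|n IH] x.
  by exists (fun=> fun=> 0), (fun=> 0); split=> -[].
pose x' := x \o widen_ord (leqnSn n).
have [phi [T [phiP T0 phiT]]] := IH x'.
have [F [Fm F0 minF]] := min_monic (@ev_inv _ x') (ev_integral x' (x ord_max)).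
have [ext [extP extC extF]] : exists ext : ({mpoly k[n]} -> E) -> {mpoly k[n.+1]} -> E,
  [/\ forall f, functional (ev iota x') f -> functional (ev iota x) (ext f),
      forall f c, functional (ev iota x') f -> ext f (mwiden c) = f c &
      forall f, functional (ev iota x') f -> ext f (mmulti F) = 0].
  exists (fun f p => ext_functional (x ord_max) F f (muni p)); split.
  - move=> f fP a P Q P0 Q0; rewrite rmorphD rmorphM -(evp_muni x a) /=.
    by apply: (ext_functionalP Fm F0 minF fP); rewrite evp_muni.
  - by move=> f c fP; rewrite muni_mwiden (ext_functionalC Fm F0 fP).
  - by move=> f fP; rewrite mmultiK (ext_functionalF _ Fm fP).
have [new [newP newC newF]] : exists new : {mpoly k[n.+1]} -> E,
  [/\ functional (ev iota x) new, forall c, new (mwiden c) = 0 & new (mmulti F) = 1].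
  exists (fun p => new_functional (ev iota x') (x ord_max) F (muni p)); split.
  - move=> a P Q P0 Q0; rewrite rmorphD rmorphM -(evp_muni x a) /=.
    by apply: (new_functionalP Fm F0 minF); rewrite evp_muni.
  - by move=> c; rewrite muni_mwiden (new_functionalC Fm F0).
  - by rewrite mmultiK (new_functionalF _ _ Fm).
exists (fun i => if unlift ord_max i is Some j then ext (phi j) else new).
exists (fun i => if unlift ord_max i is Some j then mwiden (T j) else mmulti F).
split=> [i|j|i j].
- by case: unliftP => [j|] _; [apply: extP|].
- rewrite -evp_muni; case: unliftP => [i|] _; last by rewrite mmultiK.
  by rewrite muni_mwiden evpC; exact: T0.
- case: unliftP => [i'|] ->; case: unliftP => [j'|] ->.
  + by rewrite extC // phiT (inj_eq lift_inj).
  + by rewrite extF // eq_sym (negPf (neq_lift _ _)).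
  + by rewrite newC (negPf (neq_lift _ _)).
  + by rewrite newF eqxx.
Qed.
End FunctionalSystem.

(** * Presentations and the line omega *)

Section Fcat.
Variables (T : Type) (n m : nat) (x : 'I_n -> T) (y : 'I_m -> T).
Lemma fcatl i : fcat x y (lshift m i) = x i.
Proof. by rewrite /fcat; case: split_ordP => j /eqP; rewrite ?eq_lshift ?eq_lrshift // => /eqP->. Qed.
Lemma fcatr i : fcat x y (rshift n i) = y i.
Proof. by rewrite /fcat; case: split_ordP => j /eqP; rewrite ?eq_rshift ?eq_rlshift // => /eqP->. Qed.
Lemma fcat_lshift : fcat x y \o @lshift n m = x.
Proof. by apply/funext => i; rewrite /= fcatl. Qed.
Lemma fcat_rshift : fcat x y \o @rshift n m = y.
Proof. by apply/funext => i; rewrite /= fcatr. Qed.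
Lemma comp_fcat (U : Type) (h : T -> U) : h \o fcat x y =1 fcat (h \o x) (h \o y).
Proof. by move=> i; rewrite /fcat /=; case: fintype.split. Qed.
End Fcat.

Section DetRows.
Variables (E : fieldType) (N a c : nat) (eN : (a + c)%N = N).
Variables (s : 'I_a -> 'I_N) (t : 'I_c -> 'I_N) (st_inj : injective (fcat s t)).
Variables (A B : 'M[E]_N) (M : 'M[E]_a).

Let det_rowsub (X : 'M[E]_(a + c)) :
  (forall i j, A (fcat s t i) j = \sum_l X i l * B (fcat s t l) j) ->
  \det A = \det X * \det B.
Proof.
case: _ / eN s t st_inj A B => s' t' inj A' B' AB.
pose p := perm inj.
have : row_perm p A' = X *m row_perm p B'.
  apply/matrixP => i j; rewrite !mxE permE AB; apply: eq_bigr => l _.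
  by rewrite mxE permE.
rewrite !row_permE => /(congr1 (fun Y => \det Y)); rewrite !det_mulmx => h.
have p0 : \det (perm_mx p) != 0 :> E by rewrite det_perm signr_eq0.
by apply: (mulfI p0); rewrite h mulrCA.
Qed.

(** Up to one permutation of the rows of both matrices, [A] is [B] multiplied by a block triangular
    matrix with diagonal blocks [M] and 1; the sign of the permutation cancels. *)
Lemma det_rows_lower :
  (forall i j, A (s i) j = \sum_l M i l * B (s l) j) ->
  (forall i, exists v : 'I_a -> E,
     forall j, A (t i) j = B (t i) j + \sum_l v l * B (s l) j) ->
  \det A = \det M * \det B.
Proof.
move=> hs /choice[v hv].
rewrite (det_rowsub (X := block_mx M 0 (\matrix_(i, l) v i l) 1%:M)); last first.
  move=> i j; rewrite big_split_ord /=; case: (split_ordP i) => i' ->.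
    rewrite fcatl hs [X in _ = _ + X]big1 ?addr0; last first.
      by move=> l _; rewrite block_mxEur mxE mul0r.
    by apply: eq_bigr => l _; rewrite block_mxEul fcatl.
  rewrite fcatr hv [RHS]addrC; congr (_ + _); last first.
    by apply: eq_bigr => l _; rewrite block_mxEdl fcatl mxE.
  rewrite (bigD1 i') //= big1 ?addr0; last first.
    by move=> l li; rewrite block_mxEdr mxE eq_sym (negPf li) mul0r.
  by rewrite block_mxEdr mxE eqxx mul1r fcatr.
by rewrite det_lblock det1 mulr1.
Qed.

Lemma det_rows_upper :
  (forall i, exists v : 'I_c -> E, forall j, A (s i) j =
     \sum_l M i l * B (s l) j + \sum_l v l * B (t l) j) ->
  (forall i j, A (t i) j = B (t i) j) ->
  \det A = \det M * \det B.
Proof.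
move=> /choice[v hv] ht.
rewrite (det_rowsub (X := block_mx M (\matrix_(i, l) v i l) 0 1%:M)); last first.
  move=> i j; rewrite big_split_ord /=; case: (split_ordP i) => i' ->.
    rewrite fcatl hv; congr (_ + _); apply: eq_bigr => l _.
      by rewrite block_mxEul fcatl.
    by rewrite block_mxEur fcatr mxE.
  rewrite fcatr ht big1 ?add0r; last by move=> l _; rewrite block_mxEdl mxE mul0r.
  rewrite (bigD1 i') //= big1 ?addr0; last first.
    by move=> l li; rewrite block_mxEdr mxE eq_sym (negPf li) mul0r.
  by rewrite block_mxEdr mxE eqxx mul1r fcatr.
by rewrite det_ublock det1 mulr1.
Qed.
End DetRows.

Section Ideal.
Variables (R : comNzRingType) (m : nat) (h : 'I_m -> R).
Definition ideal_gen (P : R) := exists a : 'I_m -> R, P = \sum_i a i * h i.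

Lemma ideal_gen0 : ideal_gen 0.
Proof. by exists (fun=> 0); rewrite big1 // => i _; rewrite mul0r. Qed.
Lemma ideal_genD P Q : ideal_gen P -> ideal_gen Q -> ideal_gen (P + Q).
Proof.
move=> [a ->] [b ->]; exists (fun i => a i + b i).
by rewrite -big_split; apply: eq_bigr => i _; rewrite mulrDl.
Qed.
Lemma ideal_genM c P : ideal_gen P -> ideal_gen (c * P).
Proof.
move=> [a ->]; exists (fun i => c * a i).
by rewrite mulr_sumr; apply: eq_bigr => i _; rewrite mulrA.
Qed.
Lemma ideal_gen_gen i : ideal_gen (h i).
Proof.
exists (fun j => (j == i)%:R); rewrite (bigD1 i) //= eqxx mul1r big1 ?addr0 //.
by move=> j /negPf->; rewrite mul0r.
Qed.
Lemma ideal_gen_sum (I : Type) (r : seq I) (P : I -> R) :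
  (forall i, ideal_gen (P i)) -> ideal_gen (\sum_(i <- r) P i).
Proof.
move=> hP; elim: r => [|i r IH]; first by rewrite big_nil; apply: ideal_gen0.
by rewrite big_cons; apply: ideal_genD.
Qed.
End Ideal.

Lemma ideal_gen_trans (R : comNzRingType) m n (h : 'I_m -> R) (g : 'I_n -> R) P :
  (forall i, ideal_gen g (h i)) -> ideal_gen h P -> ideal_gen g P.
Proof. by move=> hg [a ->]; apply: ideal_gen_sum => i; apply: ideal_genM. Qed.

Lemma ideal_gen_morph (R S : comNzRingType) m (h : 'I_m -> R) (f : {rmorphism R -> S}) P :
  ideal_gen h P -> ideal_gen (f \o h) (f P).
Proof.
move=> [a ->]; exists (f \o a); rewrite rmorph_sum.
by apply: eq_bigr => i _; rewrite rmorphM.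
Qed.

Lemma mpoly_rmorph_congr (k : comNzRingType) (R : comNzRingType) n m (h : 'I_m -> R)
    (f g : {rmorphism {mpoly k[n]} -> R}) :
  (forall c, f c%:MP = g c%:MP) -> (forall i, ideal_gen h (f 'X_i - g 'X_i)) ->
  forall P, ideal_gen h (f P - g P).
Proof.
move=> fgC fgX P; rewrite [P]mpolyE !rmorph_sum -sumrB.
apply: ideal_gen_sum => mm; rewrite -mul_mpolyC !rmorphM /= fgC -mulrBr.
apply: ideal_genM; rewrite mpolyXE_id !rmorph_prod /=.
elim: (index_enum _) => [|i r IH]; first by rewrite !big_nil subrr; apply: ideal_gen0.
rewrite !big_cons.
set u := f (_ ^+ _); set v := g (_ ^+ _); set w := \prod_(_ <- _) _.
set z := \prod_(_ <- _) _.
have -> : u * w - v * z = u * (w - z) + z * (u - v) by ring.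
apply: ideal_genD; apply: ideal_genM => //.
rewrite /u /v !rmorphXn /=; elim: (mm i) => [|e IHe].
  by rewrite !expr0 subrr; apply: ideal_gen0.
rewrite !exprS.
have -> : f 'X_i * f 'X_i ^+ e - g 'X_i * g 'X_i ^+ e =
  f 'X_i * (f 'X_i ^+ e - g 'X_i ^+ e) + g 'X_i ^+ e * (f 'X_i - g 'X_i) by ring.
by apply: ideal_genD; apply: ideal_genM.
Qed.

Section Presentations.
Variables (k E : fieldType) (iota : {rmorphism k -> E}).
Local Notation ev := (ev iota).
Local Notation presentation := (presentation iota).

Lemma presentation_gen n (x : 'I_n -> E) f i : presentation x f -> ev x (f i) = 0.
Proof.
by case=> _ hf; apply/hf; apply: (ideal_gen_gen f i).
Qed.

Lemma presentation_ideal n (x : 'I_n -> E) f p : presentation x f ->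
  ev x p = 0 -> ideal_gen f p.
Proof. by case=> _ hf /hf. Qed.

Lemma presentation_lift n (x : 'I_n -> E) f m (y : 'I_m -> E) : presentation x f ->
  exists p : 'I_m -> {mpoly k[n]}, forall j, ev x (p j) = y j.
Proof. by case=> sx _; have /choice[p hp] := fun j => sx (y j); exists p. Qed.

(** Modulo [X_i - p_i], every variable is a polynomial in those enumerated by [s]. *)
Lemma ideal_concat n N (s : 'I_n -> 'I_N) (z : 'I_N -> E)
    (x : 'I_n -> E) f (p : 'I_N -> {mpoly k[n]}) M (A : 'I_M -> {mpoly k[N]}) :
  presentation x f -> z \o s =1 x -> (forall i, ev x (p i) = z i) ->
  (forall a, ideal_gen A (mrename s (f a))) ->
  (forall i, ideal_gen A ('X_i - mrename s (p i))) ->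
  forall P, ev z P = 0 -> ideal_gen A P.
Proof.
move=> pr zs zt Af At P P0.
pose P' := mmap (@mpolyC n k) p P.
have h : ideal_gen A (P - mrename s P').
  apply: (mpoly_rmorph_congr (f := idfun)
     (g := mrename s \o mmap (@mpolyC n k) p)) => [c|i] /=.
    by rewrite mmapC mrenameC.
  by rewrite mmapX mmap1U.
rewrite -[P](subrK (mrename s P')); apply: ideal_genD => //.
have e : ev x P' = 0.
  rewrite -P0; apply: (mpoly_rmorph_eq (f := ev x \o mmap (@mpolyC n k) p)
    (g := ev z)) => [c|i] /=.
    by rewrite mmapC !evC.
  by rewrite mmapX mmap1U zt evX.
apply: ideal_gen_trans Af _; exact: (@ideal_gen_morph _ _ _ _ (mrename s) _ (presentation_ideal pr e)).
Qed.

(** [trF f p] and [trG q g] are the families bound to [F] and [G] inside [transition]: two systems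
    of generators of one and the same kernel. *)
Definition trF n m (f : 'I_n -> {mpoly k[n]}) (p : 'I_m -> {mpoly k[n]}) :
    'I_(n + m) -> {mpoly k[n + m]} :=
  fcat (fun i => mrename (@lshift n m) (f i))
       (fun j => 'X_(rshift n j) - mrename (@lshift n m) (p j)).
Definition trG n m (q : 'I_n -> {mpoly k[m]}) (g : 'I_m -> {mpoly k[m]}) :
    'I_(n + m) -> {mpoly k[n + m]} :=
  fcat (fun i => 'X_(lshift m i) - mrename (@rshift n m) (q i))
       (fun j => mrename (@rshift n m) (g j)).

Section Two.
Variables (n m : nat) (x : 'I_n -> E) (f : 'I_n -> {mpoly k[n]}).
Variables (y : 'I_m -> E) (g : 'I_m -> {mpoly k[m]}).
Variables (p : 'I_m -> {mpoly k[n]}) (q : 'I_n -> {mpoly k[m]}).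
Hypotheses (prx : presentation x f) (pry : presentation y g).
Hypotheses (hp : forall j, ev x (p j) = y j) (hq : forall i, ev y (q i) = x i).

Lemma ev_fcatl P : ev (fcat x y) (mrename (@lshift n m) P) = ev x P.
Proof. by rewrite ev_mrename fcat_lshift. Qed.
Lemma ev_fcatr P : ev (fcat x y) (mrename (@rshift n m) P) = ev y P.
Proof. by rewrite ev_mrename fcat_rshift. Qed.

Lemma ev_trF i : ev (fcat x y) (trF f p i) = 0.
Proof.
rewrite /trF; case: (split_ordP i) => j ->; rewrite ?fcatl ?fcatr.
  by rewrite ev_fcatl presentation_gen.
by rewrite evB evX ev_fcatl fcatr hp subrr.
Qed.

Lemma ev_trG i : ev (fcat x y) (trG q g i) = 0.
Proof.
rewrite /trG; case: (split_ordP i) => j ->; rewrite ?fcatl ?fcatr.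
  by rewrite evB evX ev_fcatr fcatl hq subrr.
by rewrite ev_fcatr presentation_gen.
Qed.

Lemma ideal_trG P : ev (fcat x y) P = 0 -> ideal_gen (trG q g) P.
Proof.
apply: (ideal_concat (s := @rshift n m) (p := fcat q (fun j => 'X_j)) pry).
- by rewrite fcat_rshift.
- by move=> i; case: (split_ordP i) => j ->; rewrite ?fcatl ?fcatr // evX.
- by move=> a; have := ideal_gen_gen (trG q g) (rshift n a); rewrite {2}/trG fcatr.
- move=> i; case: (split_ordP i) => j ->; rewrite ?fcatl ?fcatr.
    by have := ideal_gen_gen (trG q g) (lshift m j); rewrite {2}/trG fcatl.
  by rewrite mrenameX subrr; apply: ideal_gen0.
Qed.

Lemma ideal_trF P : ev (fcat x y) P = 0 -> ideal_gen (trF f p) P.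
Proof.
apply: (ideal_concat (s := @lshift n m) (p := fcat (fun j => 'X_j) p) prx).
- by rewrite fcat_lshift.
- by move=> i; case: (split_ordP i) => j ->; rewrite ?fcatl ?fcatr // evX.
- by move=> a; have := ideal_gen_gen (trF f p) (lshift m a); rewrite {2}/trF fcatl.
- move=> i; case: (split_ordP i) => j ->; rewrite ?fcatl ?fcatr.
    by rewrite mrenameX subrr; apply: ideal_gen0.
  by have := ideal_gen_gen (trF f p) (rshift n j); rewrite {2}/trF fcatr.
Qed.

Lemma in_ker_sq0 N (z : 'I_N -> E) : in_ker_sq iota z 0.
Proof. by exists 0%N, (fun=> 0), (fun=> 0); split; [case|rewrite big_ord0]. Qed.

(** The congruence modulo squares that defines [transition] can be chosen to be an equality, because
    [trG q g] generates the whole kernel. *)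
Lemma transition_exists : exists (M : 'M[{mpoly k[n + m]}]_(n + m)),
  [/\ forall i, trF f p i = \sum_j M i j * trG q g j &
      transition iota x f y g (\det (map_mx (ev (fcat x y)) M))].
Proof.
have /choice[M hM] : forall i, exists a : 'I_(n + m) -> {mpoly k[n + m]},
    trF f p i = \sum_j a j * trG q g j.
  by move=> i; apply/ideal_trG/ev_trF.
pose MM := \matrix_(i, j) M i j.
have h i : trF f p i = \sum_j MM i j * trG q g j.
  by rewrite hM; apply: eq_bigr => j _; rewrite mxE.
exists MM; split => //; exists p, q, MM; split=> // i.
by rewrite -/(trF f p) -/(trG q g) h subrr; apply: in_ker_sq0.
Qed.
End Two.

(** On the kernel [I] of the evaluation a functional is linear and thus kills [I^2]: it amounts to a
    linear form on [I / I^2], its values outside [I] being arbitrary. *)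
Lemma functional_ker_sq N (z : 'I_N -> E) phi P :
  functional (ev z) phi -> in_ker_sq iota z P -> phi P = 0.
Proof.
move=> phiP [m [a [b [ab ->]]]].
rewrite (functional_sum (ev := ev z)) // => [|i]; last by case: (ab i).
by rewrite big1 // => i _; rewrite /= (ab i).1 mul0r.
Qed.

Lemma functional_mrename n N (s : 'I_n -> 'I_N) (z : 'I_N -> E) phi :
  functional (ev z) phi -> functional (ev (z \o s)) (phi \o mrename s).
Proof.
move=> phiP a P Q P0 Q0 /=.
by rewrite rmorphD rmorphM phiP ?ev_mrename.
Qed.

Definition fmx N (phi : 'I_N -> {mpoly k[N]} -> E) (A : 'I_N -> {mpoly k[N]}) :
  'M[E]_N := \matrix_(i, j) phi j (A i).

(** [fmx phi A] lists the coordinates of the classes of [A] in the basis of [I / I^2] dual to [phi].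
    Writing each [T j] in terms of the generators [A] provides a left inverse. *)
Lemma fmx_neq0 N (z : 'I_N -> E) phi T A :
  (forall i, functional (ev z) (phi i)) -> (forall j, ev z (T j) = 0) ->
  (forall i j, phi i (T j) = (i == j)%:R) ->
  (forall i, ev z (A i) = 0) -> (forall P, ev z P = 0 -> ideal_gen A P) ->
  \det (fmx phi A) != 0.
Proof.
move=> phiP T0 phiT A0 gA.
have /choice[C hC] : forall j, exists a : 'I_N -> {mpoly k[N]}, T j = \sum_l a l * A l.
  by move=> j; apply: gA.
have : (\matrix_(j, l) ev z (C j l)) *m fmx phi A = 1%:M.
  apply/matrixP => j i; rewrite !mxE eq_sym -phiT hC.
  rewrite (functional_sum (ev := ev z)) //; apply: eq_bigr => l _.
  by rewrite !mxE.
move/(congr1 (fun Y => \det Y)); rewrite det_mulmx det1 => h.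
by apply: contra_eq_neq h => ->; rewrite mulr0 eq_sym oner_eq0.
Qed.

Lemma transition_functional n m (x : 'I_n -> E) f (y : 'I_m -> E) g p q
    (M : 'M[{mpoly k[n + m]}]_(n + m)) N (z : 'I_N -> E) (s : 'I_(n + m) -> 'I_N) phi :
  presentation x f -> presentation y g ->
  (forall j, ev x (p j) = y j) -> (forall i, ev y (q i) = x i) ->
  (forall i, in_ker_sq iota (fcat x y) (trF f p i - \sum_j M i j * trG q g j)) ->
  z \o s =1 fcat x y -> functional (ev z) phi ->
  forall i, phi (mrename s (trF f p i)) =
    \sum_j (map_mx (ev (fcat x y)) M) i j * phi (mrename s (trG q g j)).
Proof.
move=> prx pry hp hq hM zs phiP i.
have phiP' := functional_mrename (s := s) phiP.
have e : ev (z \o s) = ev (fcat x y) by rewrite (funext zs).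
rewrite e in phiP'; set psi := phi \o mrename s in phiP'.
have G0 j : ev (fcat x y) (trG q g j) = 0 by apply: ev_trG.
have -> : phi (mrename s (trF f p i)) = psi (\sum_j M i j * trG q g j).
  have S0 : ev (fcat x y) (\sum_j M i j * trG q g j) = 0.
    by rewrite ev_sum big1 // => j _; rewrite evM G0 mulr0.
  apply/eqP; rewrite -subr_eq0 -[phi _]/(psi _); apply/eqP.
  rewrite -(functionalB (ev := ev (fcat x y)) phiP') //; last exact: ev_trF.
  exact: functional_ker_sq phiP' (hM i).
rewrite (functional_sum (ev := ev (fcat x y))) //; apply: eq_bigr => j _.
by rewrite mxE.
Qed.

(** The transition is carried out inside a ring with more variables. The rows indexed by [t] may
    change as well, but only by elements of the ideal of [trG q g]; their values under the
    functionals are combinations of the rows of [B] indexed by [s], so these changes do not affect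
    the determinant. *)
Lemma transition_det_step n m r N (x : 'I_n -> E) f (y : 'I_m -> E) g p q
    (M : 'M[{mpoly k[n + m]}]_(n + m)) (z : 'I_N -> E)
    (s : 'I_(n + m) -> 'I_N) (t : 'I_r -> 'I_N) phi (A B : 'I_N -> {mpoly k[N]})
    (D : 'I_r -> {mpoly k[n + m]}) :
  (n + m + r)%N = N -> injective (fcat s t) ->
  presentation x f -> presentation y g ->
  (forall j, ev x (p j) = y j) -> (forall i, ev y (q i) = x i) ->
  (forall i, in_ker_sq iota (fcat x y) (trF f p i - \sum_j M i j * trG q g j)) ->
  z \o s =1 fcat x y -> (forall i : 'I_N, functional (ev z) (phi i)) ->
  (forall i, ev z (A i) = 0) -> (forall i, ev z (B i) = 0) ->
  (forall i, A (s i) = mrename s (trF f p i)) ->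
  (forall i, B (s i) = mrename s (trG q g i)) ->
  (forall i, A (t i) - B (t i) = mrename s (D i)) ->
  \det (fmx phi A) = \det (map_mx (ev (fcat x y)) M) * \det (fmx phi B).
Proof.
move=> eN inj prx pry hp hq hM zs phiP A0 B0 As Bs ABt.
apply: (det_rows_lower eN inj).
  move=> i j; rewrite mxE As (transition_functional prx pry hp hq hM zs) //.
  by apply: eq_bigr => l _; rewrite [fmx _ _ _ _]mxE Bs.
move=> i.
have D0 : ev (fcat x y) (D i) = 0.
  have <- : ev z (A (t i) - B (t i)) = 0 by rewrite evB A0 B0 subr0.
  by rewrite ABt ev_mrename (funext zs).
have [a ha] := ideal_trG pry hq D0.
exists (fun l => ev (fcat x y) (a l)) => j; rewrite !mxE.
have -> : A (t i) = B (t i) + mrename s (D i) by rewrite -ABt addrC subrK.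
rewrite (functionalD (phiP j)) //=; last by rewrite ev_mrename (funext zs).
congr (_ + _); rewrite ha rmorph_sum.
rewrite (eq_bigr (fun l => mrename s (a l) * B (s l))); last first.
  by move=> l _; rewrite rmorphM Bs.
rewrite (functional_sum (phiP j)) => [|l]; last exact: B0.
apply: eq_bigr => l _; by rewrite /= ev_mrename (funext zs) mxE.
Qed.
End Presentations.

Lemma fcat_inj (T : eqType) n m (x : 'I_n -> T) (y : 'I_m -> T) :
  injective x -> injective y -> (forall i j, x i != y j) -> injective (fcat x y).
Proof.
move=> ix iy xy i j.
case: (split_ordP i) => i' ->; case: (split_ordP j) => j' ->;
  rewrite ?fcatl ?fcatr.
- by move/ix->.
- by move/eqP; rewrite (negPf (xy _ _)).
- by move/esym/eqP; rewrite (negPf (xy _ _)).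
- by move/iy->.
Qed.

Section Omega.
Variables (k E : fieldType) (iota : {rmorphism k -> E}).
Hypothesis alg : algebraic_ext iota.
Local Notation ev := (ev iota).
Local Notation presentation := (presentation iota).
Local Notation transition := (transition iota).

(** In the polynomial ring in the three families of variables, [A], [B] and [C] keep the equations
    of [f], [g] and [h] respectively and eliminate the other two families. The passages from [A] to
    [B], from [B] to [C] and from [A] to [C] have determinants [d1], [d2] and [d3]; the determinant
    of [C] is invertible because [C] generates the kernel. *)
Lemma transition_cocycle n m r (x : 'I_n -> E) f (y : 'I_m -> E) g (w : 'I_r -> E) h
    d1 d2 d3 :
  presentation x f -> presentation y g -> presentation w h ->
  transition x f y g d1 -> transition y g w h d2 -> transition x f w h d3 ->
  d3 = d1 * d2.
Proof.
move=> prx pry prw [p1 [q1 [M1 [hp1 hq1 hM1 ->]]]] [p2 [q2 [M2 [hp2 hq2 hM2 ->]]]]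
  [p3 [q3 [M3 [hp3 hq3 hM3 ->]]]].
rewrite -/(trF f p1) -/(trG q1 g) in hM1.
rewrite -/(trF g p2) -/(trG q2 h) in hM2.
rewrite -/(trF f p3) -/(trG q3 h) in hM3.
pose s1 : 'I_n -> 'I_(n + m + r) := fun i => lshift r (lshift m i).
pose s2 : 'I_m -> 'I_(n + m + r) := fun i => lshift r (rshift n i).
pose s3 : 'I_r -> 'I_(n + m + r) := fun i => rshift (n + m) i.
have i1 : injective s1 by move=> i j /lshift_inj/lshift_inj.
have i2 : injective s2 by move=> i j /lshift_inj/rshift_inj.
have i3 : injective s3 by move=> i j /rshift_inj.
have i12 i j : s1 i != s2 j by rewrite /s1 /s2 eq_lshift eq_lrshift.
have i13 i j : s1 i != s3 j by rewrite /s1 /s3 eq_lrshift.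
have i23 i j : s2 i != s3 j by rewrite /s2 /s3 eq_lrshift.
have i21 i j : s2 i != s1 j by rewrite eq_sym.
have i31 i j : s3 i != s1 j by rewrite eq_sym.
have i32 i j : s3 i != s2 j by rewrite eq_sym.
pose z := fcat (fcat x y) w.
have z1 : z \o s1 =1 x by move=> i; rewrite /z /s1 /= !fcatl.
have z2 : z \o s2 =1 y by move=> i; rewrite /z /s2 /= fcatl fcatr.
have z3 : z \o s3 =1 w by move=> i; rewrite /z /s3 /= fcatr.
have ez1 P : ev z (mrename s1 P) = ev x P by rewrite ev_mrename (funext z1).
have ez2 P : ev z (mrename s2 P) = ev y P by rewrite ev_mrename (funext z2).
have ez3 P : ev z (mrename s3 P) = ev w P by rewrite ev_mrename (funext z3).
have [phi [T [phiP T0 phiT]]] := functional_system alg z.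
pose A := fcat (fcat (fun i => mrename s1 (f i))
                     (fun i => 'X_(s2 i) - mrename s1 (p1 i)))
               (fun i => 'X_(s3 i) - mrename s1 (p3 i)).
pose B := fcat (fcat (fun i => 'X_(s1 i) - mrename s2 (q1 i))
                     (fun i => mrename s2 (g i)))
               (fun i => 'X_(s3 i) - mrename s2 (p2 i)).
pose C := fcat (fcat (fun i => 'X_(s1 i) - mrename s3 (q3 i))
                     (fun i => 'X_(s2 i) - mrename s3 (q2 i)))
               (fun i => mrename s3 (h i)).
have fcat3 (U : Type) (a : 'I_n -> U) (b : 'I_m -> U) (c : 'I_r -> U) :
    [/\ forall i, fcat (fcat a b) c (s1 i) = a i,
        forall i, fcat (fcat a b) c (s2 i) = b i &
        forall i, fcat (fcat a b) c (s3 i) = c i].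
  by split=> i; rewrite /s1 /s2 /s3 ?fcatr ?fcatl ?fcatr ?fcatl.
have cover (P : 'I_(n + m + r) -> Prop) : (forall i, P (s1 i)) -> (forall i, P (s2 i)) ->
    (forall i, P (s3 i)) -> forall i, P i.
  move=> P1 P2 P3 i; case: (split_ordP i) => j ->; last exact: P3.
  by case: (split_ordP j) => j' ->; [apply: P1|apply: P2].
have [A1 A2 A3] := fcat3 _ (fun i => mrename s1 (f i))
  (fun i => 'X_(s2 i) - mrename s1 (p1 i)) (fun i => 'X_(s3 i) - mrename s1 (p3 i)).
have [B1 B2 B3] := fcat3 _ (fun i => 'X_(s1 i) - mrename s2 (q1 i))
  (fun i => mrename s2 (g i)) (fun i => 'X_(s3 i) - mrename s2 (p2 i)).
have [C1 C2 C3] := fcat3 _ (fun i => 'X_(s1 i) - mrename s3 (q3 i))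
  (fun i => 'X_(s2 i) - mrename s3 (q2 i)) (fun i => mrename s3 (h i)).
rewrite -/A in A1 A2 A3; rewrite -/B in B1 B2 B3; rewrite -/C in C1 C2 C3.
have [Z1 Z2 Z3] := fcat3 _ x y w; rewrite -/z in Z1 Z2 Z3.
have A0 : forall i, ev z (A i) = 0.
  apply: cover => i; rewrite ?A1 ?A2 ?A3 ?evB ?evX ?ez1 ?presentation_gen //.
    by rewrite Z2 hp1 subrr.
  by rewrite Z3 hp3 subrr.
have B0 : forall i, ev z (B i) = 0.
  apply: cover => i; rewrite ?B1 ?B2 ?B3 ?evB ?evX ?ez2 ?presentation_gen //.
    by rewrite Z1 hq1 subrr.
  by rewrite Z3 hp2 subrr.
have C0 : forall i, ev z (C i) = 0.
  apply: cover => i; rewrite ?C1 ?C2 ?C3 ?evB ?evX ?ez3 ?presentation_gen //.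
    by rewrite Z1 hq3 subrr.
  by rewrite Z2 hq2 subrr.
have gC : forall P, ev z P = 0 -> ideal_gen C P.
  apply: (ideal_concat (s := s3) (p := fcat (fcat q3 q2) (fun i => 'X_i)) prw z3).
  - have [Q1 Q2 Q3] := fcat3 _ q3 q2 (fun i => 'X_i).
    by apply: cover => i; rewrite ?Q1 ?Q2 ?Q3 ?Z1 ?Z2 ?Z3 ?evX.
  - by move=> i; rewrite -C3; apply: ideal_gen_gen.
  - have [Q1 Q2 Q3] := fcat3 _ q3 q2 (fun i => 'X_i).
    apply: cover => i; rewrite ?Q1 ?Q2 ?Q3.
    + by rewrite -C1; apply: ideal_gen_gen.
    + by rewrite -C2; apply: ideal_gen_gen.
    + by rewrite mrenameX subrr; apply: ideal_gen0.
have detC : \det (fmx phi C) != 0 := fmx_neq0 phiP T0 phiT C0 gC.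
have AB : \det (fmx phi A) =
    \det (map_mx (ev (fcat x y)) M1) * \det (fmx phi B).
  apply: (transition_det_step (s := fcat s1 s2) (t := s3)
    (D := fun i => mrename (@rshift n m) (p2 i) - mrename (@lshift n m) (p3 i))
    _ _ prx pry hp1 hq1 hM1 _ phiP A0 B0) => //.
  - by apply: fcat_inj => //; [apply: fcat_inj|move=> i j; case: (split_ordP i) => a ->; rewrite ?fcatl ?fcatr].
  - by move=> i; case: (split_ordP i) => a ->; rewrite /= ?fcatl ?fcatr.
  - move=> i; rewrite /trF; case: (split_ordP i) => a ->.
      by rewrite !fcatl A1 mrename_comp fcat_lshift.
    rewrite !fcatr A2 rmorphB /= mrenameX mrename_comp fcatr fcat_lshift.
    exact: erefl.
  - move=> i; rewrite /trG; case: (split_ordP i) => a ->; last first.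
      by rewrite !fcatr B2 mrename_comp fcat_rshift.
    rewrite !fcatl B1 rmorphB /= mrenameX mrename_comp fcatl fcat_rshift.
    exact: erefl.
  - move=> i; rewrite A3 B3 rmorphB /= !mrename_comp.
    rewrite opprB addrC subrKA fcat_lshift fcat_rshift; exact: erefl.
have BC : \det (fmx phi B) =
    \det (map_mx (ev (fcat y w)) M2) * \det (fmx phi C).
  apply: (transition_det_step (s := fcat s2 s3) (t := s1)
    (D := fun i => mrename (@rshift m r) (q3 i) - mrename (@lshift m r) (q1 i))
    _ _ pry prw hp2 hq2 hM2 _ phiP B0 C0) => //.
  - by rewrite addnC addnA.
  - by apply: fcat_inj => //; [apply: fcat_inj|move=> i j; case: (split_ordP i) => a ->; rewrite ?fcatl ?fcatr].
  - by move=> i; case: (split_ordP i) => a ->; rewrite /= ?fcatl ?fcatr.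
  - move=> i; rewrite /trF; case: (split_ordP i) => a ->.
      by rewrite !fcatl B2 mrename_comp fcat_lshift.
    rewrite !fcatr B3 rmorphB /= mrenameX mrename_comp fcatr fcat_lshift.
    exact: erefl.
  - move=> i; rewrite /trG; case: (split_ordP i) => a ->; last first.
      by rewrite !fcatr C3 mrename_comp fcat_rshift.
    rewrite !fcatl C2 rmorphB /= mrenameX mrename_comp fcatl fcat_rshift.
    exact: erefl.
  - move=> i; rewrite B1 C1 rmorphB /= !mrename_comp.
    rewrite opprB addrC subrKA fcat_lshift fcat_rshift; exact: erefl.
have AC : \det (fmx phi A) =
    \det (map_mx (ev (fcat x w)) M3) * \det (fmx phi C).
  apply: (transition_det_step (s := fcat s1 s3) (t := s2)
    (D := fun i => mrename (@rshift n r) (q2 i) - mrename (@lshift n r) (p1 i))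
    _ _ prx prw hp3 hq3 hM3 _ phiP A0 C0) => //.
  - by rewrite addnAC.
  - by apply: fcat_inj => //; [apply: fcat_inj|move=> i j; case: (split_ordP i) => a ->; rewrite ?fcatl ?fcatr].
  - by move=> i; case: (split_ordP i) => a ->; rewrite /= ?fcatl ?fcatr.
  - move=> i; rewrite /trF; case: (split_ordP i) => a ->.
      by rewrite !fcatl A1 mrename_comp fcat_lshift.
    rewrite !fcatr A3 rmorphB /= mrenameX mrename_comp fcatr fcat_lshift.
    exact: erefl.
  - move=> i; rewrite /trG; case: (split_ordP i) => a ->; last first.
      by rewrite !fcatr C3 mrename_comp fcat_rshift.
    rewrite !fcatl C1 rmorphB /= mrenameX mrename_comp fcatl fcat_rshift.
    exact: erefl.
  - move=> i; rewrite A2 C2 rmorphB /= !mrename_comp.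
    rewrite opprB addrC subrKA fcat_lshift fcat_rshift; exact: erefl.
by apply: (mulIf detC); rewrite -AC AB BC mulrA.
Qed.

Lemma transition_neq0 n m (x : 'I_n -> E) f (y : 'I_m -> E) g d :
  presentation x f -> presentation y g -> transition x f y g d -> d != 0.
Proof.
move=> prx pry [p [q [M [hp hq hM ->]]]].
rewrite -/(trF f p) -/(trG q g) in hM.
have [phi [T [phiP T0 phiT]]] := functional_system alg (fcat x y).
have mid P : mrename id P = P :> {mpoly k[n + m]}.
  apply: (mpoly_rmorph_eq (f := @mrename k _ _ id) (g := idfun)) => [c|i] /=.
    exact: mrenameC.
  exact: mrenameX.
have detF : \det (fmx phi (trF f p)) != 0.
  by apply: (fmx_neq0 phiP T0 phiT) => [i|P]; [apply: ev_trF|apply: ideal_trF].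
have : fmx phi (trF f p) = map_mx (ev (fcat x y)) M *m fmx phi (trG q g).
  apply/matrixP => i j; rewrite !mxE -{1}(mid (trF f p i)).
  rewrite (transition_functional prx pry hp hq hM (s := id) _ (phiP j)) //.
  by apply: eq_bigr => l _; rewrite mid [fmx _ _ _ _]mxE.
move/(congr1 (fun Y => \det Y)); rewrite det_mulmx => e.
by apply: contraNneq detF => d0; rewrite e d0 mul0r.
Qed.

Lemma transition_total n m (x : 'I_n -> E) f (y : 'I_m -> E) g :
  presentation x f -> presentation y g -> exists d, transition x f y g d.
Proof.
move=> prx pry; have [p hp] := presentation_lift y prx.
have [q hq] := presentation_lift x pry.
by have [M [_ h]] := transition_exists prx pry hp hq; eexists; exact: h.
Qed.

(** The cocycle relation gives [d = d * d] for any self-transition, and [d] is nonzero. Uniqueness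
    of transition coefficients follows from this case. *)
Lemma transition_refl n (x : 'I_n -> E) f : presentation x f -> transition x f x f 1.
Proof.
move=> prx; have [d h] := transition_total prx prx.
have := transition_cocycle prx prx prx h h h.
rewrite -{1}[d]mulr1 => /(mulfI (transition_neq0 prx prx h)) d1.
by rewrite d1.
Qed.

Lemma transition_uniq n m (x : 'I_n -> E) f (y : 'I_m -> E) g d d' :
  presentation x f -> presentation y g ->
  transition x f y g d -> transition x f y g d' -> d = d'.
Proof.
move=> prx pry h h'.
by rewrite (transition_cocycle prx prx pry (transition_refl prx) h' h) mul1r.
Qed.

(** One coordinate is prescribed and propagated by transition coefficients; coherence of the result
    is the cocycle relation. Together with [ocoord_inj] this makes [omega] a line. *)
Lemma omega_exists n (x : 'I_n -> E) f (e : E) : presentation x f ->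
  exists l : omega iota, ocoord l x f = e.
Proof.
move=> prx.
pose P (a : pdata k E) := presentation (projT2 a).1 (projT2 a).2.
have /choice[D hD] : forall a, exists d, P a -> transition (projT2 a).1 (projT2 a).2 x f d.
  move=> a; have [Pa|nPa] := pselect (P a); last by exists 0.
  by have [d hd] := transition_total Pa prx; exists d.
pose c a := if `[< P a >] then D a * e else 0.
have cc : c \in coherentb iota.
  apply/asboolP; split=> [m y g npr|m y g r w h d pry prw t].
    by rewrite /c; case: asboolP.
  rewrite /c !asboolT //.
  rewrite (transition_cocycle pry prw prx t (hD (existT _ r (w, h)) prw)
    (hD (existT _ m (y, g)) pry)).
  by rewrite mulrA.
exists (Omega cc); rewrite /ocoord /= /c asboolT //.
by rewrite (transition_uniq prx prx (hD (existT _ n (x, f)) prx)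
  (transition_refl prx)) mul1r.
Qed.

Lemma ocoord_transition (l : omega iota) n m (x : 'I_n -> E) f (y : 'I_m -> E) g d :
  presentation x f -> presentation y g -> transition x f y g d ->
  ocoord l x f = d * ocoord l y g.
Proof. by case: l => c /= /asboolP[_ h]; apply: h. Qed.

Lemma ocoord_npres (l : omega iota) n (x : 'I_n -> E) f :
  ~ presentation x f -> ocoord l x f = 0.
Proof. by case: l => c /= /asboolP[h _]; apply: h. Qed.

Lemma ocoord_inj n (x : 'I_n -> E) f (l l' : omega iota) : presentation x f ->
  ocoord l x f = ocoord l' x f -> l = l'.
Proof.
move=> prx e; apply: val_inj; apply/funext => -[m [y g]].
suff : ocoord l y g = ocoord l' y g by [].
have [pry|npry] := pselect (presentation y g); last by rewrite !ocoord_npres.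
have [d hd] := transition_total pry prx.
by rewrite !(ocoord_transition _ pry prx hd) e.
Qed.

Lemma ocoordZ (c : E) (l : omega iota) n (x : 'I_n -> E) f :
  ocoord (c *: l) x f = c * ocoord l x f.
Proof. by []. Qed.
Lemma ocoordD (l l' : omega iota) n (x : 'I_n -> E) f :
  ocoord (l + l') x f = ocoord l x f + ocoord l' x f.
Proof. by []. Qed.
Lemma ocoord0E n (x : 'I_n -> E) f : ocoord (0 : omega iota) x f = 0.
Proof. by []. Qed.

Lemma ocoord_eq0 n (x : 'I_n -> E) f (l : omega iota) : presentation x f ->
  (ocoord l x f == 0) = (l == 0).
Proof.
move=> prx; apply/eqP/eqP => [e|->]; last exact: ocoord0E.
by apply: (ocoord_inj prx); rewrite e ocoord0E.
Qed.

End Omega.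

(** * Towers of extensions *)

Section PartialEvaluation.
Variables (k K : fieldType) (i1 : {rmorphism k -> K}).

Definition partial_ev N c (hz : 'I_N -> {mpoly K[c]}) : {mpoly k[N]} -> {mpoly K[c]} :=
  mmap (@mpolyC c K \o i1) hz.
HB.instance Definition _ N c hz :=
  GRing.RMorphism.copy (@partial_ev N c hz) (mmap (@mpolyC c K \o i1) hz).

Lemma partial_evC N c (hz : 'I_N -> {mpoly K[c]}) a :
  partial_ev hz a%:MP = (i1 a)%:MP.
Proof. exact: mmapC. Qed.
Lemma partial_evX N c (hz : 'I_N -> {mpoly K[c]}) i : partial_ev hz 'X_i = hz i.
Proof. by rewrite /partial_ev mmapX mmap1U. Qed.

Section Fixed.
Variables (a N c : nat) (s : 'I_a -> 'I_N) (t : 'I_c -> 'I_N).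
Variables (x : 'I_a -> K) (f : 'I_a -> {mpoly k[a]}) (hz : 'I_N -> {mpoly K[c]}).
Hypotheses (cover : forall i, (exists j, i = s j) \/ (exists j, i = t j)).
Hypotheses (hzs : forall j, hz (s j) = (x j)%:MP) (hzt : forall j, hz (t j) = 'X_j).
Hypothesis prx : presentation i1 x f.

Let theta : {mpoly {mpoly k[a]}[c]} -> {mpoly k[N]} :=
  mmap (mrename s) (fun j => 'X_(t j)).
HB.instance Definition _ := GRing.RMorphism.copy theta
  (mmap (mrename (k := k) s) (fun j => 'X_(t j))).

Let theta_surj P : exists Q, theta Q = P.
Proof.
have /choice[h hh] : forall i, exists Q, theta Q = 'X_i.
  move=> i; case: (cover i) => -[j ->].
    by exists (@mpolyC c {mpoly k[a]} 'X_j); rewrite /theta mmapC; apply: mrenameX.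
  by exists 'X_j; rewrite /theta mmapX mmap1U.
exists (mmap (@mpolyC c {mpoly k[a]} \o @mpolyC a k) h P).
apply: (mpoly_rmorph_eq (f := theta \o mmap (@mpolyC c {mpoly k[a]} \o @mpolyC a k) h)
  (g := idfun)) => [b|i] /=.
  rewrite mmapC /= /theta mmapC; exact: mrenameC.
by rewrite mmapX mmap1U hh.
Qed.

Let partial_ev_theta Q : partial_ev hz (theta Q) = map_mpoly (ev i1 x) Q.
Proof.
apply: (mpoly_rmorph_eq (f := partial_ev hz \o theta) (g := map_mpoly (ev i1 x))).
  move=> p; rewrite /= /theta mmapC map_mpolyC.
  apply: (mpoly_rmorph_eq (f := partial_ev hz \o mrename s)
    (g := @mpolyC c K \o ev i1 x)) => [b|i] /=.
    by rewrite mrenameC partial_evC evC.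
  by rewrite mrenameX partial_evX evX hzs.
by move=> i; rewrite /= /theta mmapX mmap1U partial_evX hzt map_mpolyX.
Qed.

Lemma partial_ev_surj Q : exists P, partial_ev hz P = Q.
Proof.
have /choice[r hr] := prx.1.
exists (theta (\sum_(m <- msupp Q) r Q@_m *: 'X_[m])).
rewrite partial_ev_theta rmorph_sum [RHS]mpolyE; apply: eq_bigr => m _.
by apply: etrans (map_mpolyZ _ _ _) _; rewrite map_mpolyX /= hr.
Qed.

(** [theta] rewrites polynomials over [k] as polynomials in the variables [t] over the polynomial
    ring in the variables [s]. There [partial_ev] becomes evaluation of the coefficients at [x],
    whose kernel is known from the presentation, coefficient by coefficient. *)
Lemma partial_ev_ker P : partial_ev hz P = 0 -> ideal_gen (mrename s \o f) P.
Proof.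
have [Q <-] := theta_surj P; rewrite partial_ev_theta => Q0.
apply: ideal_gen_sum => m; rewrite mulrC; apply: ideal_genM.
apply: (@ideal_gen_morph _ _ _ _ (mrename s)).
apply: (presentation_ideal prx).
by rewrite -[LHS]mcoeff_map_mpoly Q0 mcoeff0.
Qed.

Variables (E : fieldType) (i2 : {rmorphism K -> E}) (i : {rmorphism k -> E}).
Hypothesis hi : forall b, i b = i2 (i1 b).
Variables (y : 'I_c -> E) (z : 'I_N -> E).
Hypotheses (zs : forall j, z (s j) = i2 (x j)) (zt : forall j, z (t j) = y j).

Lemma ev_partial_ev P : ev i2 y (partial_ev hz P) = ev i z P.
Proof.
apply: (mpoly_rmorph_eq (f := ev i2 y \o partial_ev hz) (g := ev i z)) => [b|j] /=.
  by rewrite partial_evC !evC hi.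
rewrite partial_evX evX; case: (cover j) => -[j' ->].
  by rewrite hzs zs evC.
by rewrite hzt zt evX.
Qed.

(** A congruence modulo squares over [K] lifts to one over [k] up to a combination of the equations
    [f]. In a determinant that error only adds multiples of the rows of [f], which [det_rows_upper]
    permits. *)
Lemma partial_ev_ker_sq P : in_ker_sq i2 y (partial_ev hz P) ->
  exists v : 'I_a -> {mpoly k[N]},
    in_ker_sq i z (P - \sum_j v j * mrename s (f j)).
Proof.
move=> [m [b [b' [bb e]]]].
have /choice[B hB] := fun j => partial_ev_surj (b j).
have /choice[B' hB'] := fun j => partial_ev_surj (b' j).
have [v hv] : ideal_gen (mrename s \o f) (P - \sum_j B j * B' j).
  apply: partial_ev_ker; rewrite rmorphB rmorph_sum /= e; apply/eqP.
  rewrite subr_eq0; apply/eqP/eq_bigr => j _; rewrite rmorphM /=.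
  by rewrite hB hB'.
exists v, m, B, B'; split=> [j|].
  by rewrite -!ev_partial_ev hB hB'.
by rewrite -[\sum_j v j * _]hv opprB addrC subrK.
Qed.
End Fixed.
End PartialEvaluation.

Lemma transition_presentation (k E : fieldType) (iota : {rmorphism k -> E}) n m
    (x : 'I_n -> E) (y : 'I_m -> E) g q :
  presentation iota y g -> (forall i, ev iota y (q i) = x i) ->
  presentation iota (fcat x y) (trG q g).
Proof.
move=> pry hq; split=> [e|P].
  have [p <-] := pry.1 e; exists (mrename (@rshift n m) p); exact: ev_fcatr.
split; first exact: ideal_trG.
move=> [a ->]; rewrite ev_sum big1 // => i _.
by rewrite evM ev_trG // mulr0.
Qed.

Section Tower.
Variables (k K E : fieldType) (i1 : {rmorphism k -> K}) (i2 : {rmorphism K -> E}).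
Variables (i : {rmorphism k -> E}) (hi : forall b, i b = i2 (i1 b)).

Definition tower_hz n m (x : 'I_n -> K) : 'I_(n + m) -> {mpoly K[m]} :=
  fcat (fun a => (x a)%:MP) (fun b => 'X_b).

Lemma tower_cover n m (j : 'I_(n + m)) :
  (exists a, j = lshift m a) \/ (exists b, j = rshift n b).
Proof. by case: (split_ordP j) => a ->; [left|right]; exists a. Qed.

Lemma ev_map n (x : 'I_n -> K) P : ev i (i2 \o x) P = i2 (ev i1 x P).
Proof.
apply: (mpoly_rmorph_eq (f := ev i (i2 \o x)) (g := i2 \o ev i1 x)) => [b|j] /=.
  by rewrite !evC hi.
by rewrite !evX.
Qed.

Section One.
Variables (n m : nat) (x : 'I_n -> K) (f : 'I_n -> {mpoly k[n]}).
Variables (y : 'I_m -> E) (g : 'I_m -> {mpoly K[m]}) (g' : 'I_m -> {mpoly k[n + m]}).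
Hypotheses (prx : presentation i1 x f) (pry : presentation i2 y g).
Hypothesis gg' : forall j, partial_ev i1 (tower_hz x) (g' j) = g j.

Definition tower_gen : 'I_(n + m) -> {mpoly k[n + m]} :=
  fcat (fun a => mrename (@lshift n m) (f a)) g'.
Definition tower_pt : 'I_(n + m) -> E := fcat (i2 \o x) y.

Lemma tower_ptl (j : 'I_n) : tower_pt (lshift m j) = i2 (x j).
Proof. by rewrite /tower_pt fcatl. Qed.
Lemma tower_ptr (j : 'I_m) : tower_pt (rshift n j) = y j.
Proof. by rewrite /tower_pt fcatr. Qed.
Lemma tower_hzl (j : 'I_n) : @tower_hz n m x (lshift m j) = (x j)%:MP.
Proof. by rewrite /tower_hz fcatl. Qed.
Lemma tower_hzr (j : 'I_m) : @tower_hz n m x (rshift n j) = 'X_j.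
Proof. by rewrite /tower_hz fcatr. Qed.

Lemma ev_tower (P : {mpoly k[n + m]}) : ev i2 y (partial_ev i1 (tower_hz x) P) = ev i tower_pt P.
Proof.
exact: (ev_partial_ev (@tower_cover n m) tower_hzl tower_hzr hi tower_ptl tower_ptr).
Qed.

Lemma tower_lift (Q : {mpoly K[m]}) : exists P, partial_ev i1 (tower_hz x) P = Q.
Proof. exact: (partial_ev_surj tower_hzl tower_hzr prx Q). Qed.

(** A relation over [k] becomes a combination of the [g j] over [K]; after lifting the cofactors,
    the discrepancy is killed by [partial_ev] and is thus generated by the equations of [K/k]. *)
Lemma tower_presentation : presentation i tower_pt tower_gen.
Proof.
split=> [e|P].
  have [Q <-] := pry.1 e; have [P <-] := tower_lift Q.
  by exists P; rewrite ev_tower.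
have G0 j : ev i tower_pt (tower_gen j) = 0.
  rewrite /tower_gen; case: (split_ordP j) => b ->.
    by rewrite fcatl ev_fcatl ev_map (presentation_gen _ prx) rmorph0.
  by rewrite fcatr -ev_tower gg' (presentation_gen _ pry).
split=> [P0|[a ->]]; last first.
  by rewrite ev_sum big1 // => j _; rewrite evM G0 mulr0.
have [a ha] : ideal_gen g (partial_ev i1 (tower_hz x) P).
  by apply: (presentation_ideal pry); rewrite ev_tower.
have /choice[A hA] := fun j => tower_lift (a j).
have h : ideal_gen (mrename (@lshift n m) \o f) (P - \sum_j A j * g' j).
  apply: (partial_ev_ker (@tower_cover n m) tower_hzl tower_hzr prx).
  rewrite rmorphB rmorph_sum /= ha; apply/eqP; rewrite subr_eq0; apply/eqP.
  by apply: eq_bigr => j _; rewrite rmorphM /= hA gg'.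
rewrite -[P](subrK (\sum_j A j * g' j)); apply: ideal_genD.
  apply: ideal_gen_trans h => j.
  by have := ideal_gen_gen tower_gen (lshift m j); rewrite {2}/tower_gen fcatl.
apply: ideal_gen_sum => j; apply: ideal_genM.
by have := ideal_gen_gen tower_gen (rshift n j); rewrite {2}/tower_gen fcatr.
Qed.
End One.

Lemma functional_congr n N (s : 'I_n -> 'I_N) (z : 'I_N -> E) (w : 'I_n -> E) phi
    (F G : 'I_n -> {mpoly k[n]}) (M : 'M[{mpoly k[n]}]_n) :
  functional (ev i z) phi -> z \o s = w ->
  (forall j, ev i w (F j) = 0) -> (forall j, ev i w (G j) = 0) ->
  (forall j, in_ker_sq i w (F j - \sum_l M j l * G l)) ->
  forall j, phi (mrename s (F j)) = \sum_l ev i w (M j l) * phi (mrename s (G l)).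
Proof.
move=> phiP zs F0 G0 hM j.
have phiP' := functional_mrename (s := s) phiP; rewrite zs in phiP'.
have S0 : ev i w (\sum_l M j l * G l) = 0.
  by rewrite ev_sum big1 // => l _; rewrite evM G0 mulr0.
have := functional_ker_sq phiP' (hM j).
rewrite (functionalB (ev := ev i w) phiP' (F0 j) S0) => /eqP.
rewrite subr_eq0 => /eqP /= ->.
by rewrite -[LHS]/((phi \o mrename s) _) (functional_sum (ev := ev i w) phiP').
Qed.

Lemma in_ker_sq_map n (x : 'I_n -> K) P :
  in_ker_sq i1 x P -> in_ker_sq i (i2 \o x) P.
Proof.
move=> [m [a [b [ab e]]]]; exists m, a, b; split=> // j.
by rewrite !ev_map (ab j).1 (ab j).2 !rmorph0.
Qed.

Hypothesis alg : algebraic_ext i.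

Section Two.
Variables (n m n0 m0 : nat).
Variables (x : 'I_n -> K) (f : 'I_n -> {mpoly k[n]}).
Variables (y : 'I_m -> E) (g : 'I_m -> {mpoly K[m]}) (g' : 'I_m -> {mpoly k[n + m]}).
Variables (x0 : 'I_n0 -> K) (f0 : 'I_n0 -> {mpoly k[n0]}).
Variables (y0 : 'I_m0 -> E) (g0 : 'I_m0 -> {mpoly K[m0]}) (g0' : 'I_m0 -> {mpoly k[n0 + m0]}).
Hypotheses (prx : presentation i1 x f) (pry : presentation i2 y g).
Hypotheses (prx0 : presentation i1 x0 f0) (pry0 : presentation i2 y0 g0).
Hypothesis gg' : forall j, partial_ev i1 (tower_hz x) (g' j) = g j.
Hypothesis gg0' : forall j, partial_ev i1 (tower_hz x0) (g0' j) = g0 j.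
Variables (d1 : K) (d2 : E).
Hypotheses (t1 : transition i1 x f x0 f0 d1) (t2 : transition i2 y g y0 g0 d2).

Let b1 : 'I_n -> 'I_(n + m + (n0 + m0)) := lshift (n0 + m0) \o lshift m.
Let b2 : 'I_m -> 'I_(n + m + (n0 + m0)) := lshift (n0 + m0) \o @rshift n m.
Let b3 : 'I_n0 -> 'I_(n + m + (n0 + m0)) := @rshift (n + m) (n0 + m0) \o lshift m0.
Let b4 : 'I_m0 -> 'I_(n + m + (n0 + m0)) := @rshift (n + m) (n0 + m0) \o @rshift n0 m0.

Let fcat4 (U : Type) (a : 'I_n -> U) (b : 'I_m -> U) (c : 'I_n0 -> U) (d : 'I_m0 -> U) :
  [/\ forall j, fcat (fcat a b) (fcat c d) (b1 j) = a j,
      forall j, fcat (fcat a b) (fcat c d) (b2 j) = b j,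
      forall j, fcat (fcat a b) (fcat c d) (b3 j) = c j &
      forall j, fcat (fcat a b) (fcat c d) (b4 j) = d j].
Proof. by split=> j; rewrite /b1 /b2 /b3 /b4 /= ?fcatr ?fcatl ?fcatr ?fcatl. Qed.

Let cover4 (P : 'I_(n + m + (n0 + m0)) -> Prop) :
  (forall j, P (b1 j)) -> (forall j, P (b2 j)) -> (forall j, P (b3 j)) ->
  (forall j, P (b4 j)) -> forall j, P j.
Proof.
move=> P1 P2 P3 P4 j; case: (split_ordP j) => l ->; case: (split_ordP l) => l' ->;
  [exact: P1|exact: P2|exact: P3|exact: P4].
Qed.

Let b13_inj : injective (fcat b1 b3).
Proof.
apply: fcat_inj => [u v /lshift_inj/lshift_inj|u v /rshift_inj/lshift_inj|u v] //.
by rewrite /b1 /b3 /= eq_lrshift.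
Qed.
Let b24_inj : injective (fcat b2 b4).
Proof.
apply: fcat_inj => [u v /lshift_inj/rshift_inj|u v /rshift_inj/rshift_inj|u v] //.
by rewrite /b2 /b4 /= eq_lrshift.
Qed.
Let b13_24 u v : fcat b1 b3 u != fcat b2 b4 v.
Proof.
case: (split_ordP u) => u' ->; case: (split_ordP v) => v' ->;
  rewrite ?fcatl ?fcatr /b1 /b2 /b3 /b4 /=.
- by rewrite eq_lshift eq_lrshift.
- by rewrite eq_lrshift.
- by rewrite eq_rlshift.
- by rewrite eq_rshift eq_lrshift.
Qed.

(** The change is split at a mixed system [C]. From [A] to [C] only the presentation of [K/k] is
    replaced, by the matrix [M1] mapped to [E]; from [C] to [B] only that of [E/K], by lifts of the
    entries of [M2] and modulo the rows of [K/k]. The two steps contribute [i2 d1] and [d2]. *)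
Lemma tower_transition :
  transition i (tower_pt x y) (tower_gen f g') (tower_pt x0 y0) (tower_gen f0 g0')
    (d2 * i2 d1).
Proof.
have [p1 [q1 [M1 [hp1 hq1 hM1 e1]]]] := t1.
have [p2 [q2 [M2 [hp2 hq2 hM2 e2]]]] := t2.
rewrite -/(trF f p1) -/(trG q1 f0) in hM1.
rewrite -/(trF g p2) -/(trG q2 g0) in hM2.
have /choice[p2' hp2'] := fun j => tower_lift prx (p2 j).
have /choice[q2' hq2'] := fun j => tower_lift prx0 (q2 j).
pose FA := tower_gen f g'; pose FB := tower_gen f0 g0'.
pose zA := tower_pt x y; pose zB := tower_pt x0 y0.
have prA : presentation i zA FA by exact: tower_presentation prx pry gg'.
have prB : presentation i zB FB by exact: tower_presentation prx0 pry0 gg0'.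
pose p := fcat (fun j => mrename (@lshift n m) (p1 j)) p2'.
pose q := fcat (fun j => mrename (@lshift n0 m0) (q1 j)) q2'.
have hp j : ev i zA (p j) = zB j.
  rewrite /p /zB /tower_pt; case: (split_ordP j) => l ->; rewrite ?fcatl ?fcatr.
    by rewrite /zA ev_fcatl ev_map hp1.
  by rewrite -ev_tower hp2' hp2.
have hq j : ev i zB (q j) = zA j.
  rewrite /q /zA /tower_pt; case: (split_ordP j) => l ->; rewrite ?fcatl ?fcatr.
    by rewrite /zB ev_fcatl ev_map hq1.
  by rewrite -ev_tower hq2' hq2.
have [M [hM tM]] := transition_exists prA prB hp hq.
suff <- : \det (map_mx (ev i (fcat zA zB)) M) = d2 * i2 d1 by [].
pose z := fcat zA zB.
have [Z1 Z2 Z3 Z4] := fcat4 (i2 \o x) y (i2 \o x0) y0.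
rewrite -/(tower_pt x y) -/(tower_pt x0 y0) -/zA -/zB -/z in Z1 Z2 Z3 Z4.
have [phi [T [phiP T0 phiT]]] := functional_system alg z.
(* The blocks of [C] for [K/k] ([C1] and [C3]) are taken from the target presentation, those for
   [E/K] ([C2] and [C4]) from the source. *)
pose C1 := fun j => 'X_(b1 j) - mrename b3 (q1 j).
pose C2 := fun j => mrename (@lshift (n + m) (n0 + m0)) (g' j).
pose C3 := fun j => mrename b3 (f0 j).
pose C4 := fun j => 'X_(b4 j) - mrename (@lshift (n + m) (n0 + m0)) (p2' j).
pose A := trF FA p; pose B := trG q FB.
pose C := fcat (fcat C1 C2) (fcat C3 C4).
have [c1 c2 c3 c4] := fcat4 C1 C2 C3 C4; rewrite -/C in c1 c2 c3 c4.
have a1 j : A (b1 j) = mrename b1 (f j).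
  by rewrite /A /trF /b1 /= fcatl /FA /tower_gen fcatl mrename_comp.
have a2 j : A (b2 j) = C2 j.
  by rewrite /A /trF /b2 /= fcatl /FA /tower_gen fcatr.
have a3 j : A (b3 j) = 'X_(b3 j) - mrename b1 (p1 j).
  by rewrite /A /trF /b3 /= fcatr /p fcatl mrename_comp.
have a4 j : A (b4 j) = C4 j.
  by rewrite /A /trF /b4 /= fcatr /p fcatr.
have B1 j : B (b1 j) = C1 j.
  by rewrite /B /trG /b1 /= fcatl /q fcatl mrename_comp.
have B2 j : B (b2 j) = 'X_(b2 j) - mrename (@rshift (n + m) (n0 + m0)) (q2' j).
  by rewrite /B /trG /b2 /= fcatl /q fcatr.
have B3 j : B (b3 j) = C3 j.
  by rewrite /B /trG /b3 /= fcatr /FB /tower_gen fcatl mrename_comp.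
have B4 j : B (b4 j) = mrename (@rshift (n + m) (n0 + m0)) (g0' j).
  by rewrite /B /trG /b4 /= fcatr /FB /tower_gen fcatr.
have A0 j : ev i z (A j) = 0 by apply: ev_trF.
have B0 j : ev i z (B j) = 0 by apply: ev_trG.
have detB : \det (fmx phi B) != 0.
  by apply: (fmx_neq0 phiP T0 phiT B0) => P; apply: ideal_trG.
have AB : \det (fmx phi A) = \det (map_mx (ev i z) M) * \det (fmx phi B).
  rewrite -det_mulmx; congr (\det _); apply/matrixP => j l; rewrite !mxE /A hM.
  rewrite (functional_sum (ev := ev i z)) //; apply: eq_bigr => u _.
  by rewrite !mxE.
have AC : \det (fmx phi A) = i2 d1 * \det (fmx phi C).
  have eN : (n + n0 + (m + m0))%N = (n + m + (n0 + m0))%N by rewrite addnACA.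
  have -> : i2 d1 = \det (map_mx i2 (map_mx (ev i1 (fcat x x0)) M1)) by rewrite det_map_mx e1.
  apply: (det_rows_lower (s := fcat b1 b3) (t := fcat b2 b4) eN).
  - by apply: fcat_inj.
  - have zb : z \o fcat b1 b3 = i2 \o fcat x x0.
      apply/funext => j; case: (split_ordP j) => l ->; rewrite /= ?fcatl ?fcatr.
        exact: Z1.
      exact: Z3.
    move=> j l; rewrite !mxE.
    have -> : A (fcat b1 b3 j) = mrename (fcat b1 b3) (trF f p1 j).
      rewrite /trF; case: (split_ordP j) => u ->; rewrite ?fcatl ?fcatr.
        by rewrite a1 mrename_comp fcat_lshift.
      by rewrite a3 rmorphB /= mrenameX mrename_comp fcatr fcat_lshift.
    rewrite (functional_congr (phiP l) zb (F := trF f p1) (G := trG q1 f0) (M := M1)).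
    + apply: eq_bigr => u _; rewrite !mxE ev_map; congr (_ * phi l _).
      rewrite /trG; case: (split_ordP u) => v ->; rewrite ?fcatl ?fcatr.
        by rewrite c1 rmorphB /= mrenameX mrename_comp fcatl fcat_rshift.
      by rewrite c3 mrename_comp fcat_rshift.
    + by move=> u; rewrite ev_map (ev_trF prx hp1) rmorph0.
    + by move=> u; rewrite ev_map (ev_trG prx0 hq1) rmorph0.
    + by move=> u; apply: in_ker_sq_map.
  - move=> j; exists (fun=> 0) => l; rewrite !mxE big1 ?addr0; last first.
      by move=> u _; rewrite mul0r.
    congr (phi l _); case: (split_ordP j) => u ->; rewrite ?fcatl ?fcatr.
      by rewrite a2 c2.
    by rewrite a4 c4.
have CB : \det (fmx phi C) = d2 * \det (fmx phi B).
  have eN : (m + m0 + (n + n0))%N = (n + m + (n0 + m0))%N by rewrite addnACA [(m + n)%N]addnC [(m0 + n0)%N]addnC.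
  pose hz : 'I_(n + m + (n0 + m0)) -> {mpoly K[m + m0]} :=
    fcat (fcat (fun j => (x j)%:MP) (fun j => 'X_(lshift m0 j)))
         (fcat (fun j => (x0 j)%:MP) (fun j => 'X_(rshift m j))).
  have [h1 h2 h3 h4] := fcat4 (fun j => (x j)%:MP_[m + m0]) (fun j => 'X_(lshift m0 j))
         (fun j => (x0 j)%:MP) (fun j => 'X_(rshift m j)).
  rewrite -/hz in h1 h2 h3 h4.
  have cov : forall j, (exists u, j = fcat b1 b3 u) \/ (exists u, j = fcat b2 b4 u).
    apply: cover4 => u.
    - by left; exists (lshift n0 u); rewrite fcatl.
    - by right; exists (lshift m0 u); rewrite fcatl.
    - by left; exists (rshift n u); rewrite fcatr.
    - by right; exists (rshift m u); rewrite fcatr.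
  have hzs j : hz (fcat b1 b3 j) = (fcat x x0 j)%:MP.
    by case: (split_ordP j) => u ->; rewrite ?fcatl ?fcatr.
  have hzt j : hz (fcat b2 b4 j) = 'X_j.
    by case: (split_ordP j) => u ->; rewrite ?fcatl ?fcatr.
  have zs j : z (fcat b1 b3 j) = i2 (fcat x x0 j).
    case: (split_ordP j) => u ->; rewrite ?fcatl ?fcatr; [exact: Z1|exact: Z3].
  have zt j : z (fcat b2 b4 j) = fcat y y0 j.
    case: (split_ordP j) => u ->; rewrite ?fcatl ?fcatr; [exact: Z2|exact: Z4].
  have prG := transition_presentation prx0 hq1.
  have laml P : partial_ev i1 hz (mrename (lshift (n0 + m0)) P) =
      mrename (lshift m0) (partial_ev i1 (tower_hz x) P).
    apply: (mpoly_rmorph_eq (f := partial_ev i1 hz \o mrename (lshift (n0 + m0)))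
      (g := mrename (lshift m0) \o partial_ev i1 (tower_hz x))) => [b|j] /=.
      by rewrite mrenameC !partial_evC mrenameC.
    rewrite mrenameX !partial_evX; case: (split_ordP j) => u ->.
      by rewrite h1 tower_hzl mrenameC.
    by rewrite h2 tower_hzr mrenameX.
  have lamr P : partial_ev i1 hz (mrename (@rshift (n + m) (n0 + m0)) P) =
      mrename (@rshift m m0) (partial_ev i1 (tower_hz x0) P).
    apply: (mpoly_rmorph_eq (f := partial_ev i1 hz \o mrename (@rshift (n + m) (n0 + m0)))
      (g := mrename (@rshift m m0) \o partial_ev i1 (tower_hz x0))) => [b|j] /=.
      by rewrite mrenameC !partial_evC mrenameC.
    rewrite mrenameX !partial_evX; case: (split_ordP j) => u ->.
      by rewrite h3 tower_hzl mrenameC.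
    by rewrite h4 tower_hzr mrenameX.
  have lamC j : partial_ev i1 hz (C (fcat b2 b4 j)) = trF g p2 j.
    rewrite /trF; case: (split_ordP j) => u ->; rewrite ?fcatl ?fcatr.
      by rewrite c2 /C2 laml gg'.
    by rewrite c4 /C4 rmorphB /= partial_evX h4 laml hp2'.
  have lamB j : partial_ev i1 hz (B (fcat b2 b4 j)) = trG q2 g0 j.
    rewrite /trG; case: (split_ordP j) => u ->; rewrite ?fcatl ?fcatr; last first.
      by rewrite B4 lamr gg0'.
    by rewrite B2 rmorphB /= partial_evX h2 lamr hq2'.
  have /choice[L hL] : forall jl : 'I_(m + m0) * 'I_(m + m0),
      exists P, partial_ev i1 hz P = M2 jl.1 jl.2.
    by move=> jl; apply: (partial_ev_surj hzs hzt prG).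
  rewrite e2; apply: (det_rows_upper (s := fcat b2 b4) (t := fcat b1 b3) eN).
  - by apply: fcat_inj => // u v; rewrite eq_sym.
  - move=> j.
    have [v hv] : exists v : 'I_(n + n0) -> {mpoly k[n + m + (n0 + m0)]},
        in_ker_sq i z (C (fcat b2 b4 j) - \sum_l L (j, l) * B (fcat b2 b4 l)
           - \sum_u v u * mrename (fcat b1 b3) (trG q1 f0 u)).
      apply: (partial_ev_ker_sq cov hzs hzt prG hi zs zt).
      rewrite rmorphB rmorph_sum /= lamC.
      have -> : \sum_l partial_ev i1 hz (L (j, l) * B (fcat b2 b4 l)) =
          \sum_l M2 j l * trG q2 g0 l.
        by apply: eq_bigr => l _; rewrite rmorphM /= hL lamB.
      exact: hM2.
    exists (ev i z \o v) => l; rewrite !mxE.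
    have BE u : mrename (fcat b1 b3) (trG q1 f0 u) = B (fcat b1 b3 u).
      rewrite /trG; case: (split_ordP u) => w ->; rewrite ?fcatl ?fcatr.
        by rewrite B1 rmorphB /= mrenameX mrename_comp fcatl fcat_rshift.
      by rewrite B3 mrename_comp fcat_rshift.
    have := functional_ker_sq (phiP l) hv.
    have S1 : ev i z (\sum_u L (j, u) * B (fcat b2 b4 u)) = 0.
      by rewrite ev_sum big1 // => u _; rewrite evM B0 mulr0.
    have S2 : ev i z (\sum_u v u * mrename (fcat b1 b3) (trG q1 f0 u)) = 0.
      by rewrite ev_sum big1 // => u _; rewrite evM BE B0 mulr0.
    have C0 : ev i z (C (fcat b2 b4 j)) = 0.
      case: (split_ordP j) => w ->; rewrite ?fcatl ?fcatr.
        by rewrite c2 -a2 A0.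
      by rewrite c4 -a4 A0.
    rewrite !(functionalB (phiP l)) //=; last by rewrite evB C0 S1 subr0.
    move/eqP; rewrite subr_eq0 => /eqP h; rewrite -[LHS](subrK (phi l (\sum_u L (j, u) * B (fcat b2 b4 u)))).
    rewrite h addrC; congr (_ + _).
      rewrite (functional_sum (phiP l)) => [|u]; last exact: B0.
      by apply: eq_bigr => u _; rewrite /= -(ev_partial_ev cov hzs hzt hi zs zt) hL !mxE.
    rewrite (functional_sum (phiP l)) => [|u]; last by rewrite /= BE; apply: B0.
    by apply: eq_bigr => u _; rewrite BE !mxE.
  - move=> j l; rewrite !mxE; congr (phi l _).
    case: (split_ordP j) => u ->; rewrite ?fcatl ?fcatr.
      by rewrite c1 B1.
    by rewrite c3 B3.
by apply: (mulIf detB); rewrite -AB AC CB; ring.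
Qed.
End Two.
End Tower.

(** * Finite extensions, isomorphisms of the lines [omega], presentations with at most one
    variable *)

Section FiniteExtension.
Variables (k E : fieldType) (iota : {rmorphism k -> E}).
(** Finiteness is attached to a field morphism and not to an algebra structure, since a tower
    presents the same top field over several bases. *)
Definition semilinear_basis d (b : 'rV[k]_d -> E) : Prop :=
  bijective b /\ forall c v w, b (c *: v + w) = iota c * b v + b w.
Definition finite_ext : Prop := exists d b, @semilinear_basis d b.

Lemma finite_ext_algebraic : finite_ext -> algebraic_ext iota.
Proof.
move=> [d [b [[b' bK b'K] bl]]] e.
have b0 : b 0 = 0.
  by have := bl (-1) 0 0; rewrite scaleN1r oppr0 addr0 rmorphN1 mulN1r addNr.
pose M : 'M[k]_(d.+1, d) := \matrix_(i, j) b' (e ^+ i) 0 j.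
have Mrow i : row i M = b' (e ^+ i) by apply/rowP => j; rewrite !mxE.
have : kermx M != 0.
  rewrite -mxrank_eq0 mxrank_ker subn_eq0 -ltnNge ltnS; exact: rank_leq_col.
case/rowV0Pn => u /sub_kermxP uM u0.
exists (rVpoly u).
  by apply: contra_neq u0 => e0; rewrite -[u]rVpolyK e0 linear0.
have bsum (I : Type) (r : seq I) (c : I -> k) v :
    b (\sum_(i <- r) c i *: v i) = \sum_(i <- r) iota (c i) * b (v i).
  by elim: r => [|i r IH]; rewrite ?big_nil // !big_cons bl IH.
apply/eqP; transitivity (b (u *m M)); last by rewrite uM.
have -> : u *m M = \sum_i u 0 i *: b' (e ^+ i).
  by rewrite mulmx_sum_row; apply: eq_bigr => i _; rewrite Mrow.
rewrite bsum (horner_coef_wide _ (n := d.+1)); last first.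
  by rewrite (leq_trans (size_poly _ _)) // size_poly.
by apply: eq_bigr => i _; rewrite coef_map coef_rVpoly_ord b'K.
Qed.
End FiniteExtension.

Lemma finite_ext_vect (k : fieldType) (E : fieldExtType k) : finite_ext (in_alg E).
Proof.
pose X := vbasis {:E}.
exists (\dim {:E}), (fun v => \sum_i v ord0 i *: X`_(i : 'I_(\dim {:E}))); split.
  exists (fun e => \row_i coord X i e) => [v|e].
    apply/rowP => i; rewrite !mxE coord_sum_free //.
    exact: (basis_free (vbasisP _)).
  rewrite [RHS](coord_vbasis (memvf e)); apply: eq_bigr => i _.
  by rewrite mxE.
move=> c v w; rewrite mulr_sumr -big_split; apply: eq_bigr => i _.
by rewrite /= !mxE scalerDl mulr_algl scalerA.
Qed.

Section TowerIso.
Variables (k K E : fieldType) (i1 : {rmorphism k -> K}) (i2 : {rmorphism K -> E}).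
Variables (i : {rmorphism k -> E}) (hi : forall b, i b = i2 (i1 b)).
Hypothesis alg : algebraic_ext i.

(** The vector [l] is fixed by its coordinate at one concatenated presentation; [tower_transition]
    propagates the required product formula to all presentations and all lifts. *)
Lemma tower_iso_exists n (x : 'I_n -> K) f m (y : 'I_m -> E) g
    (w : omega i2) (l' : omega i1) :
  presentation i1 x f -> presentation i2 y g ->
  exists l : omega i, tower_iso w l' l.
Proof.
move=> prx pry.
have /choice[g' gg'] := fun j => tower_lift prx (g j).
have prT := tower_presentation hi prx pry gg'.
have [l hl] := omega_exists alg (ocoord w y g * i2 (ocoord l' x f)) prT.
exists l => n1 x1 f1 m1 y1 g1 g1' prx1 pry1 gg1.
have [d1 t1] := transition_total prx1 prx.
have [d2 t2] := transition_total pry1 pry.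
rewrite (ocoord_transition _ (tower_presentation hi prx1 pry1 gg1) prT
  (tower_transition hi alg prx1 pry1 prx pry gg1 gg' t1 t2)) hl.
rewrite (ocoord_transition _ prx1 prx t1) (ocoord_transition _ pry1 pry t2).
by rewrite rmorphM mulrACA [i2 d1 * _]mulrC -!mulrA; congr (_ * _); ring.
Qed.
End TowerIso.

Section EmptyPresentation.
Variables (k E : fieldType) (iota : {rmorphism k -> E}).
Hypothesis surj : forall e, exists c, iota c = e.

Lemma mpoly0_const (p : {mpoly k[0]}) : p = (p@_0%MM)%:MP.
Proof.
apply/mpolyP => m; rewrite mcoeffC; have -> : m = 0%MM by apply/mnmP => -[].
by rewrite eqxx mulr1.
Qed.

Lemma empty_presentation (x : 'I_0 -> E) f : presentation iota x f.
Proof.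
split=> [e|p].
  by have [c <-] := surj e; exists c%:MP; rewrite evC.
rewrite {1}[p]mpoly0_const evC; split=> [/eqP|[a ->]].
  rewrite fmorph_eq0 => /eqP p0; exists (fun=> 0); rewrite big_ord0.
  by rewrite [p]mpoly0_const p0 mpolyC0.
by rewrite big_ord0 mcoeff0 rmorph0.
Qed.
End EmptyPresentation.

Section Monogenic.
Variables (k E : fieldType) (iota : {rmorphism k -> E}).

HB.instance Definition _ := GRing.RMorphism.copy (@poly_mpoly1 k)
  (horner_eval ('X_ord0 : {mpoly k[1]}) \o map_poly (@mpolyC 1 k)).

Lemma poly_mpoly1C c : poly_mpoly1 c%:P = (c%:MP : {mpoly k[1]}).
Proof. by rewrite /poly_mpoly1 map_polyC hornerC. Qed.
Lemma poly_mpoly1X : poly_mpoly1 'X = ('X_ord0 : {mpoly k[1]}).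
Proof. by rewrite /poly_mpoly1 map_polyX hornerX. Qed.

Lemma poly_mpoly1_surj (Q : {mpoly k[1]}) : exists P, poly_mpoly1 P = Q.
Proof.
exists (\sum_(m <- msupp Q) Q@_m *: 'X^(m ord0)).
rewrite rmorph_sum [RHS]mpolyE; apply: eq_bigr => m _.
rewrite -mul_polyC rmorphM rmorphXn /= poly_mpoly1C poly_mpoly1X.
by rewrite mul_mpolyC [in RHS]mpolyXE_id big_ord1.
Qed.

Lemma ev_poly_mpoly1 (x : 'I_1 -> E) P :
  ev iota x (poly_mpoly1 P) = (map_poly iota P).[x ord0].
Proof.
rewrite -[LHS](horner_map (ev iota x)) /= evX -map_poly_comp /=.
by congr (_.[_]); apply: eq_map_poly => c; apply: evC.
Qed.

Lemma monogenic_presentation (x : 'I_1 -> E) p :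
  (forall e, exists P, (map_poly iota P).[x ord0] = e) ->
  (forall P, (map_poly iota P).[x ord0] = 0 <-> exists Q, P = Q * p) ->
  presentation iota x (fun=> poly_mpoly1 p).
Proof.
move=> hs hp; split=> [e|Q].
  by have [P <-] := hs e; exists (poly_mpoly1 P); rewrite ev_poly_mpoly1.
have [P <-] := poly_mpoly1_surj Q; rewrite ev_poly_mpoly1; split.
  move/hp => [R ->]; exists (fun=> poly_mpoly1 R).
  by rewrite big_ord1 rmorphM.
move=> [a]; rewrite big_ord1; have [R <-] := poly_mpoly1_surj (a ord0).
move=> e; rewrite -[P in LHS]/(P) -ev_poly_mpoly1 e evM !ev_poly_mpoly1.
by rewrite ((hp p).2 _) ?mulr0 //; exists 1; rewrite mul1r.
Qed.
End Monogenic.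

Section OmegaIso.
Variables (k E E' : fieldType) (i : {rmorphism k -> E}) (i' : {rmorphism k -> E'}).
Variables (phi : {rmorphism E -> E'}).
Hypotheses (phi_i : forall c, i' c = phi (i c)) (surj : forall e, exists c, phi c = e).
Hypothesis alg : algebraic_ext i.

Lemma iso_presentation n (x : 'I_n -> E) f :
  presentation i x f -> presentation i' (phi \o x) f.
Proof.
move=> prx; split=> [e|P].
  have [c <-] := surj e; have [P <-] := prx.1 c.
  by exists P; rewrite (ev_map phi_i).
rewrite (ev_map phi_i); split=> [/eqP|h].
  by rewrite fmorph_eq0 => /eqP; apply: (prx.2 P).1.
by rewrite ((prx.2 P).2 h) rmorph0.
Qed.

Lemma iso_transition n (x : 'I_n -> E) f m (y : 'I_m -> E) g d :
  transition i x f y g d -> transition i' (phi \o x) f (phi \o y) g (phi d).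
Proof.
have xy : fcat (phi \o x) (phi \o y) = phi \o fcat x y.
  by apply/funext => j; rewrite comp_fcat.
move=> [p [q [M [hp hq hM ->]]]]; exists p, q, M; split.
- by move=> j; rewrite (ev_map phi_i) hp.
- by move=> j; rewrite (ev_map phi_i) hq.
- by move=> j; rewrite xy; apply: in_ker_sq_map.
- rewrite -det_map_mx; congr (\det _); apply/matrixP => u v.
  by rewrite !mxE xy (ev_map phi_i).
Qed.

Lemma omega_iso_exists n (x : 'I_n -> E) f (l' : omega i') :
  presentation i x f -> exists l : omega i, omega_iso phi l l'.
Proof.
move=> prx; have [c hc] := surj (ocoord l' (phi \o x) f).
have [l hl] := omega_exists alg c prx.
exists l => m y g pry; have [d t] := transition_total pry prx.
rewrite (ocoord_transition l pry prx t) hl rmorphM hc.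
exact: ocoord_transition (iso_presentation pry) (iso_presentation prx) (iso_transition t).
Qed.
End OmegaIso.

(** At infinity the transfer is normalized by the empty presentation of [k], whereas [adjunction]
    uses one variable with the equation [t]. Eliminating this variable has transition coefficient
    1. *)
Lemma ocoord0E1 (k : fieldType) (l : omega (idfun : {rmorphism k -> k})) :
  ocoord0 l = @ocoord _ _ _ l 1 (fun=> 0) (fun=> poly_mpoly1 'X).
Proof.
have pr0 : presentation (idfun : {rmorphism k -> k}) (fun _ : 'I_0 => 0) (fun=> 0).
  by apply: empty_presentation => e; exists e.
have pr1 : presentation (idfun : {rmorphism k -> k})
    (fun _ : 'I_1 => 0) (fun=> poly_mpoly1 'X).
  apply: monogenic_presentation => [e|P].
    by exists e%:P; rewrite map_polyC hornerC.
  rewrite map_poly_id //; split=> [P0|[Q ->]]; last by rewrite hornerM hornerX mulr0.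
  by have /factor_theorem[Q ->] : root P 0 by [apply/eqP]; exists Q; rewrite subr0.
rewrite /ocoord0 (ocoord_transition l pr0 pr1 (d := 1)) ?mul1r //.
exists (fun=> 0), (fun i : 'I_0 => 0), 1%:M; split.
- by move=> j; rewrite ev0.
- by case.
- move=> j; have -> : j = rshift 0 ord0.
    by apply/val_inj; case: j => -[].
  rewrite big_ord_recl big_ord0 addr0 mxE /= !fcatr rmorph0 subr0.
  rewrite mul1r; have -> : ord0 = rshift 0 ord0 :> 'I_(0 + 1) by apply/val_inj.
  rewrite fcatr poly_mpoly1X mrenameX subrr; exact: in_ker_sq0.
- by symmetry; apply: etrans (det_map_mx _ _) _; rewrite det1 rmorph1.
Qed.

(** * Transfers of Witt groups *)

(** Nondegeneracy tested against all multiples by [E] is what makes pushforwards of inner product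
    spaces nondegenerate. The target is a space [L'] and not just [k], in order to include twisted
    transfers and changes of line over the identity. *)
Record trace_map (k E : fieldType) (iota : {rmorphism k -> E}) (L : lmodType E)
    (L' : lmodType k) := TraceMap {
  trace_fun :> L -> L';
  trace_lin : forall c l l',
    trace_fun (iota c *: l + l') = c *: trace_fun l + trace_fun l';
  trace_nd : forall l, (forall e, trace_fun (e *: l) = 0) -> l = 0
}.

Section Transfer.
Variables (k E : fieldType) (iota : {rmorphism k -> E}) (fe : finite_ext iota).
Variables (L : lmodType E) (L' : lmodType k) (s : trace_map iota L L').

Lemma trace0 : s 0 = 0.
Proof.
by have := trace_lin s (-1) 0 0; rewrite !scaler0 add0r scaleN1r => {1}->; rewrite addNr.
Qed.
Lemma traceD l l' : s (l + l') = s l + s l'.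
Proof. by rewrite -{1}[l]scale1r -(rmorph1 iota) trace_lin scale1r. Qed.
Lemma traceZ c l : s (iota c *: l) = c *: s l.
Proof. by rewrite -[_ *: l]addr0 trace_lin trace0 addr0. Qed.

Definition pushforward_form (P : ips L) (Q : ips L') : Prop :=
  exists g : 'rV[k]_(ips_dim Q) -> 'rV[E]_(ips_dim P),
    [/\ bijective g, forall c v w, g (c *: v + w) = iota c *: g v + g w &
        forall v w, Q v w = s (P (g v) (g w))].

Lemma pushforward_form_exists P : exists Q, pushforward_form P Q.
Proof.
have [d [b [[b' bK b'K] bl]]] := fe.
pose n := ips_dim P.
pose g (v : 'rV[k]_(n * d)) : 'rV[E]_n := \row_i b (row i (vec_mx v)).
pose g' (u : 'rV[E]_n) : 'rV[k]_(n * d) := mxvec (\matrix_i b' (u 0 i)).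
have gK : cancel g g'.
  move=> v; rewrite /g' -[RHS]vec_mxK; congr mxvec; apply/row_matrixP => i.
  by rewrite rowK mxE bK.
have g'K : cancel g' g.
  by move=> u; apply/rowP => i; rewrite mxE mxvecK rowK b'K.
have gl c v w : g (c *: v + w) = iota c *: g v + g w.
  by apply/rowP => i; rewrite !mxE !linearP /= bl.
have g0 : g 0 = 0.
  by have := gl (-1) 0 0; rewrite scaleN1r oppr0 addr0 rmorphN1 scaleN1r addNr.
have Ql a v v' w : s (P (g (a *: v + v')) (g w)) = a *: s (P (g v) (g w)) + s (P (g v') (g w)).
  by rewrite gl ips_linear trace_lin.
have Qs v w : s (P (g v) (g w)) = s (P (g w) (g v)) by rewrite ips_sym.
have Qn v : (forall w, s (P (g v) (g w)) = 0) -> v = 0.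
  move=> h; apply: (can_inj gK); rewrite g0; apply: (@ips_nondeg _ _ P) => u.
  apply: (trace_nd (t := s)) => e.
  by rewrite -ips_formZr -(g'K (e *: u)).
exists (Ips Ql Qs Qn), g; split=> //; by exists g'.
Qed.

Lemma pushforward_form_iso P P' Q Q' : pushforward_form P Q -> pushforward_form P' Q' ->
  isometric P P' -> isometric Q Q'.
Proof.
move=> [g [[g1 gK g1K] gl gQ]] [g' [[g1' gK' g1K'] gl' gQ']] [h [hl [h1 hK h1K] hP]].
exists (g1' \o h \o g); split.
- move=> c v w /=; apply: (can_inj gK'); rewrite gl' !g1K' gl hl.
  by rewrite -[iota c *: _]/(iota c *: _).
- exists (g1 \o h1 \o g') => v /=; first by rewrite g1K' hK gK.
  by rewrite g1K h1K gK'.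
- by move=> v w /=; rewrite gQ' !g1K' hP gQ.
Qed.

Lemma isometric_refl (K : fieldType) (M : lmodType K) (P : ips M) : isometric P P.
Proof. by exists id; split=> //; exists id. Qed.

Lemma pushforward_form_sum P P' Q Q' : pushforward_form P Q -> pushforward_form P' Q' ->
  pushforward_form (ips_sum P P') (ips_sum Q Q').
Proof.
move=> [g [[g1 gK g1K] gl gQ]] [g' [[g1' gK' g1K'] gl' gQ']].
exists (fun v => row_mx (g (lsubmx v)) (g' (rsubmx v))); split.
- exists (fun v => row_mx (g1 (lsubmx v)) (g1' (rsubmx v))) => v.
    by rewrite row_mxKl row_mxKr gK gK' hsubmxK.
  by rewrite row_mxKl row_mxKr g1K g1K' hsubmxK.
- by move=> c v w; rewrite !linearP gl gl' scale_row_mx add_row_mx.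
- by move=> v w; rewrite /= !row_mxKl !row_mxKr traceD gQ gQ'.
Qed.

Lemma pushforward_form_scale u P Q : pushforward_form P Q ->
  pushforward_form (ips_scale (iota u) P) (ips_scale u Q).
Proof.
move=> [g [bg gl gQ]]; exists g; split=> // v w /=.
have -> : unit_or_1 (iota u) = iota (unit_or_1 u).
  by rewrite /unit_or_1 fmorph_eq0; case: eqP => // _; rewrite rmorph1.
by rewrite gQ traceZ.
Qed.

Definition pushforward (P : ips L) : ips L' := sval (cid (pushforward_form_exists P)).
Lemma pushforwardP P : pushforward_form P (pushforward P).
Proof. exact: svalP (cid (pushforward_form_exists P)). Qed.

Lemma pushforward_uniq P Q : pushforward_form P Q ->
  wclass (pushforward P) = wclass Q.
Proof.
move=> h; apply: wclass_iso.
exact: pushforward_form_iso (pushforwardP P) h (isometric_refl P).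
Qed.

Lemma transfer_rel x y : witt_rel x y ->
  geval (fun P => wclass (pushforward P)) x = geval (fun P => wclass (pushforward P)) y.
Proof.
case=> [P Q PQ|P Q|P] /=.
- apply: wclass_iso.
  exact: pushforward_form_iso (pushforwardP P) (pushforwardP Q) PQ.
- rewrite -wclass_sum; apply: pushforward_uniq.
  exact: pushforward_form_sum (pushforwardP P) (pushforwardP Q).
- rewrite -(wclass_hyp (pushforward P)) -wclass_sum; apply: pushforward_uniq.
  apply: pushforward_form_sum (pushforwardP P) _.
  rewrite -(rmorphN1 iota); exact: pushforward_form_scale (pushforwardP P).
Qed.

Definition transfer : Witt L -> Witt L' := pglift transfer_rel.
HB.instance Definition _ := GRing.Additive.copy transfer (pglift transfer_rel).

Lemma transferE P Q : pushforward_form P Q -> transfer (wclass P) = wclass Q.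
Proof.
by move/pushforward_uniq <-; apply: (pglift_gen transfer_rel).
Qed.

Lemma transfer_uniq (W : {additive Witt L -> Witt L'}) :
  (forall P Q, pushforward_form P Q -> W (wclass P) = wclass Q) -> W =1 transfer.
Proof.
move=> h; apply: pgroup_ind => [|x e|x y ex ey|P].
- by rewrite !raddf0.
- by rewrite !raddfN /= e.
- by rewrite !raddfD /= ex ey.
- have PQ := pushforwardP P; rewrite -/(wclass P).
  by rewrite (h _ _ PQ) (transferE PQ).
Qed.

Lemma transfer_wscale u y : transfer (wscale L (iota u) y) = wscale L' u (transfer y).
Proof.
elim/pgroup_ind: y => [|x e|x y ex ey|P].
- by rewrite !raddf0.
- by rewrite !raddfN /= e.
- by rewrite !raddfD /= ex ey.
- have PQ := pushforwardP P; rewrite -/(wclass P) wscaleE (transferE PQ) wscaleE.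
  exact: transferE (pushforward_form_scale u PQ).
Qed.

(** The projection formula for classes defined over [k]: symbols act through scalings by units of
    [k], which commute with pushforward, and [eta] through a sign. *)
Lemma transfer_mu_ring x y :
  transfer (mu_ring L (KMWring_map iota x) y) = mu_ring L' x (transfer y).
Proof.
elim/pring_ind: x y => [||x ex|x x' ex ex'|x x' ex ex'|[a|]] y.
- by rewrite !rmorph0 !endo0 raddf0.
- by rewrite !rmorph1 !endo1.
- by rewrite !rmorphN !endoN raddfN /= ex.
- by rewrite !rmorphD !endoD raddfD /= ex ex'.
- by rewrite !rmorphM !endoM ex ex'.
- have -> : KMWring_map iota (prgen (@mw_rel k) (MWsym a)) = mw_sym (iota a).
    exact: (prlift_gen (mw_map_rel iota) (MWsym a)).
  rewrite -/(mw_sym a) !mu_sym !endoD !endoN !endo1 raddfB.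
  by rewrite /= transfer_wscale.
- have -> : KMWring_map iota (prgen (@mw_rel k) MWeta) = mw_eta E.
    exact: (prlift_gen (mw_map_rel iota) MWeta).
  by rewrite -/(mw_eta k) !mu_eta !endoN !endo1 raddfN.
Qed.

Hypothesis surj : forall e, exists c, iota c = e.

Lemma trace_neq0 l : l != 0 -> s l != 0.
Proof.
apply: contra_neq => sl; apply: (trace_nd (t := s)) => e.
by have [c <-] := surj e; rewrite traceZ sl scaler0.
Qed.

(** Surjectivity of [iota] makes the extension an isomorphism, so that lines push forward to lines.
    The point at infinity, identifications of residue fields and changes of line are all computed by
    this case. *)
Lemma transfer_line l : transfer (wline l) = wline (s l).
Proof.
have [->|l0] := eqVneq l 0; first by rewrite trace0 !wline0 raddf0.
rewrite (wlineE l0) (wlineE (trace_neq0 l0)); apply: transferE.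
have /choice[r hr] := surj.
exists (map_mx iota); split.
- exists (map_mx r) => v; apply/rowP => j; rewrite !mxE //.
  by apply: (fmorph_inj iota); rewrite hr.
- by move=> c v w; rewrite map_mxD map_mxZ.
- by move=> v w; rewrite /= !mxE -rmorphM traceZ.
Qed.

Lemma mu_twE (K : fieldType) (M : lmodType K) n (x : KMW K n) (l : M) :
  mu_tw (tens x l) = mu_ring M (val x) (wline l).
Proof. exact: (pglift_gen (@mu_tw_rel K M n)). Qed.

Lemma transfer_mu_tw n (x : KMW k n) l :
  transfer (mu_tw (tens (KMW_map iota x) l)) = mu_tw (tens x (s l)).
Proof. by rewrite !mu_twE transfer_mu_ring transfer_line. Qed.
End Transfer.

Lemma muE (K : fieldType) n (x : KMW K n) : mu x = mu_tw (tens x (1 : K^o)).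
Proof. by rewrite mu_twE. Qed.

Section Composition.
Variables (k K E : fieldType) (i1 : {rmorphism k -> K}) (i2 : {rmorphism K -> E}).
Variables (i : {rmorphism k -> E}) (hi : forall b, i b = i2 (i1 b)).
Variables (fe1 : finite_ext i1) (fe2 : finite_ext i2) (fe : finite_ext i).
Variables (L : lmodType E) (L1 : lmodType K) (L0 : lmodType k).
Variables (s2 : trace_map i2 L L1) (s1 : trace_map i1 L1 L0).

Lemma comp_trace_lin c l l' : s1 (s2 (i c *: l + l')) = c *: s1 (s2 l) + s1 (s2 l').
Proof. by rewrite hi trace_lin trace_lin. Qed.
Lemma comp_trace_nd l : (forall e, s1 (s2 (e *: l)) = 0) -> l = 0.
Proof.
move=> h; apply: (trace_nd (t := s2)) => e; apply: (trace_nd (t := s1)) => c.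
by rewrite -traceZ scalerA h.
Qed.
Definition comp_trace : trace_map i L L0 := TraceMap comp_trace_lin comp_trace_nd.

Lemma transfer_comp (s : trace_map i L L0) : s =1 s1 \o s2 ->
  forall y, transfer fe1 s1 (transfer fe2 s2 y) = transfer fe s y.
Proof.
move=> hs; apply: pgroup_ind => [|x e|x y ex ey|P].
- by rewrite !raddf0.
- by rewrite !raddfN /= e.
- by rewrite !raddfD /= ex ey.
rewrite -/(wclass P); have [Q PQ] := pushforward_form_exists fe2 s2 P.
have [R QR] := pushforward_form_exists fe1 s1 Q.
rewrite (transferE fe2 PQ) (transferE fe1 QR); apply/esym/transferE.
case: PQ => g [[g1 gK g1K] gl gQ]; case: QR => h [[h1 hK h1K] hl hR].
exists (g \o h); split.
- by exists (h1 \o g1) => v /=; rewrite ?gK ?hK ?h1K ?g1K.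
- by move=> c v w /=; rewrite hl gl hi.
- by move=> v w; rewrite hR gQ hs.
Qed.
End Composition.

(** * Residue forms of polynomials *)

Section WittForms.
Variable k : fieldType.

Definition isform n (B : 'rV[k]_n -> 'rV[k]_n -> k^o) : Prop :=
  [/\ forall a v v' w, B (a *: v + v') w = a *: B v w + B v' w,
      forall v w, B v w = B w v &
      forall v, (forall w, B v w = 0) -> v = 0].

Definition ips_of n (B : 'rV[k]_n -> 'rV[k]_n -> k^o) (h : isform B) : ips k^o :=
  let: And3 h1 h2 h3 := h in Ips h1 h2 h3.

(** The class of a form, or [0] (junk) if it is not an inner product. *)
Definition wf n (B : 'rV[k]_n -> 'rV[k]_n -> k^o) : Witt k^o :=
  if pselect (isform B) is left h then wclass (ips_of h) else 0.

Lemma wfE n (B : 'rV[k]_n -> 'rV[k]_n -> k^o) (h : isform B) :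
  wf B = wclass (ips_of h).
Proof.
rewrite /wf; case: pselect => // h'; congr (wclass (ips_of _)).
exact: Prop_irrelevance.
Qed.

Lemma wf_iso n m (B : 'rV[k]_n -> 'rV[k]_n -> k^o) (B' : 'rV[k]_m -> 'rV[k]_m -> k^o)
    (g : 'rV[k]_n -> 'rV[k]_m) :
  isform B -> isform B' -> linear g -> bijective g ->
  (forall v w, B' (g v) (g w) = B v w) -> wf B = wf B'.
Proof.
move=> h h' gl gb gB; rewrite (wfE h) (wfE h'); apply: wclass_iso.
by case: h h' => [h1 h2 h3] [h1' h2' h3']; exists g.
Qed.

Lemma wf_iso' n m (B : 'rV[k]_n -> 'rV[k]_n -> k^o) (B' : 'rV[k]_m -> 'rV[k]_m -> k^o)
    (g : 'rV[k]_n -> 'rV[k]_m) (g' : 'rV[k]_m -> 'rV[k]_n) :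
  isform B' -> linear g -> cancel g g' -> cancel g' g ->
  (forall v w, B' (g v) (g w) = B v w) -> isform B /\ wf B = wf B'.
Proof.
move=> h' gl gK g'K gB.
have h : isform B.
  case: (h') => h1 h2 h3; split=> [a v v' w|v w|v hv].
  - by rewrite -!gB gl h1.
  - by rewrite -!gB h2.
  - apply: (can_inj gK); have -> : g 0 = 0.
      by have := gl (-1) 0 0; rewrite scaler0 add0r scaleN1r addNr.
    by apply: h3 => w; rewrite -(g'K w) gB hv.
by split=> //; apply: wf_iso gB => //; exists g'.
Qed.

Definition form_sum n m (B : 'rV[k]_n -> 'rV[k]_n -> k^o) (B' : 'rV[k]_m -> 'rV[k]_m -> k^o) :
  'rV[k]_(n + m) -> 'rV[k]_(n + m) -> k^o :=
  fun v w => B (lsubmx v) (lsubmx w) + B' (rsubmx v) (rsubmx w).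

Lemma wf_sum n m (B : 'rV[k]_n -> 'rV[k]_n -> k^o) (B' : 'rV[k]_m -> 'rV[k]_m -> k^o) :
  isform B -> isform B' ->
  isform (form_sum B B') /\ wf (form_sum B B') = wf B + wf B'.
Proof.
move=> h h'.
rewrite (wfE h) (wfE h') -wclass_sum; case: h h' => h1 h2 h3 [h1' h2' h3'] /=.
set X := ips_sum _ _.
have hs : isform (form_sum B B').
  by split; [exact: (@ips_linear _ _ X)|exact: (@ips_sym _ _ X)|exact: (@ips_nondeg _ _ X)].
split=> //; rewrite (wfE hs); apply: wclass_iso.
by case: hs => g1 g2 g3; exists id; split=> //; exists id.
Qed.

Definition line_form (c : k) : 'rV[k]_1 -> 'rV[k]_1 -> k^o :=
  fun v w => v 0 0 * w 0 0 * c.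

Lemma wf_line c : c != 0 -> isform (line_form c) /\ wf (line_form c) = wline (c : k^o).
Proof.
move=> c0; have h : isform (line_form c).
  split=> [a v v' w|v w|v hv]; rewrite /line_form.
  - by rewrite !mxE /GRing.scale /=; ring.
  - by rewrite [v 0 0 * _]mulrC.
  - apply/rowP => i; rewrite ord1 mxE; apply/eqP.
    have /eqP := hv (const_mx 1); rewrite /line_form mxE mulr1 mulf_eq0.
    by rewrite (negPf c0) orbF.
split=> //; rewrite (wfE h) (wlineE (l := c : k^o) c0).
by apply: wclass_iso; case: h => h1 h2 h3; exists id; split=> //; exists id.
Qed.

Lemma wline_sq u c : u != 0 -> wline (u * u * c : k^o) = wline (c : k^o).
Proof.
move=> u0; have [->|c0] := eqVneq c 0; first by rewrite mulr0.
have uc0 : u * u * c != 0 by rewrite !mulf_neq0.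
have [h1 <-] := wf_line uc0; have [h2 <-] := wf_line c0.
apply: (wf_iso' (g := fun v => u *: v) (g' := fun v => u^-1 *: v) h2 _ _ _ _).2.
- by move=> a v w; rewrite scalerDr !scalerA mulrC.
- by move=> v; rewrite scalerA mulVf // scale1r.
- by move=> v; rewrite scalerA mulfV // scale1r.
- by move=> v w; rewrite /line_form !mxE; ring.
Qed.

Lemma wlineN c : wline (c : k^o) + wline (- c : k^o) = 0.
Proof.
have n1 : (-1 : k) != 0 by rewrite oppr_eq0 oner_eq0.
have := congr1 (fun f : endo (Witt k^o) => f (wline (c : k^o))) (wscaleN1 k^o).
rewrite endoD endo1 endo0 => h; rewrite -[RHS]h; congr (_ + _).
by rewrite (wscale_line (L := k^o) (c : k^o) n1) scaleN1r.
Qed.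

(** The sum of two copies of the zero-dimensional form is that form again, so its class satisfies
    [w + w = w]. *)
Lemma wf0 (B : 'rV[k]_0 -> 'rV[k]_0 -> k^o) : isform B -> wf B = 0.
Proof.
move=> h; have [hs] := wf_sum h h.
suff -> : wf (form_sum B B) = wf B by move/eqP; rewrite eq_sym -subr_eq0 addrK => /eqP.
have z (v : 'rV[k]_0) : v = 0 by apply/rowP => -[].
apply: (wf_iso' (g := id) (g' := id) h _ _ _ _).2 => // v w.
rewrite (z v) /form_sum (z (lsubmx _)) (z (rsubmx _)).
have [h1 _ _] := h.
have B0 u : B 0 u = 0.
  by have := h1 (-1) 0 0 u; rewrite scaler0 add0r scaleN1r addNr.
by rewrite !B0 addr0.
Qed.

(** A metabolic plane: its first basis vector is isotropic. *)
Definition plane_form (c a : k) : 'rV[k]_2 -> 'rV[k]_2 -> k^o :=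
  fun v w => c * (v 0 0 * w 0 1 + v 0 1 * w 0 0) + a * v 0 1 * w 0 1.

Lemma row2P (R : Type) (v w : 'rV[R]_2) : v 0 0 = w 0 0 -> v 0 1 = w 0 1 -> v = w.
Proof.
move=> h0 h1; apply/rowP => i; have [->|->] : i = 0 \/ i = 1 => //.
by case: i => -[|[|//]] ?; [left|right]; apply/val_inj.
Qed.

Lemma plane_isform c a : c != 0 -> isform (plane_form c a).
Proof.
move=> c0; split=> [b v v' w|v w|v hv]; rewrite /plane_form.
- by rewrite !mxE /GRing.scale /=; ring.
- by ring.
- pose e i : 'rV[k]_2 := delta_mx 0 i.
  have v1 : v 0 1 = 0.
    have := hv (e 0); rewrite /plane_form !mxE /= !(mulr0, mulr1, add0r, addr0).
    by move/eqP; rewrite mulf_eq0 (negPf c0) => /eqP.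
  apply: row2P; rewrite ?v1 mxE //.
  have := hv (e 1); rewrite /plane_form v1 !mxE /= !(mulr0, mulr1, mul0r, add0r, addr0).
  by move/eqP; rewrite mulf_eq0 (negPf c0) => /eqP.
Qed.

Let mk2 (x y : k) : 'rV[k]_2 := \row_i (if i == 0 then x else y).
Let mk20 x y : mk2 x y 0 0 = x. Proof. by rewrite mxE. Qed.
Let mk21 x y : mk2 x y 0 1 = y. Proof. by rewrite mxE. Qed.

(** Completing the square, [2cxy + ay^2 = a(y + cx/a)^2 - (c^2/a)x^2], which is the sum of the lines
    of [a] and [- a] up to a square factor. *)
Lemma plane_wf_neq0 c a : c != 0 -> a != 0 -> wf (plane_form c a) = 0.
Proof.
move=> c0 a0.
have b0 : - (c * c * a^-1) != 0 by rewrite oppr_eq0 !mulf_neq0 ?invr_eq0.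
have [hA eA] := wf_line a0; have [hB eB] := wf_line b0.
have [hS eS] := wf_sum hA hB.
transitivity (wf (form_sum (line_form a) (line_form (- (c * c * a^-1))))); last first.
  rewrite eS eA eB.
  have -> : - (c * c * a^-1) = (c / a) * (c / a) * (- a) by field.
  by rewrite wline_sq ?mulf_neq0 ?invr_eq0 // wlineN.
have ls (v : 'rV[k]_(1 + 1)) : lsubmx v 0 0 = v 0 0.
  by rewrite mxE; congr (v _ _); apply/val_inj.
have rs (v : 'rV[k]_(1 + 1)) : rsubmx v 0 0 = v 0 1.
  by rewrite mxE; congr (v _ _); apply/val_inj.
apply: (wf_iso' (g := fun v => mk2 (v 0 1 + c / a * v 0 0) (v 0 0) : 'rV_(1 + 1))
  (g' := fun v => mk2 (v 0 1) (v 0 0 - c / a * v 0 1)) hS _ _ _ _).2.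
- by move=> b v w; apply: row2P; rewrite ?mxE /= ?mxE; ring.
- by move=> v; apply: row2P; rewrite ?mk20 ?mk21 ?mk20 ?mk21; ring.
- by move=> v; apply: row2P; rewrite ?mk20 ?mk21 ?mk20 ?mk21; ring.
- move=> v w; rewrite /form_sum /line_form /plane_form !ls !rs !mk20 !mk21.
  by field.
Qed.

(** In characteristic 2 the plane with [a = 0] is alternating and has no orthogonal basis. Once the
    line of 1 is added it is isometric to the plane with [a = 1] plus that line, and the line
    cancels in the Witt group. *)
Lemma plane_wf c a : c != 0 -> wf (plane_form c a) = 0.
Proof.
move=> c0; have [->|a0] := eqVneq a 0; last exact: plane_wf_neq0.
have [h1 _] := wf_line (oner_neq0 k).
have [hs es] := wf_sum (plane_isform 0 c0) h1.
have [hs' es'] := wf_sum (plane_isform 1 c0) h1.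
suff : wf (form_sum (plane_form c 0) (line_form 1)) =
       wf (form_sum (plane_form c 1) (line_form 1)).
  by rewrite es es' => /addIr ->; apply: plane_wf_neq0; rewrite ?oner_neq0.
apply/esym.
have l1 : (1%:M : 'M[k]_1) 0 0 = 1 by rewrite mxE.
(* The isometry expresses [2c(x - z/c)y + (z + y)^2 = 2cxy + y^2 + z^2]. *)
apply: (wf_iso' (g := fun v => row_mx (mk2 (lsubmx v 0 0 - rsubmx v 0 0 / c) (lsubmx v 0 1))
                        (rsubmx v + (lsubmx v 0 1)%:M))
  (g' := fun v => row_mx (mk2 (lsubmx v 0 0 + (rsubmx v 0 0 - lsubmx v 0 1) / c) (lsubmx v 0 1))
                        (rsubmx v - (lsubmx v 0 1)%:M)) hs _ _ _ _).2.
- move=> b v w; rewrite !linearP /= scale_row_mx add_row_mx; congr row_mx.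
    by apply: row2P; rewrite !mxE /= ?mxE; ring.
  by apply/rowP => i; rewrite ord1 !mxE /= !mulr1n; ring.
- move=> v; rewrite !row_mxKl !row_mxKr -[RHS]hsubmxK; congr row_mx.
    by apply: row2P; rewrite ?mk20 ?mk21 ?mxE /= ?mulr1n; ring.
  by rewrite mk21 addrK.
- move=> v; rewrite !row_mxKl !row_mxKr -[RHS]hsubmxK; congr row_mx.
    by apply: row2P; rewrite ?mk20 ?mk21 ?mxE /= ?mulr1n; ring.
  by rewrite mk21 subrK.
- move=> v w; rewrite /form_sum /line_form /plane_form !row_mxKl !row_mxKr !mk20 !mk21.
  by rewrite ![(_ + _%:M) 0 0]mxE ![(_%:M) 0 0]mxE /= !mulr1n; field.
Qed.

Definition hankel_form n (h : nat -> k) : 'rV[k]_n -> 'rV[k]_n -> k^o :=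
  fun v w => \sum_(i < n) \sum_(j < n) v 0 i * w 0 j * h (i + j)%N.
Arguments hankel_form : clear implicits.

Lemma hankel_isform n h : (forall l, (l.+1 < n)%N -> h l = 0) -> h n.-1 != 0 ->
  isform (hankel_form n h).
Proof.
move=> h0 hn; split=> [a v v' w|v w|v hv]; rewrite /hankel_form.
- rewrite scaler_sumr -big_split; apply: eq_bigr => i _ /=.
  rewrite scaler_sumr -big_split; apply: eq_bigr => j _ /=.
  by rewrite !mxE /GRing.scale /=; ring.
- rewrite exchange_big; apply: eq_bigr => i _; apply: eq_bigr => j _.
  by rewrite addnC; ring.
- apply/eqP/negPn/negP => v0.
  have [i0 vi0] : exists i0, v 0 i0 != 0.
    by case/rV0Pn: v0 => i vi; exists i.
  case: (@arg_maxnP _ i0 (fun i => v 0 i != 0) val vi0) => i vi imax.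
  have lj : (n.-1 - i < n)%N by have := ltn_ord i; lia.
  have := hv (delta_mx 0 (Ordinal lj)).
  rewrite /hankel_form (bigD1 i) //= (bigD1 (Ordinal lj)) //=.
  rewrite big1 => [|j /negPf jn]; last first.
    by rewrite mxE eqxx /= -[j == _]/(j == Ordinal lj) jn mulr0 mul0r.
  rewrite mxE !eqxx /= mulr1 addr0 big1 => [|l li].
    have -> : (i + (n.-1 - i) = n.-1)%N by have := ltn_ord i; lia.
    by rewrite addr0 => /eqP; rewrite mulf_eq0 (negPf vi) (negPf hn).
  apply: big1 => j _; rewrite mxE eqxx /=.
  have [->|jn] := eqVneq j (Ordinal lj); last by rewrite mulr0 mul0r.
  have [->|vl] := eqVneq (v 0 l) 0; first by rewrite !mul0r.
  have := imax l vl; have := ltn_ord i => li1 li2.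
  rewrite h0 ?mulr0 //=.
  have : (l : nat) != i by rewrite (inj_eq val_inj).
  by move: li2 => /=; lia.
Qed.

(** As [h] vanishes below [n.-1], the first and last basis vectors span a metabolic plane and the
    middle ones are orthogonal to the first. The pairing of the middle with the last vector is
    absorbed by the first coordinate, which leaves the Hankel form of size [n - 2] for the sequence
    shifted by 2. *)
Lemma hankel_wf n h : (forall l, (l.+1 < n)%N -> h l = 0) -> h n.-1 != 0 ->
  wf (hankel_form n h) = if odd n then wline (h n.-1 : k^o) else 0.
Proof.
have [m] := ubnP n; elim: m n h => // m IH [|[|n]] h lt h0 hn.
- by rewrite wf0 //; apply: hankel_isform.
- have [hl <-] := wf_line hn.
  apply: (wf_iso' (g := id) (g' := id) hl _ _ _ _).2 => // v w.
  by rewrite /hankel_form !big_ord1 /line_form addn0.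
pose c := h n.+1; have c0 : c != 0 := hn.
pose h2 l := h l.+2.
have h20 : forall l, (l.+1 < n)%N -> h2 l = 0 by move=> l ll; apply: h0.
have [n0|n0] := posnP n.
  subst n; rewrite /= -(plane_wf (h 2) c0).
  apply: (wf_iso' (g := id) (g' := id) (plane_isform (h 2) c0) _ _ _ _).2 => // v w.
  rewrite /hankel_form !big_ord_recl !big_ord0 /= /plane_form.
  rewrite (_ : lift ord0 ord0 = 1); last by apply/val_inj.
  by rewrite /bump /= !addn0 !add0n !addn1 (h0 0%N) // -/c; ring.
have e2 : h2 n.-1 = c by rewrite /h2 /c prednK.
have IH2 := IH n h2 _ h20; rewrite e2 in IH2.
have hf2 : isform (hankel_form n h2) by apply: hankel_isform; rewrite ?e2.
have [hs es] := wf_sum (plane_isform (h (n.+1 + n.+1)%N) c0) hf2.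
rewrite /= negbK -/c -(IH2 (ltnW lt) c0).
rewrite -[RHS]add0r -(plane_wf (h (n.+1 + n.+1)%N) c0) -es.
pose md (i : 'I_n) : 'I_n.+2 := lift ord0 (widen_ord (leqnSn n) i).
pose lst : 'I_n.+2 := lift ord0 ord_max.
(* The pairing of the middle coordinates [u] with the last basis vector: the indices [i.+1] and
   [n.+1] add up to [n.+2 + i]. *)
pose S (u : 'I_n -> k) := \sum_(i < n) u i * h (n.+2 + i)%N.
pose g (v : 'rV[k]_n.+2) : 'rV[k]_(2 + n) :=
  row_mx (mk2 (v 0 ord0 + S (fun i => v 0 (md i)) / c) (v 0 lst)) (\row_i v 0 (md i)).
pose g' (u : 'rV[k]_(2 + n)) : 'rV[k]_n.+2 := \row_j
  (if unlift ord0 j is Some j' then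
     if unlift ord_max j' is Some i then rsubmx u 0 i else lsubmx u 0 1
   else lsubmx u 0 0 - S (rsubmx u 0) / c).
have mdE (i : 'I_n) : widen_ord (leqnSn n) i = lift ord_max i.
  by apply/val_inj => /=; rewrite /bump leqNgt ltn_ord.
have g'0 u : g' u 0 ord0 = lsubmx u 0 0 - S (rsubmx u 0) / c by rewrite mxE unlift_none.
have g'1 u : g' u 0 lst = lsubmx u 0 1 by rewrite mxE liftK unlift_none.
have g'm u i : g' u 0 (md i) = rsubmx u 0 i by rewrite mxE liftK mdE liftK.
have Seq u u' : u =1 u' -> S u = S u' by move=> uu; apply: eq_bigr => i _; rewrite uu.
apply: (wf_iso' (g := g) (g' := g') hs _ _ _ _).2.
- move=> b v w; rewrite /g scale_row_mx add_row_mx; congr row_mx.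
    apply: row2P; rewrite ?mxE /= ?mxE //.
    have -> : S (fun i => (b *: v + w) 0 (md i)) =
        b * S (fun i => v 0 (md i)) + S (fun i => w 0 (md i)).
      rewrite /S mulr_sumr -big_split; apply: eq_bigr => i _ /=.
      by rewrite !mxE; ring.
    by ring.
  by apply/rowP => i; rewrite !mxE.
- move=> v; apply/rowP => j; rewrite mxE /g row_mxKl row_mxKr.
  case: (unliftP ord0 j) => [j'|] ->.
    case: (unliftP ord_max j') => [i|] ->; last by rewrite mk21.
    by rewrite mxE /md mdE.
  rewrite mk20 (Seq ((\row_i v 0 (md i)) 0) (fun i => v 0 (md i))) ?addrK // => i.
  by rewrite mxE.
- move=> u; rewrite /g -[RHS]hsubmxK; congr row_mx.
    apply: row2P; rewrite ?mk20 ?mk21 ?g'1 // g'0.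
    by rewrite (Seq (fun i => g' u 0 (md i)) (rsubmx u 0)) ?subrK // => i; rewrite g'm.
  by apply/rowP => i; rewrite mxE g'm.
- move=> v w; rewrite /form_sum /g !row_mxKl !row_mxKr /plane_form !mk20 !mk21.
  pose T (t : nat) := \sum_(j < n.+2) w 0 j * h (t + j)%N.
  have hk : hankel_form n.+2 h v w = \sum_(i < n.+2) v 0 i * T i.
    rewrite /hankel_form; apply: eq_bigr => i _; rewrite mulr_sumr.
    by apply: eq_bigr => j _; rewrite mulrA.
  have Te t : T t = w 0 ord0 * h t + \sum_(j < n) w 0 (md j) * h (t + j.+1)%N
      + w 0 lst * h (t + n.+1)%N.
    by rewrite /T big_ord_recl big_ord_recr /= addn0 addrA.
  have T0 : T 0%N = w 0 lst * c.
    rewrite Te h0 // mulr0 add0r big1 ?add0r ?add0n // => j _.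
    by rewrite add0n h0 ?mulr0 // !ltnS.
  have Tn : T n.+1 = w 0 ord0 * c + S (fun j => w 0 (md j)) + w 0 lst * h (n.+1 + n.+1)%N.
    by rewrite Te; congr (_ + _ + _); apply: eq_bigr => j _; rewrite [in RHS]addSnnS.
  have Ti (i : 'I_n) : T i.+1 = \sum_(j < n) w 0 (md j) * h2 (i + j)%N + w 0 lst * h (n.+2 + i)%N.
    rewrite Te h0 ?mulr0 ?add0r; last by rewrite !ltnS.
    congr (_ + _ * h _); last by rewrite addSnnS addnC.
    by apply: eq_bigr => j _; rewrite /h2 addnS addSn.
  rewrite hk big_ord_recl big_ord_recr /= -[bump 0 n]/(n.+1) T0 Tn.
  have -> : \sum_(i < n) v 0 (lift ord0 (widen_ord (leqnSn n) i)) * T (bump 0 i) =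
      hankel_form n h2 (\row_i v 0 (md i)) (\row_i w 0 (md i)) + S (fun i => v 0 (md i)) * w 0 lst.
    rewrite mulr_suml /hankel_form -big_split; apply: eq_bigr => i _ /=.
    rewrite -[bump 0 i]/(i.+1) Ti mulrDr mulr_sumr; congr (_ + _).
      by apply: eq_bigr => j _; rewrite !mxE mulrA.
    by rewrite -/(md i); ring.
  by rewrite -/lst -/c; field.
Qed.
End WittForms.
Arguments hankel_form {k} n h.

(** * Forms on quotients of the polynomial ring: Chinese remainders and Hankel forms *)

Section PolyForms.
Variable k : fieldType.
Implicit Types G H P Q h p : {poly k}.

(** The index is [deg G - 1]. For monic [G] this coefficient is the sum of the residues of
    [(P / G) dt] at the zeros of [G]. *)
Definition res G P : k := (P %% G)`_(size G).-2.

Definition poly_form G h : 'rV[k]_(size G).-1 -> 'rV[k]_(size G).-1 -> k^o :=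
  fun v w => res G (rVpoly v * rVpoly w * h).
Arguments poly_form : clear implicits.

Lemma resD G P Q : res G (P + Q) = res G P + res G Q.
Proof. by rewrite /res modpD coefD. Qed.
Lemma resZ G c P : res G (c *: P) = c * res G P.
Proof. by rewrite /res modpZl coefZ. Qed.
Lemma res_mod G P : res G (P %% G) = res G P.
Proof. by rewrite /res modp_id. Qed.
Lemma res_mul G P : res G (G * P) = 0.
Proof. by rewrite /res modp_mulr coef0. Qed.

(** Modulo [G * H], the remainder of [P * H] is the remainder of [P] modulo [G] times [H]; as [H] is
    monic, the top coefficient is merely shifted by the degree of [H]. *)
Lemma res_mulr G H P : G \is monic -> H \is monic -> res (G * H) (P * H) = res G P.
Proof.
move=> Gm Hm; have G0 := monic_neq0 Gm; have H0 := monic_neq0 Hm.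
rewrite {1}(divp_eq P G) mulrDl -mulrA [P %/ G * _]mulrC resD res_mul add0r.
have sP : (size (P %% G)%R < size G)%N by rewrite ltn_modp.
have sG : (0 < size G)%N by rewrite size_poly_gt0.
have sH : (0 < size H)%N by rewrite size_poly_gt0.
rewrite /res modp_small; last first.
  have [->|r0] := eqVneq (P %% G) 0; first by rewrite mul0r size_poly0 size_poly_gt0 mulf_neq0.
  by rewrite !size_mul // -ltnS !prednK ?ltn_add2r // ltn_addr // size_poly_gt0.
rewrite size_mul //.
have [G1|G1] := leqP (size G) 1.
  have -> : P %% G = 0.
    by apply/eqP; rewrite -size_poly_eq0 -leqn0 -ltnS (leq_trans sP).
  by rewrite mul0r !coef0.
have -> : ((size G + size H).-1.-2 = (size G).-2 + (size H).-1)%N by lia.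
rewrite coefM (bigD1 (Ordinal (leq_addr (size H).-1 (size G).-2 : ((size G).-2 < ((size G).-2 + (size H).-1).+1)%N))) //=.
rewrite addKn -/(lead_coef H) (monicP Hm) mulr1 big1 ?addr0 // => -[i li] /= in1.
have {in1} in1 : i != (size G).-2 by [].
have [lt|gt] := ltnP i (size G).-2.
  have le : (size H <= (size G).-2 + (size H).-1 - i)%N by lia.
  by rewrite (nth_default 0 le) mulr0.
have le : (size (P %% G)%R <= i)%N by lia.
by rewrite (nth_default 0 le) mul0r.
Qed.

(** For nonzero [v], coprimality makes the remainder [x] of [v h] nonzero, and a suitable power of
    [X] moves its leading term exactly to the degree read by [res]. *)
Lemma poly_isform G h : G \is monic -> coprimep G h -> isform (poly_form G h).
Proof.
move=> Gm co; split=> [a v v' w|v w|v hv].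
- by rewrite /poly_form linearP /= !mulrDl resD -!scalerAl resZ.
- by rewrite /poly_form [rVpoly v * _]mulrC.
- apply/eqP/negPn/negP => v0.
  have vp0 : rVpoly v != 0.
    by apply: contra_neq v0 => e; rewrite -[v]rVpolyK e linear0.
  have sv : (size (rVpoly v) <= (size G).-1)%N by apply: size_poly.
  have G0 := monic_neq0 Gm.
  have sG : (0 < size G)%N by rewrite size_poly_gt0.
  pose x := (rVpoly v * h) %% G.
  have x0 : x != 0.
    apply/negP => /eqP x0; have : G %| rVpoly v * h by rewrite /dvdp -/x x0.
    rewrite Gauss_dvdpl // => /(dvdp_leq vp0)/leq_trans/(_ sv).
    by rewrite -ltnS prednK // ltnn.
  have sx : (size x < size G)%N by rewrite ltn_modp.
  have sx0 : (0 < size x)%N by rewrite size_poly_gt0.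
  have := hv (poly_rV 'X^((size G).-1 - size x)).
  rewrite /poly_form poly_rV_K; last by rewrite size_polyXn; lia.
  rewrite mulrAC -res_mod -[_ * h * _]mulrC -modp_mul -/x res_mod /res.
  rewrite modp_small; last first.
    rewrite size_monicM ?monicXn // size_polyXn.
    have ar (a b : nat) : (0 < b -> b < a -> ((a.-1 - b).+1 + b).-1 < a)%N by lia.
    exact: ar sx0 sx.
  have ar1 (a b : nat) : (0 < b -> b < a -> (a.-2 < a.-1 - b) = false)%N by lia.
  have ar2 (a b : nat) : (0 < b -> b < a -> a.-2 - (a.-1 - b) = b.-1)%N by lia.
  rewrite coefXnM (ar1 _ _ sx0 sx) (ar2 _ _ sx0 sx).
  by move/eqP; rewrite -/(lead_coef x) lead_coef_eq0 (negPf x0).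
Qed.

(** The isometry is [(a, b) |-> a H + b G], bijective by the Chinese remainder theorem. The cross
    terms are multiples of [G H], and each diagonal term has a factor that [res_mulr] cancels. *)
Lemma poly_wf_mul G H h : G \is monic -> H \is monic -> coprimep G H ->
  coprimep (G * H) h ->
  wf (poly_form (G * H) h) = wf (poly_form G (h * H)) + wf (poly_form H (h * G)).
Proof.
move=> Gm Hm GH co; have G0 := monic_neq0 Gm; have H0 := monic_neq0 Hm.
have sG : (0 < size G)%N by rewrite size_poly_gt0.
have sH : (0 < size H)%N by rewrite size_poly_gt0.
have [cG cH] : coprimep G h /\ coprimep H h by apply/andP; rewrite -coprimepMl.
have fG : isform (poly_form G (h * H)) by apply: poly_isform => //; rewrite coprimepMr cG.
have fH : isform (poly_form H (h * G)).
  by apply: poly_isform => //; rewrite coprimepMr cH coprimep_sym.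
have fGH : isform (poly_form (G * H) h) by apply: poly_isform; rewrite ?monicMl.
have [fs <-] := wf_sum fG fH; apply/esym.
have sGH : (size (G * H)).-1 = ((size G).-1 + (size H).-1)%N.
  have e : size (G * H) = (size G + size H).-1 by apply: size_mul.
  by rewrite e; lia.
pose F (v : 'rV[k]_((size G).-1 + (size H).-1)) : {poly k} :=
  rVpoly (lsubmx v) * H + rVpoly (rsubmx v) * G.
have sl (v : 'rV[k]_((size G).-1 + (size H).-1)) : (size (rVpoly (lsubmx v)) <= (size G).-1)%N.
  exact: size_poly.
have sr (v : 'rV[k]_((size G).-1 + (size H).-1)) : (size (rVpoly (rsubmx v)) <= (size H).-1)%N.
  exact: size_poly.
have sF v : (size (F v) <= (size (G * H)%R).-1)%N.
  rewrite sGH (leq_trans (size_polyD _ _)) // geq_max; apply/andP; split.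
    have e : (size (rVpoly (lsubmx v) * H)%R <= (size (rVpoly (lsubmx v)) + size H).-1)%N.
      exact: size_polyMleq.
    by apply: leq_trans e _; have := sl v; lia.
  have e : (size (rVpoly (rsubmx v) * G)%R <= (size (rVpoly (rsubmx v)) + size G).-1)%N.
    exact: size_polyMleq.
  by apply: leq_trans e _; have := sr v; lia.
have Fl a v w : F (a *: v + w) = a *: F v + F w.
  by rewrite /F !linearP /= !mulrDl -!scalerAl scalerDr addrACA.
pose g v : 'rV[k]_((size (G * H)).-1) := poly_rV (F v).
have gE v : rVpoly (g v) = F v by rewrite poly_rV_K.
have gl : linear g by move=> a v w; rewrite /g Fl linearP.
have small (A B : {poly k}) : (size A <= (size B).-1)%N -> B != 0 -> B %| A -> A = 0.
  move=> sA B0 BA; apply/eqP/negPn/negP => A0.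
  have sB : (0 < size B)%N by rewrite size_poly_gt0.
  have e : (size B <= size A)%N by apply: dvdp_leq.
  by lia.
have ginj : injective g.
  move=> v w /(congr1 rVpoly); rewrite !gE => e.
  apply/eqP; rewrite -subr_eq0; set u := v - w.
  have : F u = 0 by rewrite /u -scaleN1r addrC Fl e scaleN1r addNr.
  rewrite /F => e0.
  have l0 : rVpoly (lsubmx u) = 0.
    apply: (small _ G) => //; rewrite -(Gauss_dvdpl _ GH).
    rewrite -(subrK (rVpoly (rsubmx u) * G) (rVpoly (lsubmx u) * H)).
    by rewrite -(dvdp_addl _ (dvdp_mull (rVpoly (rsubmx u)) (dvdpp G))) subrK e0 dvdp0.
  have r0 : rVpoly (rsubmx u) = 0.
    move: e0; rewrite l0 mul0r add0r => /eqP.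
    by rewrite mulf_eq0 (negPf G0) orbF => /eqP.
  rewrite -[u]hsubmxK -[lsubmx u]rVpolyK -[rsubmx u]rVpolyK l0 r0 !linear0.
  by rewrite row_mx0.
have gsurj u : exists v, g v = u.
  have [[c d] /= cd] := Bezout_eq1_coprimepP _ _ GH.
  pose f := rVpoly u.
  pose a := (f * d) %% G; pose b := (f * c) %% H.
  have sa : (size a <= (size G).-1)%N.
    by have : (size a < size G)%N by [rewrite ltn_modp]; case: (size G) sG.
  have sb : (size b <= (size H).-1)%N.
    by have : (size b < size H)%N by [rewrite ltn_modp]; case: (size H) sH.
  exists (row_mx (poly_rV a) (poly_rV b)); apply: (can_inj rVpolyK); rewrite gE.
  apply/eqP; rewrite -subr_eq0; apply/eqP; apply: (small _ (G * H)).
  - rewrite (leq_trans (size_polyD _ _)) // size_polyN geq_max sF /=.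
    exact: size_poly.
  - by rewrite mulf_neq0.
  - rewrite /F row_mxKl row_mxKr !poly_rV_K // -/f.
    have ef : f * c * G + f * d * H = f by rewrite -[RHS]mulr1 -cd; ring.
    have ea : a = f * d - (f * d) %/ G * G by rewrite {1}(divp_eq (f * d) G) addrC addKr.
    have eb : b = f * c - (f * c) %/ H * H by rewrite {1}(divp_eq (f * c) H) addrC addKr.
    move: (f * d %/ G) (f * c %/ H) ea eb => q1 q2 ea eb.
    rewrite Gauss_dvdp //; apply/andP; split.
      have -> : a * H + b * G - f = G * (b - f * c - q1 * H).
        by rewrite -{1}ef ea; ring.
      exact: dvdp_mulr.
    have -> : a * H + b * G - f = H * (a - f * d - q2 * G).
      by rewrite -{1}ef eb; ring.
    exact: dvdp_mulr.
have /choice[g' g'K] := gsurj.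
apply: (wf_iso (g := g)) => //.
  by exists g' => v //; apply: ginj; rewrite g'K.
move=> v w; rewrite /poly_form !gE /form_sum /F.
set a := rVpoly (lsubmx v); set b := rVpoly (rsubmx v).
set a' := rVpoly (lsubmx w); set b' := rVpoly (rsubmx w).
have -> : (a * H + b * G) * (a' * H + b' * G) * h =
    a * a' * (h * H) * H + (G * H * (h * (a * b' + a' * b)) + b * b' * (h * G) * G) by ring.
by rewrite resD resD res_mul add0r res_mulr // [G * H]mulrC res_mulr.
Qed.
End PolyForms.
Arguments poly_form {k} G h.

Section Products.
Variable k : fieldType.
Implicit Types G H P Q h p : {poly k}.

Lemma wf_dim0 n (B : 'rV[k]_n -> 'rV[k]_n -> k^o) : n = 0%N -> isform B -> wf B = 0.
Proof. by move=> n0; move: B; rewrite n0; exact: wf0. Qed.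

Lemma coprimep_irr p q : monic_irreducible_poly p -> monic_irreducible_poly q ->
  p != q -> coprimep p q.
Proof.
move=> [pi pm] [qi qm] pq; rewrite irreducible_poly_coprime //.
apply/negP => pdq; have := qi.2 p.
have p1 : size p != 1%N by have [h _] := pi; rewrite neq_ltn h orbT.
move=> /(_ p1 pdq); rewrite eqp_monic // => /eqP e.
by rewrite e eqxx in pq.
Qed.

Lemma poly_wf_prod (ps : seq {poly k}) h : uniq ps ->
  (forall p, p \in ps -> monic_irreducible_poly p) ->
  (forall p, p \in ps -> coprimep p h) ->
  wf (poly_form (\prod_(p <- ps) p) h) =
  \sum_(p <- ps) wf (poly_form p (h * \prod_(q <- ps | q != p) q)).
Proof.
elim: ps h => [|p ps IH] h /=.
  move=> _ _ _; rewrite !big_nil; apply: wf_dim0; first by rewrite size_poly1.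
  by apply: poly_isform; rewrite ?monic1 // coprime1p.
move=> /andP[pps ups] irr co.
have pi := irr p (mem_head _ _).
have irr' q : q \in ps -> monic_irreducible_poly q.
  by move=> qps; apply: irr; rewrite inE qps orbT.
have pq q : q \in ps -> p != q by move=> qps; apply: contraNneq pps => ->.
have cop : coprimep p (\prod_(q <- ps) q).
  elim: (ps) irr' pq => [|q qs IHq] irr' pq; first by rewrite big_nil coprimep1.
  rewrite big_cons coprimepMr IHq ?andbT; last first.
    - by move=> r rq; apply: pq; rewrite inE rq orbT.
    - by move=> r rq; apply: irr'; rewrite inE rq orbT.
  apply: coprimep_irr => //; first by apply: irr'; rewrite mem_head.
  by apply: pq; rewrite mem_head.
have cps : coprimep (\prod_(q <- ps) q) h.
  have : forall q, q \in ps -> coprimep q h by move=> q qps; apply: co; rewrite inE qps orbT.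
  elim: (ps) => [|q qs IHq] hq; first by rewrite big_nil coprime1p.
  rewrite big_cons coprimepMl hq ?mem_head // IHq // => r rq.
  by apply: hq; rewrite inE rq orbT.
have mps : \prod_(q <- ps) q \is monic.
  by rewrite big_seq; apply: rpred_prod => q qps; have [] := irr' q qps.
rewrite big_cons poly_wf_mul //; last 2 first.
- by have [] := pi.
- by rewrite coprimepMl cps andbT; apply: co; rewrite mem_head.
rewrite big_cons; congr (_ + _).
  congr (wf (poly_form p (h * _))).
  rewrite big_cons eqxx /= [RHS]big_seq_cond [LHS]big_seq_cond; apply: eq_bigl => q.
  by rewrite andbT; case qps: (q \in ps) => //=; rewrite eq_sym pq.
rewrite IH //; last first.
  move=> q qps; rewrite coprimepMr co ?inE ?qps ?orbT //=.
  by rewrite coprimep_sym; apply: coprimep_irr; rewrite ?pq //; apply: irr'.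
rewrite [LHS]big_seq [RHS]big_seq; apply: eq_bigr => q qps.
by rewrite big_cons pq // mulrA.
Qed.

Lemma res_sum (I : Type) (r : seq I) G (P : I -> {poly k}) :
  res G (\sum_(i <- r) P i) = \sum_(i <- r) res G (P i).
Proof.
elim: r => [|i r IH]; last by rewrite !big_cons resD IH.
by rewrite !big_nil /res mod0p coef0.
Qed.

Lemma rVpoly_sum n (v : 'rV[k]_n) : rVpoly v = \sum_(i < n) v 0 i *: 'X^i.
Proof.
rewrite [LHS]poly_def; apply: eq_bigr => i _.
by case: insubP => [j _ ji|]; [congr (v _ _ *: _); apply/val_inj|rewrite ltn_ord].
Qed.

(** On monomials the form depends only on the sum of the exponents. The resulting Hankel sequence
    vanishes at exponents below [deg G - 1] and takes the value [c] there. *)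
Lemma poly_wf_const G c : G \is monic -> c != 0 ->
  wf (poly_form G c%:P) = if odd (size G).-1 then wline (c : k^o) else 0.
Proof.
move=> Gm c0.
have fG : isform (poly_form G c%:P).
  by apply: poly_isform => //; rewrite -[c%:P]mulr1 mul_polyC coprimepZr // coprimep1.
have [n0|n0] := posnP (size G).-1; first by rewrite wf_dim0 // n0.
pose h l := res G (c *: 'X^l).
have hsmall l : (l < (size G).-1)%N -> h l = c * (l == (size G).-2)%:R.
  move=> ll; rewrite /h resZ /res modp_small ?coefXn ?[_ == l]eq_sym //.
  by rewrite size_polyXn; move: ll; case: (size G) n0.
have e v w : poly_form G c%:P v w = hankel_form (size G).-1 h v w.
  rewrite /poly_form (rVpoly_sum v) (rVpoly_sum w) mulr_suml mulr_suml res_sum.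
  apply: eq_bigr => i _; rewrite mulr_sumr mulr_suml res_sum.
  apply: eq_bigr => j _; rewrite /h -resZ; congr (res G _).
  by rewrite -scalerAl -scalerAr -exprD -scalerAl -scalerAl mulrC mul_polyC !scalerA.
have -> : poly_form G c%:P = hankel_form (size G).-1 h.
  by apply/funext => v; apply/funext => w; apply: e.
have hn : h (size G).-1.-1 = c.
  by rewrite hsmall ?eqxx ?mulr1 //; case: (size G) n0 => [|[|]].
rewrite hankel_wf ?hn // => l ll; rewrite hsmall; last exact: ltnW.
by rewrite ltn_eqF ?mulr0 //; move: ll; case: (size G) n0 => [|[|]].
Qed.
End Products.

(** * Residue fields and local rings of the closed points of the projective line *)

Section Point.
Variable k : fieldType.
Implicit Types p : finite_point k.

Lemma fp_monic p : (fp_poly p) \is monic. Proof. by case: p => p []. Qed.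
Lemma fp_irreducible p : irreducible_poly (fp_poly p). Proof. by case: p => p []. Qed.
Lemma fp_size p : (1 < size (fp_poly p))%N. Proof. by case: (fp_irreducible p). Qed.
Lemma fp_neq0 p : fp_poly p != 0. Proof. exact: monic_neq0 (fp_monic p). Qed.

Lemma fp_inj : injective (@fp_poly k).
Proof.
move=> [p hp] [q hq] /= e; case: _ / e hq => hq; congr FinitePoint.
case: hp hq => a b [a' b']; congr pair; exact: Prop_irrelevance.
Qed.

Section Residue.
Variable p : finite_point k.
Local Notation kp := (residue_field (Some p)).
Local Notation red := (in_qpoly (fp_poly p) : {poly k} -> kp).

Lemma fp_mk : mk_monic (fp_poly p) = fp_poly p.
Proof. exact: mk_monicE (fp_irr p). Qed.

Lemma red_val (a : {poly k}) : val (red a : {poly %/ fp_poly p}) = (a %% fp_poly p)%R.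
Proof. by rewrite /= fp_mk -Pdiv.IdomainMonic.modpE ?fp_monic. Qed.

Lemma size_residue (u : kp) :
  (size (val (u : {poly %/ fp_poly p}) : {poly k}) < size (fp_poly p))%N.
Proof.
by apply: leq_trans (size_mk_monic (u : {poly %/ fp_poly p})) _; rewrite fp_mk.
Qed.

Lemma red_inj_val (u : kp) : red (val (u : {poly %/ fp_poly p})) = u.
Proof.
by apply: val_inj; rewrite red_val modp_small // size_residue.
Qed.

Lemma redM a b : red (a * b) = red a * red b. Proof. exact: in_qpolyM. Qed.
Lemma redD a b : red (a + b) = red a + red b. Proof. exact: in_qpolyD. Qed.
Lemma red1 : red 1 = 1. Proof. exact: in_qpoly1. Qed.
Lemma red_eq0 a : (red a == 0) = (fp_poly p %| a)%R.
Proof.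
rewrite /dvdp -(inj_eq val_inj) /=; congr (_ == _); exact: red_val.
Qed.
Lemma redC c : red c%:P = residue_inj (Some p) c.
Proof.
rewrite -[c%:P]mulr1 mul_polyC in_qpolyZ red1; exact: erefl.
Qed.

Lemma map_poly_red (P : {poly k}) :
  (map_poly (residue_inj (Some p)) P).[pt_coord (Some p)] = red P.
Proof.
elim/poly_ind: P => [|P c IH].
  by rewrite map_poly0 horner0 in_qpoly0.
by rewrite rmorphD rmorphM /= map_polyX map_polyC hornerD hornerM hornerX hornerC IH
  redD redM redC.
Qed.

Lemma point_presentation :
  presentation (residue_inj (Some p)) (fun _ : 'I_1 => pt_coord (Some p))
    (fun=> poly_mpoly1 (fp_poly p)).
Proof.
apply: monogenic_presentation => [e|P].
  by exists (val (e : {poly %/ fp_poly p})); rewrite map_poly_red red_inj_val.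
rewrite map_poly_red; split=> [/eqP|[Q ->]].
  by rewrite red_eq0 => /dvdpP[Q ->]; exists Q.
by apply/eqP; rewrite red_eq0 dvdp_mull.
Qed.

Definition tau (u : kp) : k := (val (u : {poly %/ fp_poly p}) : {poly k})`_(size (fp_poly p)).-2.

Lemma tau_red a : tau (red a) = res (fp_poly p) a.
Proof. by rewrite /tau red_val. Qed.

Lemma point_finite_ext : finite_ext (residue_inj (Some p)).
Proof.
exists (size (fp_poly p)).-1, (fun v => red (rVpoly v)); split.
  exists (fun u : kp => poly_rV (val (u : {poly %/ fp_poly p}))) => [v|u].
    rewrite red_val modp_small ?rVpolyK //.
    apply: leq_ltn_trans (size_poly _ _) _.
    by rewrite ltn_predL ltnW // fp_size.
  rewrite poly_rV_K ?red_inj_val //.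
  by rewrite -ltnS prednK ?size_residue // ltnW // fp_size.
move=> c v w; rewrite linearP /= redD -mul_polyC redM redC //.
Qed.
End Residue.
End Point.

(** * Points of the projective line and reciprocity *)

Lemma ratfun_repr (k : fieldType) (f : ratfun k) :
  f * FracField.tofrac \d_(repr f) = FracField.tofrac \n_(repr f).
Proof.
rewrite -{1}[f]reprK; move: (repr f) => x.
rewrite -[X in X * _]/(\pi_(FracField.type {poly k})%qT x).
have dx := denom_ratioP x.
rewrite ![FracField.tofrac _]piE -[LHS]/(FracField.mul _ _) piE; apply/eqmodP.
rewrite /= FracField.equivfE /FracField.mulf.
rewrite !numden_Ratio ?mulf_neq0 ?oner_eq0 //.
by rewrite !mulr1 mulrC.
Qed.

Section Valuation.
Variable k : fieldType.
Local Notation tf := (@FracField.tofrac {poly k}).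

Lemma tf_neq0 (a : {poly k}) : a != 0 -> tf a != 0. Proof. by rewrite tofrac_eq0. Qed.

Lemma multiplicityE (p a b : {poly k}) e : (1 < size p)%N -> a != 0 ->
  a = p ^+ e * b -> ~~ (p %| b)%R -> multiplicity p a = e.
Proof.
move=> sp a0 ab pb; have p0 : p != 0 by rewrite -size_poly_gt0 ltnW.
apply/eqP; rewrite eqn_leq; apply/andP; split.
  apply/bigmax_leqP => -[m /= _] pm; rewrite leqNgt; apply/negP => em.
  rewrite ab in pm.
  have : p ^+ e.+1 %| p ^+ e * b by apply: dvdp_trans (dvdp_exp2l p em) pm.
  by rewrite exprSr dvdp_mul2l ?expf_neq0 // (negPf pb).
have ea : (e < size a)%N.
  have : p ^+ e %| a by rewrite ab dvdp_mulr.
  move/(dvdp_leq a0); apply: leq_trans.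
  have sX : (0 < size (p ^+ e)%R)%N by rewrite size_poly_gt0 expf_neq0.
  by rewrite -(prednK sX) ltnS size_exp leq_pmull // -subn1 subn_gt0.
apply: (leq_bigmax_cond (F := fun m : 'I_(size a) => m : nat) (Ordinal ea)).
by rewrite /= ab dvdp_mulr.
Qed.

Lemma multiplicity_split (p a : {poly k}) : (1 < size p)%N -> a != 0 ->
  exists e b, a = p ^+ e * b /\ ~~ (p %| b)%R.
Proof.
move=> sp; have [m] := ubnP (size a); elim: m a => // m IH a sa a0.
have [pa|] := boolP (p %| a)%R; last by exists 0%N, a; rewrite expr0 mul1r.
have [c ac] := dvdpP _ _ pa.
have c0 : c != 0 by apply: contra_neq a0 => e; rewrite ac e mul0r.
have p0 : p != 0 by rewrite -size_poly_gt0 ltnW.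
have sc : (size c < m)%N.
  have e : size a = (size c + size p).-1 by rewrite ac; apply: size_mul.
  by move: sa; rewrite e; lia.
have [e [b [cb pb]]] := IH c sc c0.
by exists e.+1, b; rewrite exprSr mulrAC -cb -ac.
Qed.

Section Poly.
Variable x : closed_point k.

Definition poly_val (a : {poly k}) : int :=
  if x is Some p then (multiplicity p a)%:Z else - ((size a).-1)%:Z.
Definition poly_red (a : {poly k}) : residue_field x :=
  match x return residue_field x with
  | Some p => in_qpoly (fp_poly p) (a %/ (fp_poly p : {poly k}) ^+ multiplicity p a)%R
  | None => lead_coef a
  end.
End Poly.

Lemma poly_valM x (a b : {poly k}) : a != 0 -> b != 0 ->
  poly_val x (a * b) = poly_val x a + poly_val x b /\
  poly_red x (a * b) = poly_red x a * poly_red x b /\ poly_red x a != 0.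
Proof.
move=> a0 b0; case: x => [p|] /=; last first.
  rewrite /poly_val /poly_red lead_coefM lead_coef_eq0; split=> //.
  have e : size (a * b) = (size a + size b).-1 by apply: size_mul.
  have sa : (0 < size a)%N by rewrite size_poly_gt0.
  have sb : (0 < size b)%N by rewrite size_poly_gt0.
  have ar (m n l : nat) : l = (m + n).-1 -> (0 < m)%N -> (0 < n)%N ->
      - (l.-1)%:Z = - (m.-1)%:Z - (n.-1)%:Z by lia.
  exact: ar e sa sb.
have sp := fp_size p; have p0 := fp_neq0 p.
have [e [a' [aE pa]]] := multiplicity_split sp a0.
have [d [b' [bE pb]]] := multiplicity_split sp b0.
have pab : ~~ (fp_poly p %| a' * b')%R.
  have co : coprimep (fp_poly p) a' by rewrite irreducible_poly_coprime //; apply: fp_irreducible.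
  by rewrite Gauss_dvdpr.
have abE : a * b = fp_poly p ^+ (e + d) * (a' * b') by rewrite aE bE exprD; ring.
have ma := multiplicityE sp a0 aE pa; have mb := multiplicityE sp b0 bE pb.
have mab := multiplicityE sp (mulf_neq0 a0 b0) abE pab.
rewrite /poly_val /poly_red ma mb mab PoszD; split=> //.
have pX n : fp_poly p ^+ n != 0 by rewrite expf_neq0.
have -> : (a * b) %/ fp_poly p ^+ (e + d) = a' * b' by rewrite abE mulKp.
have -> : a %/ fp_poly p ^+ e = a' by rewrite aE mulKp.
have -> : b %/ fp_poly p ^+ d = b' by rewrite bE mulKp.
by split; [exact: redM|rewrite red_eq0].
Qed.

Lemma poly_red_neq0 x (a : {poly k}) : a != 0 -> poly_red x a != 0.
Proof. by move=> a0; have [_ []] := poly_valM x a0 a0. Qed.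

(** [pt_val] and [pt_red] are defined on the fraction chosen by [repr]; multiplicativity on
    polynomials shows that any other fraction may be used. *)
Lemma pt_frac x f (a b : {poly k}) : a != 0 -> b != 0 -> f * tf b = tf a ->
  pt_val x f = poly_val x a - poly_val x b /\
  pt_red x f = poly_red x a / poly_red x b.
Proof.
move=> a0 b0 fab.
have d0 : \d_(repr f) != 0 := denom_ratioP (repr f).
have f0 : f != 0.
  apply: contra_neq a0 => e; move: fab; rewrite e mul0r => /esym/eqP.
  by rewrite tofrac_eq0 => /eqP.
have n0 : \n_(repr f) != 0.
  have h : f * tf \d_(repr f) != 0 by exact: mulf_neq0 f0 (tf_neq0 d0).
  by move: h; rewrite ratfun_repr tofrac_eq0.
have nb : \n_(repr f) * b = a * \d_(repr f).
  apply/eqP; rewrite -tofrac_eq !rmorphM /= -ratfun_repr -fab mulrAC.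
  by [].
have [v1 [r1 _]] := poly_valM x n0 b0.
have [v2 [r2 _]] := poly_valM x a0 d0.
rewrite nb in v1 r1.
have val_eq : pt_val x f = poly_val x \n_(repr f) - poly_val x \d_(repr f).
  case: (x) => [p|] //; rewrite /pt_val /poly_val.
  have sa : (0 < size (\n_(repr f)) )%N by rewrite size_poly_gt0.
  have sb : (0 < size (\d_(repr f)) )%N by rewrite size_poly_gt0.
  have ar (m n : nat) : (0 < m)%N -> (0 < n)%N ->
      n%:Z - m%:Z = - (m.-1)%:Z - - (n.-1)%:Z by lia.
  exact: ar sa sb.
have red_eq : pt_red x f = poly_red x \n_(repr f) / poly_red x \d_(repr f).
  by case: (x).
split.
  rewrite val_eq; apply/eqP; rewrite subr_eq addrAC -v2 v1 addrK //.
rewrite red_eq; apply/eqP; rewrite eqr_div ?poly_red_neq0 //.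
by rewrite -r1 r2.
Qed.

Lemma ratfun_frac (f : ratfun k) : f != 0 ->
  exists a b : {poly k}, [/\ a != 0, b != 0 & f * tf b = tf a].
Proof.
move=> f0; have d0 : \d_(repr f) != 0 := denom_ratioP (repr f).
exists \n_(repr f), \d_(repr f); split=> //; last exact: ratfun_repr.
have h : f * tf \d_(repr f) != 0 by exact: mulf_neq0 f0 (tf_neq0 d0).
by move: h; rewrite ratfun_repr tofrac_eq0.
Qed.

Lemma pt_valM (x : closed_point k) (f g : ratfun k) : f != 0 -> g != 0 ->
  pt_val x (f * g) = pt_val x f + pt_val x g.
Proof.
move=> /ratfun_frac[a [b [a0 b0 fab]]] /ratfun_frac[c [d [c0 d0 gcd]]].
have e : f * g * tf (b * d) = tf (a * c).
  by rewrite !rmorphM /= -fab -gcd mulrACA.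
rewrite (pt_frac x a0 b0 fab).1 (pt_frac x c0 d0 gcd).1.
rewrite (pt_frac x (mulf_neq0 a0 c0) (mulf_neq0 b0 d0) e).1.
rewrite (poly_valM x a0 c0).1 (poly_valM x b0 d0).1; ring.
Qed.

Lemma pt_redM (x : closed_point k) (f g : ratfun k) : f != 0 -> g != 0 -> pt_red x (f * g) = pt_red x f * pt_red x g.
Proof.
move=> /ratfun_frac[a [b [a0 b0 fab]]] /ratfun_frac[c [d [c0 d0 gcd]]].
have e : f * g * tf (b * d) = tf (a * c).
  by rewrite !rmorphM /= -fab -gcd mulrACA.
rewrite (pt_frac x a0 b0 fab).2 (pt_frac x c0 d0 gcd).2.
rewrite (pt_frac x (mulf_neq0 a0 c0) (mulf_neq0 b0 d0) e).2.
by rewrite (poly_valM x a0 c0).2.1 (poly_valM x b0 d0).2.1 invfM mulrACA.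
Qed.

Lemma pt_red_neq0 (x : closed_point k) (f : ratfun k) : f != 0 -> pt_red x f != 0.
Proof.
move=> /ratfun_frac[a [b [a0 b0 fab]]]; rewrite (pt_frac x a0 b0 fab).2.
by rewrite mulf_neq0 ?invr_eq0 ?poly_red_neq0.
Qed.

Lemma pt_val1 (x : closed_point k) : pt_val x 1 = 0.
Proof.
have := pt_valM x (oner_neq0 (ratfun k)) (oner_neq0 (ratfun k)).
by rewrite mulr1 -{1}[pt_val x 1]addr0 => /addrI.
Qed.
Lemma pt_red1 (x : closed_point k) : pt_red x 1 = 1.
Proof.
have := pt_redM x (oner_neq0 (ratfun k)) (oner_neq0 (ratfun k)).
by rewrite mulr1 -{1}[pt_red x 1]mulr1 => /mulfI -> //; apply: pt_red_neq0; rewrite oner_neq0.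
Qed.
Lemma pt_valV (x : closed_point k) (f : ratfun k) : f != 0 -> pt_val x f^-1 = - pt_val x f.
Proof.
move=> f0; apply/eqP; rewrite -addr_eq0 -pt_valM ?invr_eq0 // mulVf //.
by rewrite pt_val1.
Qed.
Lemma pt_redV (x : closed_point k) (f : ratfun k) : f != 0 -> pt_red x f^-1 = (pt_red x f)^-1.
Proof.
move=> f0; apply: (mulfI (pt_red_neq0 x f0)).
by rewrite -pt_redM ?invr_eq0 // mulfV // mulfV ?pt_red1 // pt_red_neq0.
Qed.
Lemma pt_valX (x : closed_point k) (f : ratfun k) n : f != 0 -> pt_val x (f ^+ n) = pt_val x f *+ n.
Proof.
move=> f0; elim: n => [|n IH]; first by rewrite expr0 pt_val1.
by rewrite exprS pt_valM ?expf_neq0 // IH mulrS.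
Qed.
Lemma pt_redX (x : closed_point k) (f : ratfun k) n : f != 0 -> pt_red x (f ^+ n) = pt_red x f ^+ n.
Proof.
move=> f0; elim: n => [|n IH]; first by rewrite !expr0 pt_red1.
by rewrite !exprS pt_redM ?expf_neq0 // IH.
Qed.

Lemma pt_tofrac x (a : {poly k}) : a != 0 ->
  pt_val x (tf a) = poly_val x a - poly_val x 1 /\
  pt_red x (tf a) = poly_red x a / poly_red x 1.
Proof. by move=> a0; apply: pt_frac => //; rewrite ?oner_neq0 // rmorph1 mulr1. Qed.

Lemma poly_unit (p : finite_point k) (a : {poly k}) : a != 0 -> ~~ (fp_poly p %| a)%R ->
  poly_val (Some p) a = 0 /\ poly_red (Some p) a = in_qpoly (fp_poly p) a.
Proof.
move=> a0 pa; have m0 := multiplicityE (fp_size p) a0 (esym (etrans (congr1 (fun u => u * a) (expr0 _)) (mul1r a))) pa.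
by rewrite /poly_val /poly_red m0 expr0 divp1.
Qed.

Lemma fp_ndvd1 (p : finite_point k) : ~~ (fp_poly p %| 1)%R.
Proof. by rewrite dvdp1 neq_ltn fp_size orbT. Qed.

Lemma pt_tofrac_unit (p : finite_point k) (a : {poly k}) : ~~ (fp_poly p %| a)%R ->
  pt_val (Some p) (tf a) = 0 /\ pt_red (Some p) (tf a) = in_qpoly (fp_poly p) a.
Proof.
move=> pa; have a0 : a != 0 by apply: contraNneq pa => ->; rewrite dvdp0.
have [-> ->] := pt_tofrac (Some p) a0.
have [-> ->] := poly_unit a0 pa.
have [-> ->] := poly_unit (oner_neq0 _) (fp_ndvd1 p).
by rewrite subr0 red1 divr1.
Qed.

Lemma pt_tofrac_mul (p : finite_point k) (a : {poly k}) : ~~ (fp_poly p %| a)%R ->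
  pt_val (Some p) (tf (fp_poly p * a)) = 1 /\
  pt_red (Some p) (tf (fp_poly p * a)) = in_qpoly (fp_poly p) a.
Proof.
move=> pa; have a0 : a != 0 by apply: contraNneq pa => ->; rewrite dvdp0.
have pa0 : fp_poly p * a != 0 by rewrite mulf_neq0 ?fp_neq0.
have [-> ->] := pt_tofrac (Some p) pa0.
have [-> ->] := poly_unit (oner_neq0 _) (fp_ndvd1 p).
have m1 : multiplicity p (fp_poly p * a) = 1%N.
  by apply: (multiplicityE (fp_size p) pa0 _ pa); rewrite expr1.
by rewrite /poly_val /poly_red m1 expr1 mulKp ?fp_neq0 // subr0 red1 divr1.
Qed.

Lemma pt_tofrac_inf (a : {poly k}) : a != 0 ->
  pt_val None (tf a) = - ((size a).-1)%:Z /\ pt_red None (tf a) = lead_coef a.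
Proof.
move=> a0; have [-> ->] := pt_tofrac None a0.
by rewrite /poly_val /poly_red size_poly1 lead_coef1 subr0 divr1.
Qed.

Lemma ratvar_neq0 : ratvar k != 0. Proof. by rewrite tofrac_eq0 polyX_eq0. Qed.
Lemma pt_ratvar_inf : pt_val None (ratvar k) = -1 /\ pt_red None (ratvar k) = 1.
Proof.
by have := pt_tofrac_inf (negbT (polyX_eq0 k)); rewrite size_polyX lead_coefX.
Qed.

Lemma pt_param_neq0 (x : closed_point k) : pt_param x != 0.
Proof.
by case: x => [p|] /=; rewrite ?tofrac_eq0 ?fp_neq0 // invr_eq0 ratvar_neq0.
Qed.
Lemma pt_paramE (x : closed_point k) : pt_val x (pt_param x) = 1 /\ pt_red x (pt_param x) = 1.
Proof.
case: x => [p|]; rewrite /pt_param.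
  by have := pt_tofrac_mul (fp_ndvd1 p); rewrite mulr1 red1.
by rewrite pt_valV ?pt_redV ?ratvar_neq0 // !pt_ratvar_inf.1 pt_ratvar_inf.2 opprK invr1.
Qed.

Lemma pt_diff_neq0 (x : closed_point k) : pt_diff x != 0 :> ratfun k.
Proof.
case: x => [p|] /=; first exact: oner_neq0.
by rewrite oppr_eq0 invr_eq0 expf_neq0 // ratvar_neq0.
Qed.
Lemma pt_valN1 (x : closed_point k) : pt_val x (-1) = 0.
Proof.
have n1 : (-1 : ratfun k) != 0 by rewrite oppr_eq0 oner_neq0.
have := pt_valM x n1 n1; rewrite mulrNN mulr1 pt_val1; lia.
Qed.
Lemma pt_redN1 : pt_red None (-1 : ratfun k) = -1.
Proof.
have n1 : (-1 : {poly k}) != 0 by rewrite oppr_eq0 oner_neq0.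
by have [_] := pt_tofrac_inf n1; rewrite rmorphN1 lead_coefN lead_coef1.
Qed.
(** The even valuation preserves the parity of degrees at infinity, and the sign in [ds = - t^-2 dt]
    makes infinity contribute [<-c>], so that it cancels [<c>] in [reciprocity]. *)
Lemma pt_diff_inf : pt_val None (pt_diff None : ratfun k) = 2 /\
  pt_red None (pt_diff None : ratfun k) = -1.
Proof.
have t0 := ratvar_neq0; have n1 : (-1 : ratfun k) != 0 by rewrite oppr_eq0 oner_neq0.
have tX : ratvar k ^+ 2 != 0 := expf_neq0 2 t0.
have tV : (ratvar k ^+ 2)^-1 != 0 by rewrite invr_eq0; exact: tX.
have -> : pt_diff None = (-1) * (ratvar k ^+ 2)^-1 :> ratfun k by exact: esym (mulN1r _).
rewrite (pt_valM _ n1 tV) (pt_redM _ n1 tV).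
rewrite pt_valN1 pt_redN1 (pt_valV _ tX) (pt_redV _ tX) (pt_valX _ _ t0) (pt_redX _ _ t0).
by rewrite pt_ratvar_inf.1 pt_ratvar_inf.2 expr1n invr1 mulr1.
Qed.
End Valuation.

Lemma irreducible_factor (k : fieldType) (a : {poly k}) : (1 < size a)%N ->
  exists p : finite_point k, (fp_poly p %| a)%R.
Proof.
have [m] := ubnP (size a); elim: m a => // m IH a sm sa.
have a0 : a != 0 by rewrite -size_poly_gt0 ltnW.
have [irr|nirr] := pselect (irreducible_poly a).
  pose b := (lead_coef a)^-1 *: a.
  have lc : lead_coef a != 0 by rewrite lead_coef_eq0.
  have ba : b %= a by rewrite eqp_scale ?invr_eq0.
  have bm : b \is monic by rewrite monicE lead_coefZ mulVf.
  have bi : irreducible_poly b.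
    have [h1 h2] := irr; split=> [|q q1 qb]; first by rewrite (eqp_size ba).
    by rewrite (eqp_rtrans ba); apply: h2 => //; rewrite -(eqp_dvdr _ ba).
  by exists (FinitePoint (bi, bm)); rewrite /= (eqp_dvdl _ ba).
have [q [q1 qa nqa]] : exists q : {poly k}, [/\ size q != 1%N, (q %| a)%R & ~~ (q %= a)].
  apply: contrapT => h; apply: nirr; split=> // q q1 qa.
  by apply: contrapT => /negP nqa; apply: h; exists q.
have q0 : q != 0 by apply: contraTneq qa => ->; rewrite dvd0p.
have sq : (size q < size a)%N.
  by rewrite ltn_neqAle dvdp_leq // andbT; apply: contraNneq nqa => e; rewrite -dvdp_size_eqp // e.
have sq1 : (1 < size q)%N by rewrite ltn_neqAle eq_sym q1 size_poly_gt0.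
have [|p pq] := IH q _ sq1; first exact: leq_trans sq sm.
by exists p; apply: dvdp_trans pq qa.
Qed.

(** An irreducible factor that is already in the list when it is met again is removed from it and
    moved into the square, which [witt_term] ignores. *)
Lemma squarefree_part (k : fieldType) (a : {poly k}) : a != 0 ->
  exists (c : k) (ps : seq (finite_point k)) (b : {poly k}), [/\ c != 0, b != 0, uniq ps &
    a = c%:P * \prod_(p <- ps) fp_poly p * b ^+ 2].
Proof.
have [m] := ubnP (size a); elim: m a => // m IH a sm a0.
have [s1|s1] := leqP (size a) 1.
  exists a`_0, [::], 1; rewrite oner_neq0 big_nil expr1n !mulr1 -size1_polyC //.
  by split=> //; move: a0; rewrite {1}(size1_polyC s1) polyC_eq0.
have [p /dvdpP[a' aE]] := irreducible_factor s1.
have a'0 : a' != 0 by apply: contra_neq a0 => e; rewrite aE e mul0r.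
have sa' : (size a' < m)%N.
  have e : size a = (size a' + size (fp_poly p)).-1 by rewrite aE; apply: size_mul => //; apply: fp_neq0.
  by have := fp_size p; move: sm; rewrite e; lia.
have [c [ps [b [c0 b0 ups a'E]]]] := IH a' sa' a'0.
have [pps|pps] := boolP (p \in ps); last first.
  exists c, (p :: ps), b; split; rewrite /= ?pps // big_cons aE a'E; ring.
exists c, (rem p ps), (fp_poly p * b); split=> //.
- by rewrite mulf_neq0 ?fp_neq0.
- exact: rem_uniq.
- have e : \prod_(q <- ps) fp_poly q = fp_poly p * \prod_(q <- rem p ps) fp_poly q.
    by rewrite (perm_big _ (perm_to_rem pps)) big_cons.
  by rewrite aE a'E e; move: (\prod_(q <- rem p ps) fp_poly q) => X; ring.
Qed.

Lemma big_uniq_support (T : eqType) (V : zmodType) (r r0 : seq T) (F : T -> V) :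
  uniq r -> uniq r0 -> {subset r0 <= r} -> (forall x, x \notin r0 -> F x = 0) ->
  \sum_(x <- r) F x = \sum_(x <- r0) F x.
Proof.
move=> ur ur0 sub F0; rewrite (bigID (mem r0)) /= [X in _ + X]big1 ?addr0 => [|x]; last exact: F0.
rewrite -big_filter; apply: perm_big; apply: uniq_perm => //; first exact: filter_uniq.
by move=> x; rewrite mem_filter; have [/sub|] := boolP (x \in r0).
Qed.

Lemma wline_scale_sq (K : fieldType) (L : lmodType K) (u : K) (l : L) : u != 0 ->
  wline ((u * u) *: l) = wline l.
Proof.
move=> u0; have [->|l0] := eqVneq l 0; first by rewrite scaler0.
have ul0 : (u * u) *: l != 0 by rewrite scaler_eq0 negb_or l0 mulf_neq0.
rewrite (wlineE ul0) (wlineE l0); apply: wclass_iso.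
exists (fun v => u *: v); split.
- by move=> a v w; rewrite scalerDr !scalerA [u * a]mulrC.
- exists (fun v => u^-1 *: v) => v; rewrite scalerA ?mulVf ?mulfV ?scale1r //.
- by move=> v w; rewrite /= !mxE !scalerA; congr (_ *: l); ring.
Qed.

Lemma frac_square (F : fieldType) (f A B C D : F) : B != 0 -> f * B = A ->
  A * B = C * D ^+ 2 -> f = C * (D / B) ^+ 2.
Proof.
move=> B0 fB AB; rewrite expr_div_n mulrA -AB -fB expr2 invfM.
by rewrite mulrA mulfK // mulfK.
Qed.

Lemma odd_absz_inf n : odd `|- n%:Z - 2|%N = odd n.
Proof. by lia. Qed.

Lemma coprimep_prod (k : fieldType) (p : {poly k}) (I : eqType) (s : seq I)
    (F : I -> {poly k}) :
  (forall q, q \in s -> coprimep p (F q)) -> coprimep p (\prod_(q <- s) F q).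
Proof.
elim: s => [|q s IH] h; first by rewrite big_nil coprimep1.
rewrite big_cons coprimepMr h ?mem_head // IH // => r rs.
by apply: h; rewrite inE rs orbT.
Qed.

Lemma fp_coprime (k : fieldType) (p q : finite_point k) : p != q ->
  coprimep (fp_poly p) (fp_poly q).
Proof.
move=> pq; apply: coprimep_irr; [exact: fp_irr|exact: fp_irr|].
by rewrite (inj_eq (@fp_inj k)).
Qed.

Lemma coprimep_ndvd (k : fieldType) (p : finite_point k) (a : {poly k}) :
  coprimep (fp_poly p) a -> ~~ (fp_poly p %| a)%R.
Proof. by rewrite irreducible_poly_coprime //; apply: fp_irreducible. Qed.

Section Reciprocity.
Variable k : fieldType.
Implicit Types (x : closed_point k) (f g : ratfun k).
Local Notation tf := (@FracField.tofrac {poly k}).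

Definition pt_coordinate x (l : omega (residue_inj x)) : residue_field x :=
  @ocoord _ _ _ l 1 (fun=> pt_coord x) (fun=> poly_mpoly1 (pt_poly x)).

Lemma pt_presentation x : presentation (residue_inj x) (fun _ : 'I_1 => pt_coord x)
  (fun=> poly_mpoly1 (pt_poly x)).
Proof.
case: x => [p|]; first exact: point_presentation.
apply: monogenic_presentation => [e|P] /=.
  by exists e%:P; rewrite map_polyC hornerC.
rewrite map_poly_id //; split=> [P0|[Q ->]]; last by rewrite hornerM hornerX mulr0.
by have /factor_theorem[Q ->] : root P 0 by [apply/eqP]; exists Q; rewrite subr0.
Qed.

Lemma pt_finite_ext x : finite_ext (residue_inj x).
Proof.
case: x => [p|]; first exact: point_finite_ext.
exists 1%N, (fun v : 'rV[k]_1 => v 0 0); split.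
  exists (fun c => const_mx c) => [v|c]; last by rewrite mxE.
  by apply/rowP => i; rewrite ord1 mxE.
by move=> c v w; rewrite !mxE.
Qed.

Definition pt_alg x : algebraic_ext (residue_inj x) :=
  finite_ext_algebraic (pt_finite_ext x).

Definition pt_base x : omega (residue_inj x) :=
  sval (cid (omega_exists (@pt_alg x) 1 (pt_presentation x))).
Lemma pt_baseE x : pt_coordinate (pt_base x) = 1.
Proof. exact: svalP (cid (omega_exists (@pt_alg x) 1 (pt_presentation x))). Qed.

Lemma pt_coordinateZ x c (l : omega (residue_inj x)) :
  pt_coordinate (c *: l) = c * pt_coordinate l.
Proof. by []. Qed.

Lemma pt_coordinate_eq x (l : omega (residue_inj x)) : l = pt_coordinate l *: pt_base x.
Proof.
apply: (ocoord_inj (pt_presentation x)); rewrite ocoordZ.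
by rewrite -[ocoord (pt_base x) _ _]/(pt_coordinate (pt_base x)) pt_baseE mulr1.
Qed.

Definition pt_form x : residue_field x -> k :=
  match x with Some p => @tau k p | None => id end.

Lemma pt_form_lin x c u v :
  @pt_form x (residue_inj x c * u + v) = c * pt_form u + pt_form v.
Proof.
case: x u v => [p|] //= u v; rewrite /tau mulr_algl.
by rewrite -[val (c *: u + v)]/(c *: val (u : {poly %/ fp_poly p}) + val (v : {poly %/ fp_poly p})) coefD coefZ.
Qed.

Lemma pt_form_nd x u : (forall e, @pt_form x (e * u) = 0) -> u = 0.
Proof.
case: x u => [p|] /= u h; last by have := h 1; rewrite mul1r.
apply/eqP/negPn/negP => u0.
have := h (in_qpoly (fp_poly p) 'X^((size (fp_poly p)).-2) / u).
rewrite divfK // tau_red /res modp_small ?coefXn ?eqxx; last first.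
  by rewrite size_polyXn; case: (size (fp_poly p)) (fp_size p) => [|[]].
by move/eqP; rewrite oner_eq0.
Qed.

Lemma pt_trace_lin x c (l l' : omega (residue_inj x)) :
  pt_form (pt_coordinate (residue_inj x c *: l + l')) =
  c * pt_form (pt_coordinate l) + pt_form (pt_coordinate l').
Proof. exact: pt_form_lin. Qed.

Lemma pt_trace_nd x (l : omega (residue_inj x)) :
  (forall e, pt_form (pt_coordinate (e *: l)) = 0) -> l = 0.
Proof.
move=> h; rewrite (pt_coordinate_eq l) (_ : pt_coordinate l = 0) ?scale0r //.
by apply: pt_form_nd => e; apply: h.
Qed.

Definition pt_trace x : trace_map (residue_inj x) (omega (residue_inj x)) k^o :=
  TraceMap (L' := k^o) (@pt_trace_lin x) (@pt_trace_nd x).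

Definition pt_transfer x := transfer (pt_finite_ext x) (pt_trace x).
HB.instance Definition _ x := GRing.Additive.copy (@pt_transfer x)
  (transfer (pt_finite_ext x) (pt_trace x)).

Lemma pt_transfer_inf u : pt_transfer (wline (u *: pt_base None)) = wline (u : k^o).
Proof.
rewrite /pt_transfer transfer_line; last by move=> e; exists e.
congr wline; rewrite -[LHS]/(pt_coordinate (u *: pt_base None)).
by rewrite pt_coordinateZ pt_baseE mulr1.
Qed.


Lemma pt_transfer_fin (p : finite_point k) (h : {poly k}) : coprimep (fp_poly p) h ->
  @pt_transfer (Some p) (wline ((in_qpoly (fp_poly p) h : residue_field (Some p)) *: pt_base (Some p))) =
  wf (poly_form (fp_poly p) h).
Proof.
move=> co; have fB := poly_isform (fp_monic p) co.
set u : residue_field (Some p) := in_qpoly (fp_poly p) h.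
have u0 : u != 0.
  rewrite red_eq0; apply/negP => /dvdp_gcd_idl; rewrite -/(gcdp _ _) => e.
  have := fp_size p; rewrite -(eqp_size e); move: co; rewrite /coprimep => /eqP ->.
  by [].
have ul : u *: pt_base (Some p) != 0.
  rewrite scaler_eq0 negb_or u0; apply/eqP => b0.
  by have := pt_baseE (Some p); rewrite b0 => /esym/eqP; rewrite oner_eq0.
rewrite (wlineE ul) (wfE fB); apply: transferE.
have [b [bb bl]] : exists b : 'rV[k]_(size (fp_poly p)).-1 -> residue_field (Some p),
    bijective b /\ b = (fun v => in_qpoly (fp_poly p) (rVpoly v)).
  exists (fun v => in_qpoly (fp_poly p) (rVpoly v)); split=> //.
  exists (fun u : residue_field (Some p) => poly_rV (val (u : {poly %/ fp_poly p}))) => [v|e].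
    rewrite red_val modp_small ?rVpolyK //.
    apply: leq_ltn_trans (size_poly _ _) _.
    by rewrite ltn_predL ltnW // fp_size.
  rewrite poly_rV_K ?red_inj_val //.
  by rewrite -ltnS prednK ?size_residue // ltnW // fp_size.
case: fB => h1 h2 h3; exists (fun v => const_mx (b v)); split.
- case: bb => b' bK b'K; exists (fun v : 'rV_1 => b' (v 0 0)) => v.
    by rewrite mxE bK.
  by apply/rowP => i; rewrite ord1 mxE b'K.
- move=> c v w; apply/rowP => i; rewrite !mxE bl linearP /= redD -mul_polyC redM redC.
  by [].
- move=> v w; rewrite /= !mxE /poly_form bl scalerA.
  rewrite -[tau _]/(tau (pt_coordinate (_ *: pt_base (Some p)))).
  rewrite pt_coordinateZ pt_baseE mulr1.
  by rewrite -(tau_red p) !(redM p).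
Qed.

(** The Witt residue at [x] of the line form of [f dt], followed by the transfer. In the local
    generator [pt_diff x] the coefficient is [f / pt_diff x], and only an odd valuation gives a
    nonzero residue. *)
Definition witt_term x f : Witt k^o :=
  if odd `|pt_val x (f / pt_diff x)|%N
  then pt_transfer (wline (pt_red x (f / pt_diff x) *: pt_base x)) else 0.

Lemma witt_term_sq x f g : f != 0 -> g != 0 -> witt_term x (f * g ^+ 2) = witt_term x f.
Proof.
move=> f0 g0; rewrite /witt_term.
have fd0 : f / pt_diff x != 0.
  by apply: mulf_neq0; [exact: f0|rewrite invr_eq0; exact: pt_diff_neq0].
have g20 : g ^+ 2 != 0 := expf_neq0 2 g0.
have -> : f * g ^+ 2 / pt_diff x = f / pt_diff x * g ^+ 2 by exact: mulrAC.
rewrite (pt_valM _ fd0 g20) (pt_redM _ fd0 g20) (pt_valX _ _ g0) (pt_redX _ _ g0).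
have -> : odd `|(pt_val x (f / pt_diff x) + pt_val x g *+ 2)%R|%N = odd `|pt_val x (f / pt_diff x)|%N.
  by lia.
case: (odd _); last exact: erefl.
rewrite [pt_red _ _ * _]mulrC expr2 -scalerA wline_scale_sq; first exact: erefl.
exact: pt_red_neq0.
Qed.

(** Up to a square, [f] is a constant times a product of distinct points, so every finite term is a
    form attached to one factor of a squarefree polynomial. Quantifying over all lists that contain
    some [r0] lets relations with different supports be added. *)
Theorem reciprocity f : f != 0 ->
  exists r0 : seq (closed_point k), forall r : seq (closed_point k), uniq r -> {subset r0 <= r} -> \sum_(x <- r) witt_term x f = 0.
Proof.
move=> f0; have [a [b [a0 b0 fab]]] := ratfun_frac f0.
have [c [ps [g [c0 g0 ups abE]]]] := squarefree_part (mulf_neq0 a0 b0).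
pose G := \prod_(p <- ps) fp_poly p.
have Gm : G \is monic by apply: monic_prod => p _; apply: fp_monic.
have G0 := monic_neq0 Gm.
have cG0 : c%:P * G != 0 by rewrite mulf_neq0 // polyC_eq0.
have tcG0 := tf_neq0 cG0.
have tb0 := tf_neq0 b0; have tg0 := tf_neq0 g0.
have fE : f = tf (c%:P * G) * (tf g / tf b) ^+ 2.
  have e1 : tf a * tf b = tf (c%:P * G) * tf g ^+ 2.
    by rewrite -rmorphM abE rmorphM rmorphXn.
  exact: frac_square tb0 fab e1.
have gb0 : tf g / tf b != 0.
  by apply: mulf_neq0; [exact: tg0|rewrite invr_eq0; exact: tb0].
have tE x : witt_term x f = witt_term x (tf (c%:P * G)).
  by rewrite fE; apply: witt_term_sq; [exact: tcG0|exact: gb0].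
pose r0 : seq (closed_point k) := None :: [seq Some p | p <- ps].
have ur0 : uniq r0.
  rewrite /= map_inj_uniq ?ups; last by move=> p q [].
  by rewrite andbT; apply/mapP => -[].
exists r0 => r ur sub.
rewrite (eq_bigr _ (fun x _ => tE x)) (big_uniq_support ur ur0 sub) => [|x xr0]; last first.
  case: x xr0 => [p|] xr0; last by rewrite inE eqxx in xr0.
  have pps : p \notin ps.
    by apply: contra xr0 => pps; rewrite inE; apply/orP; right; apply/mapP; exists p.
  have nd : ~~ (fp_poly p %| c%:P * G)%R.
    apply: coprimep_ndvd; rewrite mul_polyC coprimepZr //.
    apply: coprimep_prod => q qps; apply: fp_coprime.
    by apply: contraNneq pps => ->.
  rewrite /witt_term /pt_diff divr1 (pt_tofrac_unit nd).1.
  exact: erefl.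
rewrite big_cons big_map.
have -> : witt_term None (tf (c%:P * G)) = if odd (size G).-1 then wline (- c : k^o) else 0.
  rewrite /witt_term.
  have dV0 : (pt_diff None : ratfun k)^-1 != 0 by rewrite invr_eq0; exact: pt_diff_neq0.
  have d0 : (pt_diff None : ratfun k) != 0 by exact: pt_diff_neq0.
  rewrite (pt_valM _ tcG0 dV0) (pt_redM _ tcG0 dV0) (pt_valV _ d0) (pt_redV _ d0).
  rewrite (pt_tofrac_inf cG0).1 (pt_tofrac_inf cG0).2 (pt_diff_inf k).1 (pt_diff_inf k).2.
  rewrite mul_polyC lead_coefZ (monicP Gm) size_scale // mulr1 invrN1 mulrN1 pt_transfer_inf.
  by rewrite odd_absz_inf.
have -> : \sum_(p <- ps) witt_term (Some p) (tf (c%:P * G)) = wf (poly_form G c%:P).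
  have uG : uniq [seq fp_poly p | p <- ps] by rewrite map_inj_uniq //; apply: fp_inj.
  have GE : G = \prod_(q <- [seq fp_poly p | p <- ps]) q by rewrite big_map.
  rewrite GE poly_wf_prod //; first last.
  - by move=> q _; rewrite -[c%:P]mulr1 mul_polyC coprimepZr // coprimep1.
  - by move=> q /mapP[p _ ->]; apply: fp_irr.
  rewrite -GE big_map big_seq [RHS]big_seq; apply: eq_bigr => p pps.
  rewrite big_map; pose H := \prod_(q <- ps | fp_poly q != fp_poly p) fp_poly q.
  rewrite -/H.
  have cH : coprimep (fp_poly p) (c%:P * H).
    rewrite mul_polyC coprimepZr // /H -big_filter; apply: coprimep_prod => q.
    rewrite mem_filter => /andP[qp _]; apply: fp_coprime.
    by apply: contraNneq qp => ->.
  have e : c%:P * G = fp_poly p * (c%:P * H).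
    rewrite mulrCA /G (big_rem p pps) /=; congr (_ * (_ * _)).
    rewrite /H (rem_filter _ ups) big_filter; apply: eq_bigl => q /=.
    by rewrite (inj_eq (@fp_inj k)).
  rewrite e /witt_term /pt_diff divr1.
  rewrite (pt_tofrac_mul (coprimep_ndvd cH)).1 (pt_tofrac_mul (coprimep_ndvd cH)).2.
  exact: pt_transfer_fin.
rewrite poly_wf_const //; case: (odd _); last by rewrite addr0.
by rewrite addrC wlineN.
Qed.
End Reciprocity.

(** * Milnor-Witt K-theory modulo eta *)

Section Homogeneous.
Variable K : fieldType.
Local Notation hd := (hdeg (@mw_deg K)).
Local Notation eta := (mw_eta K).
Implicit Types (x y z : KMWring K).

(** A total constructor, with default 0 outside degree [n]: degree proofs enter only through
    [val_kmw] and not in terms. *)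
Definition kmw n x : KMW K n := insubd 0 x.
Lemma val_kmw n x : hd n x -> val (kmw n x) = x.
Proof. by move=> h; rewrite /kmw insubdK //; apply/hdegbP. Qed.
Lemma hdeg_val n (s : KMW K n) : hd n (val s).
Proof. by apply/hdegbP; case: s. Qed.

Lemma hdeg_eq m n x : m = n -> hd m x -> hd n x. Proof. by move->. Qed.

Lemma hdeg_sym a : hd 1 (mw_sym a).
Proof. exact: (@hdeg_gen _ (@mw_rel K) (@mw_deg K) (MWsym a)). Qed.
Lemma hdeg_meta : hd (-1) eta.
Proof. exact: (@hdeg_gen _ (@mw_rel K) (@mw_deg K) MWeta). Qed.
Lemma hdeg_etaX j : hd (- j%:Z) (eta ^+ j).
Proof.
elim: j => [|j IH]; first by rewrite expr0; apply: hdeg1.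
by rewrite exprS; apply: hdeg_eq (hdegM hdeg_meta IH); lia.
Qed.
Lemma hdeg_prod us : hd (size us)%:Z (\prod_(u <- us) mw_sym u).
Proof.
elim: us => [|u us IH]; first by rewrite big_nil; apply: hdeg1.
by rewrite big_cons; apply: hdeg_eq (hdegM (hdeg_sym u) IH) => /=; lia.
Qed.
Lemma hdeg_angle a : hd 0 (mw_angle a).
Proof.
apply: hdegD; first exact: hdeg1.
by apply: hdeg_eq (hdegM hdeg_meta (hdeg_sym a)).
Qed.
Lemma hdegM0 n x y : hd 0 x -> hd n y -> hd n (x * y).
Proof. by move=> hx hy; apply: hdeg_eq (hdegM hx hy); rewrite add0r. Qed.
Lemma hdeg_sum n (I : Type) (r : seq I) (F : I -> KMWring K) :
  (forall i, hd n (F i)) -> hd n (\sum_(i <- r) F i).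
Proof.
move=> h; elim: r => [|i r IH]; first by rewrite big_nil; apply: hdeg0.
by rewrite big_cons; apply: hdegD.
Qed.
Lemma hdeg_neps m : hd 0 (mw_neps K m).
Proof.
have he : hd 0 (mw_eps K) by apply: hdegN; apply: hdeg_angle.
have hX n : hd 0 ((- mw_eps K) ^+ n).
  elim: n => [|n IH]; first by rewrite expr0; apply: hdeg1.
  by rewrite exprS; apply: hdegM0 => //; apply: hdegN.
have hS n : hd 0 (\sum_(i < n) (- mw_eps K) ^+ i) by apply: hdeg_sum => i; apply: hX.
by case: m => n; [apply: hS|apply: hdegM0].
Qed.

Lemma eta_comm x : eta * x = x * eta.
Proof.
elim/pring_ind: x => [||x e|x y ex ey|x y ex ey|[a|]].
- by rewrite mulr0 mul0r.
- by rewrite mulr1 mul1r.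
- by rewrite mulrN mulNr e.
- by rewrite mulrDr mulrDl ex ey.
- by rewrite mulrA ex -mulrA ey mulrA.
- exact: eta_sym.
- by [].
Qed.

Lemma etaX_comm j x : eta ^+ j * x = x * eta ^+ j.
Proof.
elim: j => [|j IH]; first by rewrite !expr0 mul1r mulr1.
by rewrite exprS -mulrA IH mulrA eta_comm -mulrA.
Qed.

Definition mono j (us : seq K) : KMWring K := eta ^+ j * \prod_(u <- us) mw_sym u.

Lemma hdeg_mono j us : hd ((size us)%:Z - j%:Z) (mono j us).
Proof. by apply: hdeg_eq (hdegM (hdeg_etaX j) (hdeg_prod us)); lia. Qed.

Inductive span (n : int) : KMWring K -> Prop :=
| span0 : span n 0
| spanN x : span n x -> span n (- x)
| spanD x y : span n x -> span n y -> span n (x + y)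
| span_mono j us : n = (size us)%:Z - j%:Z -> (forall u, u \in us -> u != 0) ->
    span n (mono j us).

Lemma spanM m n x y : span m x -> span n y -> span (m + n) (x * y).
Proof.
move=> hx hy; elim: hx => [|x' _ IH|x1 x2 _ IH1 _ IH2|j us em u0].
- by rewrite mul0r; apply: span0.
- by rewrite mulNr; apply: spanN.
- by rewrite mulrDl; apply: spanD.
elim: hy => [|x' _ IH|x1 x2 _ IH1 _ IH2|l vs en v0].
- by rewrite mulr0; apply: span0.
- by rewrite mulrN; apply: spanN.
- by rewrite mulrDr; apply: spanD.
have -> : mono j us * mono l vs = mono (j + l) (us ++ vs).
  rewrite /mono exprD -!mulrA; congr (_ * _).
  by rewrite mulrA -etaX_comm -mulrA big_cat.
apply: span_mono => [|u]; first by rewrite size_cat em en; lia.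
by rewrite mem_cat => /orP[/u0|/v0].
Qed.

(** Since [eta] commutes with symbols, its powers can be collected in front of each monomial; the
    symbol of 0 is 0, so only units occur. *)
Lemma hdeg_span n x : hd n x -> span n x.
Proof.
elim=> {n x} [n||[a|]|n x _ IH|n x y _ IHx _ IHy|m n x y _ IHx _ IHy].
- exact: span0.
- have -> : 1 = mono 0 [::] by rewrite /mono expr0 mul1r big_nil.
  by apply: span_mono.
- rewrite -/(mw_sym a) /=; have [->|a0] := eqVneq a 0.
    by rewrite mw_sym0; apply: span0.
  have -> : mw_sym a = mono 0 [:: a] by rewrite /mono expr0 mul1r big_seq1.
  by apply: span_mono => // u; rewrite inE => /eqP->.
- have -> : prgen (@mw_rel K) MWeta = mono 1 [::] by rewrite /mono expr1 big_nil mulr1.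
  by apply: span_mono.
- exact: spanN.
- exact: spanD.
- exact: spanM.
Qed.
End Homogeneous.
Arguments kmw {K} n x.

Section Twisted.
Variables (K : fieldType) (L : lmodType K).

Lemma tens0l n (l : L) : tens (0 : KMW K n) l = 0.
Proof. by have := tensD (0 : KMW K n) 0 l; rewrite addr0 -{1}[tens 0 l]addr0 => /addrI. Qed.
Lemma tensN n (s : KMW K n) (l : L) : tens (- s) l = - tens s l.
Proof. by apply/eqP; rewrite -addr_eq0 -tensD addNr tens0l. Qed.

Lemma tens_scale n (s : KMW K n) (u : K) (l : L) : u != 0 ->
  tens s (u *: l) = tens (kmw n (mw_angle u * val s)) l.
Proof.
move=> u0; apply/esym/tensA => //; apply: val_kmw.
by apply: hdegM0; [exact: hdeg_angle|exact: hdeg_val].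
Qed.

Lemma tens_line_ind n (l0 : L) (P : KMWt L n -> Prop) :
  (forall l : L, l != 0 -> exists2 u, u != 0 & l = u *: l0) ->
  P 0 -> (forall x, P x -> P (- x)) -> (forall x y, P x -> P y -> P (x + y)) ->
  (forall s, P (tens s l0)) -> forall x, P x.
Proof.
move=> hl P0 PN PD Pl; apply: pgroup_ind => // -[s l]; rewrite -/(tens s l).
have [->|l0'] := eqVneq l 0; first by rewrite tens0.
by have [u u0 ->] := hl l l0'; rewrite tens_scale.
Qed.

Lemma tens_ind n (l0 : L) (P : KMWt L n -> Prop) :
  (forall l : L, l != 0 -> exists2 u, u != 0 & l = u *: l0) ->
  P 0 -> (forall x, P x -> P (- x)) -> (forall x y, P x -> P y -> P (x + y)) ->
  (forall j us s, n = (size us)%:Z - j%:Z -> (forall u, u \in us -> u != 0) ->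
     val s = mono j us -> P (tens s l0)) ->
  forall x, P x.
Proof.
move=> hl P0 PN PD Pm; apply: (tens_line_ind hl) => // s.
have [x hx] : exists x, x = val s by exists (val s).
have := hdeg_span (hdeg_val s); rewrite -hx => sp.
elim: sp s hx => [|x' sx IH|x1 x2 s1 IH1 s2 IH2|j us en u0] s hx.
- by have -> : s = 0 by [apply: val_inj]; rewrite tens0l.
- rewrite -[s]opprK tensN; apply: PN; apply: IH.
  by rewrite /= -hx opprK.
- have h1 : hdeg (@mw_deg K) n x1 /\ hdeg (@mw_deg K) n x2.
    have h y : span n y -> hdeg (@mw_deg K) n y.
      elim=> [|x'' _ h|y1 y2 _ ? _ ?|j us -> _]; [exact: hdeg0|exact: hdegN|exact: hdegD|exact: hdeg_mono].
    by split; apply: h.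
  have -> : s = kmw n x1 + kmw n x2.
    by apply: val_inj; rewrite /= -hx !val_kmw //; case: h1.
  by rewrite tensD; apply: PD; [apply: IH1|apply: IH2]; rewrite val_kmw //; case: h1.
- by apply: Pm en u0 _.
Qed.

Lemma mu_tw_tens n (s : KMW K n) (l : L) : mu_tw (tens s l) = mu_ring L (val s) (wline l).
Proof. exact: mu_twE. Qed.

Lemma modeta_twE n (s : KMW K n) (l : L) : l != 0 -> modeta_tw (tens s l) = modeta s.
Proof.
move=> l0; rewrite [LHS](pglift_gen (@modeta_tw_rel K L n)) /modeta_tw_gen /=.
by rewrite (negPf l0).
Qed.

Lemma eta_twE n (s : KMW K n) (l : L) : eta_tw (tens s l) = tens (eta_mul s) l.
Proof. exact: (pglift_gen (@eta_tw_rel K L n)). Qed.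

Lemma mu_tw_eta n (y : KMWt L n) : mu_tw (eta_tw y) = - mu_tw y.
Proof.
elim/pgroup_ind: y => [|x e|x y ex ey|[s l]].
- by rewrite !raddf0.
- by rewrite !raddfN /= e.
- by rewrite !raddfD /= ex ey.
rewrite -/(tens s l) eta_twE !mu_tw_tens /= rmorphM /= -/(mw_eta K) (mu_eta L).
by [].
Qed.

Lemma modeta_eta (x : KMWring K) : modeta_ring (mw_eta K * x) = 0 :> KMring K.
Proof. by rewrite rmorphM /= [X in X * _](prlift_gen (@modeta_rel K) MWeta) mul0r. Qed.

Lemma modeta_tw_eta n (y : KMWt L n) : modeta_tw (eta_tw y) = 0.
Proof.
elim/pgroup_ind: y => [|x e|x y ex ey|[s l]].
- by rewrite !raddf0.
- by rewrite !raddfN /= e oppr0.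
- by rewrite !raddfD /= ex ey addr0.
rewrite -/(tens s l) eta_twE; have [->|l0] := eqVneq l 0; first by rewrite tens0 raddf0.
by rewrite modeta_twE //; apply: val_inj; rewrite /= modeta_eta.
Qed.

(** On Witt groups [<-1>] acts as -1, hence [eps] as 1, and [m_eps] is an alternating sum of 1 and
    -1 that retains only the parity of [m]. *)
Lemma mu_neps m : mu_ring L (mw_neps K m) = (odd `|m|%N)%:R.
Proof.
have mue : mu_ring L (mw_eps K) = 1.
  rewrite rmorphN /= [X in - X]mu_angle; have := wscaleN1 L => /eqP.
  by rewrite addr_eq0 => /eqP ->.
have mS n : mu_ring L (\sum_(i < n) (- mw_eps K) ^+ i) = (odd n)%:R.
  elim: n => [|n IH]; first by rewrite big_ord0 rmorph0.
  rewrite big_ord_recr rmorphD rmorphXn rmorphN /= mue IH.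
  by rewrite -signr_odd; case: (odd n); rewrite /= ?subrr ?expr0 ?add0r // expr1 subrr.
by case: m => n; rewrite /mw_neps ?rmorphM /= ?mue ?mul1r mS.
Qed.
End Twisted.

Section ModuloEta.
Variable K : fieldType.
Local Notation hd := (hdeg (@mw_deg K)).
Local Notation eta := (mw_eta K).
Local Notation "[[ a ]]" := (mw_sym a).
Implicit Types (x y z w : KMWring K).

Definition eta_cong n x y := exists2 z, hd (n + 1) z & x = y + eta * z.

Lemma eta_cong_refl n x : eta_cong n x x.
Proof. by exists 0; [exact: hdeg0|rewrite mulr0 addr0]. Qed.
Lemma eta_cong_sym n x y : eta_cong n x y -> eta_cong n y x.
Proof.
case=> z h ->; exists (- z); first exact: hdegN.
by rewrite mulrN addrK.
Qed.
Lemma eta_cong_trans n x y z : eta_cong n x y -> eta_cong n y z -> eta_cong n x z.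
Proof.
case=> a ha -> [b hb ->]; exists (b + a); first exact: hdegD.
by rewrite mulrDr addrA.
Qed.
Lemma eta_congD n x y x' y' : eta_cong n x y -> eta_cong n x' y' ->
  eta_cong n (x + x') (y + y').
Proof.
case=> a ha -> [b hb ->]; exists (a + b); first exact: hdegD.
by rewrite mulrDr addrACA.
Qed.
Lemma eta_congMl a n w x y : hd a w -> eta_cong n x y -> eta_cong (a + n) (w * x) (w * y).
Proof.
move=> hw [z hz ->]; exists (w * z); first by rewrite -addrA; apply: hdegM.
by rewrite mulrDr (mulrA w) -eta_comm mulrA.
Qed.
Lemma eta_congMr a n w x y : hd a w -> eta_cong n x y -> eta_cong (n + a) (x * w) (y * w).
Proof.
move=> hw [z hz ->]; exists (z * w); last by rewrite mulrDl mulrA.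
by apply: hdeg_eq (hdegM hz hw); rewrite addrAC.
Qed.

Lemma eta_cong_mul a b : a != 0 -> b != 0 -> eta_cong 1 [[a * b]] ([[a]] + [[b]]).
Proof.
move=> a0 b0; exists ([[a]] * [[b]]); last by rewrite mw_symM.
exact: hdegM (hdeg_sym a) (hdeg_sym b).
Qed.
Lemma eta_cong_1 : eta_cong 1 [[1]] 0.
Proof.
have := @eta_cong_mul 1 1 (oner_neq0 _) (oner_neq0 _); rewrite mulr1 => -[z hz e].
exists (- z); first exact: hdegN.
rewrite add0r mulrN; apply/eqP; rewrite -addr_eq0 -(inj_eq (addrI [[1]])) addr0 addrA.
by rewrite -e.
Qed.
Lemma eta_cong_inv a : a != 0 -> eta_cong 1 [[a^-1]] (- [[a]]).
Proof.
move=> a0; have := eta_cong_mul a0 (invr_neq0 a0); rewrite divff // => /eta_cong_sym h.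
have := eta_congD (eta_cong_refl 1 (- [[a]])) (eta_cong_trans h eta_cong_1).
by rewrite addKr addr0.
Qed.

(** The identity [- a = (1 - a) / (1 - a^-1)] reduces [[a][-a]] to two Steinberg relations, symbols
    being additive modulo [eta]. *)
Lemma eta_cong_neg a : a != 0 -> eta_cong 2 ([[a]] * [[- a]]) 0.
Proof.
move=> a0; have ha := hdeg_sym a.
have [->|a1] := eqVneq a 1.
  by have := eta_congMr (hdeg_sym (- 1)) eta_cong_1; rewrite mul0r.
have v0 : a^-1 != 0 by apply: invr_neq0.
have b0 : 1 - a != 0 by rewrite subr_eq0 eq_sym.
have v1 : a^-1 != 1 by rewrite invr_eq1.
have c0 : 1 - a^-1 != 0 by rewrite subr_eq0 eq_sym.
have -> : - a = (1 - a) * (1 - a^-1)^-1 by field; rewrite ?a0 // subr_eq0.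
have h1 := eta_congD (eta_cong_refl 1 [[1 - a]]) (eta_cong_inv c0).
have h2 := eta_congMl ha (eta_cong_trans (eta_cong_mul b0 (invr_neq0 c0)) h1).
apply: eta_cong_trans h2 _; rewrite mulrDr mw_sym_steinberg // add0r mulrN.
have h3 := eta_congMr (hdeg_sym (1 - a^-1)) (eta_cong_inv a0).
move: h3; rewrite mw_sym_steinberg // mulNr => /eta_cong_sym h3.
exact: h3.
Qed.

(** Modulo [eta], expanding the vanishing product [[ab][-ab]] leaves [[a][b] + [b][a]]. *)
Lemma eta_cong_anti a b : a != 0 -> b != 0 -> eta_cong 2 ([[a]] * [[b]]) (- ([[b]] * [[a]])).
Proof.
move=> a0 b0; have na0 : - a != 0 by rewrite oppr_eq0.
have nb0 : - b != 0 by rewrite oppr_eq0.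
have ab0 : a * b != 0 by rewrite mulf_neq0.
have nab0 : - (a * b) != 0 by rewrite oppr_eq0.
have h0 := eta_congMr (hdeg_sym (- (a * b))) (eta_cong_mul a0 b0).
rewrite mulrDl in h0.
have h1 : eta_cong 2 ([[a]] * [[- (a * b)]]) ([[a]] * [[b]]).
  have := eta_congMl (hdeg_sym a) (eta_cong_mul na0 b0); rewrite mulNr mulrDr => h.
  apply: eta_cong_trans h _; have := eta_congD (eta_cong_neg a0) (eta_cong_refl 2 ([[a]] * [[b]])).
  by rewrite add0r.
have h2 : eta_cong 2 ([[b]] * [[- (a * b)]]) ([[b]] * [[a]]).
  have := eta_congMl (hdeg_sym b) (eta_cong_mul a0 nb0); rewrite mulrN mulrDr => h.
  apply: eta_cong_trans h _; have := eta_congD (eta_cong_refl 2 ([[b]] * [[a]])) (eta_cong_neg b0).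
  by rewrite addr0.
have h3 := eta_cong_trans (eta_cong_sym (eta_congD h1 h2)) (eta_cong_trans (eta_cong_sym h0) (eta_cong_neg ab0)).
have := eta_congD h3 (eta_cong_refl 2 (- ([[b]] * [[a]]))).
by rewrite addrK add0r.
Qed.

Lemma eta_cong_sq a : a != 0 -> eta_cong 2 ([[a]] * [[a]]) (- ([[a]] * [[-1]])).
Proof.
move=> a0; have n0 : -1 != 0 :> K by rewrite oppr_eq0 oner_eq0.
have := eta_congMl (hdeg_sym a) (eta_cong_mul n0 a0); rewrite mulN1r mulrDr => /eta_cong_sym h.
have := eta_congD (eta_cong_refl 2 (- ([[a]] * [[-1]]))) (eta_cong_trans h (eta_cong_neg a0)).
by rewrite addKr addr0.
Qed.

Section NormalForm.
Variables (U : K -> Prop) (pi : K).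
Hypotheses (U0 : forall u, U u -> u != 0) (UN1 : U (-1)) (pi0 : pi != 0).

(** [nf_eta] makes this a normal form modulo [eta] only *)
Inductive normal_form (n : int) : KMWring K -> Prop :=
| nf0 : normal_form n 0
| nfN x : normal_form n x -> normal_form n (- x)
| nfD x y : normal_form n x -> normal_form n y -> normal_form n (x + y)
| nf_eta z : hd (n + 1) z -> normal_form n (eta * z)
| nf_unif us : n = (size us).+1%:Z -> (forall u, u \in us -> U u) ->
    normal_form n ([[pi]] * \prod_(u <- us) [[u]])
| nf_unit us : n = (size us)%:Z -> (forall u, u \in us -> U u) ->
    normal_form n (\prod_(u <- us) [[u]]).

Lemma nf_cong n x y : eta_cong n x y -> normal_form n y -> normal_form n x.
Proof. by case=> z hz -> h; apply: nfD => //; apply: nf_eta. Qed.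

Lemma nf_hdeg n x : normal_form n x -> hd n x.
Proof.
elim=> {x} [|x _ h|x y _ hx _ hy|z hz|us -> _|us -> _].
- exact: hdeg0.
- exact: hdegN.
- exact: hdegD.
- by apply: hdeg_eq (hdegM (hdeg_meta K) hz); rewrite addrC addrK.
- by rewrite -add1n PoszD; apply: hdegM (hdeg_sym pi) (hdeg_prod us).
- exact: hdeg_prod.
Qed.

Lemma nf_unit_mul u n x : U u -> normal_form n x -> normal_form (1 + n) ([[u]] * x).
Proof.
move=> Uu; elim=> {x} [|x _ h|x y _ hx _ hy|z hz|us en Us|us en Us].
- by rewrite mulr0; apply: nf0.
- by rewrite mulrN; apply: nfN.
- by rewrite mulrDr; apply: nfD.
- rewrite mulrA -eta_comm -mulrA; apply: nf_eta; rewrite -addrA.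
  exact: hdegM (hdeg_sym u) hz.
- have := eta_congMr (hdeg_prod us) (eta_cong_anti (U0 Uu) pi0).
  rewrite -mulrA mulNr => h; have -> : 1 + n = 2 + (size us)%:Z by rewrite en; lia.
  apply: nf_cong h _; apply: nfN; rewrite -mulrA -(big_cons _ _ u us xpredT) /=.
  by apply: nf_unif => [|v] /=; [lia|rewrite inE => /predU1P[->|/Us] //].
- rewrite -(big_cons _ _ u us xpredT) /=.
  by apply: nf_unit => [|v] /=; [rewrite en -add1n PoszD|rewrite inE => /predU1P[->|/Us] //].
Qed.

Lemma nf_unif_mul n x : normal_form n x -> normal_form (1 + n) ([[pi]] * x).
Proof.
elim=> {x} [|x _ h|x y _ hx _ hy|z hz|us en Us|us en Us].
- by rewrite mulr0; apply: nf0.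
- by rewrite mulrN; apply: nfN.
- by rewrite mulrDr; apply: nfD.
- rewrite mulrA -eta_comm -mulrA; apply: nf_eta; rewrite -addrA.
  exact: hdegM (hdeg_sym pi) hz.
- have := eta_congMr (hdeg_prod us) (eta_cong_sq pi0).
  rewrite -mulrA mulNr => h; have -> : 1 + n = 2 + (size us)%:Z by rewrite en; lia.
  apply: nf_cong h _; apply: nfN; rewrite -mulrA -(big_cons _ _ (-1) us xpredT) /=.
  by apply: nf_unif => [|v] /=; [lia|rewrite inE => /predU1P[->|/Us] //].
- by apply: nf_unif => //; rewrite en; lia.
Qed.

Definition nf_stable a :=
  a != 0 /\ forall n x, normal_form n x -> normal_form (1 + n) ([[a]] * x).

Lemma nf_stableM a b : nf_stable a -> nf_stable b -> nf_stable (a * b).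
Proof.
move=> [a0 ha] [b0 hb]; split=> [|n x nx]; first by rewrite mulf_neq0.
apply: nf_cong (eta_congMr (nf_hdeg nx) (eta_cong_mul a0 b0)) _.
by rewrite mulrDl; apply: nfD; [apply: ha|apply: hb].
Qed.

Lemma nf_stableV a : nf_stable a -> nf_stable a^-1.
Proof.
move=> [a0 ha]; split=> [|n x nx]; first by rewrite invr_neq0.
apply: nf_cong (eta_congMr (nf_hdeg nx) (eta_cong_inv a0)) _.
by rewrite mulNr; apply/nfN/ha.
Qed.

Lemma nf_stable_unit u : U u -> nf_stable u.
Proof. by move=> Uu; split=> [|n x]; [exact: U0|exact: nf_unit_mul]. Qed.

Lemma nf_stable_frac u m : U u -> nf_stable (u * pi ^ m).
Proof.
move=> Uu; have hX j : nf_stable (u * pi ^+ j).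
  elim: j => [|j IH]; first by rewrite expr0 mulr1; apply: nf_stable_unit.
  by rewrite exprSr mulrA; apply: nf_stableM => //; split=> //; apply: nf_unif_mul.
case: m => j; first exact: hX.
rewrite NegzE -exprnN; elim: {j}j.+1 => [|j IH].
  by rewrite expr0 invr1 mulr1; apply: nf_stable_unit.
rewrite exprS invfM [_^-1 * _]mulrC mulrA; apply: nf_stableM => //.
by apply: nf_stableV; split=> //; apply: nf_unif_mul.
Qed.

(** Modulo [eta], the symbol of [u * pi ^ m] is a combination of [[u]] and [[pi]]. Anticommutation
    brings [[pi]] to the front and [[pi][pi]] becomes [- [pi][-1]], which is why -1 must belong to
    [U]; monomials containing [eta] are of the third kind from the start. *)
Lemma normal_formP n x : (forall f : K, f != 0 -> exists u m, U u /\ f = u * pi ^ m) ->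
  hd n x -> normal_form n x.
Proof.
move=> hU hx.
elim: (hdeg_span hx) => {x hx} [|x _ h|x y _ hx _ hy|j us en u0].
- exact: nf0.
- exact: nfN.
- exact: nfD.
case: j en => [|j] en.
  rewrite /mono expr0 mul1r {n}en subr0.
  elim: us u0 => [|u us IH] u0.
    by apply: nf_unit => //; rewrite big_nil.
  rewrite big_cons /=; have [v [m [Uv eu] ] ] := hU u (u0 u (mem_head _ _)).
  have -> : (size us).+1%:Z = 1 + (size us)%:Z by lia.
  rewrite eu; apply: (nf_stable_frac m Uv).2; apply: IH => w wi.
  by apply: u0; rewrite inE wi orbT.
rewrite /mono exprS -mulrA; apply: nf_eta.
by rewrite en -[j.+1]addn1 PoszD opprD addrA subrK; apply: hdeg_mono.
Qed.
End NormalForm.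
End ModuloEta.

(** * Residues *)

Lemma hdeg_milnor_neg (K : fieldType) n (x : KMring K) :
  hdeg (@m_deg K) n x -> n < 0 -> x = 0.
Proof.
elim=> {n x} // [n x _ IH|n x y _ IHx _ IHy|m n x y _ IHx _ IHy] n0.
- by rewrite IH // oppr0.
- by rewrite IHx // IHy // addr0.
have [m0|m0] : m < 0 \/ n < 0 by lia.
  by rewrite IHx // mul0r.
by rewrite IHy // mulr0.
Qed.

Lemma mw_neps0 (K : fieldType) : mw_neps K 0 = 0.
Proof. exact: big_ord0. Qed.
Lemma mw_neps1 (K : fieldType) : mw_neps K 1 = 1.
Proof. by rewrite [LHS]big_ord1 expr0. Qed.

Lemma modeta_sym (K : fieldType) (a : K) : modeta_ring (mw_sym a) = milnor_sym a.
Proof. exact: (prlift_gen (@modeta_rel K) (MWsym a)). Qed.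
Lemma modeta_prod (K : fieldType) (T : Type) (us : seq T) (F : T -> K) :
  modeta_ring (\prod_(u <- us) mw_sym (F u)) = \prod_(u <- us) milnor_sym (F u).
Proof. by rewrite rmorph_prod; apply: eq_bigr => u _; exact: modeta_sym. Qed.

(** Computing [[1]] as the symbol of [(-1)(-1)] gives [h [-1]], which [eta] kills. *)
Lemma mw_angle1 (K : fieldType) : mw_angle 1 = 1 :> KMWring K.
Proof.
have n0 : -1 != 0 :> K by rewrite oppr_eq0 oner_eq0.
rewrite /mw_angle (_ : 1 = -1 * -1 :> K); last by rewrite mulrNN mulr1.
rewrite mw_symM // -[mw_sym (-1) + _]mulr2n.
have -> : mw_sym (-1) *+ 2 + mw_eta K * (mw_sym (-1) * mw_sym (-1)) =
    (1 + 1 + mw_eta K * mw_sym (-1)) * mw_sym (-1).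
  by rewrite !mulrDl mul1r mulrA.
by rewrite mulrA eta_hyp mul0r addr0.
Qed.

Section Residues.
Variables (k : fieldType) (x : closed_point k).
Local Notation ratfun := (ratfun k).
Local Notation pi := (pt_param x).
Local Notation diff := (pt_diff x).

Lemma pt_val_exprz (f : ratfun) (m : int) : f != 0 -> pt_val x (f ^ m) = pt_val x f * m.
Proof.
move=> f0; case: m => n; first by rewrite -exprnP pt_valX // -mulr_natr natz.
by rewrite NegzE -exprnN pt_valV ?expf_neq0 // pt_valX // -mulr_natr natz mulrN.
Qed.

Lemma pt_unit_frac (f : ratfun) : f != 0 ->
  pt_unit x (f * pi ^ (- pt_val x f)) /\ f = f * pi ^ (- pt_val x f) * pi ^ pt_val x f.
Proof.
move=> f0; have p0 := pt_param_neq0 x; have e0 := expfz_neq0 (- pt_val x f) p0.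
split; last by rewrite -mulrA -expfzDr // addNr expr0z mulr1.
split; first exact: (mulf_neq0 f0 e0).
by rewrite (pt_valM x f0 e0) (pt_val_exprz _ p0) (pt_paramE x).1 mul1r subrr.
Qed.

Lemma pt_unit_neq0 (u : ratfun) : pt_unit x u -> u != 0. Proof. by case. Qed.
Lemma pt_unitN1 : pt_unit x (-1).
Proof. by split; [rewrite oppr_eq0 oner_eq0|exact: pt_valN1]. Qed.
Lemma pt_unit1 : pt_unit x 1.
Proof. by split; [exact: oner_neq0|exact: pt_val1]. Qed.

Lemma pt_frac_unit (f : ratfun) : f != 0 -> exists u m, pt_unit x u /\ f = u * pi ^ m.
Proof.
move=> f0; have [Uu ef] := pt_unit_frac f0.
by exists (f * pi ^ (- pt_val x f)), (pt_val x f).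
Qed.

Lemma pt_uniformizer_param : pt_uniformizer x pi.
Proof. by split; [exact: pt_param_neq0|exact: (pt_paramE x).1]. Qed.

Lemma diffE : (diff : ratfun) / diff = 1.
Proof. exact: divff (pt_diff_neq0 x). Qed.
Lemma pt_unit_diff : pt_unit x ((diff : ratfun) / diff).
Proof. by rewrite diffE; apply: pt_unit1. Qed.

Lemma adjunction_base : adjunction pi diff (pt_base x).
Proof.
rewrite /adjunction diffE (divff (pt_param_neq0 x)) pt_red1 divr1.
exact: pt_baseE.
Qed.

Lemma pt_base_neq0 : pt_base x != 0.
Proof.
apply/eqP => e; have := pt_baseE x; rewrite e /pt_coordinate ocoord0E => /esym/eqP.
by rewrite oner_eq0.
Qed.

Lemma diff_generates (l : Omega_ratfun k) : l != 0 ->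
  exists2 u : ratfun, u != 0 & l = u *: diff.
Proof.
move=> l0; exists ((l : ratfun) / diff); first exact: (mulf_neq0 l0 (invr_neq0 (pt_diff_neq0 x))).
by apply/esym/(@divfK ratfun); exact: pt_diff_neq0.
Qed.

Lemma base_generates (l : omega (residue_inj x)) : l != 0 ->
  exists2 u, u != 0 & l = u *: pt_base x.
Proof.
move=> l0; exists (pt_coordinate l); last exact: pt_coordinate_eq.
by apply: contraNneq l0 => e; rewrite [l]pt_coordinate_eq e scale0r.
Qed.

Section MW.
Variable D : forall q : int, {additive KMWt (Omega_ratfun k) (q + 1) ->
                                   KMWt (omega (residue_inj x)) q}.
Hypothesis hD : mw_residue D.

Lemma residue_param q (m : int) (v : ratfun) (us : seq ratfun)
    (s : KMW ratfun (q + 1)) (s' : KMW (residue_field x) q) :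
  pt_unit x v -> (forall u, u \in us -> pt_unit x u) ->
  val s = mw_sym (v * pi ^ m) * \prod_(u <- us) mw_sym u ->
  val s' = mw_neps _ m * mw_angle (pt_red x v) * \prod_(u <- us) mw_sym (pt_red x u) ->
  D q (tens s diff) = tens s' (pt_base x).
Proof.
case: hD => _ h _ Uv Uus es es'.
exact: (h q m v pi us diff s s' (pt_base x) Uv pt_uniformizer_param Uus pt_unit_diff
  adjunction_base es es').
Qed.

(** In a nonempty product the first unit is read as [u * pi ^ 0], and [0_eps] is 0; the empty
    product is the last clause of [mw_residue]. *)
Lemma residue_units q (us : seq ratfun) (s : KMW ratfun (q + 1)) :
  (forall u, u \in us -> pt_unit x u) -> val s = \prod_(u <- us) mw_sym u ->
  D q (tens s diff) = 0.
Proof.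
case: us => [|u us] Us es.
  case: hD => _ _ h; apply: (h q s diff pt_unit_diff).
  by rewrite es big_nil.
rewrite -(tens0l q (pt_base x)); apply: (@residue_param q 0 u us).
- exact: Us (mem_head _ _).
- by move=> v vi; apply: Us; rewrite inE vi orbT.
- by rewrite expr0z mulr1 es big_cons.
- by rewrite mw_neps0 !mul0r.
Qed.

(** The lower degree is a variable [q'] with an equation, so that the clause on [eta] can be applied
    when the degrees agree only propositionally. *)
Lemma residue_eta q q' (s : KMW ratfun (q + 1)) (s' : KMW ratfun (q' + 1)) f :
  q' = q - 1 -> val s' = mw_eta ratfun * val s ->
  modeta_tw (D q' (tens s' f)) = 0 /\ mu_tw (D q' (tens s' f)) = - mu_tw (D q (tens s f)).
Proof.
move=> e es; subst q'; case: hD => h _ _; rewrite (h q s s' f es).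
by rewrite mu_tw_eta modeta_tw_eta.
Qed.

Section Milnor.
Variable DM : forall q : int, {additive KM ratfun (q + 1) -> KM (residue_field x) q}.
Hypothesis hDM : m_residue DM.

(** By the normal form it suffices to treat [[pi]] times units, where both residues are prescribed,
    products of units, where both vanish, and multiples of [eta], whose residues are again multiples
    of [eta]. *)
Lemma modeta_residue (q : int) (z : KMWt (Omega_ratfun k) (q + 1)) :
  modeta_tw (D q z) = DM q (modeta_tw z).
Proof.
apply: (@tens_line_ind _ (Omega_ratfun k) (q + 1) diff (fun z => modeta_tw (D q z) = DM q (modeta_tw z))
  diff_generates) z => [|z e|y z ey ez|s].
- by rewrite !raddf0.
- by rewrite !raddfN /= e.
- by rewrite !raddfD /= ey ez.
rewrite (@modeta_twE _ (Omega_ratfun k) _ s diff (pt_diff_neq0 x)).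
have [y hy] : exists y, y = val s by exists (val s).
have := normal_formP pt_unit_neq0 pt_unitN1 (pt_param_neq0 x) pt_frac_unit (hdeg_val s).
rewrite -hy => nf; elim: nf s hy => [|y' ny IH|y1 y2 n1 IH1 n2 IH2|w hw|us en Us|us en Us] s hy.
- by have -> : s = 0 by [apply: val_inj]; rewrite tens0l !raddf0 (_ : modeta 0 = 0) ?raddf0 //;
    apply: val_inj; rewrite /= raddf0.
- have e : modeta (- s) = - modeta s by apply: val_inj; rewrite /= raddfN.
  have es : y' = val (- s) by rewrite /= -hy opprK.
  by have := IH _ es; rewrite tensN e !raddfN => /oppr_inj.
- have h1 := nf_hdeg n1; have h2 := nf_hdeg n2.
  have -> : s = kmw _ y1 + kmw _ y2 by apply: val_inj; rewrite /= -hy !val_kmw.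
  rewrite tensD modetaD (raddfD (D q)) (raddfD (DM q)) raddfD /=.
  by congr (_ + _); [apply: IH1|apply: IH2]; rewrite val_kmw.
- pose s0 : KMW ratfun (q + 1 + 1) := kmw (q + 1 + 1) w.
  have es : val s = mw_eta ratfun * val s0 by rewrite val_kmw.
  have qq : q = (q + 1) - 1 by rewrite addrK.
  rewrite (residue_eta diff qq es).1; have -> : modeta s = 0.
    by apply: val_inj; rewrite /= -hy modeta_eta.
  by rewrite raddf0.
- pose y' := \prod_(u <- us) mw_sym (pt_red x u).
  have hy' : hdeg (@mw_deg _) q y'.
    rewrite /y' -(big_map (pt_red x) xpredT); apply: hdeg_eq (hdeg_prod _).
    by rewrite size_map; move: en; rewrite -addn1 PoszD => /addIr.
  rewrite (@residue_param q 1 1 us s (kmw q y')) //.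
  + rewrite (modeta_twE _ pt_base_neq0); apply/esym/(hDM (m := 1) (v := 1) (us := us)).
    * exact: pt_unit1.
    * exact: pt_uniformizer_param.
    * exact: Us.
    * rewrite mul1r /= -hy rmorphM /=; congr (_ * _); last exact: modeta_prod.
      exact: modeta_sym.
    * by rewrite /= [gpart_val _]val_kmw // modeta_prod.
  + exact: pt_unit1.
  + by rewrite mul1r.
  + by rewrite val_kmw // pt_red1 mw_neps1 mw_angle1 !mul1r.
- rewrite (residue_units Us) // raddf0; apply/esym.
  case: us en Us hy => [|u us] en Us hy.
    (* For the empty product [q] is -1, and Milnor K-theory vanishes in negative degrees. *)
    apply: val_inj; apply: (@hdeg_milnor_neg _ q); first by apply/hdegbP; case: (DM q _).
    by move: en => /=; lia.
  apply: (hDM (m := 0) (v := u) (us := us)).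
  + exact: Us (mem_head _ _).
  + exact: pt_uniformizer_param.
  + by move=> v vi; apply: Us; rewrite inE vi orbT.
  + rewrite expr0z mulr1 /= -hy big_cons rmorphM /=; congr (_ * _); last exact: modeta_prod.
    exact: modeta_sym.
  + by rewrite mulr0z.
Qed.
End Milnor.
End MW.
End Residues.

(** * Reciprocity for the Witt components of Milnor-Witt residues *)

Section WittReciprocity.
Variables (k : fieldType).
Local Notation ratfun := (ratfun k).
Variable D : forall (x : closed_point k) (q : int),
  {additive KMWt (Omega_ratfun k) (q + 1) -> KMWt (omega (residue_inj x)) q}.
Hypothesis hD : forall x, mw_residue (D x).

Lemma mu_residue_sym x (s : KMW ratfun (0 + 1)) (u : ratfun) : u != 0 ->
  val s = mw_sym u ->
  mu_tw (D x 0 (tens s (pt_diff x))) =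
  if odd `|pt_val x u|%N then wline (pt_red x u *: pt_base x) else 0.
Proof.
move=> u0 es; have [Uv eu] := pt_unit_frac x u0.
set m := pt_val x u in eu Uv *; set v := u * _ ^ _ in eu Uv.
have p0 := pt_param_neq0 x.
have ev : pt_red x v = pt_red x u.
  rewrite /v (pt_redM x u0 (expfz_neq0 _ p0)).
  suff -> : pt_red x (pt_param x ^ (- m)) = 1 by rewrite mulr1.
  case: (- m) => n; first by rewrite -exprnP (pt_redX _ _ p0) (pt_paramE x).2 expr1n.
  rewrite NegzE -exprnN (pt_redV _ (expf_neq0 _ p0)) (pt_redX _ _ p0) (pt_paramE x).2.
  by rewrite expr1n invr1.
pose y := mw_neps (residue_field x) m * mw_angle (pt_red x v).
have hy : hdeg (@mw_deg _) 0 y.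
  by apply: hdegM0; [apply: hdeg_neps|apply: hdeg_angle].
have es' : val s = mw_sym (v * pt_param x ^ m) * \prod_(w <- [::]) mw_sym w.
  by rewrite big_nil mulr1 -eu.
rewrite (@residue_param _ _ _ (hD x) 0 m v [::] s (kmw 0 y) Uv _ es').
- rewrite mu_tw_tens val_kmw // rmorphM /= -/(mu_ring _) mu_neps.
  have -> : mu_ring (omega (residue_inj x)) (mw_angle (pt_red x v)) (wline (pt_base x)) =
      wline (pt_red x u *: pt_base x).
    by rewrite -ev mu_angle (wscale_line _ (pt_red_neq0 x (pt_unit_neq0 Uv))).
  by case: (odd _).
- by [].
- by rewrite val_kmw // big_nil mulr1.
Qed.

Definition reciprocal q (z : KMWt (Omega_ratfun k) (q + 1)) :=
  exists r0 : seq (closed_point k), forall r, uniq r -> {subset r0 <= r} ->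
    \sum_(x <- r) pt_transfer (mu_tw (D x q z)) = 0.

Lemma reciprocal0 q : reciprocal (0 : KMWt (Omega_ratfun k) (q + 1)).
Proof. by exists [::] => r _ _; apply: big1 => x _; rewrite !raddf0. Qed.
Lemma reciprocalN q (z : KMWt (Omega_ratfun k) (q + 1)) : reciprocal z -> reciprocal (- z).
Proof.
case=> r0 h; exists r0 => r ur sr.
transitivity (- \sum_(x <- r) pt_transfer (mu_tw (D x q z))); last by rewrite h // oppr0.
by rewrite -sumrN; apply: eq_bigr => x _; rewrite !raddfN.
Qed.
Lemma reciprocalD q (z y : KMWt (Omega_ratfun k) (q + 1)) :
  reciprocal z -> reciprocal y -> reciprocal (z + y).
Proof.
case=> r0 h [r1 h']; exists (r0 ++ r1) => r ur sr.
transitivity (\sum_(x <- r) pt_transfer (mu_tw (D x q z)) +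
    \sum_(x <- r) pt_transfer (mu_tw (D x q y))).
  by rewrite -big_split; apply: eq_bigr => x _; rewrite !raddfD.
by rewrite h ?h' ?addr0 // => x xi; apply: sr; rewrite mem_cat xi ?orbT.
Qed.

(** Multiplication by [eta] only changes the sign of Witt classes. The equivalence, and not just one
    implication, is what allows passing to a lower degree and coming back. *)
Lemma reciprocal_eta q q' (s : KMW ratfun (q + 1)) (s' : KMW ratfun (q' + 1)) f :
  q' = q - 1 -> val s' = mw_eta ratfun * val s ->
  reciprocal (tens s f) <-> reciprocal (tens s' f).
Proof.
move=> e es.
have hs r : \sum_(x <- r) pt_transfer (mu_tw (D x q' (tens s' f))) =
    - \sum_(x <- r) pt_transfer (mu_tw (D x q (tens s f))).
  rewrite -sumrN; apply: eq_bigr => x _.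
  by rewrite (residue_eta (hD x) f e es).2 raddfN.
split=> -[r0 h]; exists r0 => r ur sr; first by rewrite hs h // oppr0.
by apply: oppr_inj; rewrite -hs h // oppr0.
Qed.

(** At each point [f] is [u] times the local generator, so the element is [<u>] tensored with that
    generator, and [<u> = 1 + eta [u]]. The residue of 1 vanishes, and that of [eta [u]] is, up to
    sign, the local term of [reciprocity]. *)
Lemma reciprocal_1 q (s : KMW ratfun (q + 1)) (f : ratfun) : q + 1 = 0 -> val s = 1 ->
  f != 0 -> reciprocal (tens s (f : Omega_ratfun k)).
Proof.
move=> q1 es f0; have [r0 h] := reciprocity f0.
have eq : q = 0 - 1 by rewrite -q1 addrAC addrK.
exists r0 => r ur sr; transitivity (- \sum_(x <- r) witt_term x f); last by rewrite h // oppr0.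
rewrite -sumrN; apply: eq_bigr => x _.
have d0 := pt_diff_neq0 x; pose u : ratfun := f / pt_diff x.
have u0 : u != 0 := mulf_neq0 f0 (invr_neq0 d0).
have ef : (f : Omega_ratfun k) = u *: pt_diff x by apply/esym/(@divfK ratfun).
have hs1 : hdeg (@mw_deg ratfun) (0 + 1) (mw_sym u) by exact: hdeg_sym.
have hs2 : hdeg (@mw_deg ratfun) (q + 1) (mw_eta ratfun * mw_sym u).
  by rewrite q1; apply: hdegM (hdeg_meta _) (hdeg_sym u).
rewrite [X in tens s X]ef tens_scale //.
have -> : kmw (q + 1) (mw_angle u * val s) = s + kmw (q + 1) (mw_eta ratfun * mw_sym u).
  apply: val_inj; rewrite /= [in RHS]val_kmw // es mulr1 val_kmw // q1.
  exact: hdeg_angle.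
rewrite tensD (raddfD (D x q)).
have -> : D x q (tens s (pt_diff x)) = 0.
  by case: (hD x) => _ _ h1; exact: (h1 q s _ (pt_unit_diff x) es).
have es2 : val (kmw (q + 1) (mw_eta ratfun * mw_sym u)) =
    mw_eta ratfun * val (kmw (0 + 1) (mw_sym u)) by rewrite !val_kmw.
rewrite add0r (residue_eta (hD x) _ eq es2).2.
rewrite (mu_residue_sym _ u0); last by rewrite val_kmw.
rewrite raddfN /witt_term -/u; congr (- _).
by case: ifP => // _; rewrite raddf0.
Qed.

Lemma mono_cons j u us : mono j.+1 (u :: us) = mw_angle u * mono j us - mono j us :> KMWring ratfun.
Proof.
rewrite /mw_angle mulrDl mul1r [X in X - _]addrC addrK /mono big_cons exprS -!mulrA.
by congr (_ * _); rewrite !mulrA; congr (_ * _); apply: etaX_comm.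
Qed.

Lemma reciprocal_etaX j q (s : KMW ratfun (q + 1)) (f : ratfun) : q + 1 = - j%:Z ->
  val s = mw_eta ratfun ^+ j -> f != 0 -> reciprocal (tens s (f : Omega_ratfun k)).
Proof.
move=> eq es f0; elim: j q s eq es => [|j IH] q s eq es.
  exact: (reciprocal_1 eq es f0).
have eq' : q + 1 + 1 = - j%:Z by rewrite eq -[j.+1]addn1 PoszD opprD subrK.
have hs : hdeg (@mw_deg ratfun) (q + 1 + 1) (mw_eta ratfun ^+ j).
  by rewrite eq'; apply: hdeg_etaX.
pose s0 : KMW ratfun (q + 1 + 1) := kmw _ (mw_eta ratfun ^+ j).
have es0 : val s = mw_eta ratfun * val s0 by rewrite val_kmw // -exprS.
have qq : q = q + 1 - 1 by rewrite addrK.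
apply/(reciprocal_eta f qq es0); exact: IH eq' (val_kmw hs).
Qed.

(** With at least as many factors [eta] as symbols, each symbol disappears through [eta [u] = <u> -
    1]; the action of [<u>] turns [f] into [u * f], and only powers of [eta] remain. *)
Lemma reciprocal_mono_le us j q (s : KMW ratfun (q + 1)) (f : ratfun) : (size us <= j)%N ->
  q + 1 = (size us)%:Z - j%:Z -> (forall u, u \in us -> u != 0) ->
  val s = mono j us -> f != 0 -> reciprocal (tens s (f : Omega_ratfun k)).
Proof.
elim: us j f s => [|u us IH] j f s.
  move=> _ eq _ es f0; apply: (@reciprocal_etaX j) => //; first by rewrite eq sub0r.
  by rewrite es /mono big_nil mulr1.
case: j => // j lj eq us0 es f0; have u0 : u != 0 by exact: us0 (mem_head _ _).
have eq' : q + 1 = (size us)%:Z - j%:Z.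
  by rewrite eq /= -[(size us).+1]addn1 -[j.+1]addn1 !PoszD opprD addrACA subrr addr0.
have us0' v : v \in us -> v != 0 by move=> vi; apply: us0; rewrite inE vi orbT.
have hs : hdeg (@mw_deg ratfun) (q + 1) (mono j us) by rewrite eq'; apply: hdeg_mono.
pose s0 : KMW ratfun (q + 1) := kmw _ (mono j us).
have es0 : val s0 = mono j us by apply: val_kmw.
have hsa : hdeg (@mw_deg ratfun) (q + 1) (mw_angle u * val s0).
  by rewrite es0; apply: hdegM0 => //; apply: hdeg_angle.
have -> : s = kmw (q + 1) (mw_angle u * val s0) - s0.
  apply: val_inj; rewrite /= es mono_cons; congr (_ - _); last exact: esym es0.
  by rewrite -es0; exact: esym (val_kmw hsa).
rewrite tensD tensN -tens_scale //; apply: reciprocalD.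
  exact: (IH j (u * f) s0 lj eq' us0' es0 (mulf_neq0 u0 f0)).
by apply: reciprocalN; exact: (IH j f s0 lj eq' us0' es0 f0).
Qed.

(** The number [d] bounds how many factors [eta] are missing for [reciprocal_mono_le]; they are
    supplied one at a time. *)
Lemma reciprocal_mono d us j q (s : KMW ratfun (q + 1)) (f : ratfun) : (size us <= j + d)%N ->
  q + 1 = (size us)%:Z - j%:Z -> (forall u, u \in us -> u != 0) ->
  val s = mono j us -> f != 0 -> reciprocal (tens s (f : Omega_ratfun k)).
Proof.
elim: d j q s => [|d IH] j q s.
  by rewrite addn0; exact: reciprocal_mono_le.
rewrite addnS -addSn => sj eq us0 es f0.
have eq' : q - 1 + 1 = (size us)%:Z - j.+1%:Z.
  by rewrite addrAC eq -[j.+1]addn1 PoszD opprD addrA.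
have hs : hdeg (@mw_deg ratfun) (q - 1 + 1) (mono j.+1 us) by rewrite eq'; apply: hdeg_mono.
have es' : val (kmw (q - 1 + 1) (mono j.+1 us)) = mw_eta ratfun * val s.
  by rewrite val_kmw // es /mono exprS mulrA.
apply/(reciprocal_eta f (erefl _) es').
exact: (IH j.+1 _ _ sj eq' us0 (val_kmw hs) f0).
Qed.

Theorem witt_reciprocity q (z : KMWt (Omega_ratfun k) (q + 1)) : reciprocal z.
Proof.
have h1 : (1 : ratfun) != 0 := oner_neq0 _.
have gen (l : Omega_ratfun k) : l != 0 -> exists2 u : ratfun, u != 0 & l = u *: (1 : Omega_ratfun k).
  by move=> l0; exists l => //; apply/esym/(@mulr1 ratfun).
apply: (@tens_ind _ (Omega_ratfun k) (q + 1) (1 : ratfun) (@reciprocal q) gen).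
- exact: reciprocal0.
- exact: reciprocalN.
- exact: reciprocalD.
move=> j us s eq us0 es; exact: (@reciprocal_mono (size us) us j q s 1 (leq_addl _ _) eq us0 es h1).
Qed.
End WittReciprocity.

(** * Induction on the degree of the points *)

Section ResidueMono.
Variables (k : fieldType) (x : closed_point k).
Local Notation ratfun := (ratfun k).
Variable D : forall q : int, {additive KMWt (Omega_ratfun k) (q + 1) ->
                                   KMWt (omega (residue_inj x)) q}.
Hypothesis hD : mw_residue D.

Lemma residue_mono j q (m : int) (v : ratfun) (us : seq ratfun)
    (s : KMW ratfun (q + 1)) (s' : KMW (residue_field x) q) :
  q = (size us)%:Z - j%:Z ->
  pt_unit x v -> (forall u, u \in us -> pt_unit x u) ->
  val s = mono j (v * pt_param x ^ m :: us) ->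
  val s' = mw_neps _ m * (mw_angle (pt_red x v) * mono j (map (pt_red x) us)) ->
  D q (tens s (pt_diff x)) = tens s' (pt_base x).
Proof.
move=> + Uv Uus; elim: j q s s' => [|j IH] q s s' eq es es'.
  apply: (residue_param hD Uv Uus); first by rewrite es /mono expr0 mul1r big_cons.
  by rewrite es' /mono expr0 mul1r big_map mulrA.
(* Substituting [q1 - 1] for [q] gives the types exactly the shape of the clause of [mw_residue] on
   [eta]. *)
have [q1 q1E] : exists q1, q = q1 - 1 by exists (q + 1); rewrite addrK.
have eq1 : q1 = (size us)%:Z - j%:Z.
  by apply: (addIr (-1)); rewrite -q1E eq -[j.+1]addn1 PoszD opprD addrA.
clear eq; subst q.
have hs : hdeg (@mw_deg ratfun) (q1 + 1) (mono j (v * pt_param x ^ m :: us)).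
  apply: hdeg_eq (hdeg_mono j (v * pt_param x ^ m :: us)).
  by rewrite eq1 /= -[(size us).+1]addn1 PoszD addrAC.
have hm : hdeg (@mw_deg (residue_field x)) q1 (mono j (map (pt_red x) us)).
  by apply: hdeg_eq (hdeg_mono j (map (pt_red x) us)); rewrite eq1 size_map.
have hs' : hdeg (@mw_deg _) q1 (mw_neps _ m * (mw_angle (pt_red x v) * mono j (map (pt_red x) us))).
  by apply: hdegM0; [exact: hdeg_neps|apply: hdegM0; [exact: hdeg_angle|]].
have e1 : val s = mw_eta ratfun * val (kmw (q1 + 1) (mono j (v * pt_param x ^ m :: us))).
  by rewrite val_kmw // es /mono exprS mulrA.
case: (hD) => h _ _; rewrite (h _ _ _ _ e1) (IH _ _ (kmw q1 (mw_neps (residue_field x) m *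
  (mw_angle (pt_red x v) * mono j (map (pt_red x) us)))) eq1 (val_kmw hs) (val_kmw hs')).
rewrite eta_twE; congr tens; apply: val_inj; rewrite /= -/(val (kmw _ _)) (val_kmw hs').
rewrite es' /mono exprS -!mulrA.
by rewrite !mulrA [mw_eta _ * _]eta_comm -!mulrA; congr (_ * _); rewrite !mulrA eta_angle.
Qed.
End ResidueMono.

Section PointInduction.
Variables (k : fieldType) (q : int) (A : zmodType).
Local Notation ratfun := (ratfun k).
Local Notation tf := (@FracField.tofrac {poly k}).
Variable D : forall (x : closed_point k) (q : int),
  {additive KMWt (Omega_ratfun k) (q + 1) -> KMWt (omega (residue_inj x)) q}.
Hypothesis hD : forall x, mw_residue (D x).
Variable F : forall x : closed_point k, KMWt (omega (residue_inj x)) q -> A.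
Arguments F : clear implicits.
Hypothesis F_additive : forall x, zmod_morphism (F x).
Hypothesis F_inf : forall z, F None z = 0.
Hypothesis F_sum : forall s : KMWt (Omega_ratfun k) (q + 1),
  exists r0 : seq (closed_point k), forall r, uniq r -> {subset r0 <= r} ->
    \sum_(x <- r) F x (D x q s) = 0.

Let F0 x : F x 0 = 0. Proof. by rewrite -[X in F x X](subrr 0) F_additive subrr. Qed.
Let FN x z : F x (- z) = - F x z. Proof. by rewrite -[X in F x X]sub0r F_additive F0 sub0r. Qed.
Let FD x z y : F x (z + y) = F x z + F x y.
Proof. by rewrite -{1}[y]opprK F_additive FN opprK. Qed.

(** Every monomial at a point is, up to points of smaller degree, the only residue
    of a monomial in the same symbols and the one of the point *)
Lemma point_induction x z : F x z = 0.
Proof.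
case: x z => [p|] z; last exact: F_inf.
have [d] := ubnP (size (fp_poly p)); elim: d p z => // d IH p z sp.
apply: (@tens_ind _ (omega (residue_inj (Some p))) q (pt_base (Some p))
  (fun z => F (Some p) z = 0) (@base_generates _ _)) z => [|z e|z y ez ey|j us s eq us0 es].
- exact: F0.
- by rewrite FN e oppr0.
- by rewrite FD ez ey addr0.
(* The reduced representatives have degree less than [deg p], so they are units at every point of
   degree at least [deg p]. Besides [p], only points of smaller degree and infinity can then see a
   residue. *)
pose as_ : seq {poly k} := map (fun u : residue_field (Some p) => val (u : {poly %/ fp_poly p})) us.
have as0 a : a \in as_ -> a != 0 /\ (size a < size (fp_poly p))%N.
  case/mapP => u ui ->; split; last exact: size_residue.
  apply: contraNneq (us0 u ui) => e; apply/eqP/val_inj; rewrite e; exact: erefl.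
have undiv (y : finite_point k) a : (size (fp_poly p) <= size (fp_poly y))%N -> a \in as_ ->
    ~~ (fp_poly y %| a)%R.
  move=> py ai; have [a0 sa] := as0 a ai.
  by apply: contraL (leq_trans sa py) => /(dvdp_leq a0); rewrite -leqNgt.
have unit (y : finite_point k) u : (size (fp_poly p) <= size (fp_poly y))%N ->
    u \in map tf as_ -> pt_unit (Some y) u.
  move=> py /mapP[a ai ->]; split; first exact: (tf_neq0 (as0 a ai).1).
  exact: (pt_tofrac_unit (undiv y a py ai)).1.
pose f := tf (fp_poly p).
have ef : f = 1 * pt_param (Some p) ^ 1 by rewrite mul1r.
have hS : hdeg (@mw_deg ratfun) (q + 1) (mono j (f :: map tf as_)).
  apply: hdeg_eq (hdeg_mono j (f :: map tf as_)).
  by rewrite eq /= !size_map -[(size us).+1]addn1 PoszD addrAC.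
pose S : KMW ratfun (q + 1) := kmw (q + 1) (mono j (f :: map tf as_)).
have eS : val S = mono j (f :: map tf as_) := val_kmw hS.
have eq' : q = (size (map tf as_))%:Z - j%:Z by rewrite eq !size_map.
have Dp : D (Some p) q (tens S (1 : Omega_ratfun k)) = tens s (pt_base (Some p)).
  apply: (residue_mono (hD (Some p)) eq' (pt_unit1 (Some p)) (fun u => unit p u (leqnn _)) (m := 1)).
    by rewrite eS ef.
  rewrite es pt_red1 mw_angle1 mw_neps1 !mul1r; congr mono.
  rewrite -!map_comp -[LHS]map_id; apply/eq_in_map => u ui.
  have ai : val (u : {poly %/ fp_poly p}) \in as_ by apply: map_f.
  exact: etrans (esym (red_inj_val u)) (esym (pt_tofrac_unit (undiv p _ (leqnn _) ai)).2).
have Dy (y : finite_point k) : y != p -> (size (fp_poly p) <= size (fp_poly y))%N ->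
    D (Some y) q (tens S (1 : Omega_ratfun k)) = 0.
  move=> yp py; have pf : pt_unit (Some y) f.
    split; first exact: (tf_neq0 (fp_neq0 p)).
    exact: (pt_tofrac_unit (coprimep_ndvd (fp_coprime yp))).1.
  rewrite -(tens0l q (pt_base (Some y))).
  apply: (residue_mono (hD (Some y)) eq' pf (fun u => unit y u py) (m := 0)).
    by rewrite eS expr0z mulr1.
  by rewrite mw_neps0 mul0r.
have [r0 h] := F_sum (tens S (1 : Omega_ratfun k)).
have [r [ur pr sr]] : exists r, [/\ uniq r, Some p \in r & {subset r0 <= r}].
  exists (undup (Some p :: r0)); split; first exact: undup_uniq.
    by rewrite mem_undup mem_head.
  by move=> y yr; rewrite mem_undup inE yr orbT.
have := h r ur sr; rewrite (bigD1_seq (Some p)) //=.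
rewrite Dp big1 ?addr0 // => -[y|] yp; last exact: F_inf.
have [py|py] := leqP (size (fp_poly p)) (size (fp_poly y)).
  by rewrite (Dy y _ py) ?F0.
by apply: IH; apply: leq_trans py _; rewrite -ltnS.
Qed.
End PointInduction.

(** The difference of the two families vanishes at infinity and satisfies reciprocity for the common
    residues [D], so [point_induction] kills it. *)
Lemma point_agree (k : fieldType) (q : int) (A : zmodType)
    (D : forall (x : closed_point k) (q : int),
       {additive KMWt (Omega_ratfun k) (q + 1) -> KMWt (omega (residue_inj x)) q})
    (F G : forall x : closed_point k, {additive KMWt (omega (residue_inj x)) q -> A}) :
  (forall x, mw_residue (D x)) -> F None =1 G None ->
  (forall s, exists r0 : seq (closed_point k), forall r, uniq r -> {subset r0 <= r} ->
     \sum_(x <- r) F x (D x q s) = 0) ->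
  (forall s, exists r0 : seq (closed_point k), forall r, uniq r -> {subset r0 <= r} ->
     \sum_(x <- r) G x (D x q s) = 0) ->
  forall x z, F x z = G x z.
Proof.
move=> hD FG0 hF hG x z; apply/eqP; rewrite -subr_eq0; apply/eqP.
apply: (@point_induction k q A D hD (fun x z => F x z - G x z)) => [y a b|y|s].
- by rewrite !raddfB !opprK addrACA.
- by rewrite FG0 subrr.
have [r0 h0] := hF s; have [r1 h1] := hG s; exists (r0 ++ r1) => r ur sr.
by rewrite sumrB h0 ?h1 ?subr0 // => y yr; apply: sr; rewrite mem_cat yr ?orbT.
Qed.

(** The bridge between finitely supported sums over all points and sums over all sufficiently large
    lists, in which reciprocity is expressed. *)
Lemma fsum_eventually (T : choiceType) (V : zmodType) (A : set T) (f : T -> V) :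
  finite_set A -> (forall x, ~ A x -> f x = 0) ->
  exists r0 : seq T, forall r, uniq r -> {subset r0 <= r} ->
    \sum_(x <- r) f x = \sum_(x \in [set: T]%classic) f x.
Proof.
move=> /finite_seqP[r0 eA] fA; exists r0 => r ur sr.
rewrite fsbig_seq //; apply: fsbig_widen => // x /= [_ xr].
by apply: fA; rewrite eA /= => /sr.
Qed.

Lemma mu_is_zmod_morphism (K : fieldType) n : zmod_morphism (@mu K n).
Proof. by move=> s t; rewrite /mu rmorphB. Qed.
HB.instance Definition _ (K : fieldType) n :=
  GRing.isZmodMorphism.Build (KMW K n) (Witt K^o) (@mu K n) (@mu_is_zmod_morphism K n).

Lemma modeta_is_zmod_morphism (K : fieldType) n : zmod_morphism (@modeta K n).
Proof. by move=> s t; apply: val_inj; rewrite /= raddfB. Qed.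
HB.instance Definition _ (K : fieldType) n :=
  GRing.isZmodMorphism.Build (KMW K n) (KM K n) (@modeta K n) (@modeta_is_zmod_morphism K n).

Section PointTransfers.
Variables (k : fieldType) (q : int).
Variable T : forall x : closed_point k, {additive KMWt (omega (residue_inj x)) q -> KMW k q}.

Lemma KMW_map_id (K : fieldType) (s : KMW K q) : KMW_map idfun s = s.
Proof.
apply: val_inj; rewrite /=; elim/pring_ind: (gpart_val s) => [||x e|x y ex ey|x y ex ey|g].
- exact: rmorph0.
- exact: rmorph1.
- by rewrite rmorphN /= e.
- by rewrite rmorphD /= ex ey.
- by rewrite rmorphM /= ex ey.
- by apply: etrans (prlift_gen (mw_map_rel idfun) g) _; case: g.
Qed.

Lemma KMWt_inf_ind (P : KMWt (omega (residue_inj (None : closed_point k))) q -> Prop) :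
  P 0 -> (forall x, P x -> P (- x)) -> (forall x y, P x -> P y -> P (x + y)) ->
  (forall s l, l != 0 -> P (tens s l)) -> forall z, P z.
Proof.
move=> P0 PN PD Pt; apply: (tens_line_ind (@base_generates k None)) => // s.
exact: Pt (pt_base_neq0 None).
Qed.

Lemma inf_transfer_val s (l : omega (residue_inj (None : closed_point k))) :
  mw_point_transfers T -> l != 0 ->
  T None (tens s l) = kmw q (mw_angle (ocoord0 l) * val s).
Proof.
case=> h _ l0; apply: h => //; apply: val_kmw.
by apply: hdegM0; [exact: hdeg_angle|exact: hdeg_val].
Qed.

Lemma sum_transfers (A : zmodType) (V : closed_point k -> zmodType)
    (H : forall x, V x -> A) (z : forall x, V x) :
  (forall x, H x 0 = 0) -> finite_set [set x | z x != 0]%classic ->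
  \sum_(x \in [set: closed_point k]%classic) H x (z x) = 0 ->
  exists r0 : seq (closed_point k), forall r, uniq r -> {subset r0 <= r} ->
    \sum_(x <- r) H x (z x) = 0.
Proof.
move=> H0 fs es; have Hz x : ~ [set x | z x != 0]%classic x -> H x (z x) = 0.
  by move=> /= /negP; rewrite negbK => /eqP ->.
have [r0 h] := fsum_eventually fs Hz; exists r0 => r ur sr.
by rewrite (h r ur sr).
Qed.

(** Both families are tested against the residues [D] that come with [T]: reciprocity is part of the
    hypothesis on one side and [witt_reciprocity] on the other. At infinity both give the class of
    [<c> s], where [c] is the coordinate of [l]. *)
Theorem point_transfers_mu (x : closed_point k) z : mw_point_transfers T ->
  mu (T x z) = pt_transfer (mu_tw z).
Proof.
move=> hT; case: (hT) => _ [D [hD hs]].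
apply: (@point_agree k q _ D (fun x => @mu k q \o T x)
  (fun x => @pt_transfer k x \o @mu_tw _ (omega (residue_inj x)) q)) => //.
- elim/KMWt_inf_ind => [|y e|y1 y2 e1 e2|s l l0].
  + by rewrite !raddf0.
  + by rewrite !raddfN e.
  + by rewrite !raddfD e1 e2.
  have surj (e : k) : exists c, (residue_inj (None : closed_point k)) c = e by exists e.
  rewrite /= (inf_transfer_val s hT l0) /mu val_kmw; last first.
    by apply: hdegM0; [exact: hdeg_angle|exact: hdeg_val].
  rewrite -{2}(KMW_map_id s) /pt_transfer.
  rewrite (transfer_mu_tw _ (pt_trace (None : closed_point k)) surj) mu_tw_tens.
  have c0 : ocoord0 l != 0.
    by rewrite ocoord0E1 ocoord_eq0 //; exact: (pt_presentation (None : closed_point k)).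
  have -> : pt_trace None l = ocoord0 l *: (1 : k^o).
    by rewrite ocoord0E1; apply/esym/mulr1.
  have -> : mu_ring k^o (mw_angle (ocoord0 l) * val s) = mu_ring k^o (val s) * wscale k^o (ocoord0 l).
    by rewrite rmorphM mu_wscale; congr (_ * _); exact: mu_angle.
  by rewrite -(wscale_line _ c0).
- move=> s; have [fs es] := hs s.
  have [r0 h0] := sum_transfers (H := fun x => T x) (fun x => raddf0 (T x)) fs es.
  exists r0 => r ur sr; rewrite -[RHS](raddf0 (@mu k q)) -(h0 r ur sr) raddf_sum.
  exact: eq_bigr.
- by move=> s; have [r0 h] := witt_reciprocity hD s; exists r0 => r ur sr; exact: h.
Qed.

Variable TM : forall x : closed_point k, {additive KM (residue_field x) q -> KM k q}.

Theorem point_transfers_modeta (x : closed_point k) z :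
  mw_point_transfers T -> m_point_transfers TM ->
  modeta (T x z) = TM x (modeta_tw z).
Proof.
move=> hT hTM; case: (hT) => _ [D [hD hs]]; case: (hTM) => TM0 [DM [hDM hsM]].
apply: (@point_agree k q _ D (fun x => @modeta k q \o T x)
  (fun x => TM x \o @modeta_tw _ (omega (residue_inj x)) q)) => //.
- elim/KMWt_inf_ind => [|y e|y1 y2 e1 e2|s l l0].
  + by rewrite !raddf0.
  + by rewrite !raddfN e.
  + by rewrite !raddfD e1 e2.
  rewrite /= (inf_transfer_val s hT l0) TM0 modeta_twE //.
  apply: val_inj; rewrite /= val_kmw; last first.
    by apply: hdegM0; [exact: hdeg_angle|exact: hdeg_val].
  by rewrite rmorphM /= modeta_angle mul1r.
- move=> s; have [fs es] := hs s.
  have [r0 h0] := sum_transfers (H := fun x => T x) (fun x => raddf0 (T x)) fs es.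
  exists r0 => r ur sr; rewrite -[RHS](raddf0 (@modeta k q)) -(h0 r ur sr) raddf_sum.
  exact: eq_bigr.
- move=> s; have [fs es] := hsM (modeta_tw s).
  have [r0 h0] := sum_transfers (H := fun x => TM x) (fun x => raddf0 (TM x)) fs es.
  exists r0 => r ur sr; rewrite -[RHS](h0 r ur sr); apply: eq_bigr => y _.
  by rewrite /= (modeta_residue (hD y) (hDM y)).
Qed.
End PointTransfers.

(** * Monogenic extensions *)

Lemma surj_finite_ext (K E : fieldType) (phi : {rmorphism K -> E}) :
  (forall e, exists c, phi c = e) -> finite_ext phi.
Proof.
move=> /choice[psi hpsi]; exists 1%N, (fun v : 'rV[K]_1 => phi (v 0 0)); split.
  exists (fun c => const_mx (psi c)) => [v|c]; last by rewrite mxE.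
  by apply/rowP => i; rewrite ord1 mxE; apply: (fmorph_inj phi).
by move=> c v w; rewrite !mxE rmorphD rmorphM.
Qed.

Lemma iso_finite_ext (k K E : fieldType) (i : {rmorphism k -> K}) (phi : {rmorphism K -> E})
    (i' : {rmorphism k -> E}) :
  (forall c, i' c = phi (i c)) -> (forall e, exists c, phi c = e) ->
  finite_ext i -> finite_ext i'.
Proof.
move=> hi /choice[psi hpsi] [d [b [[b' bK b'K] bl]]]; exists d, (phi \o b); split.
  exists (b' \o psi) => [v|c] /=; last by rewrite b'K hpsi.
  by apply: (can_inj bK); rewrite b'K; apply: (fmorph_inj phi).
by move=> c v w /=; rewrite bl rmorphD rmorphM hi.
Qed.

Lemma KMWring_map_mono (K E : fieldType) (phi : {rmorphism K -> E}) j us :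
  KMWring_map phi (mono j us) = mono j (map phi us).
Proof.
rewrite /mono rmorphM rmorphXn rmorph_prod big_map; congr (_ * _).
  by congr (_ ^+ _); exact: (prlift_gen (mw_map_rel phi) MWeta).
by apply: eq_bigr => u _; exact: (prlift_gen (mw_map_rel phi) (MWsym u)).
Qed.

(** Units of [E] lift along [phi], so monomials over [E] are images of monomials over [K]. *)
Lemma tens_surj_ind (K E : fieldType) (phi : {rmorphism K -> E}) (L : lmodType E) n
    (l0 : L) (P : KMWt L n -> Prop) :
  (forall e, exists c, phi c = e) ->
  (forall l : L, l != 0 -> exists2 u, u != 0 & l = u *: l0) ->
  P 0 -> (forall x, P x -> P (- x)) -> (forall x y, P x -> P y -> P (x + y)) ->
  (forall s : KMW K n, P (tens (KMW_map phi s) l0)) -> forall x, P x.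
Proof.
move=> /choice[psi hpsi] hl P0 PN PD Ps; apply: (tens_ind hl) => // j us s en u0 es.
have -> : s = KMW_map phi (kmw n (mono j (map psi us))).
  apply: val_inj; rewrite /= val_kmw; last first.
    by apply: hdeg_eq (hdeg_mono j _); rewrite size_map.
  by rewrite KMWring_map_mono -map_comp es map_id_in // => u _; apply: hpsi.
exact: Ps.
Qed.

Lemma modeta_map (K E : fieldType) (phi : {rmorphism K -> E}) n (s : KMW K n) :
  modeta (KMW_map phi s) = KM_map phi (modeta s).
Proof.
apply: val_inj => /=.
elim/pring_ind: (gpart_val s) => [||y e|y z ey ez|y z ey ez|g].
- by rewrite !rmorph0.
- by rewrite !rmorph1.
- by rewrite !rmorphN /= e.
- by rewrite !rmorphD /= ey ez.
- by rewrite !rmorphM /= ey ez.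
have -> : modeta_ring (prgen (@mw_rel _) g) = modeta_gen g := prlift_gen _ g.
have -> : KMWring_map phi (prgen (@mw_rel _) g) = mw_map_gen phi g := prlift_gen _ g.
case: g => [b|] /=; first by rewrite modeta_sym; exact/esym/(prlift_gen (m_map_rel phi) b).
by rewrite rmorph0; apply/(prlift_gen (@modeta_rel _) MWeta).
Qed.

Section Monogenic.
Variables (K E : fieldType) (j : {rmorphism K -> E}) (a : E) (q : int).
Hypothesis gen : forall e : E, exists P : {poly K}, (map_poly j P).[a] = e.
Variable M : {additive KMWt (omega j) q -> KMW K q}.

Section Iso.
Variables (p : finite_point K) (phi : {rmorphism residue_field (Some p) -> E}).
Hypotheses (phi_j : phi \o residue_inj (Some p) =1 j) (phi_a : phi (pt_coord (Some p)) = a).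

Lemma point_iso_red (P : {poly K}) : phi (in_qpoly (fp_poly p) P) = (map_poly j P).[a].
Proof.
rewrite -(map_poly_red p P) -phi_a -horner_map -map_poly_comp /=.
by congr (_.[_]); apply: eq_map_poly => c; rewrite -phi_j.
Qed.

Lemma point_iso_surj e : exists c, phi c = e.
Proof. by have [P <-] := gen e; exists (in_qpoly (fp_poly p) P); apply: point_iso_red. Qed.

Lemma point_iso_presentation : presentation j (fun _ : 'I_1 => a)
  (fun=> poly_mpoly1 (fp_poly p)).
Proof.
have := iso_presentation (fun c => esym (phi_j c)) point_iso_surj (pt_presentation (Some p)).
by congr (presentation j); apply/funext => i /=.
Qed.

Let psi e : residue_field (Some p) := sval (cid (point_iso_surj e)).
Let psiE e : phi (psi e) = e. Proof. exact: svalP (cid (point_iso_surj e)). Qed.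
Let phiK c : psi (phi c) = c. Proof. by apply: (fmorph_inj phi). Qed.

Let coord (l : omega j) : E := ocoord l (fun _ : 'I_1 => a) (fun=> poly_mpoly1 (fp_poly p)).
(** The inverse of the isomorphism of lines induced by [phi]. It is a trace map over [phi], so that
    transport of structure becomes an instance of composition of transfers. *)
Let back (l : omega j) : omega (residue_inj (Some p)) := psi (coord l) *: pt_base (Some p).

Let back_lin c l l' : back (phi c *: l + l') = c *: back l + back l'.
Proof.
rewrite /back /coord ocoordD ocoordZ scalerA -scalerDl; congr (_ *: _).
by apply: (fmorph_inj phi); rewrite psiE rmorphD rmorphM !psiE.
Qed.
Let back_nd l : (forall e, back (e *: l) = 0) -> l = 0.
Proof.
move=> h; apply/eqP; rewrite -(ocoord_eq0 l point_iso_presentation).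
have := h 1; rewrite scale1r /back => /eqP.
rewrite scaler_eq0 (negPf (pt_base_neq0 _)) orbF => /eqP e.
by rewrite -[ocoord _ _ _]/(coord l) -(psiE (coord l)) e rmorph0.
Qed.
Let back_trace : trace_map phi (omega j) (omega (residue_inj (Some p))) :=
  TraceMap back_lin back_nd.

Definition point_iso_trace : trace_map j (omega j) K^o :=
  comp_trace (fun c => esym (phi_j c)) back_trace (pt_trace (Some p)).

Lemma point_iso_traceE l P :
  ocoord l (fun _ : 'I_1 => a) (fun=> poly_mpoly1 (fp_poly p)) = (map_poly j P).[a] ->
  point_iso_trace l = res (fp_poly p) P.
Proof.
move=> e; rewrite -[point_iso_trace l]/(tau (pt_coordinate (psi (coord l) *: pt_base (Some p)))).
by rewrite pt_coordinateZ pt_baseE mulr1 /coord e -point_iso_red phiK tau_red.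
Qed.

Lemma back_iso l l' : omega_iso phi l l' -> back l' = l.
Proof.
move=> h; rewrite [RHS]pt_coordinate_eq /back; congr (_ *: _).
apply: (fmorph_inj phi); rewrite psiE /pt_coordinate -(h _ _ _ (pt_presentation (Some p))).
by congr (ocoord l' _ _); apply/funext => i /=.
Qed.

Variable Tx : forall x : closed_point K, {additive KMWt (omega (residue_inj x)) q -> KMW K q}.
Hypotheses (hTx : mw_point_transfers Tx)
  (hM : forall s l l', omega_iso phi l l' -> M (tens (KMW_map phi s) l') = Tx (Some p) (tens s l)).

Let line_base : exists2 l0 : omega j, l0 != 0 &
  forall l, l != 0 -> exists2 u, u != 0 & l = u *: l0.
Proof.
have alg : algebraic_ext j.
  apply: finite_ext_algebraic; apply: iso_finite_ext (fun c => esym (phi_j c)) point_iso_surj _.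
  exact: pt_finite_ext.
have prx := point_iso_presentation.
have [l0 e0] := omega_exists alg 1 prx.
have l0' : l0 != 0 by rewrite -(ocoord_eq0 l0 prx) e0 oner_eq0.
exists l0 => // l ll; exists (ocoord l (fun _ : 'I_1 => a) (fun=> poly_mpoly1 (fp_poly p))).
  by rewrite ocoord_eq0.
by apply: (ocoord_inj prx); rewrite ocoordZ e0 mulr1.
Qed.

Let M_iso s l' : exists l, [/\ omega_iso phi l l', l = back l' &
  M (tens (KMW_map phi s) l') = Tx (Some p) (tens s l)].
Proof.
have [l h] := omega_iso_exists (fun c => esym (phi_j c)) point_iso_surj (@pt_alg _ _)
  l' (pt_presentation (Some p)).
by exists l; split=> //; [rewrite (back_iso h)|exact: hM].
Qed.

Lemma point_iso_mu (fe : finite_ext j) z :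
  mu (M z) = transfer fe point_iso_trace (mu_tw z).
Proof.
have [l0 l00 hl0] := line_base.
apply: (@tens_surj_ind _ _ phi (omega j) q l0
  (fun z => mu (M z) = transfer fe point_iso_trace (mu_tw z)) point_iso_surj hl0) z
  => [|z e|y z ey ez|s].
- by rewrite !raddf0.
- by rewrite !raddfN /= e.
- by rewrite !raddfD /= ey ez.
have [l [h el ->]] := M_iso s l0; rewrite (point_transfers_mu _ hTx) el.
pose fphi := surj_finite_ext point_iso_surj.
rewrite -(transfer_mu_tw fphi back_trace point_iso_surj).
exact: (transfer_comp (fun c => esym (phi_j c)) (pt_finite_ext (Some p)) fphi fe
  (s2 := back_trace) (s1 := pt_trace (Some p))).
Qed.

Lemma point_iso_modeta (TM : forall x : closed_point K, {additive KM (residue_field x) q -> KM K q})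
    (MM : {additive KM E q -> KM K q}) :
  m_point_transfers TM -> (forall s, MM (KM_map phi s) = TM (Some p) s) ->
  forall z, modeta (M z) = MM (modeta_tw z).
Proof.
move=> hTM hMM; have [l0 l00 hl0] := line_base.
apply: (@tens_surj_ind _ _ phi (omega j) q l0
  (fun z => modeta (M z) = MM (modeta_tw z)) point_iso_surj hl0) => [|z e|y z ey ez|s].
- by rewrite !raddf0.
- by rewrite !raddfN /= e.
- by rewrite !raddfD /= ey ez.
have [l [h el ->]] := M_iso s l0; rewrite (point_transfers_modeta _ hTx hTM).
have ln0 : l != 0.
  apply: contraNneq l00 => l_eq0; rewrite -(ocoord_eq0 l0 point_iso_presentation).
  have := h _ _ _ (pt_presentation (Some p)); rewrite l_eq0 ocoord0E rmorph0 => e.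
  apply/eqP; rewrite -[RHS]e; congr (ocoord l0 _ _); apply/funext => i /=; exact: esym phi_a.
rewrite !modeta_twE // -hMM; congr (MM _); exact: esym (modeta_map phi s).
Qed.
End Iso.

(** The closed point and the isomorphism are forgotten: what the tower argument uses is a monic
    equation of [a] together with the values of the trace form on the powers of [a], nonzero only at
    exponent [deg p - 1]. *)
Theorem monogenic_transfer_mu : mw_monogenic_transfer a M ->
  exists (p : {poly K}) (s : trace_map j (omega j) K^o),
  [/\ p \is monic /\ (1 < size p)%N, presentation j (fun _ : 'I_1 => a) (fun=> poly_mpoly1 p),
      forall l i, (i < (size p).-1)%N ->
        ocoord l (fun _ : 'I_1 => a) (fun=> poly_mpoly1 p) = a ^+ i ->
        s l = (i == (size p).-2)%:R,
      finite_ext j &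
      forall (fe : finite_ext j) z, mu (M z) = transfer fe s (mu_tw z)].
Proof.
move=> [Tx [p [phi [hTx phi_j phi_a hM]]]].
exists (fp_poly p), (point_iso_trace phi_j phi_a); split.
- by split; [exact: fp_monic|exact: fp_size].
- exact: point_iso_presentation.
- move=> l i ip e; rewrite (@point_iso_traceE p phi phi_j phi_a l 'X^i).
    rewrite /res modp_small ?size_polyXn ?coefXn 1?eq_sym //.
    by case: (size _) (fp_size p) ip.
  by rewrite e map_polyXn hornerXn.
- apply: iso_finite_ext (fun c => esym (phi_j c)) (point_iso_surj phi_j phi_a) _.
  exact: pt_finite_ext.
- exact: (point_iso_mu phi_j phi_a hTx hM).
Qed.

Theorem monogenic_transfer_modeta (MM : {additive KM E q -> KM K q}) :
  mw_monogenic_transfer a M -> m_monogenic_transfer j a MM ->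
  forall z, modeta (M z) = MM (modeta_tw z).
Proof.
move=> [Tx [p [phi [hTx phi_j phi_a hM]]]] [TM [p' [phi' [hTM phi_j' phi_a' hMM]]]].
(* Both polynomials vanish at [a], whereas distinct monic irreducible polynomials are coprime. *)
have pp' : p = p'.
  apply: contraTeq isT => pp'; have := coprimep_ndvd (fp_coprime pp').
  rewrite -red_eq0 -(fmorph_eq0 phi) (point_iso_red phi_j phi_a).
  by rewrite -(point_iso_red phi_j' phi_a') (eqP (_ : in_qpoly _ _ == 0)) ?rmorph0 ?eqxx ?red_eq0.
subst p'; have ephi : phi' = phi :> (_ -> _).
  apply/funext => c; rewrite -(red_inj_val c).
  by rewrite (point_iso_red phi_j phi_a) (point_iso_red phi_j' phi_a').
apply: (point_iso_modeta phi_j phi_a hTx hM hTM) => s; rewrite -hMM; congr (MM _).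
apply: val_inj => /=; elim/pring_ind: (gpart_val s) => [||y e|y z ey ez|y z ey ez|b].
- by rewrite !rmorph0.
- by rewrite !rmorph1.
- by rewrite !rmorphN /= e.
- by rewrite !rmorphD /= ey ez.
- by rewrite !rmorphM /= ey ez.
have -> : KMring_map phi (prgen (@m_rel _) b) = milnor_sym (phi b) := prlift_gen _ b.
have -> : KMring_map phi' (prgen (@m_rel _) b) = milnor_sym (phi' b) := prlift_gen _ b.
by rewrite ephi.
Qed.
End Monogenic.

(** * Twisted transfers and towers *)

Lemma mu_tw_line (K : fieldType) (L L' : lmodType K) n (s : KMW K n) (l : L)
    (fe : finite_ext (idfun : {rmorphism K -> K})) (t : trace_map (idfun : {rmorphism K -> K}) L L') :
  mu_tw (tens s (t l)) = transfer fe t (mu_tw (tens s l)).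
Proof.
have surj (e : K) : exists c, (idfun : {rmorphism K -> K}) c = e by exists e.
by rewrite -{2}(KMW_map_id s) (transfer_mu_tw fe t surj).
Qed.

Section Twist.
Variables (k K E : fieldType) (i1 : {rmorphism k -> K}) (j : {rmorphism K -> E}).
Variable i : {rmorphism k -> E}.
Variables (fe : finite_ext j) (q : int) (s : trace_map j (omega j) K^o).
Variables (M : {additive KMWt (omega j) q -> KMW K q})
  (Mtw : {additive KMWt (omega i) q -> KMWt (omega i1) q}).
Hypothesis hMtw : twisted_transfer M Mtw.
Variables (w : omega j) (l' : omega i1) (l : omega i).
Hypotheses (wl : tower_iso w l' l) (w0 : w != 0) (l'0 : l' != 0).
Variable c : omega i -> E.
Hypotheses (c_lin : forall u m m', c (u *: m + m') = u * c m + c m')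
  (cE : forall m, m = c m *: l) (cl : c l = 1).

(** The vector [m = c m *: l] corresponds to [c m *: w] tensored with [l']; this is [s] on the first
    factor. *)
Definition twist_trace_fun (m : omega i) : omega i1 := (s (c m *: w) : K) *: l'.
Let sl u x y : s (j u *: x + y) = u *: s x + s y := trace_lin s u x y.

Lemma twist_trace_lin u m m' :
  twist_trace_fun (j u *: m + m') = u *: twist_trace_fun m + twist_trace_fun m'.
Proof.
rewrite /twist_trace_fun c_lin scalerDl -scalerA (sl u) scalerDl scalerA; congr (_ + _).
Qed.
Lemma twist_trace_nd m : (forall e, twist_trace_fun (e *: m) = 0) -> m = 0.
Proof.
have c0 : c 0 = 0 by have := c_lin (-1) 0 0; rewrite scaler0 addr0 mulN1r addNr.
move=> h; suff : c m *: w = 0.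
  by move/eqP; rewrite scaler_eq0 (negPf w0) orbF => /eqP e; rewrite (cE m) e scale0r.
apply: (trace_nd (t := s)) => e; apply/eqP; have /eqP := h e.
rewrite /twist_trace_fun scaler_eq0 (negPf l'0) orbF.
by rewrite -[e *: m]addr0 c_lin c0 addr0 scalerA.
Qed.
Definition twist_trace : trace_map j (omega i) (omega i1) :=
  TraceMap twist_trace_lin twist_trace_nd.

Let l0 : l != 0.
Proof.
apply/eqP => e; have := c_lin (-1) l l; rewrite e scaler0 addr0 -e cl mulN1r addNr => /eqP.
by rewrite oner_eq0.
Qed.

Let line (m : omega i) : m != 0 -> exists2 u, u != 0 & m = u *: l.
Proof.
move=> m0; exists (c m) => //; apply: contraNneq m0 => e.
by rewrite (cE m) e scale0r.
Qed.

Let MtwE (t : KMW E q) : Mtw (tens t l) = tens (M (tens t w)) l'.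
Proof.
rewrite -[l]scale1r; apply: (hMtw (s := t) (oner_neq0 _) wl).
by rewrite mw_angle1 mul1r.
Qed.

Let scale_lin (F : fieldType) (L : lmodType F) (x : L) (u a b : F) :
  ((idfun : {rmorphism F -> F}) u *: (a : F^o) + b) *: x = u *: (a *: x) + b *: x.
Proof. by rewrite scalerDl scalerA. Qed.

(** Passing from multiples of [l] to multiples of [w], and from scalars to multiples of [l'], are
    trace maps over the identity. The twisted trace is the composite of [t2], [s] and [t1], and
    transfers compose. *)
Theorem twisted_mu :
  (forall z, mu (M z) = transfer fe s (mu_tw z)) ->
  forall z, mu_tw (Mtw z) = transfer fe twist_trace (mu_tw z).
Proof.
move=> hM z; apply: (@tens_line_ind _ (omega i) q l
  (fun z => mu_tw (Mtw z) = transfer fe twist_trace (mu_tw z)) line) z => [|z e|y z ey ez|t].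
- by rewrite !raddf0.
- by rewrite !raddfN /= e.
- by rewrite !raddfD /= ey ez.
have fK : finite_ext (idfun : {rmorphism K -> K}) by apply: surj_finite_ext => e; exists e.
have fE : finite_ext (idfun : {rmorphism E -> E}) by apply: surj_finite_ext => e; exists e.
have nd1 (x : K^o) : (forall e : K, ((e *: x : K^o) : K) *: l' = 0) -> x = 0.
  move=> h; apply/eqP; have /eqP := h 1; rewrite scaler_eq0 (negPf l'0) orbF.
  by rewrite scale1r.
pose t1 : trace_map (idfun : {rmorphism K -> K}) K^o (omega i1) :=
  TraceMap (trace_fun := fun x : K^o => (x : K) *: l') (scale_lin l') nd1.
have lin2 u m m' : c ((idfun : {rmorphism E -> E}) u *: m + m') *: w = u *: (c m *: w) + c m' *: w.
  by rewrite c_lin scalerDl scalerA.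
have nd2 (m : omega i) : (forall e : E, c (e *: m) *: w = 0) -> m = 0.
  move=> h; have /eqP := h 1; rewrite scaler_eq0 (negPf w0) orbF scale1r => /eqP e.
  by rewrite (cE m) e scale0r.
pose t2 : trace_map (idfun : {rmorphism E -> E}) (omega i) (omega j) := TraceMap lin2 nd2.
rewrite MtwE -[l' in LHS]scale1r (mu_tw_line (M (tens t w)) (1 : K^o) fK t1) -muE hM.
have {1}-> : w = t2 l by rewrite /= cl scale1r.
rewrite (mu_tw_line t l fE t2).
have h1 b : j b = j ((idfun : {rmorphism K -> K}) b) by [].
rewrite (transfer_comp h1 fK fe fe (s := comp_trace h1 s t1)) //.
rewrite -[RHS](transfer_comp (i2 := (idfun : {rmorphism E -> E})) (i1 := j) (i := j) (fun b => erefl (j b)) fe fE fe (s2 := t2)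
  (s1 := comp_trace h1 s t1)) //.
Qed.

Theorem twisted_modeta (MM : {additive KM E q -> KM K q}) :
  (forall z, modeta (M z) = MM (modeta_tw z)) ->
  forall z, modeta_tw (Mtw z) = MM (modeta_tw z).
Proof.
move=> hM z; apply: (@tens_line_ind _ (omega i) q l
  (fun z => modeta_tw (Mtw z) = MM (modeta_tw z)) line) z => [|z e|y z ey ez|t].
- by rewrite !raddf0.
- by rewrite !raddfN /= e.
- by rewrite !raddfD /= ey ez.
by rewrite MtwE !modeta_twE // hM modeta_twE.
Qed.
End Twist.

Section Msupp.
Variable k : fieldType.

(** It carries the degree bounds of [triangular] over to equations placed in a larger set of
    variables, where the new exponents are zero. *)
Lemma msupp_mrename n N (s : 'I_n -> 'I_N) (p : {mpoly k[n]}) m : injective s ->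
  m \in msupp (mrename s p) ->
  exists2 m', m' \in msupp p &
    (forall i, m (s i) = m' i) /\ forall j, (forall i, s i != j) -> m j = 0%N.
Proof.
move=> s_inj; pose im (m' : 'X_{1..n}) : 'X_{1..N} := [multinom (\sum_(i | s i == j) m' i)%N | j < N].
have e : mrename s p = \sum_(m' <- msupp p) p@_m' *: 'X_[im m'].
  rewrite /mrename /mmap; apply: eq_bigr => m' _; rewrite mul_mpolyC; congr (_ *: _).
  rewrite /mmap1 mpolyXE_id (eq_bigr (fun i => \prod_(j | s i == j) 'X_j ^+ m' i)) => [|i _].
    rewrite (exchange_big_dep predT) //=; apply: eq_bigr => j _; rewrite mnmE.
    by rewrite (big_morph (fun x => 'X_j ^+ x) (fun x y => exprD _ x y) (expr0 _)).
  by rewrite (big_pred1 (s i)) // => j; rewrite eq_sym.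
rewrite mcoeff_msupp e raddf_sum /= => nz.
have [m' mi hm] : exists2 m', m' \in msupp p & im m' == m.
  apply: contrapT => h; move/eqP: nz; apply; apply: big1_seq => m' /andP[_ mi].
  rewrite mcoeffZ mcoeffX; case: eqP => [em|]; last by rewrite mulr0.
  by case: h; exists m' => //; apply/eqP.
exists m' => //; rewrite -(eqP hm); split=> [i|j sj]; rewrite mnmE.
  by rewrite (big_pred1 i) // => i'; rewrite (inj_eq s_inj).
by rewrite big_pred0 // => i; apply: negbTE.
Qed.

Lemma msupp_sum (n : nat) (I : Type) (r : seq I) (P : pred I) (F : I -> {mpoly k[n]}) m :
  m \in msupp (\sum_(i <- r | P i) F i) -> exists i, m \in msupp (F i).
Proof.
rewrite mcoeff_msupp raddf_sum /= => nz; apply: contrapT => h; move/eqP: nz; apply.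
apply: big1 => i _; apply/eqP/negPn/negP; rewrite -mcoeff_msupp => mi.
by apply: h; exists i.
Qed.

Lemma msupp_mulX n (p : {mpoly k[n]}) i t m :
  m \in msupp (p * 'X_i ^+ t) -> exists2 m', m' \in msupp p & m = (m' + U_(i) *+ t)%MM.
Proof.
rewrite mpolyXn (perm_mem (msuppMX _ _)) => /mapP[m' mi ->].
by exists m' => //; rewrite addmC.
Qed.
End Msupp.

Section TowerBasis.
Variables (k E : fieldType) (i : {rmorphism k -> E}).

(** The presentations on which the trace of Grothendieck duality is computed by
    means of a basis of monomials; that the monomials span is stated as an induction
    principle *)
Definition tower_basis n (x : 'I_n -> E) (tr : omega i -> k) : Prop :=
  exists f d, [/\ presentation i x f, triangular f d,
    forall P : E -> Prop, P 0 -> (forall c e e', P e -> P e' -> P (i c * e + e')) ->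
      (forall m : 'I_n -> nat, (forall a, (m a < d a)%N) -> P (\prod_a x a ^+ m a)) ->
      forall e, P e &
    forall (m : 'I_n -> nat) l, (forall a, (m a < d a)%N) ->
      ocoord l x f = \prod_a x a ^+ m a -> tr l = [forall a, m a == (d a).-1]%:R].

Lemma tower_basis_cast n n' (e : n' = n) (x : 'I_n -> E) tr :
  tower_basis x tr -> tower_basis (x \o cast_ord e) tr.
Proof.
case: n / e x => x; have -> // : x \o cast_ord (erefl n') = x.
by apply/funext => a /=; rewrite cast_ord_id.
Qed.
End TowerBasis.

Section TowerStep.
Variables (k K E : fieldType) (i1 : {rmorphism k -> K}) (j : {rmorphism K -> E}).
Variables (i : {rmorphism k -> E}) (hi : forall b, i b = j (i1 b)).
Variables (m : nat) (x : 'I_m -> K) (a : E) (p : {poly K}) (tr1 : trace_map i1 (omega i1) k^o).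
Hypotheses (pm : p \is monic) (p1 : (1 < size p)%N).
Variables (f : 'I_m -> {mpoly k[m]}) (d : 'I_m -> nat).
Hypotheses (prx : presentation i1 x f) (tri : triangular f d).
Hypothesis pry : presentation j (fun _ : 'I_1 => a) (fun=> poly_mpoly1 p).

Definition step_deg : 'I_(m + 1) -> nat := fcat d (fun=> (size p).-1).
Definition step_last : 'I_(m + 1) := rshift m ord0.
Notation last := step_last.

(** Lifting [p] coefficient by coefficient keeps the degree in the last variable below [deg p],
    apart from the leading monomial, as [triangular] requires of the concatenated equations. *)
Lemma step_lift : exists g' : {mpoly k[m + 1]},
  partial_ev i1 (tower_hz x) g' = poly_mpoly1 p /\
  forall mu, mu \in msupp (g' - 'X_last ^+ (size p).-1) -> (mu last < (size p).-1)%N.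
Proof.
have /choice[R hR] : forall t, exists R : {mpoly k[m]}, ev i1 x R = p`_t.
  by move=> t; exact: prx.1.
exists (\sum_(t < (size p).-1) mrename (@lshift m 1) (R t) * 'X_last ^+ t + 'X_last ^+ (size p).-1).
split.
  have pe : p = \sum_(t < (size p).-1) (p`_t)%:P * 'X^t + 'X^((size p).-1).
    rewrite {1}(_ : p = \sum_(t < (size p).-1.+1) p`_t *: 'X^t).
      rewrite big_ord_recr /= -lead_coefE (monicP pm) scale1r; congr (_ + _).
      by apply: eq_bigr => t _; rewrite mul_polyC.
    by rewrite prednK ?(ltn_trans _ p1) // -poly_def coefK.
  rewrite rmorphD rmorph_sum /= [in RHS]pe rmorphD rmorph_sum /=.
  have hX t : partial_ev i1 (tower_hz x) ('X_last ^+ t) = poly_mpoly1 'X^t.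
    by rewrite !rmorphXn /= partial_evX tower_hzr poly_mpoly1X.
  congr (_ + _); last exact: hX.
  apply: eq_bigr => t _; rewrite !rmorphM; congr (_ * _); last exact: hX.
  apply: etrans _ (esym (poly_mpoly1C _)); rewrite -hR.
  apply: (mpoly_rmorph_eq (f := partial_ev i1 (tower_hz x) \o mrename (@lshift m 1))
    (g := @mpolyC 1 K \o ev i1 x)) => [c|u] /=.
    by rewrite mrenameC partial_evC evC.
  by rewrite mrenameX partial_evX tower_hzl evX.
move=> mu; rewrite addrK => /msupp_sum[t /msupp_mulX[m' mi ->]].
have [|m2 _ [_ h0]] := msupp_mrename _ mi; first exact: lshift_inj.
rewrite mnmDE mulmnE mnm1E eqxx mul1n h0 ?add0n // => u.
by apply/eqP => /(congr1 val) /=; have := ltn_ord u; lia.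
Qed.

Hypothesis span : forall P : K -> Prop, P 0 ->
  (forall c e e', P e -> P e' -> P (i1 c * e + e')) ->
  (forall m' : 'I_m -> nat, (forall u, (m' u < d u)%N) -> P (\prod_u x u ^+ m' u)) ->
  forall e, P e.
Hypothesis dual : forall (m' : 'I_m -> nat) l, (forall u, (m' u < d u)%N) ->
  ocoord l x f = \prod_u x u ^+ m' u -> tr1 l = [forall u, m' u == (d u).-1]%:R.
Variable s : trace_map j (omega j) K^o.
Hypothesis dual_s : forall l t, (t < (size p).-1)%N ->
  ocoord l (fun _ : 'I_1 => a) (fun=> poly_mpoly1 p) = a ^+ t -> s l = (t == (size p).-2)%:R.
Variables (w : omega j) (l' : omega i1).
Hypotheses (w1 : ocoord w (fun _ : 'I_1 => a) (fun=> poly_mpoly1 p) = 1)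
  (l'1 : ocoord l' x f = 1).

Definition step_pt : 'I_(m + 1) -> E := tower_pt j x (fun _ : 'I_1 => a).

Lemma step_prod (e : 'I_(m + 1) -> nat) :
  \prod_u step_pt u ^+ e u =
  j (\prod_u x u ^+ e (lshift 1 u)) * a ^+ e last.
Proof.
rewrite big_split_ord big_ord1 /step_pt rmorph_prod; congr (_ * _); last by rewrite tower_ptr.
by apply: eq_bigr => u _; rewrite tower_ptl rmorphXn.
Qed.

(** Division by [p] leaves powers of [a] below [deg p] with coefficients in [K], and those
    coefficients are spanned over [k] by the monomials in [x]. *)
Lemma step_span (P : E -> Prop) : P 0 ->
  (forall c e e', P e -> P e' -> P (i c * e + e')) ->
  (forall m' : 'I_(m + 1) -> nat, (forall u, (m' u < step_deg u)%N) ->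
     P (\prod_u step_pt u ^+ m' u)) ->
  forall e, P e.
Proof.
move=> P0 PD Pm.
have Pt t b : (t < (size p).-1)%N -> P (j b * a ^+ t).
  move=> tp; apply: (span (P := fun b => P (j b * a ^+ t))) => [|c e e' he he'|m' hm'].
  - by rewrite rmorph0 mul0r.
  - by rewrite rmorphD rmorphM -hi mulrDl -mulrA; apply: PD.
  pose e : 'I_(m + 1) -> nat := fcat m' (fun=> t).
  have := step_prod e; have -> : e last = t by rewrite /e fcatr.
  have -> : \prod_u x u ^+ e (lshift 1 u) = \prod_u x u ^+ m' u.
    by apply: eq_bigr => u _; rewrite /e fcatl.
  move=> <-; apply: Pm => u; rewrite /e.
  by case: (tower_cover u) => [[v ->]|[v ->]]; rewrite /step_deg ?fcatl ?fcatr.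
have PA e e' : P e -> P e' -> P (e + e').
  by move=> he he'; rewrite -[e]mul1r -(rmorph1 i); apply: PD.
move=> e; have [Q <-] := pry.1 e.
have [R <-] := poly_mpoly1_surj Q; rewrite ev_poly_mpoly1.
have pa : (map_poly j p).[a] = 0.
  by rewrite -(ev_poly_mpoly1 j (fun _ : 'I_1 => a)); apply: (presentation_gen ord0 pry).
have -> : (map_poly j R).[a] = (map_poly j (R %% p)).[a].
  by rewrite {1}(divp_eq R p) rmorphD rmorphM hornerD hornerM pa mulr0 add0r.
have sR : (size (R %% p)%R <= (size p).-1)%N.
  have h : (size (R %% p)%R < size p)%N by rewrite ltn_modp monic_neq0.
  by rewrite -ltnS (ltn_predK p1).
rewrite (horner_coef_wide _ (n := (size p).-1)) ?size_map_poly //.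
elim/big_rec: _ => // t e' _ he'; apply: PA => //; rewrite coef_map; exact: Pt.
Qed.

(** On a monomial, [s] returns the part in [x] when the exponent of [a] is the top one and 0
    otherwise, by linearity over [K]; [tr1] then tests the remaining exponents. This is the rule of
    the duality trace for the concatenated presentation. *)
Theorem step_basis (g' : {mpoly k[m + 1]}) :
  partial_ev i1 (tower_hz x) g' = poly_mpoly1 p ->
  (forall mu, mu \in msupp (g' - 'X_last ^+ (size p).-1) -> (mu last < (size p).-1)%N) ->
  tower_basis step_pt (fun mm => tr1 (twist_trace_fun s w l'
    (fun mm : omega i => ocoord mm step_pt (tower_gen f (fun=> g'))) mm)).
Proof.
move=> hg' supp_g'; exists (tower_gen f (fun=> g')), step_deg; split.
- exact: (tower_presentation hi prx pry (fun=> hg')).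
- move=> u mu; case: (tower_cover u) => [[v ->]|[v ->]]; rewrite /tower_gen /step_deg ?fcatl ?fcatr.
    rewrite -mrenameX -rmorphXn -rmorphB => /msupp_mrename[|m' mi [h1 h2]]; first exact: lshift_inj.
    have [hd h0] := tri mi; split; first by rewrite h1.
    move=> b; case: (tower_cover b) => [[c ->]|[c ->]] vb; first by rewrite h1; apply: h0.
    by rewrite h2 // => c'; apply/eqP => /(congr1 val) /=; have := ltn_ord c'; lia.
  have -> : rshift m v = last by rewrite ord1.
  move=> /supp_g' h; split => // b; have := ltn_ord b; rewrite /step_last /=; lia.
- exact: step_span.
- move=> e l he el; rewrite /twist_trace_fun el step_prod.
  set X := \prod_u _; set t := e last.
  have tp : (t < (size p).-1)%N by have := he last; rewrite /step_deg fcatr.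
  have st : s ((j X * a ^+ t) *: w) = X * (t == (size p).-2)%:R.
    rewrite -scalerA -[j X *: _]addr0 (trace_lin s) (trace0 s) addr0; congr (_ * _).
    by apply: dual_s => //; rewrite ocoordZ w1 mulr1.
  rewrite st.
  have -> : [forall u, e u == (step_deg u).-1] =
      [forall u, e (lshift 1 u) == (d u).-1] && (t == (size p).-2).
    apply/forallP/andP => [h|[/forallP h ht] u].
      split; last by have := h last; rewrite /step_deg fcatr.
      by apply/forallP => u; have := h (lshift 1 u); rewrite /step_deg fcatl.
    case: (tower_cover u) => [[v ->]|[v ->]]; rewrite /step_deg ?fcatl ?fcatr //.
    by rewrite ord1.
  case: eqP => _; last by rewrite andbF mulr0 scale0r (trace0 tr1).
  rewrite andbT mulr1; apply: (dual (m' := fun u => e (lshift 1 u))).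
    by move=> u; have := he (lshift 1 u); rewrite /step_deg fcatl.
  by rewrite ocoordZ l'1 mulr1.
Qed.
End TowerStep.

(** Finiteness of [E] makes each successive adjunction polynomial, so that generation as a field
    gives surjectivity of the evaluation. *)
Lemma subfield_gen_ev (k : fieldType) (E : fieldExtType k) n (alpha : 'I_n -> E) e :
  e \in subfield_gen alpha -> exists P, ev (in_alg E) alpha P = e.
Proof.
rewrite /subfield_gen /=; have : forall y, y \in codom alpha -> exists P, ev (in_alg E) alpha P = y.
  by move=> y /codomP[u ->]; exists 'X_u; rewrite evX.
elim/last_ind: (codom alpha) e => [|s x IH] e hs.
  rewrite Fadjoin_nil => /vlineP[c ->]; exists c%:MP; exact: evC.
rewrite adjoin_rcons => /Fadjoin_polyP[p /polyOverP hp ->].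
have [X hX] : exists X, ev (in_alg E) alpha X = x by apply: hs; rewrite mem_rcons mem_head.
have /choice[c hc] : forall t, exists P, ev (in_alg E) alpha P = p`_t.
  by move=> t; apply: IH (hp t) => y ys; apply: hs; rewrite mem_rcons inE ys orbT.
exists (\sum_(t < size p) c t * X ^+ t); rewrite ev_sum horner_coef.
by apply: eq_bigr => t _; rewrite evM hc -hX; congr (_ * _); exact: rmorphXn.
Qed.

Section Step.
Variables (k : fieldType) (E : fieldExtType k) (m : nat) (alpha : 'I_m.+1 -> E).
Local Notation K := (subfield_gen (family_init alpha)).
Local Notation i1 := (in_alg (subvs_of K)).
Local Notation i := (in_alg E).
Local Notation j := (vsval : {rmorphism subvs_of K -> E}).

Lemma step_in_alg b : i b = j (i1 b).
Proof. by apply: esym; apply: etrans (linearZ _ _) _; congr (_ *: _); exact: rmorph1. Qed.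

Lemma step_init u : j (vsproj K (family_init alpha u)) = family_init alpha u.
Proof. by apply: vsprojK; apply/seqv_sub_adjoin/codom_f. Qed.

Lemma step_gen_init (u : subvs_of K) : exists P, ev i1 (vsproj K \o family_init alpha) P = u.
Proof.
have [P hP] := subfield_gen_ev (subvsP u).
exists P; apply: val_inj; apply: etrans (esym (ev_map step_in_alg _ _)) (etrans _ hP).
by apply: ev_eq => v /=; apply: step_init.
Qed.

Lemma step_gen_last : (forall e, exists P, ev i alpha P = e) ->
  forall e, exists Q : {poly subvs_of K}, (map_poly j Q).[alpha ord_max] = e.
Proof.
move=> gen e; have [P <-] := gen e.
pose X (t : 'I_m.+1) : {poly subvs_of K} :=
  if insub (t : nat) is Some u then (vsproj K (family_init alpha u))%:P else 'X.
exists (mmap (polyC \o i1) X P).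
apply: (mpoly_rmorph_eq (f := evp j (alpha ord_max) \o mmap (polyC \o i1) X)
  (g := ev i alpha)) => [c|t] /=.
  by rewrite mmapC /= evpC evC; exact: esym (step_in_alg c).
rewrite mmapX evX mmap1U /X; case: insubP => [u _ et|nt].
  by rewrite evpC step_init; congr (alpha _); apply/val_inj.
rewrite evpX; congr (alpha _); apply/val_inj => /=; have := ltn_ord t; lia.
Qed.

Lemma step_family : alpha = step_pt j (vsproj K \o family_init alpha) (alpha ord_max)
  \o cast_ord (esym (addn1 m)).
Proof.
apply/funext => t /=; case: (tower_cover (cast_ord (esym (addn1 m)) t)) => [[u e]|[u e]].
  rewrite e /step_pt tower_ptl step_init; congr (alpha _); apply/val_inj.
  exact: (congr1 val e).
rewrite e /step_pt tower_ptr; congr (alpha _); apply/val_inj.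
by have := congr1 val e; rewrite ord1 /= addn0.
Qed.
End Step.

(** The induction carries the monomial basis along with the trace form, as the values on monomials
    are what identifies this form with the duality trace in the end. The field [E] must vary,
    because the preceding steps of the tower concern the subfield generated by all but the last
    element. *)
Theorem bass_tate_components n (k : fieldType) (E : fieldExtType k) (alpha : 'I_n -> E) q
    (T : {additive KMWt (omega (in_alg E)) q -> KMW k q}) :
  (forall e, exists P, ev (in_alg E) alpha P = e) -> bass_tate_transfer alpha T ->
  (exists2 tr : trace_map (in_alg E) (omega (in_alg E)) k^o, tower_basis alpha tr &
     forall z, mu (T z) = transfer (finite_ext_vect E) tr (mu_tw z)) /\
  forall N : {additive KM E q -> KM k q}, m_bass_tate_transfer alpha N ->
    forall z, modeta (T z) = N (modeta_tw z).
Proof.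
elim: n E alpha T => [|m IH] E alpha T gen.
  move=> hT; have surj (e : E) : exists c : k, in_alg E c = e.
    have [P <-] := gen e; rewrite (mpoly0_const P); exists P@_0%MM.
    by apply/esym/(evC (in_alg E) alpha).
  have /choice[r hr] := surj.
  have rE b e : in_alg E b = e -> r e = b.
    by move=> <-; apply: (fmorph_inj (in_alg E)); exact: hr.
  have prx : presentation (in_alg E) alpha (fun=> 0) := empty_presentation surj alpha _.
  have o0 (l : omega (in_alg E)) : ocoord0 l = ocoord l alpha (fun=> 0).
    by rewrite /ocoord0; congr (ocoord l _ _); apply/funext => -[].
  have tr_lin c (l l' : omega (in_alg E)) :
      (r (ocoord0 (in_alg E c *: l + l')) : k^o) = c *: (r (ocoord0 l) : k^o) + r (ocoord0 l').
    have D b b' : in_alg E (c * b + b') = in_alg E c * in_alg E b + in_alg E b'.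
      by rewrite rmorphD rmorphM.
    apply: rE; rewrite [LHS]D !hr.
    by rewrite /ocoord0 ocoordD ocoordZ.
  have tr_nd (l : omega (in_alg E)) : (forall e : E, r (ocoord0 (e *: l)) = 0 :> k^o) -> l = 0.
    move=> h; apply/eqP; rewrite -(ocoord_eq0 l prx) -o0 -(hr (ocoord0 l)).
    by have := h 1; rewrite scale1r => ->; rewrite rmorph0.
  pose tr : trace_map (in_alg E) (omega (in_alg E)) k^o := TraceMap tr_lin tr_nd.
  have [l0 e0] := omega_exists (finite_ext_algebraic (finite_ext_vect E)) 1 prx.
  have l00 : l0 != 0 by rewrite -(ocoord_eq0 l0 prx) e0 oner_eq0.
  have line l : l != 0 -> exists2 u, u != 0 & l = u *: l0.
    move=> ln0; exists (ocoord l alpha (fun=> 0)); first by rewrite (ocoord_eq0 l prx).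
    by apply: (ocoord_inj prx); rewrite ocoordZ e0 mulr1.
  have r1 : r 1 = 1 by apply: rE; rewrite rmorph1.
  have tr0 : tr l0 = 1 by rewrite /= o0 e0 r1.
  have T0 s : T (tens (KMW_map (in_alg E) s) l0) = s.
    by apply: (hT 1) => //; rewrite ?o0 ?e0 ?scale1r // mw_angle1 mul1r.
  split.
    exists tr; last first.
      apply: (@tens_surj_ind _ _ (in_alg E) (omega (in_alg E)) q l0
        (fun z => mu (T z) = transfer (finite_ext_vect E) tr (mu_tw z)) surj line)
        => [|z e|y z ey ez|s].
      - by rewrite !raddf0.
      - by rewrite !raddfN /= e.
      - by rewrite !raddfD /= ey ez.
      by rewrite T0 (transfer_mu_tw _ tr surj) tr0 muE.
    exists (fun=> 0), (fun=> 0%N); split => //.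
    - by case.
    - move=> P P0 PD Pm e; have [c <-] := surj e.
      rewrite -[X in P X]addr0 -[X in P (X + 0)]mulr1; apply: PD => //.
      have := Pm (fun=> 0%N); rewrite big_ord0; apply; by case.
    - move=> mm l _; rewrite big_ord0 => el; rewrite /= o0 el r1.
      by rewrite (_ : [forall a, _]) //; apply/forallP => -[].
  move=> N hN; apply: (@tens_surj_ind _ _ (in_alg E) (omega (in_alg E)) q l0
    (fun z => modeta (T z) = N (modeta_tw z)) surj line) => [|z e|y z ey ez|s].
  - by rewrite !raddf0.
  - by rewrite !raddfN /= e.
  - by rewrite !raddfD /= ey ez.
  by rewrite T0 modeta_twE // modeta_map hN.
case=> T' [M [Mtw [hT' hM hMtw hT]]].
have [[tr' [f' [d' [prx tri span dual]]] mu'] modeta'] := IH _ _ _ (@step_gen_init _ _ _ alpha) hT'.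
have gen_last := step_gen_last gen.
have [p [s [[pm p1] pry dual_s fe mu_s]]] := monogenic_transfer_mu gen_last hM.
have [g' [hg' supp_g']] := step_lift pm p1 prx.
have [w w1] := omega_exists (finite_ext_algebraic fe) 1 pry.
have [l' l'1] := omega_exists (finite_ext_algebraic (finite_ext_vect _)) 1 prx.
have hi := @step_in_alg _ E m alpha.
have [l wl] := tower_iso_exists hi (finite_ext_algebraic (finite_ext_vect E)) w l' prx pry.
have prT := tower_presentation hi prx pry (fun=> hg').
have w0 : w != 0 by rewrite -(ocoord_eq0 w pry) w1 oner_eq0.
have l'0 : l' != 0 by rewrite -(ocoord_eq0 l' prx) l'1 oner_eq0.
pose K := subfield_gen (family_init alpha).
pose c (mm : omega (in_alg E)) : E := ocoord mm (step_pt (vsval : {rmorphism subvs_of K -> E})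
  (vsproj K \o family_init alpha) (alpha ord_max)) (tower_gen f' (fun=> g')).
have cl : c l = 1.
  by apply: etrans (wl _ _ _ _ _ _ (fun=> g') prx pry (fun=> hg')) _; rewrite w1 l'1 rmorph1 mulr1.
have c_lin u a b : c (u *: a + b) = u * c a + c b by rewrite /c ocoordD ocoordZ.
have cE mm : mm = c mm *: l.
  by apply: (ocoord_inj prT); rewrite ocoordZ -[ocoord l _ _]/(c l) cl mulr1.
pose sigma := twist_trace s w0 l'0 c_lin cE.
split.
  exists (comp_trace hi sigma tr').
    have := step_basis hi pm p1 prx tri pry span dual dual_s w1 l'1 hg' supp_g'.
    by move/(tower_basis_cast (esym (addn1 m))); rewrite -(step_family alpha).
  move=> z; rewrite hT /= mu' (twisted_mu hMtw wl w0 l'0 c_lin cE cl (mu_s fe)).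
  exact: transfer_comp.
move=> N [N' [MM [hN' hMM hN]]] z; rewrite hT hN /= (modeta' _ hN').
congr (N' _); apply: (twisted_modeta hMtw wl w0 l'0 c_lin cE cl).
exact: (monogenic_transfer_modeta gen_last hM hMM).
Qed.

Theorem proposition4p4p13 (k : fieldType) (E : fieldExtType k)
    (n : nat) (alpha : 'I_n -> E)
    (halpha : <<1 & codom alpha>>%VS = fullv)
    (q : int)
    (Tr TrBT : {additive KMWt (omega (in_alg E)) q -> KMW k q})
    (hTr : glued_transfer Tr)
    (hTrBT : bass_tate_transfer alpha TrBT) :
  forall z : KMWt (omega (in_alg E)) q, Tr z = TrBT z.
Proof.
move=> z; have gen e : exists P, ev (in_alg E) alpha P = e.
  by apply: subfield_gen_ev; rewrite /subfield_gen /= halpha memvf.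
have [[tr [f [d [prx tri span dual]]] hmu] hmodeta] := bass_tate_components gen hTrBT.
case: hTr => tr' [W [N [[tr'_lin dual'] hW hN hTr]]].
(* [hTr] characterizes [Tr z] by its two components, so it remains to compute those of [TrBT z]. *)
apply/hTr; split; last exact: hmodeta (hN _ _ halpha) z.
have tr'0 : tr' 0 = 0.
  by have := tr'_lin (-1) 0 0; rewrite scaler0 addr0 mulN1r addNr.
(* The triangular presentation built along the tower is one on which the duality trace is
   prescribed; two linear forms with the same values on its monomials coincide. *)
have trE : tr' =1 tr.
  move=> l; have [e] : exists e, e = ocoord l alpha f by exists (ocoord l alpha f).
  have alg := finite_ext_algebraic (finite_ext_vect E).
  have [l1 e1] := omega_exists alg 1 prx.
  have lE : l = ocoord l alpha f *: l1 by apply: (ocoord_inj prx); rewrite ocoordZ e1 mulr1.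
  rewrite lE => _; apply: (span (fun e => tr' (e *: l1) = tr (e *: l1))).
  - by rewrite scale0r tr'0 (trace0 tr).
  - move=> c a b ha hb; rewrite scalerDl -scalerA tr'_lin ha hb.
    exact: esym (trace_lin tr c (a *: l1) (b *: l1)).
  - move=> m hm; rewrite (dual' _ _ _ _ prx tri m) //; last by rewrite ocoordZ e1 mulr1.
    by apply/esym/dual => //; rewrite ocoordZ e1 mulr1.
rewrite hmu; apply/esym/transfer_uniq => P Q [g [gb gl gQ]]; apply: hW.
by exists g; split=> // v w; rewrite gQ -trE.
Qed.
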